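(* Let $k\ge0$ and let $\Gamma(\vec{x})\cup\Delta(\vec{x})\subseteq\Pi^b_k(open)$. Then $I\Delta_0+\mathrm{EXP}\vdash\Gamma(\vec{x})\Rightarrow\Delta(\vec{x})$ if and only if $\Gamma\rhd_d^{(\Pi^b_k(open),\,\mathcal{R}(exp))}\Delta$.
   Context: **Base theory.** $\mathcal{R}$, in the language $\{0,1,+,-,\cdot,\lfloor\frac{\cdot}{\cdot}\rfloor,\le\}$, is the theory of commutative discrete ordered semirings (commutative ring axioms without additive inverses, plus: $\le$ is a total discrete order with $<$ compatible with addition and with multiplication by non-zero elements) together with $(x\ge y\to (x-y)+y=x)\wedge(x<y\to x-y=0)$ and $((y+1)\cdot\lfloor\frac{x}{y}\rfloor\le x)\wedge(x-(y+1)\cdot\lfloor\frac{x}{y}\rfloor<y+1)$ (so $\lfloor\frac{x}{y}\rfloor$ really denotes $\lfloor x/(y+1)\rfloor$). $\mathcal{R}(exp)$ is $\mathcal{R}$ augmented with a function symbol $exp$ for exponentiation and its usual recursive defining axioms. $I\Delta_0+\mathrm{EXP}$ is the theory of induction for bounded formulas with exponentiation total, formulated in the language with the function symbol $exp$ (and $-$, $\lfloor\frac{\cdot}{\cdot}\rfloor$). **Classes.** For a class $\Phi$ containing the quantifier-free formulas and closed under boolean operations, $\Pi_0(\Phi)=\Sigma_0(\Phi)=\Phi$; $\Sigma_{k+1}(\Phi)$ consists of formulas with a block of bounded existential quantifiers in front of a $\Pi_k(\Phi)$ formula, and $\Pi_{k+1}(\Phi)$ of formulas with a block of bounded universal quantifiers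 in front of a $\Sigma_k(\Phi)$ formula. $\Pi^b_k(open)$ is $\Pi_k(\Phi)$ with $\Phi$ the quantifier-free formulas of the language of $\mathcal{R}(exp)$. Boolean combinations such as $\bigwedge\Gamma$, $\bigvee\Delta$ are replaced by $\mathcal{R}$-equivalent prenex formulas in the relevant class. A theory proves $\Gamma\Rightarrow\Delta$ iff it proves $\bigwedge\Gamma\to\bigvee\Delta$. **Deterministic reductions** (over a base theory $\mathcal{B}$). For $A,B$ both in $\Pi_k(\Phi)$ or both in $\Sigma_k(\Phi)$ and a sequence of terms $F=(F_i)_{i=1}^k$, define $A\le_d^{F,k}B$ by recursion on $k$. For $k=0$: $F$ is empty and $\mathcal{B}\vdash A\to B$. If $A=\forall\vec u\le\vec p(\vec x)\,C(\vec x,\vec u)$, $B=\forall\vec v\le\vec q(\vec x)\,D(\vec x,\vec v)$: $A\le_d^{F,k+1}B$ iff $\mathcal{B}\vdash\vec v\le\vec q(\vec x)\to F_{k+1}(\vec x,\vec v)\le\vec p(\vec x)$ and $\big(F_{k+1}(\vec x,\vec v)\le\vec p(\vec x)\to C(\vec x,F_{k+1}(\vec x,\vec v))\big)\le_d^{\hat F,k}\big(\vec v\le\vec q(\vec x)\to D(\vec x,\vec v)\big)$ with $\hat F=(F_i)_{i=1}^{k}$. If $A=\exists\vec u\le\vec p(\vec x)\,C$, $B=\exists\vec v\le\vec q(\vec x)\,D$: iff $\mathcal{B}\vdash\vec u\le\vec p(\vec x)\to F_{k+1}(\vec x,\vec u)\le\vec q(\vec x)$ and $\big(\vec u\le\vec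 p(\vec x)\wedge C(\vec x,\vec u)\big)\le_d^{\hat F,k}\big(F_{k+1}(\vec x,\vec u)\le\vec q(\vec x)\wedge D(\vec x,F_{k+1}(\vec x,\vec u))\big)$. $A\equiv_d^{(E_0,E_1)}B$ means $A\le_d^{E_0}B$ and $B\le_d^{E_1}A$. **Deterministic flow.** $A\rhd_d^{(\Pi_k(\Phi),\mathcal{B})}B$ (for $A,B\in\Pi_k(\Phi)$) means there are a term $t(\vec x)$, a formula $H(u,\vec x)\in\Pi_k(\Phi)$ and sequences of terms $E_0,E_1,G_0,G_1,F(u)$ such that, provably in $\mathcal{B}$: $H(0,\vec x)\equiv_d^{(E_0,E_1)}A(\vec x)$; $H(t(\vec x),\vec x)\equiv_d^{(G_0,G_1)}B(\vec x)$; and for all $u<t(\vec x)$, $H(u,\vec x)\le_d^{F(u)}H(u+1,\vec x)$. $\Gamma\rhd_d\Delta$ means $\bigwedge\Gamma\rhd_d\bigvee\Delta$. *)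

(* Defs.v *)
From Stdlib Require Import List Arith.
Import ListNotations.

(** De Bruijn syntax for the language of R(exp).  The free variables of an expression are the
    parameters [x]; [Div s t] stands for the floor of [s / (t + 1)], and
    [Exp t] for [2 ^ t]. *)

Inductive term : Type :=
| Var (i : nat)
| Zero
| One
| Add (s t : term)
| Sub (s t : term)
| Mul (s t : term)
| Div (s t : term)
| Exp (t : term).

Inductive form : Type :=
| Eq (s t : term)
| Le (s t : term)
| Bot
| Imp (A B : form)
| And (A B : form)
| Or (A B : form)
| All (A : form)
| Ex (A : form).

Definition Top : form := Imp Bot Bot.
Definition Neg (A : form) : form := Imp A Bot.
Definition Iff (A B : form) : form := And (Imp A B) (Imp B A).
Definition Lt (s t : term) : form := And (Le s t) (Neg (Eq s t)).

Declare Scope tm_scope.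
Delimit Scope tm_scope with tm.
Bind Scope tm_scope with term.
Notation "0" := Zero : tm_scope.
Notation "1" := One : tm_scope.
Notation "s + t" := (Add s t) : tm_scope.
Notation "s - t" := (Sub s t) : tm_scope.
Notation "s * t" := (Mul s t) : tm_scope.

Declare Scope fm_scope.
Delimit Scope fm_scope with fm.
Bind Scope fm_scope with form.
Notation "s == t" := (Eq s%tm t%tm) (at level 70, no associativity) : fm_scope.
Notation "s <= t" := (Le s%tm t%tm) : fm_scope.
Notation "s < t" := (Lt s%tm t%tm) : fm_scope.
Notation "A --> B" := (Imp A B) (at level 90, right associativity) : fm_scope.
Notation "A && B" := (And A B) : fm_scope.
Notation "A || B" := (Or A B) : fm_scope.

Definition subst := nat -> term.

Definition shift (n : nat) : subst := fun i => Var (n + i).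

Fixpoint subst_t (s : subst) (t : term) : term :=
  match t with
  | Var i => s i
  | Zero => Zero
  | One => One
  | Add a b => Add (subst_t s a) (subst_t s b)
  | Sub a b => Sub (subst_t s a) (subst_t s b)
  | Mul a b => Mul (subst_t s a) (subst_t s b)
  | Div a b => Div (subst_t s a) (subst_t s b)
  | Exp a => Exp (subst_t s a)
  end.

(** The tuple [ts] replaces the first [length ts] variables, and [s] is
    applied to the remaining ones (renumbered from 0). *)
Definition inst (ts : list term) (s : subst) : subst :=
  fun i =>
    match nth_error ts i with
    | Some t => t
    | None => s (i - length ts)
    end.

Definition vars (n : nat) : list term := map Var (seq 0 n).

Definition up (n : nat) (s : subst) : subst :=
  inst (vars n) (fun i => subst_t (shift n) (s i)).

Fixpoint subst_f (s : subst) (A : form) : form :=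
  match A with
  | Eq a b => Eq (subst_t s a) (subst_t s b)
  | Le a b => Le (subst_t s a) (subst_t s b)
  | Bot => Bot
  | Imp B C => Imp (subst_f s B) (subst_f s C)
  | And B C => And (subst_f s B) (subst_f s C)
  | Or B C => Or (subst_f s B) (subst_f s C)
  | All B => All (subst_f (up 1 s) B)
  | Ex B => Ex (subst_f (up 1 s) B)
  end.

Notation lift_t n := (subst_t (shift n)).
Notation lift_f n := (subst_f (shift n)).

(** A theory is a set of formulas, each standing for its universal closure:
    [prv_ax] gives all their substitution instances. *)

Definition theory := form -> Prop.

Inductive prv (T : theory) : list form -> form -> Prop :=
| prv_ax L A s : T A -> prv T L (subst_f s A)
| prv_hyp L A : In A L -> prv T L A
| prv_botE L A : prv T L Bot -> prv T L A
| prv_dne L A : prv T L (Neg (Neg A)) -> prv T L A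
| prv_impI L A B : prv T (A :: L) B -> prv T L (Imp A B)
| prv_impE L A B : prv T L (Imp A B) -> prv T L A -> prv T L B
| prv_andI L A B : prv T L A -> prv T L B -> prv T L (And A B)
| prv_andE1 L A B : prv T L (And A B) -> prv T L A
| prv_andE2 L A B : prv T L (And A B) -> prv T L B
| prv_orI1 L A B : prv T L A -> prv T L (Or A B)
| prv_orI2 L A B : prv T L B -> prv T L (Or A B)
| prv_orE L A B C :
    prv T L (Or A B) -> prv T (A :: L) C -> prv T (B :: L) C -> prv T L C
| prv_allI L A : prv T (map (lift_f 1) L) A -> prv T L (All A)
| prv_allE L A t : prv T L (All A) -> prv T L (subst_f (inst [t] Var) A)
| prv_exI L A t : prv T L (subst_f (inst [t] Var) A) -> prv T L (Ex A)
| prv_exE L A B :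
    prv T L (Ex A) -> prv T (A :: map (lift_f 1) L) (lift_f 1 B) -> prv T L B
| prv_eqI L t : prv T L (Eq t t)
| prv_eqE L A a b :
    prv T L (Eq a b) -> prv T L (subst_f (inst [a] Var) A) ->
    prv T L (subst_f (inst [b] Var) A).

Fixpoint big_and (L : list form) : form :=
  match L with
  | [] => Top
  | A :: L => And A (big_and L)
  end.

Fixpoint big_or (L : list form) : form :=
  match L with
  | [] => Bot
  | A :: L => Or A (big_or L)
  end.

Definition proves_seq (T : theory) (Gamma Delta : list form) : Prop :=
  prv T [] (Imp (big_and Gamma) (big_or Delta)).

Section Theories.
Local Open Scope tm_scope.
Local Open Scope fm_scope.

Local Notation x := (Var (S (S O))).
Local Notation y := (Var (S O)).
Local Notation z := (Var O).

(** Nonnegativity needs no axiom of its own: if [x < 0], then multiplying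
    [0 < 1] by [x] gives [0 < x]. *)
Inductive R_ax : theory :=
| ax_addA : R_ax ((x + y) + z == x + (y + z))
| ax_addC : R_ax (x + y == y + x)
| ax_add0 : R_ax (x + 0 == x)
| ax_mulA : R_ax ((x * y) * z == x * (y * z))
| ax_mulC : R_ax (x * y == y * x)
| ax_mul1 : R_ax (x * 1 == x)
| ax_mul0 : R_ax (x * 0 == 0)
| ax_mulD : R_ax (x * (y + z) == x * y + x * z)
| ax_le_refl : R_ax (x <= x)
| ax_le_anti : R_ax ((x <= y) && (y <= x) --> x == y)
| ax_le_trans : R_ax ((x <= y) && (y <= z) --> x <= z)
| ax_le_total : R_ax ((x <= y) || (y <= x))
| ax_discrete : R_ax ((x < x + 1) && (x < y --> x + 1 <= y))
| ax_lt_add : R_ax (x < y --> x + z < y + z)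
| ax_lt_mul : R_ax (Neg (z == 0) && (x < y) --> x * z < y * z)
| ax_sub : R_ax ((y <= x --> (x - y) + y == x) && (x < y --> x - y == 0))
| ax_div :
    R_ax (((y + 1) * Div x y <= x) && (x - (y + 1) * Div x y < y + 1)).

Inductive R_exp : theory :=
| R_exp_base A : R_ax A -> R_exp A
| R_exp_0 : R_exp (Exp 0 == 1)
| R_exp_S : R_exp (Exp (x + 1) == (1 + 1) * Exp x).

End Theories.

Fixpoint qfree (A : form) : Prop :=
  match A with
  | Eq _ _ | Le _ _ | Bot => True
  | Imp B C | And B C | Or B C => qfree B /\ qfree C
  | All _ | Ex _ => False
  end.

(** The bound [t] does not contain the quantified variable. *)
Definition AllLe (t : term) (A : form) : form :=
  All (Imp (Le (Var 0) (lift_t 1 t)) A).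
Definition ExLe (t : term) (A : form) : form :=
  Ex (And (Le (Var 0) (lift_t 1 t)) A).

Inductive bounded : form -> Prop :=
| bd_qfree A : qfree A -> bounded A
| bd_imp A B : bounded A -> bounded B -> bounded (Imp A B)
| bd_and A B : bounded A -> bounded B -> bounded (And A B)
| bd_or A B : bounded A -> bounded B -> bounded (Or A B)
| bd_all t A : bounded A -> bounded (AllLe t A)
| bd_ex t A : bounded A -> bounded (ExLe t A).

(** Induction on the variable 0 of [A]; the other variables are parameters. *)
Definition induction (A : form) : form :=
  Imp (And (subst_f (inst [Zero] Var) A)
           (All (Imp A (subst_f (inst [Add (Var 0) One] (shift 1)) A))))
      (All A).

Inductive IDelta0_EXP : theory :=
| ID0_base A : R_exp A -> IDelta0_EXP A
| ID0_ind A : bounded A -> IDelta0_EXP (induction A).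

(** [BAll ps C] is the block [forall u <= ps, C]: the bounds [ps] live in the
    outer context, and the variable [i < length ps] of [C] is bounded by the
    [i]-th element of [ps]. *)

Inductive pform : Type :=
| Mat (A : form)
| BAll (ps : list term) (C : pform)
| BEx (ps : list term) (C : pform).

Fixpoint all_block (ps : list term) (A : form) : form :=
  match ps with
  | [] => A
  | p :: ps => all_block ps (AllLe (lift_t (length ps) p) A)
  end.

Fixpoint ex_block (ps : list term) (A : form) : form :=
  match ps with
  | [] => A
  | p :: ps => ex_block ps (ExLe (lift_t (length ps) p) A)
  end.

Fixpoint to_form (A : pform) : form :=
  match A with
  | Mat A => A
  | BAll ps C => all_block ps (to_form C)
  | BEx ps C => ex_block ps (to_form C)
  end.

Fixpoint subst_p (s : subst) (A : pform) : pform :=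
  match A with
  | Mat A => Mat (subst_f s A)
  | BAll ps C => BAll (map (subst_t s) ps) (subst_p (up (length ps) s) C)
  | BEx ps C => BEx (map (subst_t s) ps) (subst_p (up (length ps) s) C)
  end.

Inductive in_Pi (Phi : form -> Prop) : nat -> pform -> Prop :=
| in_Pi_0 A : Phi A -> in_Pi Phi 0 (Mat A)
| in_Pi_S k ps C : in_Sigma Phi k C -> in_Pi Phi (S k) (BAll ps C)
with in_Sigma (Phi : form -> Prop) : nat -> pform -> Prop :=
| in_Sigma_0 A : Phi A -> in_Sigma Phi 0 (Mat A)
| in_Sigma_S k ps C : in_Pi Phi k C -> in_Sigma Phi (S k) (BEx ps C).

Definition Pib_open : nat -> pform -> Prop := in_Pi qfree.

(** [guard op P A] is a prenex form of [op P A], for [op] an implication or a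
    conjunction and [P] quantifier-free.  It is R-equivalent to [op P A], like
    [merge] below, because the range of a bounded quantifier is never empty. *)
Fixpoint guard (op : form -> form -> form) (P : form) (A : pform) : pform :=
  match A with
  | Mat A => Mat (op P A)
  | BAll ps C => BAll ps (guard op (lift_f (length ps) P) C)
  | BEx ps C => BEx ps (guard op (lift_f (length ps) P) C)
  end.

(** Prenex form of [op A B], for [op] a conjunction or a disjunction and
    [A], [B] both in Pi_k or both in Sigma_k.  Blocks are concatenated: the
    variables of the block of [A] come first, then those of [B]. *)
Fixpoint merge (op : form -> form -> form) (k : nat) (A B : pform) : pform :=
  let left m n := inst (vars m) (shift (m + n)) in
  let right m n := inst (map Var (seq m n)) (shift (m + n)) in
  match k, A, B with
  | 0, Mat A, Mat B => Mat (op A B)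
  | S k, BAll ps C, BAll qs D =>
      let m := length ps in let n := length qs in
      BAll (ps ++ qs)
        (merge op k (subst_p (left m n) C) (subst_p (right m n) D))
  | S k, BEx ps C, BEx qs D =>
      let m := length ps in let n := length qs in
      BEx (ps ++ qs)
        (merge op k (subst_p (left m n) C) (subst_p (right m n) D))
  | _, _, _ => A
  end.

(** A quantifier-free formula as an element of Pi_k / Sigma_k. *)
Fixpoint pad_Pi (k : nat) (A : form) : pform :=
  match k with
  | 0 => Mat A
  | S k => BAll [] (pad_Sigma k A)
  end
with pad_Sigma (k : nat) (A : form) : pform :=
  match k with
  | 0 => Mat A
  | S k => BEx [] (pad_Pi k A)
  end.

Fixpoint big_merge (op : form -> form -> form) (neutral : form) (k : nat)
    (L : list pform) : pform :=
  match L with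
  | [] => pad_Pi k neutral
  | [A] => A
  | A :: L => merge op k A (big_merge op neutral k L)
  end.

Definition big_and_Pi : nat -> list pform -> pform := big_merge And Top.
Definition big_or_Pi : nat -> list pform -> pform := big_merge Or Bot.

Fixpoint tuple_le (ts ps : list term) : form :=
  match ts, ps with
  | t :: ts, p :: ps => And (Le t p) (tuple_le ts ps)
  | _, _ => Top
  end.

(** [dred T L F A B]: the reduction of [A] to [B] by [F], with all the
    required proofs carried out in [T] from the side hypotheses [L].  Each
    [F_i] is a tuple of terms, and [F] is listed from the outermost block
    ([F_k]) to the innermost one ([F_1]), so that [k = length F].

    In the universal case the tuple [f] depends on the variables [v] of the
    block of [B]; in the existential case, on the variables [u] of the block
    of [A].  These are the variables below [n]. *)
Fixpoint dred (T : theory) (L : list form) (F : list (list term))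
    (A B : pform) : Prop :=
  match F, A, B with
  | [], Mat A, Mat B => prv T L (Imp A B)
  | f :: F, BAll ps C, BAll qs D =>
      let n := length qs in
      let L' := map (lift_f n) L in
      let v_le_q := tuple_le (vars n) (map (lift_t n) qs) in
      let f_le_p := tuple_le f (map (lift_t n) ps) in
      length f = length ps /\
      prv T L' (Imp v_le_q f_le_p) /\
      dred T L' F (guard Imp f_le_p (subst_p (inst f (shift n)) C))
                  (guard Imp v_le_q D)
  | f :: F, BEx ps C, BEx qs D =>
      let n := length ps in
      let L' := map (lift_f n) L in
      let u_le_p := tuple_le (vars n) (map (lift_t n) ps) in
      let f_le_q := tuple_le f (map (lift_t n) qs) in
      length f = length qs /\
      prv T L' (Imp u_le_p f_le_q) /\
      dred T L' F (guard And u_le_p C)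
                  (guard And f_le_q (subst_p (inst f (shift n)) D))
  | _, _, _ => False
  end.

Definition dequiv (T : theory) (E0 E1 : list (list term)) (A B : pform) : Prop :=
  dred T [] E0 A B /\ dred T [] E1 B A.

(** In [H] and [F] the variable 0 is the time [u], followed by [x]. *)
Definition dflow (Phi : form -> Prop) (k : nat) (T : theory)
    (A B : pform) : Prop :=
  exists (t : term) (H : pform) (E0 E1 G0 G1 F : list (list term)),
    in_Pi Phi k H /\
    dequiv T E0 E1 (subst_p (inst [Zero] Var) H) A /\
    dequiv T G0 G1 (subst_p (inst [t] Var) H) B /\
    dred T [Lt (Var 0) (lift_t 1 t)] F
      H (subst_p (inst [Add (Var 0) One] (shift 1)) H).

Definition dflow_seq (Phi : form -> Prop) (k : nat) (T : theory)
    (Gamma Delta : list pform) : Prop :=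
  dflow Phi k T (big_and_Pi k Gamma) (big_or_Pi k Delta).

(* Main.v *)
(** A provable reduction is true in every model, so a flow gives the implication by induction on the
    time, for a bounded formula.

    Conversely, call [f] summable if a term computes [sum (i < n) f(i) 2^(b i)] from [n] and [b]. In a
    model of R(exp) with induction for quantifier-free formulas all terms are summable.  A product is
    read off as a coefficient of a product of two polynomials; a positive part [(f - g)^+] is obtained
    from a floor sum [sum floor(u P / Q)], for convergents of a continued fraction given by a Lucas
    sequence, which jumps exactly at prescribed arguments; exponentials and quotients are sums of
    comparisons.  Hence bounded formulas have characteristic terms, the model satisfies bounded
    induction, and bounded quantifiers have Skolem terms.

    So if the implication from [A] to [B] is provable, then between the matrices of [A] and [B], the
    variables that a reduction has to guess being given by Skolem terms, it is a quantifier-free theorem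
    of open induction.  By a Henkin construction it has a derivation with the quantifier-free induction
    rule only, and such a derivation unfolds into a flow of quantifier-free formulas.  Putting the
    quantifier blocks of both [A] and [B] in front of this flow yields the deterministic flow. *)

From HB Require Import structures.
From mathcomp Require Import ssreflect ssrfun ssrbool eqtype choice order ssralg ssrnum.
From mathcomp Require boolp.
From Stdlib Require Import List Arith Lia Classical ClassicalEpsilon FunctionalExtensionality.
From Stdlib Require Import PropExtensionality ProofIrrelevance Ring.
Import ListNotations.
Require Import Defs.

(** * Substitution *)

(** Two demands of uniformity shape the proof. The terms for sums are found by calculating in the
    integers of one model, but one term has to serve in all models; so every construction is an
    operator on a family of rings, instantiated by a single model for the inductions and by all
    pairs of a model and an environment for the terms. And the length of a flow must not depend on
    what varies inside it: the induction rule repeats the flow of its step for changing values of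
    the induction variable, and the time bound of the final flow may mention the free variables
    only, not those of the blocks. Lengths are therefore terms in a common bound [z] of the
    variables, and that terms stay below their majorants is itself proved by flows. A positive part
    is obtained by counting: for a large [a], the floor sum runs through [a - 1 + f - g] blocks of
    equal length, and each block from the [a]-th on contains one jump, which makes [(f - g)^+]
    jumps. Twice the rest of the sum vanishes modulo [a], because modulo [a] the Lucas sequence runs
    periodically through 0, 1, 0, -1. *)

Definition scons {X : Type} (x : X) (e : nat -> X) : nat -> X :=
  fun i => match i with O => x | S j => e j end.
Notation "x .: e" := (scons x e) (at level 55, right associativity).

Definition apps {X : Type} (xs : list X) (e : nat -> X) : nat -> X :=
  fun i => match nth_error xs i with Some x => x | None => e (i - length xs) end.

Lemma apps_nil X (e : nat -> X) : apps [] e = e.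
Proof. apply functional_extensionality => i; rewrite /apps; case: i => //. Qed.

Lemma apps_cons X (x : X) xs e : apps (x :: xs) e = x .: apps xs e.
Proof. by apply functional_extensionality => -[|i]. Qed.

Lemma inst_apps ts s : inst ts s = apps ts s.
Proof. by []. Qed.

Lemma apps_map X Y (f : X -> Y) xs e :
  (fun i => f (apps xs e i)) = apps (map f xs) (fun i => f (e i)).
Proof.
apply functional_extensionality => i; rewrite /apps nth_error_map length_map.
by case: (nth_error xs i).
Qed.

Lemma apps_shift X (xs : list X) e i : apps xs e (length xs + i) = e i.
Proof.
rewrite /apps (proj2 (nth_error_None _ _)); last by lia.
by f_equal; lia.
Qed.

Lemma apps_app X (xs ys : list X) e : apps (xs ++ ys) e = apps xs (apps ys e).
Proof. by elim: xs => [|x xs IH]; rewrite /= ?apps_nil // !apps_cons IH. Qed.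

Lemma nth_error_vars n i : i < n -> nth_error (vars n) i = Some (Var i).
Proof.
move=> lt_in; rewrite /vars nth_error_map.
by rewrite nth_error_seq; case: Nat.ltb_spec => //=; lia.
Qed.

Lemma length_vars n : length (vars n) = n.
Proof. by rewrite /vars length_map length_seq. Qed.

Lemma subst_t_comp s s' t :
  subst_t s (subst_t s' t) = subst_t (fun i => subst_t s (s' i)) t.
Proof. by elim: t => //= *; congruence. Qed.

Lemma subst_t_ext s s' t : (forall i, s i = s' i) -> subst_t s t = subst_t s' t.
Proof. by move=> H; elim: t => //= *; congruence. Qed.

Lemma subst_t_id t : subst_t Var t = t.
Proof. by elim: t => //= *; congruence. Qed.

Lemma up_apps n s : up n s = apps (vars n) (fun i => lift_t n (s i)).
Proof. by []. Qed.

Lemma up1 s : up 1 s = Var 0 .: (fun i => lift_t 1 (s i)).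
Proof. by rewrite up_apps /vars /= apps_cons apps_nil. Qed.

Lemma inst1 t s : inst [t] s = t .: s.
Proof. by rewrite inst_apps apps_cons apps_nil. Qed.

Lemma subst_t_lift ts s t :
  subst_t (apps ts s) (lift_t (length ts) t) = subst_t s t.
Proof.
rewrite subst_t_comp; apply: subst_t_ext => i /=.
exact: apps_shift.
Qed.

Lemma subst_t_lift1 u s t : subst_t (u .: s) (lift_t 1 t) = subst_t s t.
Proof. by rewrite -(subst_t_lift [u] s t) apps_cons apps_nil. Qed.

Lemma up_comp n s s' :
  (fun i => subst_t (up n s) (up n s' i)) = up n (fun i => subst_t s (s' i)).
Proof.
rewrite !up_apps apps_map; f_equal.
  rewrite /vars map_map; apply: map_ext_in => i /in_seq [_ lt_in] /=.
  by rewrite /apps nth_error_vars.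
apply functional_extensionality => i.
have := subst_t_lift (vars n) (fun i => lift_t n (s i)) (s' i).
by rewrite length_vars => ->; rewrite subst_t_comp.
Qed.

Lemma subst_f_ext A : forall s s', (forall i, s i = s' i) -> subst_f s A = subst_f s' A.
Proof.
by move=> s s' H; have -> : s = s' by apply functional_extensionality.
Qed.

Lemma subst_f_comp A : forall s s',
  subst_f s (subst_f s' A) = subst_f (fun i => subst_t s (s' i)) A.
Proof.
elim: A => [a b|a b| |A IHA B IHB|A IHA B IHB|A IHA B IHB|A IHA|A IHA] s s' /=;
  rewrite ?subst_t_comp ?IHA ?IHB ?up_comp //.
Qed.

Lemma up_id n : up n Var = Var.
Proof.
apply functional_extensionality => i; rewrite up_apps /apps length_vars.
case: (Nat.lt_ge_cases i n) => H; first by rewrite nth_error_vars.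
rewrite (proj2 (nth_error_None _ _)) ?length_vars //=.
by rewrite /shift; f_equal; lia.
Qed.

Lemma subst_f_id A : subst_f Var A = A.
Proof. by elim: A => //= *; rewrite ?subst_t_id ?up_id; congruence. Qed.

Lemma subst_f_lift1 u s A : subst_f (u .: s) (lift_f 1 A) = subst_f s A.
Proof. by rewrite subst_f_comp; apply: subst_f_ext. Qed.

Lemma subst_up1 u s A :
  subst_f (inst [u] Var) (subst_f (up 1 s) A) = subst_f (u .: s) A.
Proof.
rewrite subst_f_comp; apply: subst_f_ext => -[|i]; rewrite inst1 up1 //=.
by rewrite subst_t_lift1 subst_t_id.
Qed.

(** * Models *)

Record model := Model {
  car :> Type;
  m0 : car; m1 : car;
  madd : car -> car -> car; msub : car -> car -> car; mmul : car -> car -> car;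
  mdiv : car -> car -> car; mexp : car -> car;
  mle : car -> car -> Prop }.

Arguments m0 {_}. Arguments m1 {_}.
Arguments madd {_}. Arguments msub {_}. Arguments mmul {_}. Arguments mdiv {_}.
Arguments mexp {_}. Arguments mle {_}.

Fixpoint eval (M : model) (e : nat -> M) (t : term) : M :=
  match t with
  | Var i => e i
  | Zero => m0
  | One => m1
  | Add a b => madd (eval M e a) (eval M e b)
  | Sub a b => msub (eval M e a) (eval M e b)
  | Mul a b => mmul (eval M e a) (eval M e b)
  | Div a b => mdiv (eval M e a) (eval M e b)
  | Exp a => mexp (eval M e a)
  end.
Arguments eval {M}.

Fixpoint sat (M : model) (e : nat -> M) (A : form) : Prop :=
  match A with
  | Eq a b => eval e a = eval e b
  | Le a b => mle (eval e a) (eval e b)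
  | Bot => False
  | Imp A B => sat M e A -> sat M e B
  | And A B => sat M e A /\ sat M e B
  | Or A B => sat M e A \/ sat M e B
  | All A => forall x, sat M (x .: e) A
  | Ex A => exists x, sat M (x .: e) A
  end.
Arguments sat {M}.

Definition models (M : model) (T : theory) : Prop :=
  forall A, T A -> forall e : nat -> M, sat e A.

Lemma eval_subst (M : model) (e : nat -> M) s t :
  eval e (subst_t s t) = eval (fun i => eval e (s i)) t.
Proof. by elim: t => //= *; congruence. Qed.

Lemma eval_lift (M : model) (xs : list M) (e : nat -> M) t :
  eval (apps xs e) (lift_t (length xs) t) = eval e t.
Proof.
rewrite eval_subst; f_equal; apply functional_extensionality => i.
exact: apps_shift.
Qed.

Lemma eval_lift1 (M : model) (x : M) e t : eval (x .: e) (lift_t 1 t) = eval e t.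
Proof. by rewrite eval_subst. Qed.

Lemma eval_up (M : model) (xs : list M) (e : nat -> M) s :
  (fun i => eval (apps xs e) (up (length xs) s i)) = apps xs (fun i => eval e (s i)).
Proof.
rewrite up_apps apps_map; f_equal; last first.
  by apply functional_extensionality => i; rewrite eval_lift.
apply: nth_error_ext => i; rewrite nth_error_map.
case: (Nat.lt_ge_cases i (length xs)) => H.
  rewrite nth_error_vars //= /apps.
  by case E: (nth_error xs i) => //; move/nth_error_None: E; lia.
rewrite !(proj2 (nth_error_None _ _)) //.
by rewrite ?length_vars.
Qed.

Lemma sat_subst (M : model) A : forall (e : nat -> M) s,
  sat e (subst_f s A) <-> sat (fun i => eval e (s i)) A.
Proof.
elim: A => [a b|a b| |A IHA B IHB|A IHA B IHB|A IHA B IHB|A IHA|A IHA] e s /=;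
  rewrite ?eval_subst //; try (by rewrite IHA IHB).
all: have E x : (fun i => eval (x .: e) (up 1 s i)) = x .: (fun i => eval e (s i))
  by have := eval_up M [x] e s; rewrite !apps_cons !apps_nil.
  by split=> H x; move: (H x); rewrite IHA E.
by split=> -[x H]; exists x; move: H; rewrite IHA E.
Qed.

Lemma sat_lift (M : model) (xs : list M) (e : nat -> M) A :
  sat (apps xs e) (lift_f (length xs) A) <-> sat e A.
Proof.
rewrite sat_subst; suff -> : (fun i => eval (apps xs e) (shift (length xs) i)) = e by [].
by apply functional_extensionality => i; apply: apps_shift.
Qed.

Lemma sat_lift1 (M : model) (x : M) e A : sat (x .: e) (lift_f 1 A) <-> sat e A.
Proof. by rewrite sat_subst. Qed.

Lemma sat_inst (M : model) (ts : list term) s (e : nat -> M) A :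
  sat e (subst_f (inst ts s) A) <->
  sat (apps (map (eval e) ts) (fun i => eval e (s i))) A.
Proof. by rewrite sat_subst inst_apps apps_map. Qed.

Lemma sat_inst1 (M : model) t (e : nat -> M) A :
  sat e (subst_f (inst [t] Var) A) <-> sat (eval e t .: e) A.
Proof. by rewrite sat_inst /= apps_cons apps_nil. Qed.

Theorem soundness (M : model) (T : theory) L A :
  models M T -> prv T L A ->
  forall e : nat -> M, (forall B, In B L -> sat e B) -> sat e A.
Proof.
move=> MT; elim=> {L A}.
- by move=> L A s TA e _; rewrite sat_subst; apply: MT.
- by move=> L A inA e H; apply: H.
- by move=> L A _ IH e H; case: (IH e H).
- by move=> L A _ IH e H; apply: NNPP; apply: (IH e H).
- move=> L A B _ IH e H a; apply: IH => C [<- //|]; exact: H.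
- by move=> L A B _ IH1 _ IH2 e H; apply: (IH1 e H); apply: IH2.
- by move=> L A B _ IH1 _ IH2 e H; split; [apply: IH1|apply: IH2].
- by move=> L A B _ IH e H; case: (IH e H).
- by move=> L A B _ IH e H; case: (IH e H).
- by move=> L A B _ IH e H; left; apply: IH.
- by move=> L A B _ IH e H; right; apply: IH.
- move=> L A B C _ IH _ IH1 _ IH2 e H; case: (IH e H) => h;
    [apply: IH1 | apply: IH2] => D [<- //|]; exact: H.
- move=> L A _ IH e H x; apply: IH => B /in_map_iff [C [<- inC]].
  by rewrite sat_lift1; apply: H.
- by move=> L A t _ IH e H; rewrite sat_inst1; apply: (IH e H).
- by move=> L A t _ IH e H; exists (eval e t); rewrite -sat_inst1; apply: IH.
- move=> L A B _ IH _ IH1 e H; case: (IH e H) => x satx.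
  rewrite -(sat_lift1 M x e); apply: IH1 => C [<- //|/in_map_iff [D [<- inD]]].
  by rewrite sat_lift1; apply: H.
- by [].
- move=> L A a b _ IH1 _ IH2 e H; have := IH2 e H; rewrite !sat_inst1.
  by have /= -> := IH1 e H.
Qed.

(** * Completeness *)

Lemma prv_weak T L A : prv T L A -> forall L', incl L L' -> prv T L' A.
Proof.
elim=> {L A}.
- by move=> L A s TA L' _; apply: prv_ax.
- by move=> L A inA L' sub; apply/prv_hyp/sub.
- by move=> L A _ IH L' sub; apply/prv_botE/IH.
- by move=> L A _ IH L' sub; apply/prv_dne/IH.
- move=> L A B _ IH L' sub; apply/prv_impI/IH => C [<-|inC]; [by left|right; exact: sub].
- by move=> L A B _ IH1 _ IH2 L' sub; apply: prv_impE (IH1 _ sub) (IH2 _ sub).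
- by move=> L A B _ IH1 _ IH2 L' sub; apply: prv_andI (IH1 _ sub) (IH2 _ sub).
- by move=> L A B _ IH L' sub; apply: prv_andE1 (IH _ sub).
- by move=> L A B _ IH L' sub; apply: prv_andE2 (IH _ sub).
- by move=> L A B _ IH L' sub; apply: prv_orI1 (IH _ sub).
- by move=> L A B _ IH L' sub; apply: prv_orI2 (IH _ sub).
- move=> L A B C _ IH _ IH1 _ IH2 L' sub; apply: prv_orE (IH _ sub) (IH1 _ _) (IH2 _ _);
    move=> D [<-|inD]; [by left|right; exact: sub|by left|right; exact: sub].
- by move=> L A _ IH L' sub; apply/prv_allI/IH/incl_map.
- by move=> L A t _ IH L' sub; apply/prv_allE/IH.
- by move=> L A t _ IH L' sub; apply/prv_exI/IH.
- move=> L A B _ IH _ IH1 L' sub; apply: prv_exE (IH _ sub) (IH1 _ _).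
  move=> D [<-|inD]; [by left|right]; exact: (incl_map _ sub).
- by move=> L t L' _; apply: prv_eqI.
- by move=> L A a b _ IH1 _ IH2 L' sub; apply: prv_eqE (IH1 _ sub) (IH2 _ sub).
Qed.

Lemma subst_inst1 s t A :
  subst_f s (subst_f (inst [t] Var) A) =
  subst_f (inst [subst_t s t] Var) (subst_f (up 1 s) A).
Proof.
rewrite subst_up1 subst_f_comp; apply: subst_f_ext => i.
by rewrite inst1; case: i.
Qed.

Lemma subst_lift1 s A :
  subst_f (up 1 s) (lift_f 1 A) = lift_f 1 (subst_f s A).
Proof. by rewrite !subst_f_comp; apply: subst_f_ext => i; rewrite up1. Qed.

Lemma map_subst_lift1 s L :
  map (subst_f (up 1 s)) (map (lift_f 1) L) = map (lift_f 1) (map (subst_f s) L).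
Proof. by rewrite !map_map; apply: map_ext => A; rewrite subst_lift1. Qed.

Lemma prv_subst T L A : prv T L A -> forall s, prv T (map (subst_f s) L) (subst_f s A).
Proof.
elim=> {L A} /=.
- by move=> L A s TA s'; rewrite subst_f_comp; apply: prv_ax.
- by move=> L A inA s; apply/prv_hyp/in_map.
- by move=> L A _ IH s; apply/prv_botE/IH.
- by move=> L A _ IH s; apply/prv_dne/IH.
- by move=> L A B _ IH s; apply/prv_impI/IH.
- by move=> L A B _ IH1 _ IH2 s; apply: prv_impE (IH1 s) (IH2 s).
- by move=> L A B _ IH1 _ IH2 s; apply: prv_andI (IH1 s) (IH2 s).
- by move=> L A B _ IH s; apply: prv_andE1 (IH s).
- by move=> L A B _ IH s; apply: prv_andE2 (IH s).
- by move=> L A B _ IH s; apply: prv_orI1 (IH s).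
- by move=> L A B _ IH s; apply: prv_orI2 (IH s).
- by move=> L A B C _ IH _ IH1 _ IH2 s; apply: prv_orE (IH s) (IH1 s) (IH2 s).
- by move=> L A _ IH s; apply: prv_allI; rewrite -map_subst_lift1; apply: IH.
- by move=> L A t _ IH s; rewrite subst_inst1; apply/prv_allE/IH.
- by move=> L A t _ IH s; apply: (prv_exI _ _ _ (subst_t s t)); rewrite -subst_inst1; apply: IH.
- move=> L A B _ IH _ IH1 s; apply: (prv_exE _ _ _ _ (IH s)).
  by rewrite -map_subst_lift1 -subst_lift1; apply: IH1.
- by move=> L t s; apply: prv_eqI.
- move=> L A a b _ IH1 _ IH2 s; rewrite subst_inst1.
  by apply: prv_eqE (IH1 s) _; rewrite -subst_inst1; apply: IH2.
Qed.

(** A semantic bound on the free variables: only the effect of substitutions is constrained, which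
    is all that freshness arguments need. *)
Definition fv_below (n : nat) (A : form) : Prop :=
  forall s s', (forall i, i < n -> s i = s' i) -> subst_f s A = subst_f s' A.

Lemma fv_below_mono n n' A : n <= n' -> fv_below n A -> fv_below n' A.
Proof. by move=> le fv s s' H; apply: fv => i lt; apply: H; lia. Qed.

Lemma term_below t : exists n, forall s s', (forall i, i < n -> s i = s' i) ->
  subst_t s t = subst_t s' t.
Proof.
elim: t => [i| | |a [n Hn] b [m Hm]|a [n Hn] b [m Hm]|a [n Hn] b [m Hm]|a [n Hn] b [m Hm]|a [n Hn]];
  try by exists 0.
- by exists (S i) => s s' H; apply: H.
1-4: by exists (n + m) => s s' H /=; rewrite (Hn s s') ?(Hm s s') // => i lt; apply: H; lia.
by exists n => s s' H /=; rewrite (Hn s s').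
Qed.

Lemma form_below A : exists n, fv_below n A.
Proof.
elim: A => [a b|a b| |A [n Hn] B [m Hm]|A [n Hn] B [m Hm]|A [n Hn] B [m Hm]|A [n Hn]|A [n Hn]].
1-2: have [n Hn] := term_below a; have [m Hm] := term_below b;
  by exists (n + m) => s s' H /=; rewrite (Hn s s') ?(Hm s s') // => i lt; apply: H; lia.
- by exists 0.
1-3: by exists (n + m) => s s' H /=; rewrite (Hn s s') ?(Hm s s') // => i lt; apply: H; lia.
all: exists n => s s' H /=; rewrite (Hn (up 1 s) (up 1 s')) // => -[|i] lt;
  rewrite !up1 //=; rewrite H //; lia.
Qed.

Lemma forms_below L : exists n, forall A, In A L -> fv_below n A.
Proof.
elim: L => [|A L [n IH]]; first by exists 0.
have [m Hm] := form_below A; exists (n + m) => B [<-|inB].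
- by apply: fv_below_mono Hm; lia.
- by apply: fv_below_mono (IH _ inB); lia.
Qed.

(** Discharges an eigenvariable: the free variable [v] becomes the bound variable 0. On formulas
    whose variables lie below [v] it is a mere lifting, so it leaves a context without [v]
    intact. *)
Definition bind (v : nat) : subst := fun i => if Nat.eqb i v then Var 0 else Var (S i).

Lemma bind_lift v A : fv_below v A -> subst_f (bind v) A = lift_f 1 A.
Proof.
move=> fv; apply: fv => i lt; rewrite /bind.
by case: Nat.eqb_spec => // ?; lia.
Qed.

Lemma bind_inst v A : fv_below (S v) A -> subst_f (bind v) (subst_f (inst [Var v] Var) A) = A.
Proof.
move=> fv; rewrite subst_f_comp -{2}(subst_f_id A); apply: fv => -[|i] lt;
rewrite inst1 /= /bind; first by rewrite Nat.eqb_refl.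
by case: Nat.eqb_spec => // ?; lia.
Qed.

Lemma bind_lifts v L : (forall A, In A L -> fv_below v A) ->
  map (subst_f (bind v)) L = map (lift_f 1) L.
Proof. by move=> fv; apply: map_ext_in => A inA; apply/bind_lift/fv. Qed.

Lemma subst_inst1_up A : subst_f (inst [Var 0] Var) (subst_f (up 1 (shift 1)) A) = A.
Proof.
rewrite subst_up1 -{2}(subst_f_id A); apply: subst_f_ext => -[|i] //.
Qed.

(** * Maximal extensions by choices *)

Section Lindenbaum.
Variables (Con : list form -> Prop) (Opt : nat -> form -> Prop).
Hypothesis Con_step : forall n L, Con L -> exists C, Opt n C /\ Con (C :: L).

(** Consistency and the choices allowed at a stage are kept abstract, since the construction is used
    twice: with derivability for completeness, and with the quantifier-free calculus [U] for
    conservativity. *)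
Lemma lindenbaum L0 : Con L0 -> exists G : form -> Prop,
  [/\ forall C, In C L0 -> G C, forall n, exists2 C, Opt n C & G C &
      forall K, (forall C, In C K -> G C) -> exists2 L, Con L & incl K L].
Proof.
move=> con0.
pose next n (L : {L | Con L}) :=
  constructive_indefinite_description _ (Con_step n (proj1_sig L) (proj2_sig L)).
pose fix chain n : {L | Con L} := match n with
  | 0 => exist _ L0 con0
  | S n => exist Con (proj1_sig (next n (chain n)) :: proj1_sig (chain n))
                 (proj2 (proj2_sig (next n (chain n)))) end.
have mono n m C : n <= m -> In C (proj1_sig (chain n)) -> In C (proj1_sig (chain m)).
  elim=> // m' _ IH /IH; by right.
exists (fun C => exists n, In C (proj1_sig (chain n))); split.
- by move=> C inC; exists 0.
- move=> n; exists (proj1_sig (next n (chain n))).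
    exact: (proj1 (proj2_sig (next n (chain n)))).
  by exists (S n); left.
- elim=> [|C K IH] HK; first by exists L0.
  suff [n Hn] : exists n, incl (C :: K) (proj1_sig (chain n)).
    by exists (proj1_sig (chain n)); first exact: proj2_sig.
  elim: {IH} (C :: K) HK => [|D K' IH] HK; first by exists 0.
  have [n Hn] := IH (fun B inB => HK B (or_intror inB)).
  have [m Hm] := HK D (or_introl erefl).
  exists (n + m) => B [<-|inB]; first by apply: mono Hm; lia.
  by apply: mono (Hn _ inB); lia.
Qed.

End Lindenbaum.

Lemma prv_eq_sym T L a b : prv T L (Eq a b) -> prv T L (Eq b a).
Proof.
move=> H; have := prv_eqE T L (Eq (Var 0) (lift_t 1 a)) a b H.
by rewrite /= !inst1 /= !subst_t_lift1 subst_t_id; apply; apply: prv_eqI.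
Qed.

Lemma prv_eq_trans T L a b c : prv T L (Eq a b) -> prv T L (Eq b c) -> prv T L (Eq a c).
Proof.
move=> H1 H2; have := prv_eqE T L (Eq (lift_t 1 a) (Var 0)) b c H2.
by rewrite /= !inst1 /= !subst_t_lift1 subst_t_id; apply.
Qed.

Lemma prv_eq_cong T L (t : term) a b : prv T L (Eq a b) ->
  prv T L (Eq (subst_t (a .: Var) t) (subst_t (b .: Var) t)).
Proof.
move=> H; have := prv_eqE T L (Eq (lift_t 1 (subst_t (a .: Var) t)) t) a b H.
by rewrite /= !inst1 /= !subst_t_lift1 !subst_t_id; apply; apply: prv_eqI.
Qed.

(** * The term model of a set that decides a fragment [Fr]: all formulas, or the quantifier-free
    ones *)

Section TermModel.
Variables (T : theory) (Fr G : form -> Prop).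
Hypothesis Fr_qf : forall A, qfree A -> Fr A.
Hypothesis G_prv : forall K C, Fr C -> (forall B, In B K -> G B) -> prv T K C -> G C.
Hypothesis G_bot : ~ G Bot.
Hypothesis G_dec : forall A, Fr A -> G A \/ G (Neg A).

Let R s t := G (Eq s t).

Let hyp1 A : prv T [A] A. Proof. by apply: prv_hyp; left. Qed.

Let R_refl t : R t t.
Proof. by apply: (G_prv []) => //; [exact: Fr_qf|apply: prv_eqI]. Qed.

Let R_sym s t : R s t -> R t s.
Proof.
move=> H; apply: (G_prv [Eq s t]) => [|B [<-|[]]|] //; first exact: Fr_qf.
exact: prv_eq_sym.
Qed.

Let R_trans s t u : R s t -> R t u -> R s u.
Proof.
move=> H1 H2; apply: (G_prv [Eq s t; Eq t u]) => [|B [<-|[<-|[]]]|] //; first exact: Fr_qf.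
by apply: prv_eq_trans; apply: prv_hyp; [left|right; left].
Qed.

Let rep t := epsilon (inhabits t) (R t).

Let R_rep t : R t (rep t).
Proof. by apply: (epsilon_spec (inhabits t) (R t)); exists t. Qed.

Let rep_eq s t : R s t -> rep s = rep t.
Proof.
move=> H; rewrite /rep.
have -> : R s = R t.
  apply functional_extensionality => u; apply: propositional_extensionality.
  by split=> [/(R_trans _ _ _ (R_sym _ _ H))|/(R_trans _ _ _ H)].
by apply: epsilon_inh_irrelevance; exists t.
Qed.

(** Equivalent terms have extensionally equal predicates [R], hence the same representative chosen
    by [epsilon]. The terms that represent themselves thus replace a quotient type. *)
Definition tm_car := {t : term | rep t = t}.
Definition cls (t : term) : tm_car := exist _ (rep t) (esym (rep_eq _ _ (R_rep t))).

Let cls_eq s t : cls s = cls t <-> R s t.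
Proof.
split=> [[E]|H].
  by apply: R_trans (R_rep s) _; rewrite E; apply: R_sym.
by apply: eq_exist_uncurried; exists (rep_eq _ _ H); apply: proof_irrelevance.
Qed.

Lemma cls_val (x : tm_car) : cls (proj1_sig x) = x.
Proof.
case: x => t rt; apply: eq_exist_uncurried; exists rt; exact: proof_irrelevance.
Qed.

Let v := @proj1_sig term (fun t => rep t = t).

Definition term_model : model :=
  Model tm_car (cls Zero) (cls One)
    (fun x y => cls (Add (v x) (v y))) (fun x y => cls (Sub (v x) (v y)))
    (fun x y => cls (Mul (v x) (v y))) (fun x y => cls (Div (v x) (v y)))
    (fun x => cls (Exp (v x))) (fun x y => G (Le (v x) (v y))).

Let R_val t : R (v (cls t)) t.
Proof. exact/R_sym/R_rep. Qed.

Let cong2 (op : term -> term -> term) a b a' b' :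
  (forall s x y, subst_t s (op x y) = op (subst_t s x) (subst_t s y)) ->
  R a a' -> R b b' -> R (op a b) (op a' b').
Proof.
move=> sop Ra Rb; apply: (G_prv [Eq a a'; Eq b b']) => [|B [<-|[<-|[]]]|] //; first exact: Fr_qf.
have Ha : prv T [Eq a a'; Eq b b'] (Eq a a') by apply: prv_hyp; left.
have Hb : prv T [Eq a a'; Eq b b'] (Eq b b') by apply: prv_hyp; right; left.
have := prv_eq_cong _ _ (op (Var 0) (lift_t 1 b)) _ _ Ha.
have := prv_eq_cong _ _ (op (lift_t 1 a') (Var 0)) _ _ Hb.
rewrite !sop /= !subst_t_lift1 !subst_t_id => H1 H2; exact: prv_eq_trans H2 H1.
Qed.

Lemma eval_term_model (s : nat -> term) t :
  eval (M := term_model) (fun i => cls (s i)) t = cls (subst_t s t).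
Proof.
elim: t => //= [a -> b ->|a -> b ->|a -> b ->|a -> b ->|a ->].
1-4: by apply/cls_eq; apply: cong2.
apply/cls_eq; apply: (G_prv [Eq (v (cls (subst_t s a))) (subst_t s a)]) => [|B [<-|[]]|] //;
  first exact: Fr_qf.
 exact: R_val.
exact: (prv_eq_cong T _ (Exp (Var 0)) _ _ (hyp1 (Eq (v (cls (subst_t s a))) (subst_t s a)))).
Qed.

Let G_le a b : G (Le (v (cls a)) (v (cls b))) <-> G (Le a b).
Proof.
have key x y x' y' : R x x' -> R y y' -> G (Le x y) -> G (Le x' y').
  move=> Rx Ry H; apply: (G_prv [Eq x x'; Eq y y'; Le x y]) => [|B [<-|[<-|[<-|[]]]]|] //;
    first exact: Fr_qf.
  have Hx : prv T [Eq x x'; Eq y y'; Le x y] (Eq x x') by apply: prv_hyp; left.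
  have Hy : prv T [Eq x x'; Eq y y'; Le x y] (Eq y y') by apply: prv_hyp; right; left.
  have Hl : prv T [Eq x x'; Eq y y'; Le x y] (Le x y) by apply: prv_hyp; right; right; left.
  have := prv_eqE _ _ (Le (Var 0) (lift_t 1 y)) _ _ Hx.
  have := prv_eqE _ _ (Le (lift_t 1 x') (Var 0)) _ _ Hy.
  by rewrite /= !inst1 /= !subst_t_lift1 !subst_t_id => H1 H2; apply/H1/H2.
by split; apply: key; first [exact: R_val|exact/R_sym/R_val].
Qed.

Let G_imp A B : Fr (Imp A B) -> Fr A -> Fr B -> G (Imp A B) <-> (G A -> G B).
Proof.
move=> FAB FA FB; split=> [H a|H].
  apply: (G_prv [Imp A B; A]) => [//|C [<-|[<-|[]]] //|].
  by apply: prv_impE; apply: prv_hyp; [left|right; left].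
case: (G_dec A FA) => [/H b|na].
  by apply: (G_prv [B]) => [//|C [<-|[]] //|]; apply/prv_impI/prv_hyp; right; left.
apply: (G_prv [Neg A]) => [//|C [<-|[]] //|]; apply/prv_impI/prv_botE.
by apply: (prv_impE _ _ A); apply: prv_hyp; [right; left|left].
Qed.

Let G_and A B : Fr (And A B) -> Fr A -> Fr B -> G (And A B) <-> (G A /\ G B).
Proof.
move=> FAB FA FB; split=> [H|[a b]].
  split; apply: (G_prv [And A B]) => [//|C [<-|[]] //|].
  - exact: prv_andE1 (hyp1 _).
  - exact: prv_andE2 (hyp1 _).
apply: (G_prv [A; B]) => [//|C [<-|[<-|[]]] //|].
by apply: prv_andI; apply: prv_hyp; [left|right; left].
Qed.

Let G_neg A : Fr A -> G (Neg A) -> ~ G A.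
Proof.
move=> FA na a; apply: G_bot; apply: (G_prv [Neg A; A]) => [|C [<-|[<-|[]]] //|];
  first exact: Fr_qf.
by apply: (prv_impE _ _ A); apply: prv_hyp; [left|right; left].
Qed.

Let G_or A B : Fr (Or A B) -> Fr A -> Fr B -> G (Or A B) <-> (G A \/ G B).
Proof.
move=> FAB FA FB; split=> [H|[a|b]].
- case: (G_dec A FA) => [|na]; first by left.
  right; apply: (G_prv [Or A B; Neg A]) => [//|C [<-|[<-|[]]] //|].
  apply: (prv_orE _ _ A B); first by apply: prv_hyp; left.
    apply/prv_botE; apply: (prv_impE _ _ A); apply: prv_hyp; [by right; right; left|by left].
  by apply: prv_hyp; left.
- by apply: (G_prv [A]) => [//|C [<-|[]] //|]; apply: prv_orI1.
- by apply: (G_prv [B]) => [//|C [<-|[]] //|]; apply: prv_orI2.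
Qed.

Lemma qfree_subst s A : qfree A -> qfree (subst_f s A).
Proof. by elim: A => //= A IHA B IHB [/IHA ? /IHB]. Qed.

Lemma truth_qf A : qfree A -> forall s : nat -> term,
  sat (M := term_model) (fun i => cls (s i)) A <-> G (subst_f s A).
Proof.
elim: A => //=.
- by move=> a b _ s; rewrite !eval_term_model; apply: cls_eq.
- by move=> a b _ s; rewrite !eval_term_model; apply: G_le.
- move=> A IHA B IHB [qA qB] s; rewrite IHA // IHB // G_imp //; apply: Fr_qf => /=;
    try split; exact: qfree_subst.
- move=> A IHA B IHB [qA qB] s; rewrite IHA // IHB // G_and //; apply: Fr_qf => /=;
    try split; exact: qfree_subst.
- move=> A IHA B IHB [qA qB] s; rewrite IHA // IHB // G_or //; apply: Fr_qf => /=;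
    try split; exact: qfree_subst.
Qed.

Lemma env_cls (e : nat -> term_model) : e = (fun i => cls (v (e i))).
Proof. by apply functional_extensionality => i; rewrite cls_val. Qed.

Lemma scons_cls (t : term) (s : nat -> term) :
  cls t .: (fun i => cls (s i)) = (fun i => cls ((t .: s) i)).
Proof. by apply functional_extensionality => -[|i]. Qed.

Section Full.
Hypothesis Fr_all : forall A, Fr A.
Hypothesis G_ex : forall A, G (Ex A) -> exists t, G (subst_f (inst [t] Var) A).

Let G_iff A B : prv T [A] B -> G A -> G B.
Proof. by move=> H a; apply: (G_prv [A]) => // C [<-|[]]. Qed.

Lemma truth_full A : forall s : nat -> term,
  sat (M := term_model) (fun i => cls (s i)) A <-> G (subst_f s A).
Proof.
elim: A => [a b|a b| |A IHA B IHB|A IHA B IHB|A IHA B IHB|A IHA|A IHA] s /=;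
  try by rewrite ?eval_term_model ?IHA ?IHB ?cls_eq ?G_le ?G_imp ?G_and ?G_or.
- split=> [H|H x]; last first.
    rewrite -(cls_val x) scons_cls IHA -subst_up1.
    by apply: G_iff H; apply: prv_allE; apply: hyp1.
  apply: NNPP => nall.
  have : G (Ex (Neg (subst_f (up 1 s) A))).
    case: (G_dec _ (Fr_all (All (subst_f (up 1 s) A)))) => // nG.
    apply: G_iff nG; apply: prv_dne; apply: prv_impI.
    apply: (prv_impE _ _ (All (subst_f (up 1 s) A))); first by apply: prv_hyp; right; left.
    apply: prv_allI; apply: prv_dne; apply: prv_impI => /=.
    apply: (prv_impE _ _ (lift_f 1 (Ex (Neg (subst_f (up 1 s) A))))).
      by apply: prv_hyp; right; left.
    apply: (prv_exI _ _ _ (Var 0)); rewrite /= subst_inst1_up.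
    by apply: prv_hyp; left.
  case/G_ex => t /=; rewrite subst_up1 => /G_neg; apply => //.
  by rewrite -IHA -scons_cls; apply: H.
- split=> [[x]|/G_ex [t]].
    rewrite -(cls_val x) scons_cls IHA -subst_up1; apply: G_iff.
    exact: prv_exI (hyp1 _).
  by rewrite subst_up1 -IHA -scons_cls => H; exists (cls t).
Qed.

End Full.
End TermModel.

(** * Enumeration of the syntax *)

Fixpoint enc_t (t : term) : GenTree.tree nat :=
  match t with
  | Var i => GenTree.Leaf i
  | Zero => GenTree.Node 0 []
  | One => GenTree.Node 1 []
  | Add a b => GenTree.Node 2 [enc_t a; enc_t b]
  | Sub a b => GenTree.Node 3 [enc_t a; enc_t b]
  | Mul a b => GenTree.Node 4 [enc_t a; enc_t b]
  | Div a b => GenTree.Node 5 [enc_t a; enc_t b]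
  | Exp a => GenTree.Node 6 [enc_t a]
  end.

Fixpoint dec_t (x : GenTree.tree nat) : term :=
  match x with
  | GenTree.Leaf i => Var i
  | GenTree.Node 1 _ => One
  | GenTree.Node 2 [a; b] => Add (dec_t a) (dec_t b)
  | GenTree.Node 3 [a; b] => Sub (dec_t a) (dec_t b)
  | GenTree.Node 4 [a; b] => Mul (dec_t a) (dec_t b)
  | GenTree.Node 5 [a; b] => Div (dec_t a) (dec_t b)
  | GenTree.Node 6 [a] => Exp (dec_t a)
  | _ => Zero
  end.

Fixpoint enc_f (A : form) : GenTree.tree nat :=
  match A with
  | Eq a b => GenTree.Node 0 [enc_t a; enc_t b]
  | Le a b => GenTree.Node 1 [enc_t a; enc_t b]
  | Bot => GenTree.Node 2 []
  | Imp A B => GenTree.Node 3 [enc_f A; enc_f B]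
  | And A B => GenTree.Node 4 [enc_f A; enc_f B]
  | Or A B => GenTree.Node 5 [enc_f A; enc_f B]
  | All A => GenTree.Node 6 [enc_f A]
  | Ex A => GenTree.Node 7 [enc_f A]
  end.

Fixpoint dec_f (x : GenTree.tree nat) : form :=
  match x with
  | GenTree.Node 0 [a; b] => Eq (dec_t a) (dec_t b)
  | GenTree.Node 1 [a; b] => Le (dec_t a) (dec_t b)
  | GenTree.Node 3 [a; b] => Imp (dec_f a) (dec_f b)
  | GenTree.Node 4 [a; b] => And (dec_f a) (dec_f b)
  | GenTree.Node 5 [a; b] => Or (dec_f a) (dec_f b)
  | GenTree.Node 6 [a] => All (dec_f a)
  | GenTree.Node 7 [a] => Ex (dec_f a)
  | _ => Bot
  end.

Lemma dec_encK_t t : dec_t (enc_t t) = t.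
Proof. by elim: t => //= *; congruence. Qed.

Lemma dec_encK_f A : dec_f (enc_f A) = A.
Proof. by elim: A => //= *; rewrite ?dec_encK_t; congruence. Qed.

(** Countability comes from the encoding into finite labelled trees. Pairs are enumerated because a
    stage of the Henkin constructions needs a term besides the formula. *)
Lemma form_term_enum : exists f : nat -> form * term, forall A t, exists n, f n = (A, t).
Proof.
pose T := (GenTree.tree nat * GenTree.tree nat)%type.
exists (fun n => match unpickle n : option T with
  | Some x => (dec_f x.1, dec_t x.2) | None => (Bot, Zero) end) => A t.
by exists (pickle ((enc_f A, enc_t t) : T)); rewrite pickleK /= dec_encK_f dec_encK_t.
Qed.

Theorem completeness T L A :
  (forall M : model, models M T -> forall e : nat -> M,
     (forall B, In B L -> sat e B) -> sat e A) -> prv T L A.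
Proof.
move=> valid; apply: NNPP => nprv.
have [en en_surj] := form_term_enum.
pose Con L := ~ prv T L Bot.
(* The term of the pair is only a tag here: with [Zero] the stage decides [B] itself; with another
   term an accepted existential [B] is represented by one of its instances. Every [B] is met with
   both tags. *)
pose Opt n C := let B := (en n).1 in C = Neg B \/
  match (en n).2 with
  | Zero => C = B
  | _ => exists D, B = Ex D /\ exists t, C = subst_f (inst [t] Var) D
  end \/ (C = B /\ forall D, B <> Ex D).
have step n K : Con K -> exists C, Opt n C /\ Con (C :: K).
  move=> conK; rewrite /Opt; move: (en n).1 (en n).2 => B tg.
  case: (classic (Con (Neg B :: K))) => [con|/NNPP ncon]; first by exists (Neg B); split; [left|].
  have prvB : prv T K B by apply/prv_dne/prv_impI.
  have conB : Con (B :: K).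
    by move=> H; apply: conK; apply: prv_impE (prv_impI _ _ _ _ H) prvB.
  case: (classic (exists D, B = Ex D)) => [[D E]|nex]; last first.
    by exists B; split=> //; right; right; split=> // D E; apply: nex; exists D.
  have [n1 Hn1] := forms_below K; have [n2 Hn2] := form_below D.
  (* This variable is fresh for [K] and [D]; binding it turns a refutation of the instance into the
     second premise of [prv_exE]. *)
  set x := n1 + n2.
  have conD : Con (subst_f (inst [Var x] Var) D :: K).
    move=> H; apply: conK; rewrite E in prvB.
    apply: (prv_exE _ _ _ _ prvB); have := prv_subst _ _ _ H (bind x).
    rewrite /= bind_inst; last by apply: fv_below_mono Hn2; rewrite /x; lia.
    rewrite bind_lifts // => C inC; apply: fv_below_mono (Hn1 _ inC); rewrite /x; lia.
  have wit : exists C, (C = Neg B \/ (exists D, B = Ex D /\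
      exists t, C = subst_f (inst [t] Var) D) \/ (C = B /\ forall D, B <> Ex D)) /\ Con (C :: K).
    by eexists; split; last exact: conD; right; left; exists D; split=> //; exists (Var x).
  by case: tg => //; exists B; split=> //; right; left.
have con0 : Con (Neg A :: L) by move=> H; apply/nprv/prv_dne/prv_impI.
have [G [G0 Gopt Gfin]] := lindenbaum Con Opt step (Neg A :: L) con0.
pose Fr := fun _ : form => True.
have Gcon K : (forall C, In C K -> G C) -> ~ prv T K Bot.
  by move=> /Gfin [L' con sub] H; apply/con/(prv_weak _ _ _ H).
have Gdec B : Fr B -> G B \/ G (Neg B).
  move=> _; have [n E] := en_surj B Zero; have [C] := Gopt n.
  by rewrite /Opt E /= => -[->|[->|[-> _]]]; [right|left|left].
have Gprv K C : Fr C -> (forall B, In B K -> G B) -> prv T K C -> G C.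
  move=> _ GK H; case: (Gdec C I) => // GN.
  case: (Gcon (Neg C :: K)) => [D [<- //|]|]; first exact: GK.
  apply: (prv_impE _ _ C); first by apply: prv_hyp; left.
  by apply: prv_weak H _ _; right.
have Gbot : ~ G Bot.
  by move=> GB; apply: (Gcon [Bot]) => [C [<-|[]] //|]; apply: prv_hyp; left.
have Gex D : G (Ex D) -> exists t, G (subst_f (inst [t] Var) D).
  move=> GD; have [n E] := en_surj (Ex D) One; have [C] := Gopt n.
  rewrite /Opt E /= => -[->|[[D' [[<-] [t ->]]]|[_ /(_ D)] //]]; last by exists t.
  move=> GN; case: (Gcon [Neg (Ex D); Ex D]) => [B [<-|[<-|[]]] //|].
  by apply: (prv_impE _ _ (Ex D)); apply: prv_hyp; [left|right; left].
have frq B : qfree B -> Fr B by [].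
pose M := term_model T Fr G frq Gprv.
have truth B (s : nat -> term) :
    sat (M := M) (fun i => cls T Fr G frq Gprv (s i)) B <-> G (subst_f s B).
  exact: truth_full.
have satA : sat (M := M) (fun i => cls T Fr G frq Gprv (Var i)) A.
  apply: valid => [B TB e|B inB]; last first.
    by rewrite truth subst_f_id; apply: G0; right.
  rewrite (env_cls T Fr G frq Gprv e) truth; apply: (Gprv []) => //.
  exact: prv_ax.
apply: (Gcon [Neg A; A]) => [B [<-|[<-|[]]]|].
- by apply: G0; left.
- by move: satA; rewrite truth subst_f_id.
- by apply: (prv_impE _ _ A); apply: prv_hyp; [left|right; left].
Qed.

(** * Models of R(exp) as ordered rings *)

Section RModel.
Variables (M : model) (HM : models M R_exp).
Implicit Types x y z a b c d : M.

Definition mlt x y := mle x y /\ x <> y.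

Let ax A : R_ax A -> forall x y z, sat (z .: y .: x .: (fun _ : nat => m0)) A.
Proof. by move=> HA x y z; apply: HM; apply: R_exp_base. Qed.

Lemma maddA x y z : madd (madd x y) z = madd x (madd y z). Proof. exact: ax ax_addA x y z. Qed.
Lemma maddC x y : madd x y = madd y x. Proof. exact: ax ax_addC x y m0. Qed.
Lemma madd0 x : madd x m0 = x. Proof. exact: ax ax_add0 x m0 m0. Qed.
Lemma mmulA x y z : mmul (mmul x y) z = mmul x (mmul y z). Proof. exact: ax ax_mulA x y z. Qed.
Lemma mmulC x y : mmul x y = mmul y x. Proof. exact: ax ax_mulC x y m0. Qed.
Lemma mmul1 x : mmul x m1 = x. Proof. exact: ax ax_mul1 x m0 m0. Qed.
Lemma mmul0 x : mmul x m0 = m0. Proof. exact: ax ax_mul0 x m0 m0. Qed.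
Lemma mmulD x y z : mmul x (madd y z) = madd (mmul x y) (mmul x z). Proof. exact: ax ax_mulD x y z. Qed.
Lemma mle_refl x : mle x x. Proof. exact: ax ax_le_refl x m0 m0. Qed.
Lemma mle_anti x y : mle x y -> mle y x -> x = y.
Proof. by move=> H1 H2; apply: (ax _ ax_le_anti x y m0). Qed.
Lemma mle_trans y x z : mle x y -> mle y z -> mle x z.
Proof. by move=> H1 H2; apply: (ax _ ax_le_trans x y z). Qed.
Lemma mle_total x y : mle x y \/ mle y x. Proof. exact: ax ax_le_total x y m0. Qed.
Lemma mlt_succ x : mlt x (madd x m1). Proof. by have [] := ax _ ax_discrete x m0 m0. Qed.
Lemma mle_succ x y : mlt x y -> mle (madd x m1) y.
Proof. by have [_ H] := ax _ ax_discrete x y m0; case=> *; apply: H. Qed.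
Lemma mlt_add x y z : mlt x y -> mlt (madd x z) (madd y z).
Proof. by case=> *; apply: (ax _ ax_lt_add x y z). Qed.
Lemma mlt_mul x y z : z <> m0 -> mlt x y -> mlt (mmul x z) (mmul y z).
Proof. by move=> z0 [? ?]; apply: (ax _ ax_lt_mul x y z). Qed.
Lemma msubK x y : mle y x -> madd (msub x y) y = x.
Proof. by have [H _] := ax _ ax_sub x y m0; apply: H. Qed.
Lemma msub_lt x y : mlt x y -> msub x y = m0.
Proof. by have [_ H] := ax _ ax_sub x y m0; case=> *; apply: H. Qed.
Lemma mdiv_le x y : mle (mmul (madd y m1) (mdiv x y)) x.
Proof. by have [] := ax _ ax_div x y m0. Qed.
Lemma mdiv_lt x y : mlt (msub x (mmul (madd y m1) (mdiv x y))) (madd y m1).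
Proof. by have [] := ax _ ax_div x y m0. Qed.
Lemma mexp0 : mexp m0 = m1 :> M.
Proof. exact: (HM _ R_exp_0 (fun _ => m0)). Qed.
Lemma mexpS x : mexp (madd x m1) = mmul (madd m1 m1) (mexp x).
Proof. exact: (HM _ R_exp_S (m0 .: m0 .: x .: (fun _ => m0))). Qed.

Lemma m_srt : semi_ring_theory (m0 : M) m1 madd mmul eq.
Proof.
split=> [x|x y|x y z|x|x|x y|x y z|x y z]; rewrite ?maddA ?mmulA //.
- by rewrite maddC madd0.
- exact: maddC.
- by rewrite mmulC mmul1.
- by rewrite mmulC mmul0.
- exact: mmulC.
- by rewrite mmulC mmulD mmulC [mmul z y]mmulC.
Qed.
Add Ring m_ring : m_srt.

Lemma m_lt_or x y : mle x y \/ mlt y x.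
Proof.
case: (classic (x = y)) => [->|ne]; first by left; exact: mle_refl.
by case: (mle_total x y); [left|right; split=> // E; apply: ne].
Qed.

Lemma mlt_irr x y : mle x y -> ~ mlt y x.
Proof. by move=> le [le' ne]; apply: ne; exact: mle_anti. Qed.

Lemma mle_add x y z : mle x y -> mle (madd x z) (madd y z).
Proof.
move=> le; case: (classic (x = y)) => [->|ne]; first exact: mle_refl.
by case: (mlt_add x y z).
Qed.

Lemma maddI x y z : madd x z = madd y z -> x = y.
Proof.
move=> E; case: (m_lt_or x y) => [le|lt]; last by case: (mlt_add _ _ z lt) => _; rewrite E.
by apply: NNPP => ne; case: (mlt_add x y z).
Qed.

Lemma mle_addI x y z : mle (madd x z) (madd y z) -> mle x y.
Proof. by move=> le; case: (m_lt_or x y) => // lt; case: (mlt_irr _ _ le); exact: mlt_add. Qed.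

Lemma mlt01 : mlt m0 m1.
Proof. by have := mlt_succ m0; rewrite maddC madd0. Qed.

(** Multiplying [0 < 1] by [x] gives [0 < x]. *)
Lemma mge0 x : mle m0 x.
Proof.
case: (classic (x = m0)) => [->|ne]; first exact: mle_refl.
by have := mlt_mul _ _ x ne mlt01; rewrite ![mmul _ x]mmulC mmul0 mmul1; case.
Qed.

Lemma madd_eq0 x y : madd x y = m0 -> x = m0.
Proof.
move=> E; apply: mle_anti; last exact: mge0.
by rewrite -E -{1}(madd0 x) ![madd x _]maddC; apply: mle_add; exact: mge0.
Qed.

Lemma msub_cases x y :
  (exists d, [/\ x = madd y d, msub x y = d & msub y x = m0]) \/
  (exists d, [/\ y = madd x d, msub x y = m0 & msub y x = d]).
Proof.
have xx z : msub z z = m0.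
  apply: (maddI _ _ z); rewrite msubK; [by rewrite maddC madd0|exact: mle_refl].
case: (m_lt_or x y) => [le|lt]; last first.
  left; exists (msub x y); split=> //; last exact: msub_lt.
  by rewrite maddC msubK //; case: lt.
case: (classic (x = y)) => [->|ne]; first by left; exists m0; rewrite madd0 xx.
right; exists (msub y x); split=> //; first by rewrite maddC msubK.
by apply: msub_lt.
Qed.

(** Integers as differences in normal form, with one component 0. Truncated subtraction in both
    directions computes the normal form, and Leibniz equality is the right equality. *)
Definition zz := {p : M * M | p.1 = m0 \/ p.2 = m0}.

Lemma cls_proof a b : msub a b = m0 \/ msub b a = m0.
Proof. by case: (msub_cases a b) => -[d [_ ? ?]]; [right|left]. Qed.

Definition zcls a b : zz := exist _ (msub a b, msub b a) (cls_proof a b).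
Definition zp (u : zz) : M := (proj1_sig u).1.
Definition zn (u : zz) : M := (proj1_sig u).2.

Lemma zz_eq p q H H' : p = q -> exist _ p H = exist _ q H' :> zz.
Proof. by move=> E; case: q / E H' => H'; congr exist; exact: boolp.Prop_irrelevance. Qed.

Lemma zcls_eq a b c d : zcls a b = zcls c d <-> madd a d = madd c b.
Proof.
have sum0 x y : madd x y = m0 -> x = m0 /\ y = m0.
  by move=> E; split; [exact: madd_eq0 E|move: E; rewrite maddC; exact: madd_eq0].
rewrite /zcls; split=> [[]|E]; last apply: zz_eq; try move: E;
case: (msub_cases a b) => -[x [-> -> ->]]; case: (msub_cases c d) => -[y [-> -> ->]].
- by move=> -> _; ring.
- by move=> -> <-; ring.
- by move=> <- ->; ring.
- by move=> _ ->; ring.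
- move=> E; congr pair; apply: (maddI _ _ (madd b d)).
  by transitivity (madd (madd b x) d); [ring|rewrite E; ring].
- move=> E; have [] := sum0 x y; last by move=> -> ->.
  apply: (maddI _ _ (madd b c)); transitivity (madd (madd b x) (madd c y)); first by ring.
  by rewrite E; ring.
- move=> E; have [] := sum0 y x; last by move=> -> ->.
  apply: (maddI _ _ (madd a d)); transitivity (madd (madd d y) (madd a x)); first by ring.
  by rewrite -E; ring.
- move=> E; congr pair; apply: (maddI _ _ (madd a c)).
  by transitivity (madd c (madd a x)); [ring|rewrite -E; ring].
Qed.

Lemma zclsK u : zcls (zp u) (zn u) = u.
Proof.
case: u => -[a b] H; rewrite /zp /zn /=.
have s0 x : msub x m0 = x by have := msubK x m0 (mge0 x); rewrite madd0.
have s0' x : msub m0 x = m0.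
  case: (msub_cases m0 x) => -[d [E -> E']] //.
  by move: E; rewrite maddC => /esym /madd_eq0.
by apply: zz_eq; case: H => /= ->; rewrite s0 s0'.
Qed.

Lemma zcls_val a b : madd (zp (zcls a b)) b = madd a (zn (zcls a b)).
Proof. by apply/zcls_eq; rewrite zclsK. Qed.

Lemma zind (P : zz -> Prop) : (forall a b, P (zcls a b)) -> forall u, P u.
Proof. by move=> H u; rewrite -(zclsK u). Qed.

Definition zadd u v := zcls (madd (zp u) (zp v)) (madd (zn u) (zn v)).
Definition zopp u := zcls (zn u) (zp u).
Definition zmul u v :=
  zcls (madd (mmul (zp u) (zp v)) (mmul (zn u) (zn v))) (madd (mmul (zp u) (zn v)) (mmul (zn u) (zp v))).

Lemma zaddE a b c d : zadd (zcls a b) (zcls c d) = zcls (madd a c) (madd b d).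
Proof.
have H1 := zcls_val a b; have H2 := zcls_val c d; apply/zcls_eq.
move: (zp _) (zn _) H1 (zp _) (zn _) H2 => p1 p2 H1 q1 q2 H2.
by transitivity (madd (madd p1 b) (madd q1 d)); [ring|rewrite H1 H2; ring].
Qed.

Lemma zoppE a b : zopp (zcls a b) = zcls b a.
Proof.
have H1 := zcls_val a b; apply/zcls_eq; move: (zp _) (zn _) H1 => p1 p2 H1.
by transitivity (madd a p2); [ring|rewrite -H1; ring].
Qed.

Lemma zmulE a b c d : zmul (zcls a b) (zcls c d) =
  zcls (madd (mmul a c) (mmul b d)) (madd (mmul a d) (mmul b c)).
Proof.
have H1 := zcls_val a b; have H2 := zcls_val c d; rewrite /zmul.
move: (zp _) (zn _) H1 (zp _) (zn _) H2 => p1 p2 H1 q1 q2 H2.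
transitivity (zcls (madd (mmul a q1) (mmul b q2)) (madd (mmul a q2) (mmul b q1))); apply/zcls_eq.
  transitivity (madd (mmul (madd p1 b) q1) (mmul (madd a p2) q2)); first by ring.
  by rewrite -H1 [X in madd (mmul X _)]H1; ring.
transitivity (madd (mmul a (madd q1 d)) (mmul b (madd c q2))); first by ring.
by rewrite -H2 [X in madd (mmul _ X)]H2; ring.
Qed.

Lemma zmul_eq0 u v : zmul u v = zcls m0 m0 -> u = zcls m0 m0 \/ v = zcls m0 m0.
Proof.
rewrite -(zclsK u) -(zclsK v) zmulE !zcls_eq.
have Hu := proj2_sig u; have Hv := proj2_sig v; rewrite -/(zp u) -/(zn u) -/(zp v) -/(zn v) in Hu Hv.
move: (zp u) (zn u) (zp v) (zn v) Hu Hv => p1 p2 q1 q2 Hu Hv.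
have mul_eq0 x y : mmul x y = m0 -> x = m0 \/ y = m0.
  move=> E; case: (classic (y = m0)) => [|y0]; [by right|left; apply: NNPP => x0].
  have lt : mlt m0 x by split; [exact: mge0|move/esym].
  have [_] := mlt_mul _ _ y y0 lt; rewrite E mmulC mmul0; exact.
have a0 x : madd m0 x = x by rewrite maddC madd0.
have z0 x : mmul m0 x = m0 by rewrite mmulC mmul0.
case: Hu => ->; case: Hv => ->; rewrite ?(mmul0, z0, madd0, a0) // => E;
  first [have [->|->] := mul_eq0 _ _ E | have [->|->] := mul_eq0 _ _ (esym E)];
  first [by left | by right].
Qed.

Definition zle u v := mle (madd (zp u) (zn v)) (madd (zp v) (zn u)).

Lemma zleE a b c d : zle (zcls a b) (zcls c d) <-> mle (madd a d) (madd c b).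
Proof.
have H1 := zcls_val a b; have H2 := zcls_val c d; rewrite /zle.
move: (zp _) (zn _) H1 (zp _) (zn _) H2 => p1 p2 H1 q1 q2 H2.
have E1 : madd (madd p1 q2) (madd b d) = madd (madd a d) (madd p2 q2).
  by transitivity (madd (madd p1 b) (madd q2 d)); [ring|rewrite H1; ring].
have E2 : madd (madd q1 p2) (madd b d) = madd (madd c b) (madd p2 q2).
  by transitivity (madd (madd q1 d) (madd p2 b)); [ring|rewrite H2; ring].
split=> H; [apply: (mle_addI _ _ (madd p2 q2)); rewrite -E1 -E2
           |apply: (mle_addI _ _ (madd b d)); rewrite E1 E2]; exact: mle_add.
Qed.

End RModel.

(** A copy of [zz] that carries [HM], because the algebraic instances attached to it depend on the
    axioms. *)
Definition zring (M : model) (HM : models M R_exp) := zz M.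

Section Ring.
Import boolp.
Variables (M : model) (HM : models M R_exp).
Local Notation Z := (zring M HM).
Local Notation zc := (zcls M HM).
Add Ring m_ring2 : (m_srt M HM).
Implicit Types u v w : Z.

HB.instance Definition _ := gen_eqMixin Z.
HB.instance Definition _ := gen_choiceMixin Z.

Let zI (P : Z -> Prop) : (forall a b, P (zc a b)) -> forall u, P u := zind M HM P.

Fact zaddA : associative (zadd M HM : Z -> Z -> Z).
Proof.
elim/zI=> a b; elim/zI=> c d; elim/zI=> e f; rewrite !zaddE; apply/zcls_eq; ring.
Qed.
Fact zaddC : commutative (zadd M HM : Z -> Z -> Z).
Proof. elim/zI=> a b; elim/zI=> c d; rewrite !zaddE; apply/zcls_eq; ring. Qed.
Fact zadd0 : left_id (zc m0 m0) (zadd M HM : Z -> Z -> Z).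
Proof. elim/zI=> a b; rewrite !zaddE; apply/zcls_eq; ring. Qed.
Fact zaddN : left_inverse (zc m0 m0) (zopp M HM : Z -> Z) (zadd M HM).
Proof. elim/zI=> a b; rewrite zoppE !zaddE; apply/zcls_eq; ring. Qed.
HB.instance Definition _ := GRing.isZmodule.Build Z zaddA zaddC zadd0 zaddN.

Fact zmulA : associative (zmul M HM : Z -> Z -> Z).
Proof.
elim/zI=> a b; elim/zI=> c d; elim/zI=> e f; rewrite !zmulE; apply/zcls_eq; ring.
Qed.
Fact zmulC : commutative (zmul M HM : Z -> Z -> Z).
Proof. elim/zI=> a b; elim/zI=> c d; rewrite !zmulE; apply/zcls_eq; ring. Qed.
Fact zmul1 : left_id (zc m1 m0) (zmul M HM : Z -> Z -> Z).
Proof. elim/zI=> a b; rewrite !zmulE; apply/zcls_eq; ring. Qed.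
Fact zmulD : left_distributive (zmul M HM : Z -> Z -> Z) (zadd M HM).
Proof.
elim/zI=> a b; elim/zI=> c d; elim/zI=> e f; rewrite zaddE !zmulE zaddE; apply/zcls_eq; ring.
Qed.
Fact z1_neq0 : zc m1 m0 != zc m0 m0 :> Z.
Proof.
apply/eqP => /zcls_eq; rewrite !(madd0 M HM) => E.
by have [_] := mlt01 M HM; rewrite E.
Qed.
HB.instance Definition _ := GRing.Zmodule_isComNzRing.Build Z zmulA zmulC zmul1 zmulD z1_neq0.

Import Order.TTheory GRing.Theory Num.Theory.
Local Open Scope ring_scope.

Definition zunit : {pred Z} := fun u => `[< exists v : Z, v * u = 1 >].
(** The algebraic hierarchy places integral domains above rings with a partial inverse, which is
    chosen classically. *)
Definition zinv u : Z :=
  if pselect (exists v : Z, v * u = 1) is left H then projT1 (cid H) else u.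

Fact zmulVx : {in zunit, left_inverse 1 zinv *%R}.
Proof.
move=> u /asboolP H; rewrite /zinv; case: pselect => // H'; exact: projT2 (cid H').
Qed.
Fact zunitPl (u v : Z) : v * u = 1 -> zunit u.
Proof. by move=> H; apply/asboolP; exists v. Qed.
Fact zinv_out : {in [predC zunit], zinv =1 id}.
Proof. by move=> u /asboolP H; rewrite /zinv; case: pselect. Qed.
HB.instance Definition _ := GRing.ComNzRing_hasMulInverse.Build Z zmulVx zunitPl zinv_out.

Fact zintegral (u v : Z) : u * v = 0 -> (u == 0) || (v == 0).
Proof. by move/(zmul_eq0 M HM) => [->|->]; rewrite eqxx ?orbT. Qed.
HB.instance Definition _ := GRing.ComUnitRing_isIntegral.Build Z zintegral.

Definition zleb (u v : Z) : bool := `[< zle M u v >].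
Definition zltb (u v : Z) : bool := (v != u) && zleb u v.
Definition znorm (u : Z) : Z := if zleb 0 u then u else - u.

Lemma zlebE a b c d : zleb (zc a b) (zc c d) <-> mle (madd a d) (madd c b).
Proof. by rewrite /zleb; split=> [/asboolP/zleE|H]; [|apply/asboolP/zleE]. Qed.

Let le0 a b : zleb 0 (zc a b) <-> mle b a.
Proof. by rewrite zlebE maddC // !madd0. Qed.

Let le0' a b : zleb (zc a b) 0 <-> mle a b.
Proof. by rewrite zlebE madd0 // maddC // madd0. Qed.

Fact zle0_add (u v : Z) : zleb 0 u -> zleb 0 v -> zleb 0 (u + v).
Proof.
elim/zI: u => a b; elim/zI: v => c d; rewrite [_ + _]zaddE !le0 => H1 H2.
apply: (mle_trans _ HM (madd a d)); first exact: mle_add.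
by rewrite ![madd a _]maddC //; exact: mle_add.
Qed.

Fact zle0_anti (u : Z) : zleb 0 u -> zleb u 0 -> u = 0.
Proof.
elim/zI: u => a b; rewrite le0 le0' => H1 H2; apply/zcls_eq.
by rewrite (mle_anti _ HM _ _ H1 H2); ring.
Qed.

Fact zle0_total (u : Z) : zleb 0 u || zleb u 0.
Proof.
by elim/zI: u => a b; apply/orP; rewrite le0 le0'; case: (mle_total M HM a b); [right|left].
Qed.

Let nonneg (u : Z) : zleb 0 u -> exists a, u = zc a m0.
Proof.
elim/zI: u => a b; rewrite le0 => le; exists (msub a b); apply/zcls_eq.
by rewrite madd0 // msubK.
Qed.

Fact zle0_mul (u v : Z) : zleb 0 u -> zleb 0 v -> zleb 0 (u * v).
Proof.
move=> /nonneg [a ->] /nonneg [b ->]; rewrite [_ * _]zmulE le0.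
by rewrite !mmul0 // mmulC // mmul0 // madd0 //; exact: mge0.
Qed.

Fact zsub_ge0 (u v : Z) : zleb 0 (v - u) = zleb u v.
Proof.
apply/idP/idP; elim/zI: u => a b; elim/zI: v => c d; rewrite [- _]zoppE [_ + _]zaddE le0 zlebE;
  by rewrite [madd d a]maddC.
Qed.

Fact znormN (u : Z) : znorm (- u) = znorm u.
Proof.
have E (v : Z) : zleb 0 (- v) = zleb v 0 by rewrite -sub0r zsub_ge0.
rewrite /znorm E opprK; case: ifP; case: ifP => // H1 H2.
  by rewrite (zle0_anti _ H1 H2) oppr0.
by have := zle0_total u; rewrite H1 H2.
Qed.

Fact zge0_norm (u : Z) : zleb 0 u -> znorm u = u.
Proof. by rewrite /znorm => ->. Qed.

Fact zlt_def (u v : Z) : zltb u v = (v != u) && zleb u v. Proof. by []. Qed.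

HB.instance Definition _ := Num.IntegralDomain_isLeReal.Build Z
  zle0_add zle0_mul zle0_anti zsub_ge0 zle0_total znormN zge0_norm zlt_def.

Definition phi (a : M) : Z := zc a m0.

Lemma zc_phi a b : zc a b = phi a - phi b.
Proof. by rewrite /phi [- _]zoppE [_ + _]zaddE madd0 // maddC // madd0. Qed.

Lemma phiD a b : phi (madd a b) = phi a + phi b.
Proof. by rewrite /phi [_ + _]zaddE madd0. Qed.
Lemma phiM a b : phi (mmul a b) = phi a * phi b.
Proof. rewrite /phi [_ * _]zmulE; apply/zcls_eq; ring. Qed.
Lemma phi0 : phi m0 = 0. Proof. by []. Qed.
Lemma phi1 : phi m1 = 1. Proof. by []. Qed.
Lemma phi_le a b : phi a <= phi b <-> mle a b.
Proof. by rewrite /phi; have := zlebE a m0 b m0; rewrite !madd0. Qed.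
Lemma phi_inj a b : phi a = phi b -> a = b.
Proof. by move/zcls_eq; rewrite !madd0. Qed.
Lemma phi_lt a b : phi a < phi b <-> mlt M a b.
Proof.
rewrite lt_neqAle; split=> [/andP [/eqP ne /phi_le le]|[le ne]].
  by split=> // E; apply: ne; rewrite E.
by apply/andP; split; [apply/eqP => /phi_inj|apply/phi_le].
Qed.
Lemma phi_ge0 a : 0 <= phi a.
Proof. by rewrite -phi0; apply/phi_le; exact: mge0. Qed.

(** By the normal form, negative integers are sent to 0. *)
Definition toM (u : Z) : M := zp M u.

Lemma toMK a : toM (phi a) = a.
Proof. by have := msubK M HM a m0 (mge0 M HM a); rewrite madd0. Qed.

Lemma phi_toM u : 0 <= u -> phi (toM u) = u.
Proof. by move=> /nonneg [a ->]; rewrite toMK. Qed.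
End Ring.

From mathcomp Require Import ring lra.
Import Order.TTheory GRing.Theory Num.Theory.
Local Open Scope ring_scope.

(** * Ordered rings with floor division and powers of two *)

(** The setting for all calculations with sums. [pw] is constrained on nonnegative arguments only
    and [fl] for positive divisors only; induction comes separately, from [ind_class]. *)
Record oring := Oring {
  oz :> realDomainType;
  pw : oz -> oz;
  fl : oz -> oz -> oz;
  oz_disc : forall x y : oz, x < y -> x + 1 <= y;
  pw0 : pw 0 = 1;
  pwS : forall x, 0 <= x -> pw (x + 1) = 2 * pw x;
  fl_spec : forall x y, 0 < y -> 0 <= x - fl x y * y /\ x - fl x y * y < y }.
Arguments pw {_}. Arguments fl {_}.

Definition md {Z : oring} (x y : Z) : Z := x - fl x y * y.

Section Floor.
Variable Z : oring.
Implicit Types x y q r : Z.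

Lemma md_ge0 x y : 0 < y -> 0 <= md x y.
Proof. by case/(fl_spec _ x). Qed.

Lemma md_lt x y : 0 < y -> md x y < y.
Proof. by case/(fl_spec _ x). Qed.

Lemma fl_md x y : x = fl x y * y + md x y.
Proof. rewrite /md; ring. Qed.

Lemma fl_uniq x y q r : x = q * y + r -> 0 <= r -> r < y -> fl x y = q.
Proof.
move=> E r0 ry; have y0 : 0 < y by lra.
have m0 := md_ge0 x y y0; have my := md_lt x y y0; have := fl_md x y.
move: (fl x y) (md x y) m0 my => q' r' m0 my E'.
have Eq : (q - q') * y = r' - r by rewrite E' in E; lra.
case: (ltgtP q q') => // /oz_disc lt; nra.
Qed.

Lemma md_uniq x y q r : x = q * y + r -> 0 <= r -> r < y -> md x y = r.
Proof. by move=> E r0 ry; rewrite /md (fl_uniq _ _ _ _ E r0 ry) E; ring. Qed.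

Lemma fl_addM x y k : 0 < y -> fl (x + k * y) y = fl x y + k.
Proof.
move=> y0; apply: (fl_uniq _ _ _ (md x y)); [|exact: md_ge0|exact: md_lt].
by rewrite {1}(fl_md x y); ring.
Qed.

Lemma md_addM x y k : 0 < y -> md (x + k * y) y = md x y.
Proof. by move=> y0; rewrite /md fl_addM //; ring. Qed.

Lemma md_small x y : 0 <= x -> x < y -> md x y = x.
Proof. by move=> x0 xy; apply: (md_uniq _ _ 0) => //; ring. Qed.

Lemma fl_small x y : 0 <= x -> x < y -> fl x y = 0.
Proof. by move=> x0 xy; apply: (fl_uniq _ _ _ x) => //; ring. Qed.

Lemma md_eqE x x' y : md x y = md x' y -> exists k, x = x' + k * y.
Proof.
move=> E; exists (fl x y - fl x' y).
by rewrite {1}(fl_md x y) {1}(fl_md x' y) E; ring.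
Qed.

Lemma fl_ge0 x y : 0 <= x -> 0 < y -> 0 <= fl x y.
Proof.
move=> x0 y0; have := md_lt x y y0; have := fl_md x y => E ly.
case: (leP 0 (fl x y)) => // /oz_disc lt; nra.
Qed.

(** If neither the parts below [D] nor the digits of weight [D] in base [X] produce a carry, both
    simply add up. In this way a sum is accumulated in one digit of a growing number. *)
Lemma acc_digit D X x y : 0 < D -> 0 < X ->
  md x D + md y D < D -> md (fl x D) X + md (fl y D) X < X ->
  md (x + y) D = md x D + md y D /\
  md (fl (x + y) D) X = md (fl x D) X + md (fl y D) X.
Proof.
move=> D0 X0 lo hi.
have := md_ge0 x D D0; have := md_ge0 y D D0.
have := md_ge0 (fl x D) X X0; have := md_ge0 (fl y D) X X0 => h1 h2 h3 h4.
have E : x + y = (fl x D + fl y D) * D + (md x D + md y D).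
  by rewrite {1}(fl_md x D) {1}(fl_md y D); ring.
split; first by apply: (md_uniq _ _ _ _ E) => //; lra.
rewrite (fl_uniq _ _ _ _ E) //; last by lra.
apply: (md_uniq _ _ (fl (fl x D) X + fl (fl y D) X)) => //; last by lra.
by rewrite {1}(fl_md (fl x D) X) {1}(fl_md (fl y D) X); ring.
Qed.

Lemma digits D X x q h r : x = (q * X + h) * D + r -> 0 <= r -> r < D -> 0 <= h -> h < X ->
  md x D = r /\ md (fl x D) X = h.
Proof.
move=> E r0 rD h0 hX; rewrite (md_uniq _ _ _ _ E) // (fl_uniq _ _ _ _ E) //.
by split=> //; apply: (md_uniq _ _ q).
Qed.

End Floor.

(** * Definable functions *)

Section Closed.
Variables (W : Type) (Zw : W -> oring).

(** The ring may vary with the index: [W] is one fixed ring when induction is needed, and the type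
    of all models with environments when a uniform term is to be extracted. *)
Record closed (K : (forall w, Zw w) -> Prop) : Prop := Closed {
  cl_1 : K (fun w => 1);
  cl_add : forall F G, K F -> K G -> K (fun w => F w + G w);
  cl_opp : forall F, K F -> K (fun w => - F w);
  cl_mul : forall F G, K F -> K G -> K (fun w => F w * G w);
  cl_fl : forall F G, K F -> K G -> K (fun w => fl (F w) (G w));
  cl_pw : forall F, K F -> K (fun w => pw (F w)) }.

Variable K : (forall w, Zw w) -> Prop.
Hypothesis cK : closed K.

Lemma cl_sub F G : K F -> K G -> K (fun w => F w - G w).
Proof. by move=> HF HG; apply: (cl_add K cK) => //; apply: (cl_opp K cK). Qed.

Lemma cl_0 : K (fun w => 0).
Proof.
have -> : (fun w => 0 : Zw w) = (fun w => 1 - 1).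
  by apply: functional_extensionality_dep => w; rewrite subrr.
by apply: cl_sub; apply: (cl_1 K cK).
Qed.

Lemma cl_nat n : K (fun w => n%:R).
Proof.
elim: n => [|n IH]; first exact: cl_0.
have -> : (fun w => (S n)%:R : Zw w) = (fun w => 1 + n%:R).
  by apply: functional_extensionality_dep => w; rewrite mulrS.
by apply: (cl_add K cK) => //; apply: (cl_1 K cK).
Qed.

Lemma cl_md F G : K F -> K G -> K (fun w => md (F w) (G w)).
Proof.
by move=> HF HG; apply: cl_sub => //; apply: (cl_mul K cK) => //; apply: (cl_fl K cK).
Qed.

(** Operators are described by their action on members of [K], so that functions of several
    arguments need no class of their own. *)
Definition K1 (S : forall w, Zw w -> Zw w) :=
  forall F, K F -> K (fun w => S w (F w)).
Definition K2 (S : forall w, Zw w -> Zw w -> Zw w) :=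
  forall F G, K F -> K G -> K (fun w => S w (F w) (G w)).
Definition K3 (S : forall w, Zw w -> Zw w -> Zw w -> Zw w) :=
  forall F G H, K F -> K G -> K H -> K (fun w => S w (F w) (G w) (H w)).

End Closed.

Arguments K1 {W Zw}. Arguments K2 {W Zw}. Arguments K3 {W Zw}.
Arguments closed {W Zw}.
Arguments cl_1 {W Zw}. Arguments cl_add {W Zw} K _ {F G}. Arguments cl_opp {W Zw} K _ {F}.
Arguments cl_mul {W Zw} K _ {F G}. Arguments cl_fl {W Zw} K _ {F G}. Arguments cl_pw {W Zw} K _ {F}.

Ltac kk_op := match goal with
  | H : ?P |- ?P => exact: H
  | H : K1 ?K _ |- ?K _ => apply H
  | H : K2 ?K _ |- ?K _ => apply H
  | H : K3 ?K _ |- ?K _ => apply H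
  | H : closed ?K |- ?K _ => first
    [ exact: (cl_1 _ H) | exact: (cl_0 _ _ K H) | exact: (cl_nat _ _ K H)
    | apply: (cl_sub _ _ K H) | apply: (cl_add _ H) | apply: (cl_opp _ H)
    | apply: (cl_mul _ H) | apply: (cl_md _ _ K H) | apply: (cl_fl _ H) | apply: (cl_pw _ H) ]
  end.

(** [K] abstracts the functions given by terms with parameters, [KP] the predicates given by
    quantifier-free formulas with parameters. Induction is available for [KP] only, so that
    invariants have to be stated without bounded quantifiers. *)
Record ind_class (Z : oring) (K : (Z -> Z) -> Prop) (KP : (Z -> Prop) -> Prop) : Prop := {
  ic_closed : closed (Zw := fun _ : Z => Z) K;
  ic_id : K (fun x => x);
  ic_const : forall c, K (fun _ => c);
  ic_eq : forall F G, K F -> K G -> KP (fun x => F x = G x);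
  ic_le : forall F G, K F -> K G -> KP (fun x => F x <= G x);
  ic_lt : forall F G, K F -> K G -> KP (fun x => F x < G x);
  ic_and : forall P Q, KP P -> KP Q -> KP (fun x => P x /\ Q x);
  ic_or : forall P Q, KP P -> KP Q -> KP (fun x => P x \/ Q x);
  ic_imp : forall P Q, KP P -> KP Q -> KP (fun x => P x -> Q x);
  ic_ind : forall P, KP P -> P 0 -> (forall x, 0 <= x -> P x -> P (x + 1)) ->
    forall x, 0 <= x -> P x }.

(** The weights [pw (b * i)] make the notion closed under products and exponentials; for [b = 0] it
    is the plain sum. *)
Record sums {Z : oring} (f : Z -> Z) (S : Z -> Z -> Z) : Prop := Sums {
  s_ge0 : forall n, 0 <= n -> 0 <= f n;
  s_0 : forall b, 0 <= b -> S 0 b = 0;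
  s_S : forall n b, 0 <= n -> 0 <= b -> S (n + 1) b = S n b + f n * pw (b * n) }.

(** A summation valid only below [n0], and for bases at least [B n0], is turned into one valid
    everywhere: a sum in base [pw b] is the residue modulo [pw b' - pw b] of the one in base [pw b']. *)
Definition wbig {Z : oring} (B : Z -> Z) (G : Z -> Z -> Z -> Z) (n b : Z) :=
  B n + b + G n (B n + b) n + 1.
Definition wmod {Z : oring} (B : Z -> Z) (G : Z -> Z -> Z -> Z) (n b m : Z) :=
  md (G n (wbig B G n b) m) (pw (wbig B G n b) - pw b).
Definition wsum {Z : oring} B G (n b : Z) := wmod B G n b n.

(** [kk] and [kp] solve membership in [K] and [KP]; [zind P] is induction for the predicate [P]. *)
Ltac kk := lazymatch goal with ic : ind_class _ _ _ |- _ =>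
  repeat first [ exact: (ic_const _ _ _ ic) | exact: (ic_id _ _ _ ic) | kk_op ] end.
Ltac kp := lazymatch goal with ic : ind_class _ _ _ |- _ =>
  repeat first [ apply: (ic_and _ _ _ ic) | apply: (ic_or _ _ _ ic)
  | apply: (ic_imp _ _ _ ic) | apply: (ic_eq _ _ _ ic) | apply: (ic_lt _ _ _ ic)
  | apply: (ic_le _ _ _ ic) ]; kk end.
Tactic Notation "zind" uconstr(P) := lazymatch goal with ic : ind_class _ _ _ |- _ =>
  refine (ic_ind _ _ _ ic P _ _ _); [solve [kp]| |] end.

(** * Powers of two and change of base *)

Section PowerSums.
Variables (Z : oring) (K : (Z -> Z) -> Prop) (KP : (Z -> Prop) -> Prop).
Implicit Types (a b c m n i j x y u v : Z).
Hypothesis ic : ind_class Z K KP.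
Let cK : closed (Zw := fun _ : Z => Z) K := ic_closed _ _ _ ic.
Local Notation D1 f := (K1 (Zw := fun _ : Z => Z) K (fun _ => f)).
Local Notation D2 f := (K2 (Zw := fun _ : Z => Z) K (fun _ => f)).
Local Notation D3 f := (K3 (Zw := fun _ : Z => Z) K (fun _ => f)).

Lemma pwD (x y : Z) : 0 <= x -> 0 <= y -> pw (x + y) = pw x * pw y.
Proof.
move=> x0; move: y; zind (fun y => pw (x + y) = pw x * pw y).
  by rewrite addr0 pw0 mulr1.
move=> y y0 IH; rewrite addrA pwS ?IH ?pwS //; last by lra.
ring.
Qed.

Lemma pw_gt (x : Z) : 0 <= x -> x + 1 <= pw x.
Proof.
move: x; zind (fun x => x + 1 <= pw x); first by rewrite pw0; lra.
by move=> x x0 IH; rewrite pwS //; lra.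
Qed.

Lemma pw_gt0 (x : Z) : 0 <= x -> 0 < pw x.
Proof. by move=> x0; have := pw_gt x x0; lra. Qed.

Lemma pw_le (x y : Z) : 0 <= x -> x <= y -> pw x <= pw y.
Proof.
move=> x0 xy; have -> : y = x + (y - x) by ring.
have d0 : 0 <= y - x by lra.
rewrite pwD //; have := pw_gt (y - x) d0; have := pw_gt0 x x0; nra.
Qed.

Lemma pw_lt (x y : Z) : 0 <= x -> x < y -> pw x < pw y.
Proof.
move=> x0 /oz_disc xy; have := pw_le (x + 1) y; rewrite pwS //.
by have := pw_gt0 x x0; lra.
Qed.

(** Lets a remainder move a sum from the base [pw u] to the base [pw v]. *)
Lemma pw_congr (u v m : Z) : 0 <= v -> v < u -> 0 <= m ->
  exists k, pw (u * m) = pw (v * m) + k * (pw u - pw v).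
Proof.
move=> v0 vu m0; apply: md_eqE; move: m m0.
have D0 : 0 < pw u - pw v by have := pw_lt v u v0 vu; lra.
zind (fun m => md (pw (u * m)) (pw u - pw v) = md (pw (v * m)) (pw u - pw v)).
  by rewrite !mulr0.
move=> m m0 /md_eqE [k E]; rewrite !mulrDr !mulr1 !pwD; try nra.
have -> : pw (u * m) * pw u = pw (v * m) * pw v +
  (pw (v * m) + k * pw u) * (pw u - pw v) by rewrite E; ring.
by rewrite md_addM.
Qed.

Lemma pw_ge1 (x : Z) : 0 <= x -> 1 <= pw x.
Proof. by move=> x0; have := pw_gt x x0; lra. Qed.

Lemma down_mono (F : Z -> Z) n : D1 F -> (forall m, 0 <= m -> m < n -> F m <= F (m + 1)) ->
  forall m, 0 <= m -> m <= n -> F m <= F n.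
Proof.
move=> DF step m m0 mn.
suff H j : 0 <= j -> j <= n - m -> F (n - j) <= F n.
  by have := H (n - m); rewrite (_ : n - (n - m) = m); [apply; lra|ring].
move: j; zind (fun j => j <= n - m -> F (n - j) <= F n); first by rewrite subr0.
move=> j j0 IH le; apply: le_trans (IH _); last by lra.
have := step (n - (j + 1)); rewrite (_ : n - (j + 1) + 1 = n - j); last by ring.
by apply; lra.
Qed.

Section Wsum.
Variables (f B : Z -> Z) (G : Z -> Z -> Z -> Z).
Hypotheses (Df : D1 f) (DB : D1 B) (DG : D3 G).
Hypothesis f_ge0 : forall n, 0 <= n -> 0 <= f n.
Hypothesis B_ge0 : forall n, 0 <= n -> 0 <= B n.
Hypothesis G_0 : forall n b, 0 <= n -> B n <= b -> G n b 0 = 0.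
Hypothesis G_S : forall n b m, 0 <= n -> B n <= b -> 0 <= m -> m < n ->
  G n b (m + 1) = G n b m + f m * pw (b * m).

Lemma wG_mono n b m : 0 <= n -> B n <= b -> 0 <= m -> m <= n -> G n b m <= G n b n.
Proof.
move=> n0 Bb; have B0 := B_ge0 n n0; apply: down_mono => [|i i0 lt]; first by move=> F HF; kk.
rewrite G_S // lerDl mulr_ge0 ?f_ge0 //.
by apply: ltW; apply: pw_gt0; nra.
Qed.

Lemma wG_ge0 n b m : 0 <= n -> B n <= b -> 0 <= m -> m <= n -> 0 <= G n b m.
Proof.
move=> n0 Bb m0 mn; rewrite -(G_0 n b) //; have B0 := B_ge0 n n0.
apply: (down_mono (G n b) m) => //; [by move=> F HF; kk|move=> i i0 lt].
rewrite G_S ?lerDl ?mulr_ge0 ?f_ge0 //; try lra.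
by apply: ltW; apply: pw_gt0; nra.
Qed.

(** The remainder is the sum in base [pw b] as long as that sum is smaller than the modulus. It is
    dominated by the sum in base [pw (B n + b)], where [G] is valid; this is why the latter is a
    summand of [wbig]. *)
Lemma wmodP n b : 0 <= n -> 0 <= b -> forall m, 0 <= m ->
  (m <= n -> 0 <= wmod B G n b m <= G n (B n + b) m) /\
  (m < n -> wmod B G n b (m + 1) = wmod B G n b m + f m * pw (b * m)).
Proof.
move=> n0 b0; have B0 := B_ge0 n n0; rewrite /wmod.
have leb0 : B n <= B n + b by lra.
have g0 : 0 <= G n (B n + b) n by apply: wG_ge0.
set b' := wbig B G n b; set D := pw b' - pw b.
have b'B : B n + b + 1 <= b' by rewrite /b' /wbig; lra.
have D_big : G n (B n + b) n < D.
  rewrite /D (_ : b' = b + (b' - b)); last by ring.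
  rewrite pwD; try (rewrite /b' /wbig; lra).
  have := pw_ge1 b b0; have := pw_gt (b' - b); rewrite {2}/b' {1}/wbig.
  have : B n + b + G n (B n + b) n + 1 - b = B n + G n (B n + b) n + 1 by ring.
  move: (pw (b' - b)) => p E; rewrite /b' /wbig E => /(_ _) H1 H2.
  have {}H1 : B n + G n (B n + b) n + 1 + 1 <= p by apply: H1; lra.
  nra.
have step m : 0 <= m -> m < n -> 0 <= md (G n b' m) D <= G n (B n + b) m ->
  md (G n b' (m + 1)) D = md (G n b' m) D + f m * pw (b * m).
  move=> m0 lt /andP [h1 h2].
  rewrite G_S //; last by lra.
  have [k ->] := pw_congr b' b m b0 ltac:(lra) m0.
  rewrite {1}(fl_md _ (G n b' m) D).
  have f0 := f_ge0 m m0; have p0 := pw_gt0 (b * m) ltac:(nra).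
  have p1 : pw (b * m) <= pw ((B n + b) * m) by apply: pw_le; nra.
  have ub : G n (B n + b) m + f m * pw ((B n + b) * m) <= G n (B n + b) n.
    by rewrite -G_S //; apply: wG_mono => //; [lra|exact: oz_disc].
  apply: (md_uniq _ _ _ (fl (G n b' m) D + f m * k)); [rewrite -/D; ring|nra|nra].
suff main : forall m, 0 <= m -> m <= n -> 0 <= md (G n b' m) D <= G n (B n + b) m.
  by move=> m0; split=> [|lt]; [exact: main|apply: step => //; apply: main => //; exact: ltW].
have {}main : forall m, 0 <= m -> m <= n ->
    0 <= md (G n b' m) D /\ md (G n b' m) D <= G n (B n + b) m; last first.
  by move=> m m0 le; apply/andP; apply: main.
zind (fun m => m <= n -> 0 <= md (G n b' m) D /\ md (G n b' m) D <= G n (B n + b) m).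
  by move=> _; rewrite !G_0 ?md_small //; lra.
move=> m m0 IH lt; have lt' : m < n by lra.
have [h1 h2] := IH (ltW lt'); rewrite step //; last by apply/andP.
rewrite G_S //; have f0 := f_ge0 m m0; have p0 := pw_gt0 (b * m) ltac:(nra).
have p1 : pw (b * m) <= pw ((B n + b) * m) by apply: pw_le; nra.
split; nra.
Qed.

Lemma sums_wsum : sums f (wsum B G).
Proof.
split=> // [b b0|n b n0 b0].
  have [/(_ (lexx 0)) /andP [h1 h2] _] := wmodP 0 b (lexx 0) b0 0 (lexx 0).
  have B0 := B_ge0 0 (lexx 0); move: h1 h2; rewrite /wsum G_0 //; lra.
rewrite /wsum; have [_ ->] := wmodP (n + 1) b ltac:(lra) b0 n n0; last by lra.
congr (_ + _).
(* The lengths [n] and [n + 1] lead to different moduli, but both remainders start at 0 and obey the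
   same recursion up to [n]. *)
have main : forall m, 0 <= m -> m <= n -> wmod B G (n + 1) b m = wmod B G n b m; last first.
  by apply: main => //; exact: lexx.
zind (fun m => m <= n -> wmod B G (n + 1) b m = wmod B G n b m).
  have [/(_ n0) /andP [h1 h2] _] := wmodP n b n0 b0 0 (lexx 0).
  have [/(_ _) h3 _] := wmodP (n + 1) b ltac:(lra) b0 0 (lexx 0).
  have /andP [h4 h5] : 0 <= wmod B G (n + 1) b 0 <= G (n + 1) (B (n + 1) + b) 0 by apply: h3; lra.
  have B0 := B_ge0 n n0; have B1 : 0 <= B (n + 1) by apply: B_ge0; lra.
  by move=> _; rewrite !G_0 in h2, h5 *; lra.
move=> m m0 IH lt.
have [_ ->] := wmodP n b n0 b0 m m0; last by lra.
have [_ ->] := wmodP (n + 1) b ltac:(lra) b0 m m0; last by lra.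
by rewrite IH //; lra.
Qed.

End Wsum.
End PowerSums.

Arguments pwD {Z K KP} ic {x y}. Arguments pw_gt {Z K KP} ic {x}. Arguments pw_gt0 {Z K KP} ic {x}.
Arguments pw_ge1 {Z K KP} ic {x}.
Arguments pw_le {Z K KP} ic {x y}. Arguments pw_lt {Z K KP} ic {x y}.
Arguments pw_congr {Z K KP} ic {u v m}. Arguments down_mono {Z K KP} ic {F n}.
Arguments sums_wsum {Z K KP} ic {f B G}.

(** The geometric sum; its denominator [pw b - 1] requires [b >= 1], whence the constant bound 1. *)
Definition sconst {Z : oring} (c : Z) : Z -> Z -> Z :=
  wsum (fun _ => 1) (fun n b m => fl (c * (pw (b * m) - 1)) (pw b - 1)).
(** The closed form of [sum i X^i] for [X = pw b], obtained by differentiating the geometric sum. *)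
Definition sid {Z : oring} : Z -> Z -> Z :=
  wsum (fun _ => 1) (fun n b m =>
    fl (m * pw (b * m) * (pw b - 1) - pw b * (pw (b * m) - 1)) ((pw b - 1) * (pw b - 1))).
Definition sadd {Z : oring} (Sf Sg : Z -> Z -> Z) (n b : Z) := Sf n b + Sg n b.

(** The coefficients of [V = sum f(i) X^i] and [U = sum g(j) X^(n-j) y^j] meet at [X^n] in [V U]. *)
Definition hadX {Z : oring} (Sf Sg : Z -> Z -> Z) (n b : Z) := Sf n 0 * (Sg n b + 1) + 1.
Definition hadU {Z : oring} (Sg : Z -> Z -> Z) (c n b m : Z) :=
  let z := c * n + Sg n b + b + 1 in
  md (pw (c * n) * Sg m z) (pw (z + c) - pw b).
Definition shad {Z : oring} (Sf Sg : Z -> Z -> Z) : Z -> Z -> Z :=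
  wsum (fun _ => 0) (fun n b m => let c := hadX Sf Sg n b in
    md (fl (Sf n c * hadU Sg c n b m) (pw (c * n))) (pw c)).

Definition geo {Z : oring} (b r : Z) : Z := fl (pw (b * r) - 1) (pw b - 1).
(** The value [f i] is repeated on a block of [N] indices, which multiplies it by a geometric sum.
    The first summand collects the complete blocks, the second the block that contains [m]. *)
Definition sre {Z : oring} (f : Z -> Z) (Sf : Z -> Z -> Z) (N : Z) : Z -> Z -> Z :=
  wsum (fun _ => 1) (fun n b m => let u := fl m N in
    Sf u (b * N) * geo b N + f u * pw (b * N * u) * geo b (md m N)).

Section ClosedOps.
Variables (W : Type) (Zw : W -> oring) (K : (forall w, Zw w) -> Prop).
Hypothesis cK : closed K.

Ltac kc := intros; repeat (let x := fresh in intro x); cbv zeta beta; repeat kk_op.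

Lemma cl_wmod B G : K1 K B -> K3 K G -> K3 K (fun w => wmod (B w) (G w)).
Proof. rewrite /wmod /wbig; kc. Qed.

Lemma cl_wsum B G : K1 K B -> K3 K G -> K2 K (fun w => wsum (B w) (G w)).
Proof. by move=> HB HG F1 F2 H1 H2; rewrite /wsum; apply: (cl_wmod B G). Qed.

Lemma cl_sconst F : K F -> K2 K (fun w => sconst (F w)).
Proof. move=> HF; apply: cl_wsum; kc. Qed.

Lemma cl_sid : K2 K (fun w => sid).
Proof. apply: cl_wsum; kc. Qed.

Lemma cl_sadd Sf Sg : K2 K Sf -> K2 K Sg -> K2 K (fun w => sadd (Sf w) (Sg w)).
Proof. rewrite /sadd; kc. Qed.

Lemma cl_shad Sf Sg : K2 K Sf -> K2 K Sg -> K2 K (fun w => shad (Sf w) (Sg w)).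
Proof. move=> H1 H2; apply: cl_wsum; rewrite /hadU /hadX; kc. Qed.

Lemma cl_sre f Sf N : K1 K f -> K2 K Sf -> K N -> K2 K (fun w => sre (f w) (Sf w) (N w)).
Proof. move=> H1 H2 H3; apply: cl_wsum; rewrite /geo; kc. Qed.

End ClosedOps.

(** * Elementary sums and estimates *)

Section BasicSums.
Variables (Z : oring) (K : (Z -> Z) -> Prop) (KP : (Z -> Prop) -> Prop).
Implicit Types (a b c m n i j x y u v : Z).
Hypothesis ic : ind_class Z K KP.
Let cK : closed (Zw := fun _ : Z => Z) K := ic_closed _ _ _ ic.
Local Notation D1 f := (K1 (Zw := fun _ : Z => Z) K (fun _ => f)).
Local Notation D2 f := (K2 (Zw := fun _ : Z => Z) K (fun _ => f)).
Local Notation D3 f := (K3 (Zw := fun _ : Z => Z) K (fun _ => f)).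

Lemma pwMS b m : 0 <= b -> 0 <= m -> pw (b * (m + 1)) = pw (b * m) * pw b.
Proof. by move=> b0 m0; rewrite mulrDr mulr1 (pwD ic) // mulr_ge0. Qed.

Lemma sums_const c : 0 <= c -> sums (fun _ => c) (sconst c).
Proof.
move=> c0; apply: (sums_wsum ic) => //=; try by move=> *; kk.
- by move=> n b n0 b0; rewrite mulr0 pw0 subrr mulr0 fl_small // subr_gt0; have := pw_gt ic (x := b); lra.
move=> n b m n0 b0 m0 _.
have b1 := pw_gt ic (x := b) ltac:(lra).
have -> : c * (pw (b * (m + 1)) - 1) = c * (pw (b * m) - 1) + c * pw (b * m) * (pw b - 1).
  by rewrite pwMS //; [ring|lra].
by rewrite fl_addM //; lra.
Qed.

Lemma sums_id : sums (fun n : Z => n) sid.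
Proof.
apply: (sums_wsum ic) => //=; try by move=> *; kk.
- move=> n b n0 b0; rewrite mulr0 pw0 subrr mul0r mulr0 mul0r subr0 fl_small //.
  by have := pw_gt ic (x := b); nra.
move=> n b m n0 b0 m0 _.
have b1 := pw_gt ic (x := b) ltac:(lra).
rewrite -fl_addM; last by nra.
by congr (fl _ _); rewrite pwMS //; [ring|lra].
Qed.

Lemma sums_add f g Sf Sg : sums f Sf -> sums g Sg -> sums (fun n => f n + g n) (sadd Sf Sg).
Proof.
move=> [f0 Sf0 SfS] [g0 Sg0 SgS]; split=> [n n0|b b0|n b n0 b0]; rewrite ?/sadd.
- by rewrite addr_ge0 ?f0 ?g0.
- by rewrite Sf0 ?Sg0 ?addr0.
- by rewrite SfS ?SgS //; ring.
Qed.

(** Multiplication by powers of two only changes the base. *)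
Lemma sums_twist f Sf c : 0 <= c -> sums f Sf ->
  sums (fun n => f n * pw (c * n)) (fun n b => Sf n (c + b)).
Proof.
move=> c0 [f0 Sf0 SfS]; split=> [n n0|b b0|n b n0 b0].
- by rewrite mulr_ge0 ?f0 // ltW // (pw_gt0 ic) // mulr_ge0.
- by rewrite Sf0 // addr_ge0.
- by rewrite SfS ?addr_ge0 // mulrDl (pwD ic) ?mulr_ge0 //; ring.
Qed.

Section Bounds.
Variables (f : Z -> Z) (Sf : Z -> Z -> Z).
Hypotheses (DS : D2 Sf) (Hf : sums f Sf).

Lemma s_step n b : 0 <= n -> 0 <= b -> Sf n b + f n <= Sf (n + 1) b.
Proof.
move=> n0 b0; rewrite (s_S _ _ Hf) //; have := pw_ge1 ic (x := b * n) ltac:(nra).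
by have := s_ge0 _ _ Hf n n0; nra.
Qed.

Lemma s_mono m n b : 0 <= m -> m <= n -> 0 <= b -> Sf m b <= Sf n b.
Proof.
move=> m0 mn b0; apply: (down_mono ic (F := fun m => Sf m b)) => // [F HF|i i0 lt]; first by kk.
have := s_step i b i0 b0; have := s_ge0 _ _ Hf i i0; lra.
Qed.

Lemma s_nonneg n b : 0 <= n -> 0 <= b -> 0 <= Sf n b.
Proof. by move=> n0 b0; rewrite -(s_0 _ _ Hf b b0); apply: s_mono. Qed.

Lemma s_term m n b : 0 <= m -> m < n -> 0 <= b -> f m * pw (b * m) <= Sf n b.
Proof.
move=> m0 /oz_disc mn b0; have := s_mono (m + 1) n b ltac:(lra) mn b0.
by rewrite (s_S _ _ Hf) //; have := s_nonneg m b m0 b0; lra.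
Qed.

Lemma s_term0 m n : 0 <= m -> m < n -> f m <= Sf n 0.
Proof. by move=> m0 mn; have := s_term m n 0 m0 mn (lexx 0); rewrite mul0r pw0 mulr1. Qed.

(** Comparison with a geometric sum, the denominator being cleared. *)
Lemma s_geo n F b : 0 <= n -> 0 <= b -> 0 <= F -> (forall m, 0 <= m -> m < n -> f m <= F) ->
  Sf n b * (pw b - 1) <= F * (pw (b * n) - 1).
Proof.
move=> n0 b0 F0 fF.
suff main m : 0 <= m -> m <= n -> Sf m b * (pw b - 1) <= F * (pw (b * m) - 1) by apply: main.
move: m; zind (fun m => m <= n -> Sf m b * (pw b - 1) <= F * (pw (b * m) - 1)).
  by rewrite (s_0 _ _ Hf) // mulr0 pw0; lra.
move=> m m0 IH lt; have lt' : m < n by lra.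
have {}IH := IH (ltW lt'); rewrite (s_S _ _ Hf) // pwMS //.
have := fF m m0 lt'; have := pw_ge1 ic b0; have := pw_ge1 ic (x := b * m) ltac:(nra).
move: (pw b) (pw (b * m)) IH (s_ge0 _ _ Hf m m0) => p q IH f0 q1 p1 fF'.
have : f m * q * (p - 1) <= F * q * (p - 1) by apply: ler_wpM2r; [lra|nra].
lra.
Qed.

(** If all values are smaller than the base [pw c], the sum is a numeral with the digits [f j], and
    the remainder keeps its lowest [m] digits. *)
Lemma s_md n m c : 0 <= m -> m <= n -> 0 <= c -> (forall j, 0 <= j -> j < n -> f j < pw c) ->
  md (Sf n c) (pw (c * m)) = Sf m c.
Proof.
move=> m0 mn c0 fX.
have X0 : 0 < pw (c * m) by apply: (pw_gt0 ic); nra.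
have small : Sf m c < pw (c * m).
  (* For [pw c = 1] the factor [pw c - 1] cannot be cancelled, but then every [f j] with [j < n] is
     0. *)
  have := s_geo m (pw c - 1) c m0 c0; case: (leP (pw c) 1) => [le1 _|gt1 H].
    have -> : Sf m c = 0; last by [].
    suff main i : 0 <= i -> i <= m -> Sf i c = 0 by apply: main.
    move: i; zind (fun i => i <= m -> Sf i c = 0).
      by rewrite (s_0 _ _ Hf).
    move=> i i0 IH lt; rewrite (s_S _ _ Hf) // IH; last by lra.
    have := fX i i0 ltac:(lra); have := s_ge0 _ _ Hf i i0 => h1 h2.
    have -> : f i = 0; last by rewrite mul0r addr0.
    case: (ltgtP 0 (f i)) => // [/oz_disc|]; lra.
  have {}H : Sf m c * (pw c - 1) <= (pw c - 1) * (pw (c * m) - 1).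
    apply: H; first lra; move=> j j0 jm; have /oz_disc := fX j j0 ltac:(lra); lra.
  rewrite mulrC ler_pM2l in H; lra.
suff main k : 0 <= k -> k <= n - m -> md (Sf (m + k) c) (pw (c * m)) = Sf m c.
  by have := main (n - m); rewrite (_ : m + (n - m) = n); [apply; lra|ring].
move: k; zind (fun k => k <= n - m -> md (Sf (m + k) c) (pw (c * m)) = Sf m c).
  by rewrite addr0 md_small // s_nonneg.
move=> k k0 IH lt; rewrite -IH; last by lra.
rewrite addrA (s_S _ _ Hf) ?addr_ge0 // mulrDr (pwD ic); try nra.
have -> : Sf (m + k) c + f (m + k) * (pw (c * m) * pw (c * k)) =
  Sf (m + k) c + (f (m + k) * pw (c * k)) * pw (c * m) by ring.
by rewrite md_addM.
Qed.

End Bounds.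
End BasicSums.

Arguments pwMS {Z K KP} ic {b m}. Arguments s_mono {Z K KP} ic {f Sf}. Arguments s_nonneg {Z K KP} ic {f Sf}.
Arguments s_term {Z K KP} ic {f Sf}. Arguments s_term0 {Z K KP} ic {f Sf}.
Arguments s_geo {Z K KP} ic {f Sf}. Arguments s_md {Z K KP} ic {f Sf}. Arguments sums_const {Z K KP} ic {c}.
Arguments sums_twist {Z K KP} ic {f Sf c}. Arguments sums_id {Z K KP} ic.

(** * Products *)

Section HadamardFactor.
Variables (Z : oring) (K : (Z -> Z) -> Prop) (KP : (Z -> Prop) -> Prop).
Implicit Types (a b c m n i j x y u v : Z).
Hypothesis ic : ind_class Z K KP.
Let cK : closed (Zw := fun _ : Z => Z) K := ic_closed _ _ _ ic.
Local Notation D1 f := (K1 (Zw := fun _ : Z => Z) K (fun _ => f)).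
Local Notation D2 f := (K2 (Zw := fun _ : Z => Z) K (fun _ => f)).
Local Notation D3 f := (K3 (Zw := fun _ : Z => Z) K (fun _ => f)).

Section Hadamard.
Variables (f g : Z -> Z) (Sf Sg : Z -> Z -> Z).
Hypotheses (Df : D1 f) (Dg : D1 g) (DSf : D2 Sf) (DSg : D2 Sg).
Hypotheses (Hf : sums f Sf) (Hg : sums g Sg).

(** With [X = pw c], the factors [X^(n-j)] in [U] arise from a remainder: [pw (c * n) * pw (z * j)]
    is [X^(n-j) * pw ((z + c) * j)], and modulo [pw (z + c) - pw b] the last power becomes
    [pw (b * j)]. The exponent [z] is so large that the modulus exceeds the whole of [U]. *)
Lemma hadUP c n b : 0 <= c -> 0 <= n -> 0 <= b ->
  hadU Sg c n b 0 = 0 /\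
  forall m, 0 <= m -> m < n ->
    hadU Sg c n b (m + 1) = hadU Sg c n b m + g m * pw (c * (n - m)) * pw (b * m).
Proof.
move=> c0 n0 b0; rewrite /hadU; set z := c * n + Sg n b + b + 1; set D := pw _ - pw b.
have S0 := s_nonneg ic DSg Hg n b n0 b0.
have z0 : b < z by rewrite /z; nra.
have p0 : 1 <= pw (c * n) by apply: (pw_ge1 ic); nra.
have D_big : pw (c * n) * Sg n b < D.
  have : pw z <= pw (z + c) by apply: (pw_le ic); lra.
  have -> : pw z = pw (c * n) * (pw (Sg n b + 1) * pw b).
    by rewrite -!(pwD ic); try nra; congr pw; rewrite /z; ring.
  have := pw_gt ic (x := Sg n b + 1) ltac:(lra); have := pw_ge1 ic b0; rewrite /D.
  move: (Sg n b) (pw (c * n)) (pw (Sg n b + 1)) (pw b) S0 p0 => S p q B S0 p1 B1 q1 H.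
  have h1 : p * S <= p * S * B by rewrite ler_peMr // mulr_ge0 //; lra.
  have h2 : p * B * (S + 2) <= p * B * q by apply: ler_wpM2l; [apply: mulr_ge0; lra|lra].
  have h3 : B <= p * B by rewrite ler_peMl //; lra.
  lra.
have D0 : 0 < D by apply: le_lt_trans D_big; rewrite mulr_ge0 //; lra.
split; first by rewrite (s_0 _ _ Hg) ?mulr0 ?md_small //; lra.
have step m : 0 <= m -> m < n ->
    0 <= md (pw (c * n) * Sg m z) D /\ md (pw (c * n) * Sg m z) D <= pw (c * n) * Sg m b ->
    md (pw (c * n) * Sg (m + 1) z) D =
      md (pw (c * n) * Sg m z) D + g m * pw (c * (n - m)) * pw (b * m).
  move=> m0 lt [h1 h2]; rewrite (s_S _ _ Hg) //; last by lra.
  have [k E] := pw_congr ic (u := z + c) b0 ltac:(lra) m0.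
  have -> : pw (c * n) * (Sg m z + g m * pw (z * m)) =
      pw (c * n) * Sg m z + g m * pw (c * (n - m)) * pw ((z + c) * m).
    have -> : pw (c * n) * (Sg m z + g m * pw (z * m)) =
      pw (c * n) * Sg m z + g m * (pw (c * n) * pw (z * m)) by ring.
    rewrite -(pwD ic); [|nra|nra]; rewrite -mulrA -(pwD ic); [|nra|nra].
    by congr (_ + _ * pw _); ring.
  rewrite E {1}(fl_md _ (pw (c * n) * Sg m z) D).
  have g0 := s_ge0 _ _ Hg m m0; have q0 := pw_gt0 ic (x := c * (n - m)) ltac:(nra).
  have b1 := pw_gt0 ic (x := b * m) ltac:(nra).
  apply: (md_uniq _ _ _ (fl (pw (c * n) * Sg m z) D + g m * pw (c * (n - m)) * k)).
  - by rewrite -/D; ring.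
  - by rewrite addr_ge0 // mulr_ge0 ?mulr_ge0 //; apply: ltW.
  have le1 : pw (c * (n - m)) <= pw (c * n) by apply: (pw_le ic); nra.
  have := s_mono ic DSg Hg (m + 1) n b ltac:(lra) (oz_disc _ _ _ lt) b0.
  rewrite (s_S _ _ Hg) // => le2.
  have : pw (c * n) * (Sg m b + g m * pw (b * m)) <= pw (c * n) * Sg n b.
    by rewrite ler_pM2l //; lra.
  have : g m * pw (b * m) * pw (c * (n - m)) <= g m * pw (b * m) * pw (c * n).
    by rewrite ler_wpM2l // mulr_ge0 // ltW.
  lra.
suff main m : 0 <= m -> m <= n ->
    0 <= md (pw (c * n) * Sg m z) D /\ md (pw (c * n) * Sg m z) D <= pw (c * n) * Sg m b.
  by move=> m m0 lt; apply: step => //; apply: main => //; exact: ltW.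
move: m; zind (fun m => m <= n -> 0 <= md (pw (c * n) * Sg m z) D /\
  md (pw (c * n) * Sg m z) D <= pw (c * n) * Sg m b).
  by move=> _; rewrite !(s_0 _ _ Hg) ?mulr0 ?md_small //; lra.
move=> m m0 IH lt; have lt' : m < n by lra.
have h := IH (ltW lt'); rewrite step //; case: h => h1 h2.
rewrite (s_S _ _ Hg) //.
have g0 := s_ge0 _ _ Hg m m0; have q0 := pw_gt0 ic (x := c * (n - m)) ltac:(nra).
have b1 := pw_gt0 ic (x := b * m) ltac:(nra).
have le1 : pw (c * (n - m)) <= pw (c * n) by apply: (pw_le ic); nra.
have : g m * pw (b * m) * pw (c * (n - m)) <= g m * pw (b * m) * pw (c * n).
  by rewrite ler_wpM2l // mulr_ge0 // ltW.
have : 0 <= g m * pw (c * (n - m)) * pw (b * m) by rewrite mulr_ge0 ?mulr_ge0 //; apply: ltW.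
split; lra.
Qed.

End Hadamard.
End HadamardFactor.

Arguments hadUP {Z K KP} ic {g Sg}.

Section HadamardProduct.
Variables (Z : oring) (K : (Z -> Z) -> Prop) (KP : (Z -> Prop) -> Prop).
Implicit Types (a b c m n i j x y u v : Z).
Hypothesis ic : ind_class Z K KP.
Let cK : closed (Zw := fun _ : Z => Z) K := ic_closed _ _ _ ic.
Local Notation D1 f := (K1 (Zw := fun _ : Z => Z) K (fun _ => f)).
Local Notation D2 f := (K2 (Zw := fun _ : Z => Z) K (fun _ => f)).
Local Notation D3 f := (K3 (Zw := fun _ : Z => Z) K (fun _ => f)).

Section Hadamard.
Variables (f g : Z -> Z) (Sf Sg : Z -> Z -> Z).
Hypotheses (Df : D1 f) (Dg : D1 g) (DSf : D2 Sf) (DSg : D2 Sg).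
Hypotheses (Hf : sums f Sf) (Hg : sums g Sg).

(** Shifted by [n - m] places, the numeral [Sf n c] has the digit [f m] at weight [X^n], and the
    digits with index below [m] make up the lower part. *)
Lemma had_digit c n m F : 0 <= c -> 0 <= m -> m < n -> 0 <= F ->
  (forall j, 0 <= j -> j < n -> f j <= F) -> F < pw c ->
  exists A, Sf n c * pw (c * (n - m)) = (A * pw c + f m) * pw (c * n) + Sf m c * pw (c * (n - m)).
Proof.
move=> c0 m0 lt F0 fF Fc; exists (fl (Sf n c) (pw (c * (m + 1)))).
have fX j : 0 <= j -> j < n -> f j < pw c by move=> j0 jn; have := fF j j0 jn; lra.
have E := s_md ic DSf Hf n (m + 1) c ltac:(lra) (oz_disc _ _ _ lt) c0 fX.
have -> : c * n = c * m + c * (n - m) by ring.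
rewrite {1}(fl_md _ (Sf n c) (pw (c * (m + 1)))) E (s_S _ _ Hf) // (pwMS ic) // (pwD ic); [ring|nra|nra].
Qed.

(** By [had_digit], the summand of [U] with index [m] raises the digit of [V U] at [X^n] by
    [f m * g m * pw (b * m)]. No carry arrives from below: with [F] bounding all [f j], the lower
    part multiplied by [X - 1] is at most [F * Sg m b * X^n], and [X - 1] exceeds [F * Sg n b]. *)
Lemma sums_had : sums (fun n => f n * g n) (shad Sf Sg).
Proof.
apply: (sums_wsum ic) => //=; try by rewrite /hadU /hadX; move=> *; kk.
- by move=> n n0; apply: mulr_ge0; [apply: (s_ge0 _ _ Hf)|apply: (s_ge0 _ _ Hg)].
- move=> n b n0 b0; have S0 := s_nonneg ic DSg Hg n b n0 b0.
  have F0 := s_nonneg ic DSf Hf n 0 n0 (lexx 0).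
  have c0 : 0 <= hadX Sf Sg n b by rewrite /hadX; nra.
  have [-> _] := hadUP ic DSg Hg (hadX Sf Sg n b) n b c0 n0 b0.
  rewrite mulr0 fl_small ?md_small //; apply: (pw_gt0 ic) => //; exact: mulr_ge0.
move=> n b m' n0 b0; have S0 := s_nonneg ic DSg Hg n b n0 b0.
have F0 := s_nonneg ic DSf Hf n 0 n0 (lexx 0).
set c := hadX Sf Sg n b; have c0 : 0 <= c by rewrite /c /hadX; nra.
have [U0 US] := hadUP ic DSg Hg c n b c0 n0 b0.
have big : Sf n 0 * (Sg n b + 1) + 1 < pw c.
  by have := pw_gt ic c0; rewrite {1}/c /hadX; lra.
have fF j : 0 <= j -> j < n -> f j <= Sf n 0 by exact: (s_term0 ic DSf Hf).
move: (Sf n 0) F0 big fF => F F0 big fF; clearbody c.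
have X0 : 0 < pw c by apply: (pw_gt0 ic).
have Y0 : 0 < pw (c * n) by apply: (pw_gt0 ic); exact: mulr_ge0.
have FS0 : 0 <= F * Sg n b by exact: mulr_ge0.
have digit m : 0 <= m -> m < n -> let k := Sf n c * (g m * pw (c * (n - m)) * pw (b * m)) in
    md (fl k (pw (c * n))) (pw c) = f m * g m * pw (b * m) /\
    md k (pw (c * n)) * (pw c - 1) <= F * (g m * pw (b * m)) * pw (c * n).
  move=> m0 lt k; have [A E] := had_digit c n m F c0 m0 lt F0 fF ltac:(lra).
  have g0 := s_ge0 _ _ Hg m m0; have f0 := s_ge0 _ _ Hf m m0.
  have y0 := pw_gt0 ic (x := b * m) ltac:(nra).
  have gy0 : 0 <= g m * pw (b * m) by apply: mulr_ge0 => //; lra.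
  have gyS := s_term ic DSg Hg m n b m0 lt b0.
  have le1 : F * (g m * pw (b * m)) <= F * Sg n b by exact: ler_wpM2l.
  have le2 : f m * (g m * pw (b * m)) <= F * (g m * pw (b * m)).
    by apply: ler_wpM2r => //; apply: fF.
  have B0 := s_nonneg ic DSf Hf m c m0 c0.
  have p0 := pw_gt0 ic (x := c * (n - m)) ltac:(nra).
  have Bgeo := s_geo ic DSf Hf m F c m0 c0 F0 (fun j H H' => fF j H (lt_trans H' lt)).
  have r_le : g m * pw (b * m) * (Sf m c * pw (c * (n - m))) * (pw c - 1) <=
      F * (g m * pw (b * m)) * pw (c * n).
    have -> : c * n = c * m + c * (n - m) by ring.
    rewrite (pwD ic); try nra.
    have : Sf m c * (pw c - 1) <= F * pw (c * m) by lra.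
    move: (mulr_ge0 gy0 (ltW p0)) => /ler_wpM2l H /H {}H; lra.
  have r0 : 0 <= g m * pw (b * m) * (Sf m c * pw (c * (n - m))).
    by rewrite mulr_ge0 ?mulr_ge0 //; exact: ltW.
  have r_lt : g m * pw (b * m) * (Sf m c * pw (c * (n - m))) < pw (c * n).
    have H : F * (g m * pw (b * m)) * pw (c * n) < (pw c - 1) * pw (c * n).
      by rewrite ltr_pM2r //; lra.
    have := le_lt_trans r_le H; rewrite mulrC ltr_pM2l //; lra.
  have Ek : k = ((g m * pw (b * m) * A) * pw c + f m * g m * pw (b * m)) * pw (c * n) +
      g m * pw (b * m) * (Sf m c * pw (c * (n - m))).
    by rewrite /k; transitivity (g m * pw (b * m) * (Sf n c * pw (c * (n - m)))); [ring|rewrite E; ring].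
  have h0 : 0 <= f m * g m * pw (b * m) by rewrite -mulrA mulr_ge0.
  have hX : f m * g m * pw (b * m) < pw c by lra.
  by have [-> ->] := digits _ _ _ _ _ _ _ Ek r0 r_lt h0 hX.
have step m : 0 <= m -> m < n ->
    md (fl (Sf n c * hadU Sg c n b m) (pw (c * n))) (pw c) <= F * Sg m b /\
    md (Sf n c * hadU Sg c n b m) (pw (c * n)) * (pw c - 1) <= F * Sg m b * pw (c * n) ->
    md (fl (Sf n c * hadU Sg c n b (m + 1)) (pw (c * n))) (pw c) =
      md (fl (Sf n c * hadU Sg c n b m) (pw (c * n))) (pw c) + f m * g m * pw (b * m) /\
    md (Sf n c * hadU Sg c n b (m + 1)) (pw (c * n)) * (pw c - 1) <= F * Sg (m + 1) b * pw (c * n).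
  move=> m0 lt [h1 h2]; rewrite US // mulrDr.
  have := digit m m0 lt; cbv zeta; move: (Sf n c * (g m * _ * _)) => k [hi lo].
  have := s_mono ic DSg Hg (m + 1) n b ltac:(lra) (oz_disc _ _ _ lt) b0.
  rewrite (s_S _ _ Hg) // => leS.
  have le2 : f m * (g m * pw (b * m)) <= F * (g m * pw (b * m)).
    apply: ler_wpM2r; last by apply: fF.
    by rewrite mulr_ge0 ?(s_ge0 _ _ Hg) // ltW // (pw_gt0 ic) // mulr_ge0.
  have leF : F * (Sg m b + g m * pw (b * m)) <= F * Sg n b by exact: ler_wpM2l.
  have [||-> ->] := acc_digit _ (pw (c * n)) (pw c) (Sf n c * hadU Sg c n b m) k Y0 X0.
  - have H : F * Sg n b * pw (c * n) < (pw c - 1) * pw (c * n) by rewrite ltr_pM2r //; lra.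
    have H2 : F * (Sg m b + g m * pw (b * m)) * pw (c * n) <= F * Sg n b * pw (c * n).
      by rewrite ler_pM2r.
    have : (md (Sf n c * hadU Sg c n b m) (pw (c * n)) + md k (pw (c * n))) * (pw c - 1) <
      (pw c - 1) * pw (c * n) by lra.
    by rewrite mulrC ltr_pM2l //; lra.
  - by rewrite hi; lra.
  by rewrite hi; split=> //; lra.
suff main i : 0 <= i -> i <= n ->
    md (fl (Sf n c * hadU Sg c n b i) (pw (c * n))) (pw c) <= F * Sg i b /\
    md (Sf n c * hadU Sg c n b i) (pw (c * n)) * (pw c - 1) <= F * Sg i b * pw (c * n).
  by move=> m0 lt; case: (step m' m0 lt (main m' m0 (ltW lt))).
move: i; refine (ic_ind _ _ _ ic (fun i => i <= n ->
    md (fl (Sf n c * hadU Sg c n b i) (pw (c * n))) (pw c) <= F * Sg i b /\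
    md (Sf n c * hadU Sg c n b i) (pw (c * n)) * (pw c - 1) <= F * Sg i b * pw (c * n)) _ _ _).
- by cbv beta zeta delta [hadU]; kp.
- by rewrite U0 mulr0 (s_0 _ _ Hg) // fl_small ?md_small // mulr0 !mul0r.
move=> i i0 IH lt; have lt' : i < n by lra.
have h := IH (ltW lt'); have [h1 h2] := step i i0 lt' h; split=> //.
rewrite [X in X <= _]h1 (s_S _ _ Hg) //; case: h => h3 _.
have : f i * (g i * pw (b * i)) <= F * (g i * pw (b * i)).
  apply: ler_wpM2r; last by apply: fF.
  by rewrite mulr_ge0 ?(s_ge0 _ _ Hg) // ltW // (pw_gt0 ic) // mulr_ge0.
lra.
Qed.

End Hadamard.
End HadamardProduct.

Arguments sums_had {Z K KP} ic {f g Sf Sg}.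

Lemma floor_succ (Z : oring) (m N : Z) : 0 < N ->
  (md m N + 1 < N /\ fl (m + 1) N = fl m N /\ md (m + 1) N = md m N + 1) \/
  (md m N + 1 = N /\ fl (m + 1) N = fl m N + 1 /\ md (m + 1) N = 0).
Proof.
move=> N0; have r0 := md_ge0 _ m N N0; have /oz_disc rN := md_lt _ m N N0.
have E := fl_md _ m N; move: (fl m N) (md m N) r0 rN E => q r r0 rN E.
case: (ltgtP (r + 1) N) => [lt|gt|eq]; [left|lra|right]; split=> //.
- have E' : m + 1 = q * N + (r + 1) by rewrite E; ring.
  by split; [apply: (fl_uniq _ _ _ _ (r + 1))|apply: (md_uniq _ _ _ q)]; lra.
have E' : m + 1 = (q + 1) * N + 0 by rewrite E -eq; ring.
by split; [apply: (fl_uniq _ _ _ _ 0)|apply: (md_uniq _ _ _ (q + 1))]; lra.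
Qed.

(** * Repeating each value on a block *)

Section Reindexing.
Variables (Z : oring) (K : (Z -> Z) -> Prop) (KP : (Z -> Prop) -> Prop).
Implicit Types (a b c m n i j x y u v : Z).
Hypothesis ic : ind_class Z K KP.
Let cK : closed (Zw := fun _ : Z => Z) K := ic_closed _ _ _ ic.
Local Notation D1 f := (K1 (Zw := fun _ : Z => Z) K (fun _ => f)).
Local Notation D2 f := (K2 (Zw := fun _ : Z => Z) K (fun _ => f)).
Local Notation D3 f := (K3 (Zw := fun _ : Z => Z) K (fun _ => f)).

Lemma geo_S b r : 0 < b -> 0 <= r -> geo b (r + 1) = geo b r + pw (b * r).
Proof.
move=> b0 r0; rewrite /geo -fl_addM; last by have := pw_gt ic (x := b); lra.
by congr (fl _ _); rewrite (pwMS ic) //; [ring|exact: ltW].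
Qed.

Lemma geo_0 b : 0 < b -> geo b 0 = 0.
Proof. by move=> b0; rewrite /geo mulr0 pw0 subrr fl_small //; have := pw_gt ic (x := b); lra. Qed.

Lemma sums_re f Sf N : D1 f -> D2 Sf -> sums f Sf -> 0 < N ->
  sums (fun n => f (fl n N)) (sre f Sf N).
Proof.
move=> Df DSf Hf N0; apply: (sums_wsum ic) => //=; try by rewrite /geo; move=> *; kk.
- by move=> n n0; apply: (s_ge0 _ _ Hf); exact: fl_ge0.
- move=> n b n0 b1; rewrite fl_small // (s_0 _ _ Hf); last by apply: mulr_ge0; lra.
  by rewrite md_small // geo_0 ?mul0r ?mulr0 ?addr0 //; lra.
move=> n b m n0 b1 m0 _; have b0 : 0 < b by lra.
have u0 : 0 <= fl m N by exact: fl_ge0.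
have r0 := md_ge0 _ m N N0.
have -> : pw (b * m) = pw (b * N * fl m N) * pw (b * md m N).
  rewrite -(pwD ic); [|by rewrite !mulr_ge0 //; lra|by apply: mulr_ge0; lra].
  by rewrite {1}(fl_md _ m N); congr pw; ring.
case: (floor_succ _ m N N0) => -[E [-> ->]]; first by rewrite geo_S //; ring.
rewrite geo_0 // (s_S _ _ Hf) //; last by apply: mulr_ge0; lra.
have -> : geo b N = geo b (md m N) + pw (b * md m N) by rewrite -geo_S ?E.
ring.
Qed.
End Reindexing.

Arguments sums_re {Z K KP} ic {f Sf N}. Arguments sums_add {Z f g Sf Sg}.
Arguments geo_S {Z K KP} ic {b r}.

(** * Floor sums *)

(** [sum (u < n) X^(P u + 1)] *)
Definition fsumT {Z : oring} (P c n : Z) : Z := fl (pw c * (pw (c * (P * n)) - 1)) (pw (c * P) - 1).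

(** The sum of the floors of [P u / Q] for [u < n], provided that [n <= N]: modulo [X], the floor of
    [X^(m+1) / ((X - 1) (X^Q - 1))] is that of [m / Q]. *)
Definition fsum {Z : oring} (N P Q n : Z) : Z :=
  let c := 2 * (N * (P * N + 1)) + 1 in
  md (fl (fsumT P c n) ((pw c - 1) * (pw (c * Q) - 1))) (pw c).

Section ClosedOps.
Variables (W : Type) (Zw : W -> oring) (K : (forall w, Zw w) -> Prop).
Hypothesis cK : closed K.

Lemma cl_fsum N P Q n : K N -> K P -> K Q -> K n -> K (fun w => fsum (N w) (P w) (Q w) (n w)).
Proof. rewrite /fsum /fsumT => *; cbv zeta; repeat kk_op. Qed.

End ClosedOps.

Section FloorSums.
Variables (Z : oring) (K : (Z -> Z) -> Prop) (KP : (Z -> Prop) -> Prop).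
Implicit Types (a b c m n i j x y u v : Z).
Hypothesis ic : ind_class Z K KP.
Let cK : closed (Zw := fun _ : Z => Z) K := ic_closed _ _ _ ic.
Local Notation D1 f := (K1 (Zw := fun _ : Z => Z) K (fun _ => f)).
Local Notation D2 f := (K2 (Zw := fun _ : Z => Z) K (fun _ => f)).
Local Notation D3 f := (K3 (Zw := fun _ : Z => Z) K (fun _ => f)).

Lemma geoE b r : 0 < b -> 0 <= r -> pw (b * r) = geo b r * (pw b - 1) + 1.
Proof.
move=> b0; move: r; rewrite /geo.
zind (fun r => pw (b * r) = fl (pw (b * r) - 1) (pw b - 1) * (pw b - 1) + 1).
  by rewrite mulr0 pw0 subrr fl_small ?mul0r ?add0r //; have := pw_gt ic (x := b); lra.
move=> r r0; rewrite -/(geo b r) -/(geo b (r + 1)) (geo_S ic) // => E.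
rewrite (pwMS ic) //; last exact: ltW.
move: (geo b r) E => g E; lra.
Qed.

(** Let [X = pw c]. Expanded in powers of [1 / X], the quotient of [X^(m+1)] by [(X - 1) (X^Q - 1)]
    has as coefficient of [X^0] the number of [j >= 1] with [Q j <= m]. The proof is an induction on
    the quotient of [m] by [Q]: multiplication by [X^Q] raises the digit by 1 and the remainder by
    [X^Q - 1]. *)
Lemma fsum_digit Q c m : 0 < Q -> 0 < c -> 0 <= m ->
  let D := (pw c - 1) * (pw (c * Q) - 1) in
  (fl m Q + 1) * pw (c * Q) < D -> fl m Q < pw c ->
  md (fl (pw (c * (m + 1))) D) (pw c) = fl m Q /\
  md (pw (c * (m + 1))) D <= (fl m Q + 1) * pw (c * Q).
Proof.
move=> Q0 c0 m0 D.
have s0 := md_ge0 _ m Q Q0; have sQ := md_lt _ m Q Q0.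
have q0 := fl_ge0 _ m Q m0 Q0; have := fl_md _ m Q.
move: (fl m Q) (md m Q) s0 sQ q0 => q s s0 sQ q0 -> h1 h2.
have cQ : 0 < c * Q by exact: mulr_gt0.
have XQ := pw_gt ic (ltW cQ); have X1 := pw_gt ic (ltW c0).
have D0 : 0 < D by apply: mulr_gt0; lra.
have Xs : pw (c * (s + 1)) <= pw (c * Q).
  by apply: (pw_le ic); [apply: mulr_ge0; lra|rewrite ler_pM2l //; exact: oz_disc].
have Xs0 : 0 < pw (c * (s + 1)) by apply: (pw_gt0 ic); apply: mulr_ge0; lra.
suff [-> ->] : md (fl (pw (c * (q * Q + s + 1))) D) (pw c) = q /\
  md (pw (c * (q * Q + s + 1))) D = q * (pw (c * Q) - 1) + pw (c * (s + 1)) by split=> //; lra.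
move: q q0 h1 h2; zind (fun q => (q + 1) * pw (c * Q) < D -> q < pw c ->
  md (fl (pw (c * (q * Q + s + 1))) D) (pw c) = q /\
  md (pw (c * (q * Q + s + 1))) D = q * (pw (c * Q) - 1) + pw (c * (s + 1))).
  move=> h1 h2; rewrite !mul0r add0r; have lt : pw (c * (s + 1)) < D by lra.
  by rewrite fl_small ?md_small //; [lra|exact: ltW..].
move=> q q0 IH h1 h2; have [||E1 E2] := IH; [lra..|].
have m0' : 0 <= q * Q + s by apply: addr_ge0 => //; apply: mulr_ge0 => //; exact: ltW.
move: E1 E2; have -> : (q + 1) * Q + s + 1 = (q * Q + s + 1) + Q by ring.
rewrite [c * (_ + Q)]mulrDr (pwD ic); [|apply: mulr_ge0; lra|exact: ltW].
have : pw (c * (q * Q + s + 1)) = (pw c - 1) * (pw c * geo c (q * Q + s) + 1) + 1.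
  by rewrite (pwMS ic) ?(geoE c (q * Q + s)) //; [ring|exact: ltW].
move: (geo c _) (pw (c * (q * Q + s + 1))) => A p Ep E1 E2.
have r0 : 0 <= q * (pw (c * Q) - 1) by apply: mulr_ge0; lra.
have Ep' : p * pw (c * Q) = p + D * (pw c * A + 1) + (pw (c * Q) - 1) by rewrite Ep /D; ring.
have Ed : p * pw (c * Q) = ((fl (fl p D) (pw c) + A) * pw c + (q + 1)) * D +
    ((q + 1) * (pw (c * Q) - 1) + pw (c * (s + 1))).
  have := fl_md _ p D; rewrite {1}(fl_md _ (fl p D) (pw c)) E1 E2 Ep'.
  by move: (fl (fl p D) (pw c)) => t ->; ring.
by have [|||| -> ->] := digits _ _ _ _ _ _ _ Ed; lra.
Qed.

Lemma fsumP N P Q : 0 < P -> 0 < Q -> 0 <= N ->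
  fsum N P Q 0 = 0 /\
  forall n, 0 <= n -> n < N -> fsum N P Q (n + 1) = fsum N P Q n + fl (P * n) Q.
Proof.
(* [M] bounds the sum of [N] floors, each at most [P N], with 1 to spare for each remainder modulo
   [D]; the base [pw c] exceeds [2 M], so nothing is carried. *)
move=> P0 Q0 N0; rewrite /fsum; set M := N * (P * N + 1); set c := 2 * M + 1.
set D := (_ - 1) * _; have M0 : 0 <= M by rewrite /M; nra.
have c0 : 0 < c by rewrite /c; lra.
have cQ : 0 < c * Q by exact: mulr_gt0.
have cP : 0 < c * P by exact: mulr_gt0.
have XQ := pw_gt ic (ltW cQ); have XP := pw_gt ic (ltW cP); have := pw_gt ic (ltW c0).
rewrite {1}/c => X_big; clearbody c.
have D_big : M * pw (c * Q) < D.
  have : (2 * M + 1) * (pw (c * Q) - 1) <= D by apply: ler_wpM2r; lra.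
  have cQ2 : 1 <= c * Q by have /oz_disc := cQ; lra.
  have : M * 2 <= M * pw (c * Q) by apply: ler_wpM2l; lra.
  lra.
have D0 : 0 < D by apply: le_lt_trans D_big; apply: mulr_ge0; lra.
have X0 : 0 < pw c by lra.
have T0 : fsumT P c 0 = 0 by rewrite /fsumT !mulr0 pw0 subrr mulr0 fl_small //; lra.
have TS n : 0 <= n -> fsumT P c (n + 1) = fsumT P c n + pw (c * (P * n + 1)).
  move=> n0; rewrite /fsumT -fl_addM; last by lra.
  congr (fl _ _); rewrite (pwMS ic); [|lra|by apply: mulr_ge0; lra].
  have -> : c * (P * (n + 1)) = c * (P * n) + c * P by ring.
  rewrite (pwD ic); [ring| |exact: ltW].
  by rewrite !mulr_ge0 //; exact: ltW.
split; first by rewrite T0 fl_small ?md_small.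
have step n : 0 <= n -> n < N ->
    md (fl (fsumT P c n) D) (pw c) <= n * (P * N + 1) /\
    md (fsumT P c n) D <= n * (P * N + 1) * pw (c * Q) ->
    md (fl (fsumT P c (n + 1)) D) (pw c) = md (fl (fsumT P c n) D) (pw c) + fl (P * n) Q /\
    md (fsumT P c (n + 1)) D <= (n + 1) * (P * N + 1) * pw (c * Q) /\
    fl (P * n) Q <= P * N + 1.
  move=> n0 lt [h1 h2]; have Pn : 0 <= P * n by apply: mulr_ge0 => //; exact: ltW.
  have q0 := fl_ge0 _ (P * n) Q Pn Q0.
  have qP : fl (P * n) Q <= P * N.
    have := fl_md _ (P * n) Q; have := md_ge0 _ (P * n) Q Q0.
    have : P * n <= P * N by rewrite ler_pM2l //; exact: ltW.
    have : fl (P * n) Q * 1 <= fl (P * n) Q * Q by apply: ler_wpM2l => //; have /oz_disc := Q0; lra.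
    lra.
  have PN : 0 <= P * N by apply: mulr_ge0 => //; exact: ltW.
  have nM : (n + 1) * (P * N + 1) <= M.
    by apply: ler_wpM2r; [lra|exact: oz_disc].
  have nM0 : 0 <= n * (P * N + 1) by apply: mulr_ge0; lra.
  have nMX : (n + 1) * (P * N + 1) * pw (c * Q) <= M * pw (c * Q) by apply: ler_wpM2r; lra.
  have qX : (fl (P * n) Q + 1) * pw (c * Q) <= (P * N + 1) * pw (c * Q) by apply: ler_wpM2r; lra.
  have nX0 : 0 <= n * (P * N + 1) * pw (c * Q) by apply: mulr_ge0; lra.
  have [||hi lo] := fsum_digit Q c (P * n) Q0 c0 Pn; [rewrite -/D; lra|lra|].
  rewrite -/D in hi lo; rewrite TS //.
  have [||-> ->] := acc_digit _ D (pw c) (fsumT P c n) (pw (c * (P * n + 1))) D0 X0.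
  - lra.
  - by rewrite hi; lra.
  by rewrite hi; split=> //; split; lra.
suff main i : 0 <= i -> i <= N ->
    md (fl (fsumT P c i) D) (pw c) <= i * (P * N + 1) /\
    md (fsumT P c i) D <= i * (P * N + 1) * pw (c * Q).
  by move=> n n0 lt; case: (step n n0 lt (main n n0 (ltW lt))).
move: i; refine (ic_ind _ _ _ ic (fun i => i <= N ->
    md (fl (fsumT P c i) D) (pw c) <= i * (P * N + 1) /\
    md (fsumT P c i) D <= i * (P * N + 1) * pw (c * Q)) _ _ _).
- by rewrite /fsumT; kp.
- by rewrite T0 fl_small ?md_small // !mul0r.
move=> i i0 IH lt; have lt' : i < N by lra.
have h := IH (ltW lt'); have [h1 [h2 h3]] := step i i0 lt' h; split=> //.
by rewrite [X in X <= _]h1; lra.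
Qed.
End FloorSums.

Arguments fsumP {Z K KP} ic {N P Q}. Arguments geoE {Z K KP} ic {b r}.

Lemma disc_le (Z : oring) (x y : Z) : x < y + 1 -> x <= y.
Proof. by case: (leP x y) => // /oz_disc; lra. Qed.

(** * Convergents and Lucas sequences *)

(** [p / q] and [P / Q] are convergents of the same continued fraction, and [e = q P - p Q] is so
    small that [P / Q] separates [j q - p] from an integer multiple exactly when [j >= a]. *)
Record lane {Z : oring} (a p q P Q e e' s : Z) : Prop := Lane {
  l_p : 0 < p; l_pq : p < q; l_Q : 0 < Q; l_e' : 0 <= e'; l_e'e : e' < e;
  l_pp : p * p = 1 + q * s;
  l_e : q * P = p * Q + e;
  l_eq : Q = (a * q - p) * e - q * e' }.

(** Write [p N = F q + r]. Then [q (P N - F Q) = r Q + N e], and because of [N e < 2 Q] the new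
    floor exceeds [F] only if [r = q - 1] and [N e >= Q], and then by 1. The first condition says
    [N = j q - p], since [p] is its own inverse modulo [q]. For such [N] the second one says
    [j >= a], by [Q = (a q - p) e - q e'] with [0 <= e' < e]. *)
Lemma lane_floor (Z : oring) (a p q P Q e e' s N : Z) : lane a p q P Q e e' s -> 0 <= N -> N * e < 2 * Q ->
  (fl (P * N) Q = fl (p * N) q + 1 /\ exists2 j, a <= j & N = j * q - p) \/
  (fl (P * N) Q = fl (p * N) q /\ forall j, a <= j -> N <> j * q - p).
Proof.
case=> p0 pq Q0 e'0 e'e pp e_def Q_def N0 Ne; have q0 : 0 < q by lra.
have := oz_disc _ _ _ q0; rewrite add0r => q1.
have E := fl_md _ (p * N) q; have s0 := md_ge0 _ (p * N) q q0; have sq := md_lt _ (p * N) q q0.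
move: (fl (p * N) q) (md (p * N) q) E s0 sq => F r E r0 rq.
have key : q * (P * N - F * Q) = r * Q + N * e.
  have -> : r = p * N - F * q by rewrite E; ring.
  transitivity (q * P * N - q * F * Q); first by ring.
  by rewrite e_def; ring.
have e0 : 0 < e by lra.
have Ne0 : 0 <= N * e by apply: mulr_ge0 => //; exact: ltW.
have rQ0 : 0 <= r * Q by apply: mulr_ge0 => //; exact: ltW.
case: (ltP (r * Q + N * e) (q * Q)) => [lt|ge].
  right; split.
    apply: (fl_uniq _ _ _ _ (P * N - F * Q)); first by ring.
      by rewrite -(pmulr_rge0 _ q0) key addr_ge0.
    by rewrite -(ltr_pM2l q0) key.
  move=> j ja EN.
  have r_eq : r = q - 1.
    have E2 : p * N = (j * p - s - 1) * q + (q - 1).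
      by rewrite EN; transitivity (j * p * q - p * p); [ring|rewrite pp; ring].
    rewrite -(md_uniq _ (p * N) q F r) //; apply: (md_uniq _ _ _ _ _ E2); lra.
  have : (a - j) * q * e <= 0 by rewrite -mulrA pmulr_lle0; [lra|exact: mulr_gt0].
  have := mulr_ge0 (ltW q0) e'0.
  move: lt; rewrite r_eq EN Q_def => *; lra.
left; split.
  apply: (fl_uniq _ _ _ _ (P * N - F * Q - Q)); first by ring.
    by rewrite -(pmulr_rge0 _ q0) mulrBr key; lra.
  rewrite -(ltr_pM2l q0) mulrBr key.
  have : r * Q <= (q - 1) * Q by apply: ler_wpM2r; [exact: ltW|have /oz_disc := rq; lra].
  have : 1 * Q <= q * Q by apply: ler_wpM2r; [exact: ltW|have /oz_disc := q0; lra].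
  lra.
have r_eq : r = q - 1.
  have /oz_disc rq1 := rq; case: (ltgtP r (q - 1)) => // [/oz_disc lt|]; last by lra.
  have : r * Q <= (q - 2) * Q by apply: ler_wpM2r; [exact: ltW|lra].
  lra.
(* Multiply [p N = (F + 1) q - 1] by [p] and use [p p = 1 + q s]. *)
exists (p * (F + 1) - N * s).
  have EN : N = (p * (F + 1) - N * s) * q - p.
    transitivity (p * (p * N) - N * (q * s)); last by rewrite E r_eq; ring.
    by rewrite (_ : q * s = p * p - 1); [ring|lra].
  move: (p * (F + 1) - N * s) EN => j EN; move: ge; rewrite r_eq => ge.
  have {}ge : Q <= N * e by lra.
  rewrite EN Q_def in ge; have : 0 < (j - a + 1) * (q * e).
    have : 0 < q * (e - e') by apply: mulr_gt0; lra.
    lra.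
  rewrite pmulr_lgt0; [|exact: mulr_gt0] => H; apply: disc_le; lra.
transitivity (p * (p * N) - N * (q * s)); last by rewrite E r_eq; ring.
by rewrite (_ : q * s = p * p - 1); [ring|lra].
Qed.

(** As [p] is invertible modulo [q], the remainders of [p x] and [p (q - x)] are not 0, so they add
    up to [q]. *)
Lemma lane_pair (Z : oring) (a p q P Q e e' s x : Z) : lane a p q P Q e e' s -> 0 < x -> x < q -> fl (p * x) q + fl (p * (q - x)) q = p - 1.
Proof.
case=> p0 pq Q0 e'0 e'e pp e_def Q_def x0 xq; have q0 : 0 < q by lra.
have := oz_disc _ _ _ q0; rewrite add0r => q1.
have E := fl_md _ (p * x) q; have r0 := md_ge0 _ (p * x) q q0; have rq := md_lt _ (p * x) q q0.
move: (fl (p * x) q) (md (p * x) q) E r0 rq => F r E r0 rq.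
case: (ltgtP 0 r) => [lt|lt|eq]; first 1 [idtac]; last 2 first.
- lra.
- have Ex : x = (p * F - x * s) * q.
    transitivity (p * (p * x) - x * (q * s)); last by rewrite E -eq; ring.
    by rewrite (_ : q * s = p * p - 1); [ring|lra].
  have j1 : 0 < p * F - x * s by rewrite -(pmulr_lgt0 _ q0) -Ex.
  have := oz_disc _ _ _ j1; rewrite add0r => j2.
  have : 1 * q <= (p * F - x * s) * q by apply: ler_wpM2r => //; exact: ltW.
  lra.
rewrite (fl_uniq _ (p * (q - x)) q (p - 1 - F) (q - r)); [ring| |lra|lra].
by rewrite mulrBr E; ring.
Qed.

Section LaneBlock.
Variables (Z : oring) (K : (Z -> Z) -> Prop) (KP : (Z -> Prop) -> Prop).
Implicit Types (a b c m n i j x y u v : Z).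
Hypothesis ic : ind_class Z K KP.
Let cK : closed (Zw := fun _ : Z => Z) K := ic_closed _ _ _ ic.
Local Notation D1 f := (K1 (Zw := fun _ : Z => Z) K (fun _ => f)).
Local Notation D2 f := (K2 (Zw := fun _ : Z => Z) K (fun _ => f)).
Local Notation D3 f := (K3 (Zw := fun _ : Z => Z) K (fun _ => f)).

Section Blocks.
Variables (a p q P Q e e' s N : Z) (fs FS : Z -> Z).
Hypotheses (La : lane a p q P Q e e' s) (Dfs : D1 fs) (DFS : D1 FS) (qN : q <= N).
Hypothesis fs0 : fs 0 = 0.
Hypothesis fsS : forall n, 0 <= n -> n < N -> fs (n + 1) = fs n + fl (p * n) q.
Hypothesis FSS : forall n, 0 <= n -> n < N -> FS (n + 1) = FS n + fl (P * n) Q.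

(** For [n = 0] the arguments [x] and [q - x] are paired. Shifting the block by 1 exchanges the
    floor at [n] for the one at [n + q], which is larger by [p]. *)
Lemma block_small n : 0 <= n -> n + q <= N -> 2 * (fs (n + q) - fs n) = (p - 1) * (q - 1) + 2 * (n * p).
Proof.
have p0 := l_p _ _ _ _ _ _ _ _ La; have pq := l_pq _ _ _ _ _ _ _ _ La; have qN' := qN.
have q0 : 0 < q by lra.
have := oz_disc _ _ _ q0; rewrite add0r => q1.
have fs1 : fs 1 = 0.
  by have := fsS 0; rewrite add0r mulr0 fl_small // fs0 addr0; apply; lra.
have pair y : 0 <= y -> y + 1 <= q -> fs (y + 1) + fs q - fs (q - y) = y * (p - 1).
  move: y; zind (fun y => y + 1 <= q -> fs (y + 1) + fs q - fs (q - y) = y * (p - 1)).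
    by move=> _; rewrite add0r subr0 fs1; ring.
  move=> y y0 IH lt; have := IH ltac:(lra).
  have := fsS (q - (y + 1)); rewrite (_ : q - (y + 1) + 1 = q - y); last by ring.
  move=> -> //; try lra; rewrite (fsS (y + 1)); [|lra|lra].
  have := lane_pair _ _ _ _ _ _ _ _ _ (y + 1) La; move=> H; have {}H := H ltac:(lra) ltac:(lra).
  lra.
move: n; zind (fun n => n + q <= N -> 2 * (fs (n + q) - fs n) = (p - 1) * (q - 1) + 2 * (n * p)).
  move=> _; have := pair (q - 1); rewrite (_ : q - 1 + 1 = q); last by ring.
  rewrite (_ : q - (q - 1) = 1); last by ring.
  rewrite fs1 fs0 add0r => H; have := H ltac:(lra) (lexx q); lra.
move=> n n0 IH le; have := IH ltac:(lra).
rewrite (_ : n + 1 + q = n + q + 1); last by ring.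
rewrite !fsS; try lra.
rewrite (_ : p * (n + q) = p * n + p * q) ?fl_addM //; [lra|ring].
Qed.

(** A block of [q] consecutive arguments contains exactly one number [j q - p], the only place where
    the floors for [P / Q] and [p / q] can differ. *)
Lemma lane_block n j : 0 <= n -> n + q <= N -> (n + q) * e < 2 * Q -> n <= j * q - p -> j * q - p < n + q ->
  2 * (FS (n + q) - FS n) = (p - 1) * (q - 1) + 2 * (n * p) + (if a <= j then 2 else 0).
Proof.
have p0 := l_p _ _ _ _ _ _ _ _ La; have pq := l_pq _ _ _ _ _ _ _ _ La.
have e'0 := l_e' _ _ _ _ _ _ _ _ La; have e'e := l_e'e _ _ _ _ _ _ _ _ La.
move=> n0 nN small nj jn; rewrite -block_small //.
have q0 : 0 < q by lra.
suff main x : 0 <= x -> x <= q ->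
  (j * q - p < n + x -> FS (n + x) - FS n = fs (n + x) - fs n + (if a <= j then 1 else 0)) /\
  (n + x <= j * q - p -> FS (n + x) - FS n = fs (n + x) - fs n).
  have [H _] := main q (ltW q0) (lexx q); have := H jn; case: ifP => _; lra.
move: x; zind (fun x => x <= q ->
  (j * q - p < n + x -> FS (n + x) - FS n = fs (n + x) - fs n + (if a <= j then 1 else 0)) /\
  (n + x <= j * q - p -> FS (n + x) - FS n = fs (n + x) - fs n)).
  by move=> _; rewrite !addr0 !subrr; split=> //; lra.
move=> x x0 IH lt; have [IH1 IH2] := IH ltac:(lra).
rewrite addrA FSS ?fsS; try lra.
have Ne : (n + x) * e < 2 * Q.
  by apply: le_lt_trans small; apply: ler_wpM2r; lra.
case: (lane_floor _ _ _ _ _ _ _ _ _ (n + x) La ltac:(lra) Ne) => -[-> H].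
  have [i ia E] := H; have Eij : i = j.
    case: (ltgtP i j) => // /oz_disc lt'.
      have : (i + 1) * q <= j * q by apply: ler_wpM2r; lra. lra.
    have : (j + 1) * q <= i * q by apply: ler_wpM2r; lra. lra.
  rewrite Eij in ia E; rewrite ia in IH1 *; have := IH2 ltac:(lra); split=> h; lra.
case: (leP a j) IH1 H => [aj|ja] IH1 H; last first.
  by split=> h; [case: (ltP (j * q - p) (n + x)) => h'; [have := IH1 h'|have := IH2 h']|have := IH2 ltac:(lra)]; lra.
have /eqP neq := H j aj.
split=> h; last by have := IH2 ltac:(lra); lra.
suff h' : j * q - p < n + x by have := IH1 h'; lra.
rewrite lt_neqAle eq_sym neq /=; apply: disc_le; lra.
Qed.

End Blocks.
End LaneBlock.

Arguments lane_block {Z K KP} ic {a p q P Q e e' s N fs FS}.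

Section LaneBlocks.
Variables (Z : oring) (K : (Z -> Z) -> Prop) (KP : (Z -> Prop) -> Prop).
Implicit Types (a b c m n i j x y u v : Z).
Hypothesis ic : ind_class Z K KP.
Let cK : closed (Zw := fun _ : Z => Z) K := ic_closed _ _ _ ic.
Local Notation D1 f := (K1 (Zw := fun _ : Z => Z) K (fun _ => f)).
Local Notation D2 f := (K2 (Zw := fun _ : Z => Z) K (fun _ => f)).
Local Notation D3 f := (K3 (Zw := fun _ : Z => Z) K (fun _ => f)).

Section Blocks.
Variables (a p q P Q e e' s N : Z) (fs FS : Z -> Z).
Hypotheses (La : lane a p q P Q e e' s) (Dfs : D1 fs) (DFS : D1 FS) (qN : q <= N).
Hypothesis fs0 : fs 0 = 0.
Hypothesis fsS : forall n, 0 <= n -> n < N -> fs (n + 1) = fs n + fl (p * n) q.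
Hypothesis FSS : forall n, 0 <= n -> n < N -> FS (n + 1) = FS n + fl (P * n) Q.

(** Because of [n + p <= q], the block number [d], counted from 0, contains [(d + 1) q - p]. So
    there is no jump in the first [a - 1] blocks and one in each later block: the number of jumps is
    a truncated difference. *)
Lemma blocks n w : 1 <= a -> 0 <= n -> n + p <= q -> n + w * q <= N -> (n + w * q) * e < 2 * Q -> 0 <= w ->
  forall d, 0 <= d -> d <= w ->
    2 * (FS (n + d * q) - FS n) =
    d * ((p - 1) * (q - 1)) + 2 * (d * n * p) + p * q * (d * (d - 1)) +
      2 * (if a - 1 <= d then d - (a - 1) else 0).
Proof.
have p0 := l_p _ _ _ _ _ _ _ _ La; have pq := l_pq _ _ _ _ _ _ _ _ La.
have e'0 := l_e' _ _ _ _ _ _ _ _ La; have e'e := l_e'e _ _ _ _ _ _ _ _ La.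
have q0 : 0 < q by lra.
move=> a1 n0 npq nN small w0.
suff main d : 0 <= d -> d <= w ->
    (d <= a - 1 -> 2 * (FS (n + d * q) - FS n) =
      d * ((p - 1) * (q - 1)) + 2 * (d * n * p) + p * q * (d * (d - 1))) /\
    (a - 1 <= d -> 2 * (FS (n + d * q) - FS n) =
      d * ((p - 1) * (q - 1)) + 2 * (d * n * p) + p * q * (d * (d - 1)) + 2 * (d - (a - 1))).
  move=> d d0 dw; have [H1 H2] := main d d0 dw.
  by case: leP => [/H2|/ltW /H1] ->; rewrite ?mulr0 ?addr0.
move: d; zind (fun d => d <= w ->
    (d <= a - 1 -> 2 * (FS (n + d * q) - FS n) =
      d * ((p - 1) * (q - 1)) + 2 * (d * n * p) + p * q * (d * (d - 1))) /\
    (a - 1 <= d -> 2 * (FS (n + d * q) - FS n) =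
      d * ((p - 1) * (q - 1)) + 2 * (d * n * p) + p * q * (d * (d - 1)) + 2 * (d - (a - 1)))).
  by move=> _; rewrite !mul0r addr0 subrr; split=> h; lra.
move=> d d0 IH lt; have [IH1 IH2] := IH ltac:(lra).
have dq0 : 0 <= d * q by apply: mulr_ge0 => //; exact: ltW.
have dq : (d + 1) * q <= w * q by apply: ler_wpM2r => //; exact: ltW.
have := lane_block ic La Dfs DFS qN fs0 fsS FSS (n + d * q) (d + 1); rewrite (_ : n + d * q + q = n + (d + 1) * q); last by ring.
move=> H; have {}H : 2 * (FS (n + (d + 1) * q) - FS (n + d * q)) =
    (p - 1) * (q - 1) + 2 * ((n + d * q) * p) + (if a <= d + 1 then 2 else 0).
  apply: H; try lra; apply: le_lt_trans small; apply: ler_wpM2r; lra.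
case: (leP a (d + 1)) H => [ad|/oz_disc da] H.
  by have := IH2 ltac:(lra); split=> h; lra.
by have := IH1 ltac:(lra); split=> h; lra.
Qed.

End Blocks.
End LaneBlocks.

Arguments blocks {Z K KP} ic {a p q P Q e e' s N fs FS}.

(** The recurrence is asked up to [L] only, because the term for the sequence is correct only while
    its values fit below the base. *)
Record psis {Z : oring} (a L : Z) (ps : Z -> Z) : Prop := Psis {
  ps_0 : ps 0 = 0;
  ps_1 : ps 1 = 1;
  ps_S : forall t, 0 <= t -> t + 2 <= L -> ps (t + 2) = a * ps (t + 1) - ps t }.

(** * Arithmetic of the Lucas sequence *)

Section LucasSequence.
Variables (Z : oring) (K : (Z -> Z) -> Prop) (KP : (Z -> Prop) -> Prop).
Implicit Types (a b c m n i j x y u v : Z).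
Hypothesis ic : ind_class Z K KP.
Let cK : closed (Zw := fun _ : Z => Z) K := ic_closed _ _ _ ic.
Local Notation D1 f := (K1 (Zw := fun _ : Z => Z) K (fun _ => f)).
Local Notation D2 f := (K2 (Zw := fun _ : Z => Z) K (fun _ => f)).
Local Notation D3 f := (K3 (Zw := fun _ : Z => Z) K (fun _ => f)).

Section Psi.
Variables (a L : Z) (ps : Z -> Z).
Hypotheses (a4_ : 4 <= a) (Dps : D1 ps) (Hps : psis a L ps).

Lemma ps_growth t : 0 <= t -> t + 1 <= L ->
  [/\ 0 <= ps t, ps t + 1 <= ps (t + 1) & (a - 1) * ps t <= ps (t + 1)].
Proof.
have a4 := a4_; move=> t0 tL.
suff [? []] : 0 <= ps t /\ ps t + 1 <= ps (t + 1) /\ (a - 1) * ps t <= ps (t + 1) by [].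
move: t t0 tL; zind (fun t => t + 1 <= L ->
  0 <= ps t /\ ps t + 1 <= ps (t + 1) /\ (a - 1) * ps t <= ps (t + 1)).
  by rewrite add0r (ps_0 _ _ _ Hps) (ps_1 _ _ _ Hps); move=> _; split=> //; split; lra.
move=> t t0 IH le; have [h1 [h2 h3]] := IH ltac:(lra).
rewrite (_ : t + 1 + 1 = t + 2); last by ring.
rewrite (ps_S _ _ _ Hps) //; last by lra.
have : 0 <= (a - 4) * ps (t + 1) by apply: mulr_ge0; lra.
by split; [|split]; lra.
Qed.

(** The analogue of the Cassini identity; it makes [ps t] its own inverse modulo [ps (t + 1)]. *)
Lemma ps_cassini t : 0 <= t -> t + 1 <= L ->
  ps (t + 1) * ps (t + 1) = 1 + ps t * (a * ps (t + 1) - ps t).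
Proof.
move: t; zind (fun t => t + 1 <= L ->
  ps (t + 1) * ps (t + 1) = 1 + ps t * (a * ps (t + 1) - ps t)).
  by move=> _; rewrite add0r (ps_0 _ _ _ Hps) (ps_1 _ _ _ Hps); ring.
move=> t t0 IH le; have {}IH := IH ltac:(lra).
rewrite (_ : t + 1 + 1 = t + 2); last by ring.
rewrite (ps_S _ _ _ Hps) //; last by lra.
lra.
Qed.

(** The error [e] of the lane at index [t]. By [epsE] it is the sequence read backwards,
    [ps (L - 1 - t)]. *)
Definition eps t := ps (t + 1) * ps (L - 1) - ps t * ps L.

Lemma epsE j : 0 <= j -> j + 2 <= L -> eps (L - 1 - j) = ps j /\ eps (L - 2 - j) = ps (j + 1).
Proof.
rewrite /eps; move: j; zind (fun j => j + 2 <= L ->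
  ps (L - 1 - j + 1) * ps (L - 1) - ps (L - 1 - j) * ps L = ps j /\
  ps (L - 2 - j + 1) * ps (L - 1) - ps (L - 2 - j) * ps L = ps (j + 1)).
  rewrite !add0r !subr0 subrK (ps_0 _ _ _ Hps) (ps_1 _ _ _ Hps) => le; split; first by ring.
  have := ps_cassini (L - 2); have := ps_S _ _ _ Hps (L - 2).
  rewrite (_ : L - 2 + 1 = L - 1); last by ring.
  rewrite subrK => E1 E2; have {}E1 := E1 ltac:(lra) ltac:(lra); have {}E2 := E2 ltac:(lra) ltac:(lra).
  by rewrite E2 E1; ring.
move=> j j0 IH le; have [E1 E2] := IH ltac:(lra).
rewrite (_ : L - 1 - (j + 1) = L - 2 - j); last by ring.
split=> //; rewrite (_ : j + 1 + 1 = j + 2); last by ring.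
rewrite (ps_S _ _ _ Hps) // -?E1 -?E2; last by lra.
rewrite (_ : L - 2 - (j + 1) + 1 = L - 2 - j); last by ring.
have := ps_S _ _ _ Hps (L - 2 - (j + 1)).
rewrite (_ : L - 2 - (j + 1) + 1 = L - 2 - j); last by ring.
rewrite (_ : L - 2 - (j + 1) + 2 = L - 1 - j); last by ring.
rewrite (_ : L - 2 - j + 1 = L - 1 - j); last by ring.
move=> E3; have {}E3 := E3 ltac:(lra) ltac:(lra).
have := ps_S _ _ _ Hps (L - 2 - j).
rewrite (_ : L - 2 - j + 1 = L - 1 - j); last by ring.
rewrite (_ : L - 2 - j + 2 = L - 1 - j + 1); last by ring.
move=> E4; have {}E4 := E4 ltac:(lra) ltac:(lra).
by rewrite E4 (_ : ps (L - 2 - (j + 1)) = a * ps (L - 2 - j) - ps (L - 1 - j)); [ring|rewrite E3; ring].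
Qed.

Lemma ps_lane t : 1 <= t -> t + 2 <= L ->
  lane a (ps t) (ps (t + 1)) (ps (L - 1)) (ps L) (eps t) (eps (t + 1)) (a * ps t - ps (t + 1)).
Proof.
move=> t1 le; have t0 : 0 <= t by lra.
have [h1 h2 h3] := ps_growth t t0 ltac:(lra).
have [_ h5 _] := ps_growth (t - 1) ltac:(lra) ltac:(lra).
have [h4 _ _] := ps_growth (t - 1) ltac:(lra) ltac:(lra).
rewrite subrK in h5.
have E := ps_cassini t t0 ltac:(lra).
have [l1 l2 _] := ps_growth (L - 1) ltac:(lra) ltac:(lra); rewrite subrK in l2.
have [E1 E2] := epsE (L - 2 - t) ltac:(lra) ltac:(lra).
rewrite (_ : L - 1 - (L - 2 - t) = t + 1) in E1; last by ring.
rewrite (_ : L - 2 - (L - 2 - t) = t) in E2; last by ring.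
have [e1 e2 _] := ps_growth (L - 2 - t) ltac:(lra) ltac:(lra).
split; rewrite ?E1 ?E2; try lra.
- by rewrite -E2 /eps; ring.
rewrite -E1 -E2 /eps (_ : t + 1 + 1 = t + 2); last by ring.
rewrite (ps_S _ _ _ Hps) //.
transitivity ((ps (t + 1) * ps (t + 1) - ps t * (a * ps (t + 1) - ps t)) * ps L); last by ring.
by rewrite E; ring.
Qed.

(** Modulo [a] the recurrence says [ps (t + 2) = - ps t], so the period is 4. Convergents at the
    indices [4 i + 1], [4 i + 2] have the residues for which the regular part of the floor sum
    disappears. *)
Lemma ps_mod i : 0 <= i -> 4 * i + 2 <= L -> md (ps (4 * i + 1)) a = 1 /\ md (ps (4 * i + 2)) a = 0.
Proof.
have a4 := a4_; have a0 : 0 < a by lra.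
move: i; zind (fun i => 4 * i + 2 <= L -> md (ps (4 * i + 1)) a = 1 /\ md (ps (4 * i + 2)) a = 0).
  rewrite mulr0 !add0r => le; rewrite (ps_1 _ _ _ Hps); have := ps_S _ _ _ Hps 0 (lexx 0).
  rewrite !add0r (ps_0 _ _ _ Hps) (ps_1 _ _ _ Hps) => -> //; split; first by apply: md_small; lra.
  by apply: (md_uniq _ _ _ 1) => //; ring.
move=> i i0 IH le; have [E1 E2] := IH ltac:(lra).
have S t : 0 <= t -> t + 4 <= L -> exists k, ps (t + 4) = ps t + k * a.
  move=> t0 tL; have := ps_S _ _ _ Hps (t + 2); have := ps_S _ _ _ Hps t.
  rewrite (_ : t + 2 + 1 = t + 3); last by ring.
  rewrite (_ : t + 2 + 2 = t + 4); last by ring.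
  move=> e1 e2; rewrite e2 ?e1; [|lra..].
  by exists (ps (t + 3) - ps (t + 1)); ring.
have [k Ek] := S (4 * i + 1) ltac:(lra) ltac:(lra).
have [l El] := S (4 * i + 2) ltac:(lra) ltac:(lra).
rewrite (_ : 4 * (i + 1) + 1 = 4 * i + 1 + 4); last by ring.
rewrite (_ : 4 * (i + 1) + 2 = 4 * i + 2 + 4); last by ring.
by rewrite Ek El !md_addM.
Qed.

(** An advance of the index by 4 leaves room for a summand [w * ps (t + 2)] with [w <= 2 a]; this
    keeps the starting points [psN] below [ps (4 * m)]. *)
Lemma ps_growth4 t : 0 <= t -> t + 4 <= L -> ps t + 2 * a * ps (t + 2) <= ps (t + 4).
Proof.
have a4 := a4_; move=> t0 tL; have := ps_S _ _ _ Hps (t + 2); have := ps_S _ _ _ Hps (t + 1).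
rewrite (_ : t + 1 + 1 = t + 2); last by ring.
rewrite (_ : t + 1 + 2 = t + 3); last by ring.
rewrite (_ : t + 2 + 1 = t + 3); last by ring.
rewrite (_ : t + 2 + 2 = t + 4); last by ring.
move=> e1 e2; rewrite e2 ?e1; [|lra..].
have [h1 h2 h3] := ps_growth t t0 ltac:(lra); have [h4 h5 h6] := ps_growth (t + 1) ltac:(lra) ltac:(lra).
rewrite (_ : t + 1 + 1 = t + 2) in h5 h6; last by ring.
have : 0 <= a * (ps (t + 2) - ps (t + 1) - 1) by apply: mulr_ge0; lra.
have le4 : 4 * ps (t + 2) <= a * ps (t + 2) by apply: ler_wpM2r; lra.
have : a * (4 * ps (t + 2)) <= a * (a * ps (t + 2)) by apply: ler_wpM2l; lra.
lra.
Qed.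

(** The two size conditions of [blocks]. The second follows from [Q > (a - 2) q e], which is where
    the limit [2 * (a - 2)] for the number of blocks comes from. *)
Lemma lane_small t n w : 1 <= t -> t + 2 <= L -> 0 <= n -> n <= ps (t - 1) -> 0 <= w -> w + 1 <= 2 * (a - 2) ->
  n + ps t <= ps (t + 1) /\ (n + w * ps (t + 1)) * eps t < 2 * ps L.
Proof.
have a4 := a4_; move=> t1 tL n0 nle w0 wa; have La := ps_lane t t1 tL.
have [h1 h2 h3] := ps_growth (t - 1) ltac:(lra) ltac:(lra).
have [h4 h5 h6] := ps_growth t ltac:(lra) ltac:(lra).
rewrite subrK in h2 h3; split.
  have : 4 * ps t <= a * ps t by apply: ler_wpM2r; lra.
  lra.
have e0 := l_e' _ _ _ _ _ _ _ _ La; have e1 := l_e'e _ _ _ _ _ _ _ _ La.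
have EQ := l_eq _ _ _ _ _ _ _ _ La.
move: (eps t) (eps (t + 1)) e0 e1 EQ => e e' e0 e1 ->.
have : (n + w * ps (t + 1)) * e <= (2 * (a - 2) * ps (t + 1)) * e.
  apply: ler_wpM2r; first by lra.
  have : (w + 1) * ps (t + 1) <= (2 * (a - 2)) * ps (t + 1) by apply: ler_wpM2r; lra.
  lra.
have : 0 < ps (t + 1) * (e - e') by apply: mulr_gt0; lra.
have : 0 <= (ps (t + 1) - ps t) * e by apply: mulr_ge0; lra.
lra.
Qed.

End Psi.
End LucasSequence.

Arguments ps_growth {Z K KP} ic {a L ps}. Arguments ps_lane {Z K KP} ic {a L ps}. Arguments ps_mod {Z K KP} ic {a L ps}.
Arguments ps_growth4 {Z K KP} ic {a L ps}. Arguments lane_small {Z K KP} ic {a L ps}. 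

(** Modulo [X^2 - a X + 1], the power [X^t] is [psi_t X - psi_(t-1)]. *)
Definition psD {Z : oring} (c a : Z) : Z := pw c * pw c - a * pw c + 1.
Definition psR {Z : oring} (c a t : Z) : Z := md (pw (c * t)) (psD c a).
Definition psi {Z : oring} (c a t : Z) : Z := md (- psR c a (t + 1)) (pw c).
(** [sum (i < m) w(i) psi_(4 i + 2)] *)
Definition psN {Z : oring} (Sw : Z -> Z -> Z) (c a m : Z) : Z :=
  md (- md (pw (3 * c) * Sw m (4 * c)) (psD c a)) (pw c).

Lemma psi_bounds (Z : realDomainType) (a p u v X : Z) :
  4 <= a -> p * a * a + a <= X -> 0 < p -> 0 <= v -> v < u -> u <= p ->
  [/\ u < a * u - v, a * u - v <= p * a, a * u + a <= X, a * (a * u - v) + a <= X & a * u - v < X].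
Proof.
move=> a4 le1 p0 v0 vu le.
have au : a * u <= p * a by rewrite [p * a]mulrC; apply: ler_wpM2l; lra.
have au4 : 4 * u <= a * u by apply: ler_wpM2r; lra.
have pa : p * a * 4 <= p * a * a by apply: ler_wpM2l; [apply: mulr_ge0|]; lra.
have pa0 : 0 < p * a by apply: mulr_gt0; lra.
have aw : a * (a * u - v) <= p * a * a by rewrite [_ * a]mulrC; apply: ler_wpM2l => //; lra.
by split=> //; lra.
Qed.

Section LucasTerm.
Variables (Z : oring) (K : (Z -> Z) -> Prop) (KP : (Z -> Prop) -> Prop).
Implicit Types (a b c m n i j x y u v : Z).
Hypothesis ic : ind_class Z K KP.
Let cK : closed (Zw := fun _ : Z => Z) K := ic_closed _ _ _ ic.
Local Notation D1 f := (K1 (Zw := fun _ : Z => Z) K (fun _ => f)).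
Local Notation D2 f := (K2 (Zw := fun _ : Z => Z) K (fun _ => f)).
Local Notation D3 f := (K3 (Zw := fun _ : Z => Z) K (fun _ => f)).

Section PsiDef.
Variables (k L : Z).
Hypotheses (k2_ : 2 <= k) (L0_ : 0 <= L).
Let a := pw k.
Let c := k * (L + 3).
Let X := pw c.
Let D := psD c a.

Lemma psX t : 0 <= t -> t <= L + 2 -> [/\ pw (k * t) + a <= X, 4 <= a, 0 < X & X < D].
Proof.
have k2 := k2_; have L0 := L0_; move=> t0 tL.
have a4 : 4 <= a.
  have := pw_le ic (x := 2) (y := k) ltac:(lra) ltac:(lra).
  by rewrite (_ : 2 = 0 + 1 + 1) ?pwS ?pw0 /a; [lra|lra|lra|ring].
have p4 : 4 <= pw (k * (L + 2)).
  apply: (le_trans a4); apply: (pw_le ic); first by lra.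
  have : k * 1 <= k * (L + 2) by apply: ler_wpM2l; lra.
  lra.
have EX : X = pw (k * (L + 2)) * a.
  by rewrite /X /c /a -(pwD ic); [congr pw; ring|apply: mulr_ge0; lra|lra].
have le1 : pw (k * t) <= pw (k * (L + 2)).
  by apply: (pw_le ic); [apply: mulr_ge0; lra|apply: ler_wpM2l; lra].
have h : 0 <= (pw (k * (L + 2)) - 2) * (a - 2) by apply: mulr_ge0; lra.
have XaX : pw (k * (L + 2)) + a <= X by rewrite EX; lra.
have X0 : 0 < X by lra.
split=> //; first by lra.
have : (a + 4) * X <= X * X by apply: ler_wpM2r; lra.
rewrite /D /psD -/X; lra.
Qed.

Lemma psR_step s u v : 0 <= s -> psR c a s = u * X - v -> 0 <= v -> v < u -> a * u + a <= X ->
  psR c a (s + 1) = (a * u - v) * X - u.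
Proof.
move=> s0 E v0 vu au; have [_ a4 X0 XD] := psX 0 (lexx 0) ltac:(have := L0_; lra).
have k2 := k2_; have L0 := L0_.
have c0 : 0 <= c by apply: mulr_ge0; lra.
rewrite /psR (pwMS ic) // -/X -/D {1}(fl_md _ (pw (c * s)) D) -/(psR c a s) E.
have u1 : v + 1 <= u := oz_disc _ _ _ vu.
have au4 : 4 * u <= a * u by apply: ler_wpM2r; lra.
have h1 : u * 1 <= u * X by apply: ler_wpM2l; have := oz_disc _ _ _ X0; lra.
have h2 : u * X <= (a * u - v) * X by apply: ler_wpM2r; lra.
have h3 : (a * u + a) * X <= X * X by apply: ler_wpM2r; lra.
have h4 : 0 <= v * X by apply: mulr_ge0; lra.
apply: (md_uniq _ _ _ (fl (pw (c * s)) D * X + u)); [|lra|rewrite /D /psD -/X; lra].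
by rewrite /D /psD -/X; ring.
Qed.

Lemma psi_of s u v : psR c a (s + 1) = u * X - v -> 0 <= v -> v < X -> psi c a s = v.
Proof. by move=> E v0 vX; rewrite /psi E; apply: (md_uniq _ _ _ (- u)) => //; rewrite -/X; ring. Qed.

(** The bound [a^t] for the value at [t + 1] is part of the induction: it keeps the values so far
    below [X = a^(L+3)] that the reduced form [psi_(t+1) X - psi_t] lies between 0 and [D] and hence
    is the remainder. *)
Lemma psi_main t : 0 <= t -> t <= L ->
  [/\ psR c a (t + 1) = psi c a (t + 1) * X - psi c a t, 0 <= psi c a t, psi c a t < psi c a (t + 1) &
      psi c a (t + 1) <= pw (k * t)].
Proof.
have k2 := k2_; have L0 := L0_; move=> t0 tL.
suff : psR c a (t + 1) = psi c a (t + 1) * X - psi c a t /\ 0 <= psi c a t /\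
    psi c a t < psi c a (t + 1) /\ psi c a (t + 1) <= pw (k * t) by case=> ? [? [? ?]].
move: t t0 tL; refine (ic_ind _ _ _ ic (fun t => t <= L ->
    psR c a (t + 1) = psi c a (t + 1) * X - psi c a t /\ 0 <= psi c a t /\
    psi c a t < psi c a (t + 1) /\ psi c a (t + 1) <= pw (k * t)) _ _ _).
- by rewrite /psi /psR /psD; kp.
- move=> _; have [le a4 X0 XD] := psX 0 (lexx 0) ltac:(lra).
  have R1 : psR c a 1 = 1 * X - 0 by rewrite /psR mulr1 md_small ?subr0 ?mul1r //; exact: ltW.
  have [le2 _ _ _] := psX 1 ltac:(lra) ltac:(lra); rewrite mulr1 -/a in le2.
  have := psR_step 1 1 0 ltac:(lra) R1 (lexx 0) ltac:(lra) ltac:(lra).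
  rewrite -{1}[1]add0r in R1; move=> R2; have e0 := psi_of 0 1 0 R1 (lexx 0) X0.
  have e1 := psi_of 1 _ _ R2 ltac:(lra) ltac:(lra).
  by rewrite mulr0 pw0 !add0r e0 e1; rewrite add0r in R1; rewrite R1; do !split=> //; lra.
move=> t t0 IH lt; have [E [v0 [vu le]]] := IH ltac:(lra); move: E v0 vu le.
have [le1 a4 X0 XD] := psX (t + 2) ltac:(lra) ltac:(lra).
have k0 : 0 <= k by lra.
rewrite -{1}[2]/(1 + 1) addrA !(pwMS ic) // in le1; try lra.
rewrite -/a in le1; rewrite (pwMS ic) // -/a.
have p0 : 0 < pw (k * t) by apply: (pw_gt0 ic); exact: mulr_ge0.
move: (psi c a t) (psi c a (t + 1)) (pw (k * t)) le1 p0 => v u p le1 p0 E v0 vu le.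
have [wu wp auX awX wX] := psi_bounds _ _ _ _ _ _ a4 le1 p0 v0 vu le.
have w0 : 0 <= a * u - v by exact: le_trans v0 (ltW (lt_trans vu wu)).
have u0 : 0 <= u by exact: le_trans v0 (ltW vu).
have t1 : 0 <= t + 1 by apply: addr_ge0.
have R2 := psR_step (t + 1) u v t1 E v0 vu auX.
have R3 := psR_step (t + 1 + 1) (a * u - v) u (addr_ge0 t1 ler01) R2 u0 wu awX.
have -> := psi_of (t + 1 + 1) _ _ R3 w0 wX.
by rewrite R2.
Qed.

Lemma psi_psis : psis a L (psi c a).
Proof.
have k2 := k2_; have L0 := L0_.
have [_ a4 X0 _] := psX 0 (lexx 0) ltac:(lra).
have [E0 h1 h2 h3] := psi_main 0 (lexx 0) ltac:(lra); rewrite mulr0 pw0 add0r in h3 h2.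
have h4 := oz_disc _ _ _ h2.
split; [lra|lra|move=> t t0 tL].
have [E v0 vu le] := psi_main t t0 ltac:(lra).
have [E' u0 uw le'] := psi_main (t + 1) ltac:(lra) ltac:(lra).
have [bd _ _ _] := psX (t + 1) ltac:(lra) ltac:(lra).
rewrite (pwMS ic) -/a in bd; [|lra|lra].
have a0 : 0 <= a by apply: le_trans a4.
have auX : a * psi c a (t + 1) + a <= X.
  by apply: le_trans bd; rewrite lerD2r [_ * a]mulrC; apply: ler_wpM2l.
have := psR_step _ _ _ (addr_ge0 t0 ler01) E v0 vu auX; rewrite E'.
rewrite (_ : t + 1 + 1 = t + 2); last by ring.
move=> /(congr1 (fun x => x + psi c a (t + 1))); rewrite !subrK.
by apply: mulIf; rewrite gt_eqF.
Qed.

Lemma psi_ok : [/\ 4 <= a, 0 < X, psis a L (psi c a),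
  forall t, 0 <= t -> t <= L -> psR c a (t + 1) = psi c a (t + 1) * X - psi c a t &
  forall t, 0 <= t -> t <= L -> psi c a (t + 1) + a <= X].
Proof.
have [_ a4 X0 _] := psX 0 (lexx 0) ltac:(have := L0_; lra).
split=> // [|t t0 tL|t t0 tL]; first exact: psi_psis.
  by have [] := psi_main t t0 tL.
have [_ _ _ le] := psi_main t t0 tL.
have tL2 : t <= L + 2 by apply: le_trans tL _; rewrite lerDl.
by have [le2 _ _ _] := psX t t0 tL2; apply: le_trans le2; rewrite lerD2r.
Qed.
End PsiDef.
End LucasTerm.

Arguments psi_ok {Z K KP} ic {k L}.

(** One step of [psN_main]: [r] is the remainder of the partial sum modulo [D], [u2] and [u3] are
    the values of the sequence at [4 m + 2] and [4 m + 3], and [y0], [y1], [y4], [y5], its values at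
    [4 m], [4 m + 1], [4 m + 4], [4 m + 5], serve as bounds. *)
Lemma psN_step (Z : oring) (X a D w r u2 u3 y0 y1 y4 y5 : Z) :
  D = X * X - a * X + 1 -> 0 < X -> 0 <= r -> r <= y1 * X -> md (- r) X <= y0 ->
  0 <= w <= 2 * a -> 0 <= u2 -> 0 <= u3 ->
  y0 + 2 * a * u2 <= y4 -> y1 + 2 * a * u3 <= y5 -> y4 < X -> y5 + a <= X ->
  [/\ r + w * (u3 * X - u2) < D, r + w * (u3 * X - u2) <= y5 * X,
      md (- (r + w * (u3 * X - u2))) X = md (- r) X + w * u2 & md (- r) X + w * u2 <= y4].
Proof.
move=> DE X0 r0 ry N0 /andP [w0 wa] u20 u30 h4 h5 yX yaX.
have wu2 : w * u2 <= 2 * a * u2 by exact: ler_wpM2r.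
have wu2' : 0 <= w * u2 by exact: mulr_ge0.
have wu3 : w * u3 * X <= 2 * a * u3 * X by apply: ler_wpM2r; [exact: ltW|exact: ler_wpM2r].
have y5X : (y1 + 2 * a * u3) * X <= y5 * X by apply: ler_wpM2r => //; exact: ltW.
have y5X' : (y5 + a) * X <= X * X by apply: ler_wpM2r => //; exact: ltW.
have m0 := md_ge0 _ (- r) X X0.
have E := fl_md _ (- r) X; move: (fl (- r) X) (md (- r) X) N0 m0 E => j N N0 m0 E.
split; [rewrite DE; lra|lra| |lra].
by apply: (md_uniq _ _ _ (j - w * u3)); [rewrite opprD E; ring|lra|lra].
Qed.

Section LucasSums.
Variables (Z : oring) (K : (Z -> Z) -> Prop) (KP : (Z -> Prop) -> Prop).
Implicit Types (a b c m n i j x y u v : Z).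
Hypothesis ic : ind_class Z K KP.
Let cK : closed (Zw := fun _ : Z => Z) K := ic_closed _ _ _ ic.
Local Notation D1 f := (K1 (Zw := fun _ : Z => Z) K (fun _ => f)).
Local Notation D2 f := (K2 (Zw := fun _ : Z => Z) K (fun _ => f)).
Local Notation D3 f := (K3 (Zw := fun _ : Z => Z) K (fun _ => f)).

(** With [X = pw c], the number [pw (3 * c) * Sw m (4 * c)] is [sum w(i) X^(4 i + 3)], which modulo
    [D] is [sum w(i) (psi_(4 i + 3) X - psi_(4 i + 2))]. The negative of this, modulo [X], is the
    sum sought. *)
Lemma psN_main k L w Sw n : 2 <= k -> 0 <= L -> D2 Sw -> 0 <= n -> 4 * n + 2 <= L ->
  let a := pw k in let c := k * (L + 3) in
  Sw 0 (4 * c) = 0 ->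
  (forall m, 0 <= m -> m < n -> Sw (m + 1) (4 * c) = Sw m (4 * c) + w m * pw (4 * c * m)) ->
  (forall m, 0 <= m -> m < n -> 0 <= w m <= 2 * a) ->
  psN Sw c a 0 = 0 /\
  forall m, 0 <= m -> m <= n ->
    0 <= psN Sw c a m <= psi c a (4 * m) /\
    (m < n -> psN Sw c a (m + 1) = psN Sw c a m + w m * psi c a (4 * m + 2)).
Proof.
move=> k2 L0 DSw n0 nL a c Sw0 SwS w_bd.
have [a4 X0 Hps HR bX] := psi_ok ic k2 L0; rewrite -/a -/c in a4 X0 Hps HR bX.
have c0 : 0 <= c by apply: mulr_ge0; lra.
have Dpsi : D1 (psi c a) by move=> F HF; rewrite /psi /psR /psD; kk.
have growth t : 0 <= t -> t <= 4 * n + 1 -> 0 <= psi c a t /\ psi c a t + a <= pw c.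
  move=> t0 tn; have [h1 h2 _] := ps_growth ic a4 Dpsi Hps t t0 ltac:(lra).
  by have := bX t t0 ltac:(lra); split=> //; lra.
have D_def : psD c a = pw c * pw c - a * pw c + 1 by [].
have D0 : 0 < psD c a.
  rewrite D_def; have : a * pw c <= pw c * pw c; last by lra.
  by apply: ler_wpM2r; [exact: ltW|have [h1 h2] := growth 0 (lexx 0) ltac:(lra); lra].
have step m : 0 <= m -> m < n ->
    md (pw (3 * c) * Sw m (4 * c)) (psD c a) <= psi c a (4 * m + 1) * pw c ->
    psN Sw c a m <= psi c a (4 * m) ->
    [/\ md (pw (3 * c) * Sw (m + 1) (4 * c)) (psD c a) <= psi c a (4 * (m + 1) + 1) * pw c,
        psN Sw c a (m + 1) = psN Sw c a m + w m * psi c a (4 * m + 2) &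
        psN Sw c a (m + 1) <= psi c a (4 * (m + 1))].
  move=> m0 lt h1 h2; have m1 := oz_disc _ _ _ lt.
  have [u20 _] := growth (4 * m + 2) ltac:(lra) ltac:(lra).
  have [u30 _] := growth (4 * m + 3) ltac:(lra) ltac:(lra).
  have [y40 y4X] := growth (4 * m + 4) ltac:(lra) ltac:(lra).
  have [y50 y5X] := growth (4 * m + 5) ltac:(lra) ltac:(lra).
  have g0 := ps_growth4 ic a4 Dpsi Hps (4 * m) ltac:(lra) ltac:(lra).
  have g1 := ps_growth4 ic a4 Dpsi Hps (4 * m + 1) ltac:(lra) ltac:(lra).
  rewrite (_ : 4 * m + 1 + 2 = 4 * m + 3) in g1; last by ring.
  rewrite (_ : 4 * m + 1 + 4 = 4 * m + 5) in g1; last by ring.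
  have R := HR (4 * m + 2) ltac:(lra) ltac:(lra).
  rewrite -addrA (_ : 2 + 1 = 3) in R; last by ring.
  have y4X' : psi c a (4 * m + 4) < pw c by lra.
  have r0 := md_ge0 _ (pw (3 * c) * Sw m (4 * c)) _ D0.
  have [] := psN_step _ _ _ _ _ _ _ _ _ _ _ _ D_def X0 r0 h1 h2 (w_bd m m0 lt) u20 u30 g0 g1 y4X' y5X.
  rewrite -R => k1 k2' k3 k4.
  have Em : md (pw (3 * c) * Sw (m + 1) (4 * c)) (psD c a) =
      md (pw (3 * c) * Sw m (4 * c)) (psD c a) + w m * psR c a (4 * m + 3).
    have Ec : pw (3 * c) * Sw (m + 1) (4 * c) =
        pw (3 * c) * Sw m (4 * c) + w m * pw (c * (4 * m + 3)).
      rewrite SwS // (_ : c * (4 * m + 3) = 3 * c + 4 * c * m); last by ring.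
      rewrite (pwD ic); [ring|lra|by apply: mulr_ge0; lra].
    have /andP [w0 _] := w_bd m m0 lt.
    apply: (md_uniq _ _ _ (fl (pw (3 * c) * Sw m (4 * c)) (psD c a) +
      w m * fl (pw (c * (4 * m + 3))) (psD c a))) => //; last first.
      by apply: addr_ge0 => //; apply: mulr_ge0 => //; exact: md_ge0.
    rewrite Ec {1}(fl_md _ (pw (3 * c) * Sw m (4 * c)) (psD c a)).
    by rewrite {1}(fl_md _ (pw (c * (4 * m + 3))) (psD c a)) /psR; ring.
  have -> : psN Sw c a (m + 1) = psN Sw c a m + w m * psi c a (4 * m + 2) by rewrite -k3 -Em.
  rewrite Em (_ : 4 * (m + 1) + 1 = 4 * m + 5); last by ring.
  by rewrite (_ : 4 * (m + 1) = 4 * m + 4); last by ring.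
suff main m : 0 <= m -> m <= n ->
    md (pw (3 * c) * Sw m (4 * c)) (psD c a) <= psi c a (4 * m + 1) * pw c /\ psN Sw c a m <= psi c a (4 * m).
  split; first by rewrite /psN Sw0 mulr0 (md_small _ 0 (psD c a)) // oppr0 md_small //.
  move=> m m0 le; have [h1 h2] := main m m0 le; split; first by rewrite h2 /psN md_ge0.
  by move=> lt; have [] := step m m0 lt h1 h2.
move: m; refine (ic_ind _ _ _ ic (fun m => m <= n ->
    md (pw (3 * c) * Sw m (4 * c)) (psD c a) <= psi c a (4 * m + 1) * pw c /\ psN Sw c a m <= psi c a (4 * m)) _ _ _).
- by rewrite /psN /psD /psi /psR /psD; kp.
- move=> _; rewrite /psN Sw0 mulr0 (md_small _ 0 (psD c a)) // oppr0 md_small // mulr0.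
  by rewrite (ps_0 _ _ _ Hps) add0r (ps_1 _ _ _ Hps) mul1r; split=> //; exact: ltW.
move=> m m0 IH le; have lt : m < n by lra.
have [h1 h2] := IH (ltW lt); have [k1 k2' k3] := step m m0 lt h1 h2; split=> //.
Qed.
End LucasSums.

Arguments psN_main {Z K KP} ic {k L w Sw n}.

(** * Positive parts, exponentials and quotients *)

(** The floor of [z / (z z + 1)] is 0 for [z >= 0] and -1 for [z < 0]. *)
Definition pos {Z : oring} (z : Z) : Z := z * (1 + fl z (z * z + 1)).

Lemma posE (Z : oring) (z : Z) : pos z = if 0 <= z then z else 0.
Proof.
have zz : 0 <= (z - 1) * (z - 1) by exact: sqr_ge0.
have zz' : 0 <= z * z by exact: sqr_ge0.
rewrite /pos; case: leP => z0; first by rewrite fl_small ?addr0 ?mulr1 //; lra.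
by rewrite (fl_uniq _ z _ (-1) (z + (z * z + 1))); [rewrite subrr mulr0|ring|nra|lra].
Qed.

Lemma pos_ge0 (Z : oring) (z : Z) : 0 <= pos z.
Proof. by rewrite posE; case: ifP. Qed.

(** The sum in base [pw b'] of the numbers of blocks [w(i) = (a - 1) + f(i) 2^(b i) - g(i) 2^(b
    i)]. *)
Definition monw {Z : oring} (Sf Sg : Z -> Z -> Z) (a b m b' : Z) : Z :=
  (a - 1) * sconst 1 m b' + Sf m (b' + b) - Sg m (b' + b).
(** Lane [i] belongs to the convergent [psi_(4 i + 1) / psi_(4 i + 2)] and takes the arguments from
    [psN] at [i] to [psN] at [i + 1]; one floor sum, for [psi_(L-1) / psi_L] with [L = 4 n + 6],
    serves all lanes. The choice of [k] makes [a] exceed twice the result and keeps [w] within the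
    limit of [lane_small]. *)
Definition monG {Z : oring} (Sf Sg : Z -> Z -> Z) (n b m : Z) : Z :=
  let k := 2 * (Sf n b + Sg n b) + 16 in
  let a := pw k in
  let c := k * (4 * n + 6 + 3) in
  let P := psi c a (4 * n + 6 - 1) in
  let Q := psi c a (4 * n + 6) in
  fl (md (2 * fsum Q P Q (psN (monw Sf Sg a b) c a m)) a) 2.
Definition smon {Z : oring} (Sf Sg : Z -> Z -> Z) : Z -> Z -> Z := wsum (fun _ => 0) (monG Sf Sg).

Section ClosedOps.
Variables (W : Type) (Zw : W -> oring) (K : (forall w, Zw w) -> Prop).
Hypothesis cK : closed K.

Lemma cl_monG Sf Sg : K2 K Sf -> K2 K Sg -> K3 K (fun w => monG (Sf w) (Sg w)).
Proof.
move=> HS HT; have HC := cl_sconst _ _ _ cK _ (cl_1 _ cK).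
move=> F G H HF HG HH; rewrite /monG; cbv zeta; rewrite /psN /psi /psR /psD /monw.
apply: (cl_fl _ cK); last exact: (cl_nat _ _ _ cK).
apply: (cl_md _ _ _ cK); last by repeat kk_op.
apply: (cl_mul _ cK); first exact: (cl_nat _ _ _ cK).
by apply: (cl_fsum _ _ _ cK); repeat kk_op.
Qed.

Lemma cl_smon Sf Sg : K2 K Sf -> K2 K Sg -> K2 K (fun w => smon (Sf w) (Sg w)).
Proof.
move=> HS HT; apply: (cl_wsum _ _ _ cK); first by move=> F HF; exact: (cl_0 _ _ _ cK).
exact: cl_monG.
Qed.

End ClosedOps.

(** For [p = 1] and [q = n = 0] modulo [a], each of the three regular terms is a multiple of [a],
    and only the jumps [2 h] are left. The next starting point [n + w q] is again a multiple of
    [a]. *)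
Lemma mon_congr (Z : oring) (a p q n w F F' h : Z) : 0 < a -> md p a = 1 -> md q a = 0 -> md n a = 0 ->
  2 * (F' - F) = w * ((p - 1) * (q - 1)) + 2 * (w * n * p) + p * q * (w * (w - 1)) + 2 * h ->
  0 <= h -> md (2 * F) a + 2 * h < a ->
  md (2 * F') a = md (2 * F) a + 2 * h /\ md (n + w * q) a = 0.
Proof.
move=> a0 Ep Eq En EF h0 lt.
have := fl_md _ p a; have := fl_md _ q a; have := fl_md _ n a; rewrite Ep Eq En !addr0.
move: (fl p a) (fl q a) (fl n a) => p' q' n' {}En {}Eq {}Ep.
split; last by apply: (md_uniq _ _ _ (n' + w * q')) => //; rewrite En Eq; ring.
have m0 := md_ge0 _ (2 * F) a a0.
apply: (md_uniq _ _ _ (fl (2 * F) a + w * p' * (q - 1) + 2 * (w * n' * p) + p * q' * (w * (w - 1)))) => //.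
  have -> : 2 * F' = 2 * F + 2 * (F' - F) by ring.
  rewrite EF {1}(fl_md _ (2 * F) a).
  have -> : (p - 1) * (q - 1) = p' * (q - 1) * a by rewrite Ep; ring.
  have -> : w * n * p = w * n' * p * a by rewrite En; ring.
  have -> : p * q * (w * (w - 1)) = p * q' * (w * (w - 1)) * a by rewrite Eq; ring.
  by ring.
by apply: addr_ge0 => //; apply: mulr_ge0.
Qed.

(** * Summing positive parts *)

Section PositivePart.
Variables (Z : oring) (K : (Z -> Z) -> Prop) (KP : (Z -> Prop) -> Prop).
Implicit Types (a b c m n i j x y u v : Z).
Hypothesis ic : ind_class Z K KP.
Let cK : closed (Zw := fun _ : Z => Z) K := ic_closed _ _ _ ic.
Local Notation D1 f := (K1 (Zw := fun _ : Z => Z) K (fun _ => f)).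
Local Notation D2 f := (K2 (Zw := fun _ : Z => Z) K (fun _ => f)).
Local Notation D3 f := (K3 (Zw := fun _ : Z => Z) K (fun _ => f)).

Section Monus.
Variables (f g : Z -> Z) (Sf Sg : Z -> Z -> Z).
Hypotheses (Df : D1 f) (Dg : D1 g) (DSf : D2 Sf) (DSg : D2 Sg).
Hypotheses (Hf : sums f Sf) (Hg : sums g Sg).

Lemma monw_step a b b' m : 0 <= b' -> 0 <= b -> 0 <= m ->
  monw Sf Sg a b (m + 1) b' =
  monw Sf Sg a b m b' + ((a - 1) + f m * pw (b * m) - g m * pw (b * m)) * pw (b' * m).
Proof.
move=> b'0 b0 m0; have H1 := sums_const ic (c := 1) ler01.
rewrite /monw (s_S _ _ H1) // (s_S _ _ Hf) ?(s_S _ _ Hg) ?addr_ge0 //.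
rewrite [(b' + b) * m]mulrDl (pwD ic); [ring|exact: mulr_ge0..].
Qed.

Lemma monw_bounds n m b : 0 <= m -> m < n -> 0 <= b ->
  let a := pw (2 * (Sf n b + Sg n b) + 16) in
  let w := (a - 1) + f m * pw (b * m) - g m * pw (b * m) in
  [/\ 0 <= w, w + 1 <= 2 * (a - 2), 2 * Sf n b < a & 16 <= a].
Proof.
move=> m0 lt b0 a w; have n0 : 0 <= n by lra.
have F0 := s_nonneg ic DSf Hf n b n0 b0; have G0 := s_nonneg ic DSg Hg n b n0 b0.
have h1 := s_term ic DSf Hf m n b m0 lt b0; have h2 := s_term ic DSg Hg m n b m0 lt b0.
have y0 : 0 <= pw (b * m) by apply: ltW; apply: (pw_gt0 ic); apply: mulr_ge0.
have h3 : 0 <= f m * pw (b * m) by apply: mulr_ge0 => //; apply: (s_ge0 _ _ Hf).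
have h4 : 0 <= g m * pw (b * m) by apply: mulr_ge0 => //; apply: (s_ge0 _ _ Hg).
have a_big : 2 * (Sf n b + Sg n b) + 16 + 1 <= a by apply: (pw_gt ic); lra.
by rewrite /w; split; lra.
Qed.

Lemma sums_mon : sums (fun n => pos (f n - g n)) (smon Sf Sg).
Proof.
have H1 := sums_const ic (c := 1) ler01.
have fg0 n : 0 <= n -> 0 <= pos (f n - g n) by move=> _; exact: pos_ge0.
have DG : D3 (monG Sf Sg) by exact: (cl_monG _ _ _ cK _ _ DSf DSg).
suff main n b : 0 <= n -> 0 <= b -> monG Sf Sg n b 0 = 0 /\
    forall m, 0 <= m -> m < n ->
      monG Sf Sg n b (m + 1) = monG Sf Sg n b m + pos (f m - g m) * pw (b * m).
  apply: (sums_wsum ic DG fg0) => // n b; first by move=> n0 b0; have [] := main n b n0 b0.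
  by move=> m n0 b0; have [_] := main n b n0 b0; apply.
move=> n0 b0; rewrite /monG; cbv zeta; set k := 2 * _ + 16; set a := pw k; set c := k * _.
set L := 4 * n + 6; rewrite -/L in c *.
have F0 := s_nonneg ic DSf Hf n b n0 b0; have G0 := s_nonneg ic DSg Hg n b n0 b0.
have k2 : 2 <= k by rewrite /k; lra.
have k0 : 0 < k by lra.
have L0 : 0 <= L by rewrite /L; lra.
have c0 : 0 <= c by apply: mulr_ge0; lra.
pose w i := (a - 1) + f i * pw (b * i) - g i * pw (b * i).
have Dmon : D2 (monw Sf Sg a b).
  have HC := cl_sconst _ _ _ cK _ (cl_1 _ cK).
  by move=> F G HF HG; rewrite /monw; kk.
have w_bd m : 0 <= m -> m < n -> [/\ 0 <= w m, w m + 1 <= 2 * (a - 2), 2 * Sf n b < a & 16 <= a].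
  by move=> m0 lt; apply: monw_bounds.
have a_big : k + 1 <= a by apply: (pw_gt ic); lra.
have Sfa : 2 * Sf n b < a by rewrite /k in a_big; lra.
have a16 : 16 <= a by rewrite /k in a_big; lra.
have [a4 X0 Hps _ _] := psi_ok ic k2 L0; rewrite -/a -/c in a4 X0 Hps.
have Dpsi : D1 (psi c a) by move=> F HF; rewrite /psi /psR /psD; kk.
have mon0 : monw Sf Sg a b 0 (4 * c) = 0.
  have cb0 : 0 <= 4 * c + b by rewrite addr_ge0 // mulr_ge0.
  by rewrite /monw (s_0 _ _ H1) ?(s_0 _ _ Hf) ?(s_0 _ _ Hg) ?mulr0 ?addr0 ?subr0 // mulr_ge0.
have w_bd' m : 0 <= m -> m < n -> 0 <= w m <= 2 * a.
  by move=> m0 lt; have [h1 h2 _ _] := w_bd m m0 lt; apply/andP; split; lra.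
have c40 : 0 <= 4 * c by apply: mulr_ge0.
have nL : 4 * n + 2 <= L by rewrite /L; lra.
have [N0 NS] := psN_main ic (w := w) k2 L0 Dmon n0 nL mon0
  (fun m h _ => monw_step a b (4 * c) m c40 b0 h) w_bd'.
rewrite -/a -/c in N0 NS.
have DN : D1 (psN (monw Sf Sg a b) c a) by move=> F HF; rewrite /psN /psD; kk.
have w_def m : w m - (a - 1) = (f m - g m) * pw (b * m) by rewrite /w; ring.
move: (psN (monw Sf Sg a b) c a) DN N0 NS => N DN N0 NS.
move: (psi c a) Dpsi Hps NS => ps Dps Hps NS.
have nL' : 4 * n + 6 = L by [].
clearbody k a c w L; clear a_big.
have ps_le t u : 0 <= t -> t <= u -> u <= L -> ps t <= ps u.
  move=> t0 tu uL; apply: (down_mono ic Dps) => // i i0 iu.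
  by have [_ h _] := ps_growth ic a4 Dps Hps i i0 (le_trans (oz_disc _ _ _ iu) uL); lra.
have P0 : 0 < ps (L - 1).
  by have := ps_le 1 (L - 1); rewrite (ps_1 _ _ _ Hps) => h; have := h ltac:(lra) ltac:(lra) ltac:(lra); lra.
have Q0 : 0 < ps L by have := ps_le (L - 1) L ltac:(lra) ltac:(lra) ltac:(lra); lra.
have [FS0 FSS] := fsumP ic P0 Q0 (ltW Q0).
have DFS : D1 (fsum (ps L) (ps (L - 1)) (ps L)) by move=> F HF; apply: (cl_fsum _ _ _ cK); kk.
move: (fsum _ _ _) DFS FS0 FSS => FS DFS FS0 FSS.
(* The bound [2 * Sf m b] for the remainder ensures that the jumps of the next lane do not wrap
   around modulo [a]. *)
have step m : 0 <= m -> m < n -> md (N m) a = 0 -> md (2 * FS (N m)) a <= 2 * Sf m b ->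
    md (2 * FS (N (m + 1))) a = md (2 * FS (N m)) a + 2 * (pos (f m - g m) * pw (b * m)) /\
    md (N (m + 1)) a = 0.
  move=> m0 lt Na le; have [/andP [Nm0 Nm4] /(_ lt) NmS] := NS m m0 (ltW lt).
  have m1 := oz_disc _ _ _ lt.
  have [/andP [_ Nm5] _] := NS (m + 1) ltac:(lra) m1.
  have [w0 wa _ _] := w_bd m m0 lt.
  have t1 : 1 <= 4 * m + 1 by lra.
  have tL : 4 * m + 1 + 2 <= L by lra.
  have La := ps_lane ic a4 Dps Hps _ t1 tL.
  have [] := lane_small ic a4 Dps Hps _ (N m) (w m) t1 tL Nm0; rewrite ?addrK // => np small.
  have [p1 p2] := ps_mod ic a4 Dps Hps m m0 ltac:(lra).
  rewrite (_ : 4 * m + 1 + 1 = 4 * m + 2) in La np small *; last by ring.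
  have qQ : ps (4 * m + 2) <= ps L by apply: ps_le; lra.
  have NQ : N m + w m * ps (4 * m + 2) <= ps L.
    by rewrite -NmS; apply: (le_trans Nm5); apply: ps_le; lra.
  have p0 := l_p _ _ _ _ _ _ _ _ La; have pq := l_pq _ _ _ _ _ _ _ _ La.
  have [fs0 fsS] := fsumP ic p0 (lt_trans p0 pq) (ltW Q0).
  have Dfs : D1 (fsum (ps L) (ps (4 * m + 1)) (ps (4 * m + 2))).
    by move=> F HF; apply: (cl_fsum _ _ _ cK); kk.
  have a1 : 1 <= a by lra.
  have := blocks ic La Dfs DFS qQ fs0 fsS FSS (N m) (w m) a1 Nm0 np NQ small w0 (w m) w0 (lexx _).
  (* The weight [pw (b * m)] is positive and can be taken out of the positive part. *)
  have hE : (if a - 1 <= w m then w m - (a - 1) else 0) = pos (f m - g m) * pw (b * m).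
    rewrite posE -subr_ge0 w_def pmulr_lge0; last by apply: (pw_gt0 ic); apply: mulr_ge0.
    by case: ifP; rewrite ?mul0r.
  rewrite hE => blk.
  have y0 : 0 <= pw (b * m) by apply: ltW; apply: (pw_gt0 ic); apply: mulr_ge0.
  have f0 := s_ge0 _ _ Hf m m0; have g0 := s_ge0 _ _ Hg m m0.
  have h0 : 0 <= pos (f m - g m) * pw (b * m) by apply: mulr_ge0 => //; exact: pos_ge0.
  have hf : pos (f m - g m) * pw (b * m) <= f m * pw (b * m).
    by apply: ler_wpM2r => //; rewrite posE; case: ifP => _ //; lra.
  have Sm := s_mono ic DSf Hf (m + 1) n b ltac:(lra) m1 b0; rewrite (s_S _ _ Hf) // in Sm.
  have a0 : 0 < a by lra.
  have lta : md (2 * FS (N m)) a + 2 * (pos (f m - g m) * pw (b * m)) < a by lra.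
  have := mon_congr _ _ _ _ _ _ _ _ _ a0 p1 p2 Na blk h0 lta.
  by rewrite NmS.
have a0 : 0 < a by lra.
suff main m : 0 <= m -> m <= n -> md (N m) a = 0 /\ md (2 * FS (N m)) a <= 2 * Sf m b.
  split=> [|m' m0' lt']; first by rewrite N0 FS0 mulr0 md_small // fl_small.
  have [Na le] := main m' m0' (ltW lt'); have [-> _] := step m' m0' lt' Na le.
  by rewrite [2 * (_ * _)]mulrC fl_addM.
move: m; zind (fun m => m <= n -> md (N m) a = 0 /\ md (2 * FS (N m)) a <= 2 * Sf m b).
  by rewrite N0 FS0 mulr0 (s_0 _ _ Hf) // md_small // mulr0.
move=> m m0 IH le; have lt : m < n by lra.
have [Na le'] := IH (ltW lt); have [-> ->] := step m m0 lt Na le'; split=> //.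
rewrite (s_S _ _ Hf) // mulrDr; apply: lerD => //; rewrite ler_pM2l //.
have y0 : 0 <= pw (b * m) by apply: ltW; apply: (pw_gt0 ic); apply: mulr_ge0.
have f0 := s_ge0 _ _ Hf m m0; have g0 := s_ge0 _ _ Hg m m0.
by apply: ler_wpM2r => //; rewrite posE; case: ifP => _ //; lra.
Qed.
End Monus.
End PositivePart.

Arguments sums_mon {Z K KP} ic {f g Sf Sg}.

Definition le01 {Z : oring} (x y : Z) : Z := pos (1 - pos (x - y)).
Definition eq01 {Z : oring} (x y : Z) : Z := pos (1 - (pos (x - y) + pos (y - x))).

Lemma le01E (Z : oring) (x y : Z) : le01 x y = if x <= y then 1 else 0.
Proof.
rewrite /le01 !posE !subr_ge0; case: (ltgtP x y) => [lt|lt|->]; last first.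
- by rewrite subrr ler01 subr0.
- by case: ifP => // h; have := oz_disc _ _ _ lt; lra.
by rewrite ler01 subr0.
Qed.

Lemma eq01E (Z : oring) (x y : Z) : eq01 x y = if x == y then 1 else 0.
Proof.
rewrite /eq01 !posE !subr_ge0; case: (ltgtP x y) => [lt|lt|->]; last first.
- by rewrite subrr addr0 ler01 subr0.
- by case: ifP => // h; have := oz_disc _ _ _ lt; lra.
by case: ifP => // h; have := oz_disc _ _ _ lt; lra.
Qed.

Definition sle {Z : oring} (Sf Sg : Z -> Z -> Z) := smon (sconst 1) (smon Sf Sg).
Definition seqq {Z : oring} (Sf Sg : Z -> Z -> Z) :=
  smon (sconst 1) (sadd (smon Sf Sg) (smon Sg Sf)).
(** The remainder is written as the positive part of [n - N * fl n N], since sums of nonnegative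
    functions admit no other subtraction. *)
Definition smd {Z : oring} (N : Z) : Z -> Z -> Z := smon sid (shad (sconst N) (sre id sid N)).

(** [2 ^ f(i)] is the sum of the [2 ^ z] with [z = f(i)]. *)
Definition expG {Z : oring} f Sf (n b m : Z) : Z := seqq (sre f Sf b) (smd b) (m * b) 1.
Definition sexp {Z : oring} f Sf : Z -> Z -> Z := wsum (fun n => Sf n 0 + 1) (expG f Sf).

(** The floor of [f / (g + 1)] is the number of [z] with [(z + 1) (g + 1) <= f]. *)
Definition divG {Z : oring} f g Sf Sg (n b m : Z) : Z :=
  let N := Sf n 0 + 1 in
  shad (sle (shad (sadd (smd N) (sconst 1)) (sadd (sre g Sg N) (sconst 1))) (sre f Sf N))
    (sre (fun i => 1 * pw (b * i)) (fun n b' => sconst 1 n (b + b')) N) (m * N) 0.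
Definition sdiv {Z : oring} f g Sf Sg : Z -> Z -> Z := wsum (fun _ => 0) (divG f g Sf Sg).

Section ClosedOps.
Variables (W : Type) (Zw : W -> oring) (K : (forall w, Zw w) -> Prop).
Hypothesis cK : closed K.

Let c1 : K2 K (fun w => sconst 1).
Proof. exact: cl_sconst _ _ _ cK _ (cl_1 _ cK). Qed.

Lemma cl_sle Sf Sg : K2 K Sf -> K2 K Sg -> K2 K (fun w => sle (Sf w) (Sg w)).
Proof. by move=> H1 H2; apply: (cl_smon _ _ _ cK) => //; exact: (cl_smon _ _ _ cK). Qed.

Lemma cl_seqq Sf Sg : K2 K Sf -> K2 K Sg -> K2 K (fun w => seqq (Sf w) (Sg w)).
Proof.
move=> H1 H2; apply: (cl_smon _ _ _ cK) => //; apply: (cl_sadd _ _ _ cK); exact: (cl_smon _ _ _ cK).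
Qed.

Lemma cl_smd N : K N -> K2 K (fun w => smd (N w)).
Proof.
move=> HN; apply: (cl_smon _ _ _ cK); first exact: (cl_sid _ _ _ cK).
apply: (cl_shad _ _ _ cK); first exact: (cl_sconst _ _ _ cK).
by apply: (cl_sre _ _ _ cK) => //; exact: (cl_sid _ _ _ cK).
Qed.

Lemma cl_expG f Sf : K1 K f -> K2 K Sf -> K3 K (fun w => expG (f w) (Sf w)).
Proof.
move=> Hf HS F G H HF HG HH; rewrite /expG.
apply: (cl_seqq (fun w => sre (f w) (Sf w) (G w)) (fun w => smd (G w))).
- exact: (cl_sre _ _ _ cK).
- exact: cl_smd.
- exact: (cl_mul _ cK).
- exact: (cl_1 _ cK).
Qed.

Lemma cl_sexp f Sf : K1 K f -> K2 K Sf -> K2 K (fun w => sexp (f w) (Sf w)).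
Proof.
move=> Hf HS; apply: (cl_wsum _ _ _ cK); last exact: cl_expG.
by move=> F HF; have H0 := cl_0 _ _ _ cK; repeat kk_op.
Qed.

Lemma cl_divG f g Sf Sg : K1 K f -> K1 K g -> K2 K Sf -> K2 K Sg ->
  K3 K (fun w => divG (f w) (g w) (Sf w) (Sg w)).
Proof.
move=> Hf Hg HS HT F G H HF HG HH; rewrite /divG; cbv zeta.
have H0 := cl_0 _ _ _ cK.
pose N w := Sf w (F w) 0 + 1; have HN : K N by rewrite /N; repeat kk_op.
pose SA w := sle (shad (sadd (smd (N w)) (sconst 1)) (sadd (sre (g w) (Sg w) (N w)) (sconst 1)))
  (sre (f w) (Sf w) (N w)).
pose SB w := sre (fun i => 1 * pw (G w * i)) (fun n b' => sconst 1 n (G w + b')) (N w).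
have HSA : K2 K SA.
  apply: cl_sle; last exact: (cl_sre _ _ _ cK).
  apply: (cl_shad _ _ _ cK); apply: (cl_sadd _ _ _ cK); try exact: c1; first exact: cl_smd.
  exact: (cl_sre _ _ _ cK).
have HSB : K2 K SB.
  apply: (cl_sre _ _ _ cK) HN; first by move=> F' HF'; repeat kk_op.
  by move=> A B HA HB; apply: (c1 A (fun w => G w + B w) HA); exact: (cl_add _ cK).
exact: (cl_shad _ _ _ cK SA SB HSA HSB _ _ (cl_mul _ cK HH HN) H0).
Qed.

Lemma cl_sdiv f g Sf Sg : K1 K f -> K1 K g -> K2 K Sf -> K2 K Sg ->
  K2 K (fun w => sdiv (f w) (g w) (Sf w) (Sg w)).
Proof.
move=> Hf Hg HS HT; apply: (cl_wsum _ _ _ cK); last exact: cl_divG.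
by move=> F HF; exact: (cl_0 _ _ _ cK).
Qed.

End ClosedOps.

Section Comparison.
Variables (Z : oring) (K : (Z -> Z) -> Prop) (KP : (Z -> Prop) -> Prop).
Implicit Types (a b c m n i j x y u v : Z).
Hypothesis ic : ind_class Z K KP.
Let cK : closed (Zw := fun _ : Z => Z) K := ic_closed _ _ _ ic.
Local Notation D1 f := (K1 (Zw := fun _ : Z => Z) K (fun _ => f)).
Local Notation D2 f := (K2 (Zw := fun _ : Z => Z) K (fun _ => f)).
Local Notation D3 f := (K3 (Zw := fun _ : Z => Z) K (fun _ => f)).

Let S1 : sums (fun _ : Z => 1) (sconst 1) := sums_const ic ler01.
Let D1S : D2 (sconst 1) := cl_sconst _ _ _ cK _ (cl_1 _ cK).

Lemma sums_ext f g Sf : (forall n, 0 <= n -> f n = g n) -> sums f Sf -> sums g Sf.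
Proof.
move=> E [f0 Sf0 SfS]; split=> // [n n0|n b n0 b0]; first by rewrite -E //; exact: f0.
by rewrite SfS // E.
Qed.

Lemma sums_le f g Sf Sg : D2 Sf -> D2 Sg -> sums f Sf -> sums g Sg ->
  sums (fun n => le01 (f n) (g n)) (sle Sf Sg).
Proof.
move=> HS HT Hf Hg; apply: (sums_mon ic D1S _ S1).
- exact: (cl_smon _ _ _ cK (fun _ => Sf) (fun _ => Sg)).
- exact: (sums_mon ic).
Qed.

Lemma sums_eq f g Sf Sg : D2 Sf -> D2 Sg -> sums f Sf -> sums g Sg ->
  sums (fun n => eq01 (f n) (g n)) (seqq Sf Sg).
Proof.
move=> HS HT Hf Hg; apply: (sums_mon ic D1S _ S1).
- apply: (cl_sadd _ _ _ cK (fun _ => smon Sf Sg) (fun _ => smon Sg Sf)).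
  + exact: (cl_smon _ _ _ cK (fun _ => Sf) (fun _ => Sg)).
  + exact: (cl_smon _ _ _ cK (fun _ => Sg) (fun _ => Sf)).
- by apply: sums_add; apply: (sums_mon ic).
Qed.

Lemma sums_md N : 0 < N -> sums (fun n : Z => md n N) (smd N).
Proof.
move=> N0; have D1id : D1 id by [].
have H1 := cl_sid _ _ _ cK; have H2 := cl_sconst _ _ _ cK _ (ic_const _ _ _ ic N).
have H3 := cl_sre _ _ _ cK _ _ _ D1id H1 (ic_const _ _ _ ic N).
have HR := sums_re ic D1id H1 (sums_id ic) N0.
have HH := sums_had ic H2 H3 (sums_const ic (ltW N0)) HR.
have HM := sums_mon ic H1 (cl_shad _ _ _ cK _ _ H2 H3) (sums_id ic) HH.
apply: sums_ext HM => n n0; rewrite posE /= /md mulrC.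
by have := md_ge0 _ n N N0; rewrite /md => ->.
Qed.
End Comparison.

Arguments sums_le {Z K KP} ic {f g Sf Sg}. Arguments sums_eq {Z K KP} ic {f g Sf Sg}.
Arguments sums_md {Z K KP} ic {N}. Arguments sums_ext {Z f g Sf}.

Section ExpDiv.
Variables (Z : oring) (K : (Z -> Z) -> Prop) (KP : (Z -> Prop) -> Prop).
Implicit Types (a b c m n i j x y u v : Z).
Hypothesis ic : ind_class Z K KP.
Let cK : closed (Zw := fun _ : Z => Z) K := ic_closed _ _ _ ic.
Local Notation D1 f := (K1 (Zw := fun _ : Z => Z) K (fun _ => f)).
Local Notation D2 f := (K2 (Zw := fun _ : Z => Z) K (fun _ => f)).
Local Notation D3 f := (K3 (Zw := fun _ : Z => Z) K (fun _ => f)).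

Let D1S : D2 (sconst 1) := cl_sconst _ _ _ cK _ (cl_1 _ cK).

Lemma fl_md_block m N z : 0 <= z -> z < N -> fl (m * N + z) N = m /\ md (m * N + z) N = z.
Proof. by move=> z0 zN; split; [apply: (fl_uniq _ _ _ _ z)|apply: (md_uniq _ _ _ m)]. Qed.

Section Exp.
Variables (f : Z -> Z) (Sf : Z -> Z -> Z).
Hypotheses (Df : D1 f) (DSf : D2 Sf) (Hf : sums f Sf).

Lemma sums_expE b : 0 < b ->
  sums (fun j => eq01 (f (fl j b)) (md j b)) (seqq (sre f Sf b) (smd b)) /\
  D2 (seqq (sre f Sf b) (smd b)).
Proof.
move=> b0; have Kb := ic_const _ _ _ ic b.
have H1 := cl_sre _ _ _ cK _ _ _ Df DSf Kb; have H2 := cl_smd _ _ _ cK _ Kb.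
split; last exact: (cl_seqq _ _ _ cK _ _ H1 H2).
exact: (sums_eq ic H1 H2 (sums_re ic Df DSf Hf b0) (sums_md ic b0)).
Qed.

(** The sum is taken in base 2 over blocks of length [b]. In block [m] the only nonzero term stands
    at [m b + f m], with weight [2^(m b + f m)]. The lower bound on [b] guarantees [f m < b]. *)
Lemma sums_exp : sums (fun n => pw (f n)) (sexp f Sf).
Proof.
have DG : D3 (expG f Sf) := cl_expG _ _ _ cK _ _ Df DSf.
have B0 n : 0 <= n -> 0 <= Sf n 0 + 1.
  by move=> n0; have := s_nonneg ic DSf Hf n 0 n0 (lexx 0); lra.
apply: (sums_wsum ic DG) => // [n n0|n b n0 bB|n b m n0 bB m0 lt].
- by apply: ltW; apply: (pw_gt0 ic); exact: (s_ge0 _ _ Hf).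
- have b0 : 0 < b by have := B0 n n0; have := s_nonneg ic DSf Hf n 0 n0 (lexx 0); lra.
  by have [HE _] := sums_expE b b0; rewrite /expG mul0r (s_0 _ _ HE) // ler01.
have fb : f m < b by have := s_term0 ic DSf Hf m n m0 lt; lra.
have f0 := s_ge0 _ _ Hf m m0; have b0 : 0 < b by lra.
have [HE DE] := sums_expE b b0; rewrite /expG; move: (seqq _ _) HE DE => SE HE DE.
have mb0 : 0 <= m * b by apply: mulr_ge0 => //; exact: ltW.
suff main z : 0 <= z -> z <= b ->
    (z <= f m -> SE (m * b + z) 1 = SE (m * b) 1) /\
    (f m < z -> SE (m * b + z) 1 = SE (m * b) 1 + pw (f m) * pw (b * m)).
  have [_] := main b (ltW b0) (lexx b); rewrite (_ : (m + 1) * b = m * b + b); last by ring.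
  exact.
move: z; zind (fun z => z <= b ->
    (z <= f m -> SE (m * b + z) 1 = SE (m * b) 1) /\
    (f m < z -> SE (m * b + z) 1 = SE (m * b) 1 + pw (f m) * pw (b * m))).
  by rewrite addr0; split=> // ?; lra.
move=> z z0 IH le; have zb : z < b by lra.
have [IH1 IH2] := IH (ltW zb); rewrite addrA (s_S _ _ HE) ?addr_ge0 ?ler01 //.
have [-> ->] := fl_md_block m b z z0 zb; rewrite eq01E.
case: (ltgtP (f m) z) IH1 IH2 => [lt'|lt'|E] IH1 IH2.
- by rewrite IH2 // mul0r addr0; split=> // ?; lra.
- by rewrite IH1 ?(ltW lt') // mul0r addr0; split=> // ?; have := oz_disc _ _ _ lt'; lra.
rewrite E in IH1 IH2 *; rewrite IH1 //.
split=> [|_]; first by lra.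
by rewrite !mul1r [m * b]mulrC addrC (pwD ic) // [b * m]mulrC.
Qed.

End Exp.

Section Div.
Variables (f g : Z -> Z) (Sf Sg : Z -> Z -> Z).
Hypotheses (Df : D1 f) (Dg : D1 g) (DSf : D2 Sf) (DSg : D2 Sg).
Hypotheses (Hf : sums f Sf) (Hg : sums g Sg).

Lemma sums_divE N b : 0 < N -> 0 <= b ->
  let S := shad (sle (shad (sadd (smd N) (sconst 1)) (sadd (sre g Sg N) (sconst 1))) (sre f Sf N))
    (sre (fun i => 1 * pw (b * i)) (fun n b' => sconst 1 n (b + b')) N) in
  sums (fun j => le01 ((md j N + 1) * (g (fl j N) + 1)) (f (fl j N)) * (1 * pw (b * fl j N))) S /\ D2 S.
Proof.
move=> N0 b0 S; have KN := ic_const _ _ _ ic N; have S1 := sums_const ic ler01.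
have H1 := cl_smd _ _ _ cK _ KN.
have H2 := cl_sre _ _ _ cK _ _ _ Dg DSg KN; have H3 := cl_sre _ _ _ cK _ _ _ Df DSf KN.
have H4 := cl_sadd _ _ _ cK _ _ H1 D1S; have H5 := cl_sadd _ _ _ cK _ _ H2 D1S.
have H6 := cl_shad _ _ _ cK _ _ H4 H5; have H7 := cl_sle _ _ _ cK _ _ H6 H3.
have D8 : D1 (fun i => 1 * pw (b * i)) by move=> F HF; kk.
have DS8 : D2 (fun n b' => sconst 1 n (b + b')).
  by move=> F G HF HG; apply: (D1S F (fun w => b + G w)) => //; kk.
have H8 := cl_sre _ _ _ cK _ _ _ D8 DS8 KN.
split; last exact: (cl_shad _ _ _ cK _ _ H7 H8).
apply: (sums_had ic H7 H8); last exact: (sums_re ic D8 DS8 (sums_twist ic b0 S1) N0).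
apply: (sums_le ic H6 H3) (sums_re ic Df DSf Hf N0).
apply: (sums_had ic H4 H5); apply: sums_add => //; first exact: (sums_md ic).
exact: (sums_re ic).
Qed.

(** Block [m] tests [N] candidates [z], each with the weight [pw (b * m)], and the sum over all
    blocks is plain. [N] exceeds [f m], hence no candidate is missed. *)
Lemma sums_div : sums (fun n => fl (f n) (g n + 1)) (sdiv f g Sf Sg).
Proof.
have DG : D3 (divG f g Sf Sg) := cl_divG _ _ _ cK _ _ _ _ Df Dg DSf DSg.
have N_gt0 n : 0 <= n -> 0 < Sf n 0 + 1.
  by move=> n0; have := s_nonneg ic DSf Hf n 0 n0 (lexx 0); lra.
apply: (sums_wsum ic DG) => // [n n0|n b n0 b0|n b m n0 b0 m0 lt].
- apply: fl_ge0; first exact: (s_ge0 _ _ Hf).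
  by have := s_ge0 _ _ Hg n n0; lra.
- by have [HE _] := sums_divE _ b (N_gt0 n n0) b0; rewrite /divG mul0r (s_0 _ _ HE).
have fN : f m < Sf n 0 + 1 by have := s_term0 ic DSf Hf m n m0 lt; lra.
have N0 := N_gt0 n n0; have [] := sums_divE _ b N0 b0; rewrite /divG; cbv zeta.
move: (Sf n 0 + 1) fN N0 => N fN N0; move: (shad _ _) => S HE DE.
have mN0 : 0 <= m * N by apply: mulr_ge0 => //; exact: ltW.
have f0 := s_ge0 _ _ Hf m m0; have g0 := s_ge0 _ _ Hg m m0.
have g1 : 0 < g m + 1 by lra.
set h := fl (f m) (g m + 1).
have h0 : 0 <= h by exact: fl_ge0.
have hE := fl_md _ (f m) (g m + 1); rewrite -/h in hE.
have r0 := md_ge0 _ (f m) _ g1; have r1 := md_lt _ (f m) _ g1.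
have hN : h <= N.
  have : h * 1 <= h * (g m + 1) by apply: ler_wpM2l; lra.
  lra.
suff main z : 0 <= z -> z <= N ->
    (z <= h -> S (m * N + z) 0 = S (m * N) 0 + z * pw (b * m)) /\
    (h <= z -> S (m * N + z) 0 = S (m * N) 0 + h * pw (b * m)).
  have [_] := main N (ltW N0) (lexx N); rewrite (_ : (m + 1) * N = m * N + N); last by ring.
  exact.
move: z; zind (fun z => z <= N ->
    (z <= h -> S (m * N + z) 0 = S (m * N) 0 + z * pw (b * m)) /\
    (h <= z -> S (m * N + z) 0 = S (m * N) 0 + h * pw (b * m))).
  rewrite addr0 mul0r addr0; split=> // hz; have -> : h = 0 by lra.
  by rewrite mul0r addr0.
move=> z z0 IH le; have zN : z < N by lra.
have [IH1 IH2] := IH (ltW zN); rewrite addrA (s_S _ _ HE) ?addr_ge0 //.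
have [-> ->] := fl_md_block m N z z0 zN; rewrite le01E mul0r pw0 mulr1 mul1r.
have -> : ((z + 1) * (g m + 1) <= f m) = (z + 1 <= h).
  case: (leP (z + 1) h) => [le1|lt1].
    have : (z + 1) * (g m + 1) <= h * (g m + 1) by apply: ler_wpM2r; lra.
    by move=> h1; apply/idP; lra.
  have : (h + 1) * (g m + 1) <= (z + 1) * (g m + 1).
    by apply: ler_wpM2r; [lra|exact: oz_disc].
  by move=> h1; apply/negP => h2; lra.
case: (leP (z + 1) h) IH1 IH2 => [le1|lt1] IH1 IH2.
  rewrite IH1; last by lra.
  split=> h1; first by ring.
  have -> : h = z + 1 by lra.
  ring.
have hz : h <= z by apply: disc_le.
by rewrite IH2 // mul0r addr0; split=> // h1; lra.
Qed.

End Div.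
End ExpDiv.

Arguments sums_exp {Z K KP} ic {f Sf}. Arguments sums_div {Z K KP} ic {f g Sf Sg}.

Local Close Scope ring_scope.

(** * Models of open induction and their integers *)

Definition IO (M : model) : Prop := forall A, qfree A -> forall e : nat -> M,
  sat (m0 .: e) A -> (forall x, sat (x .: e) A -> sat (madd x m1 .: e) A) ->
  forall x, sat (x .: e) A.

Record iomodel := IOModel { im :> model; im_R : models im R_exp; im_IO : IO im }.

Section ZO.
Variables (M : model) (HM : models M R_exp).
Local Open Scope ring_scope.
Local Notation Z := (zring M HM).
Local Notation phi := (phi M HM).
Local Notation toM := (toM M HM).

Definition zpw (u : Z) : Z := phi (mexp (toM u)).
(** For negative [u] the floor is minus the ceiling of [- u] by [v], that is, of the quotient of
    [- u + y] by [y + 1] with [y = v - 1]. For [u >= 0] the second quotient is 0, for [u < 0] the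
    first one. *)
Definition zfl (u v : Z) : Z :=
  let y := msub (toM v) m1 in
  phi (mdiv (toM u) y) - phi (mdiv (madd (toM (- u)) y) y).

Fact zdisc (u v : Z) : u < v -> u + 1 <= v.
Proof.
move=> lt; rewrite -subr_ge0 -[v - _](_ : v - u - 1 = _); last by ring.
have /phi_toM E : 0 <= v - u by rewrite subr_ge0 ltW.
rewrite -subr_gt0 -E in lt; rewrite -E subr_ge0 -(phi1 M HM); apply/phi_le.
move: lt; rewrite -(phi0 M HM) => /phi_lt /(mle_succ _ HM).
by rewrite maddC // madd0.
Qed.

Fact zpw0 : zpw 0 = 1.
Proof. by rewrite /zpw -[0](phi0 M HM) toMK mexp0. Qed.

Fact zpwS (u : Z) : 0 <= u -> zpw (u + 1) = 2 * zpw u.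
Proof.
move=> /phi_toM <-; rewrite /zpw -(phi1 M HM) -phiD !toMK mexpS // phiM phiD phi1.
by congr (_ * _); ring.
Qed.

Lemma mdivP x y : exists2 r, phi x = phi (madd y m1) * phi (mdiv x y) + phi r & phi r < phi (madd y m1).
Proof.
exists (msub x (mmul (madd y m1) (mdiv x y))); last by apply/phi_lt; exact: mdiv_lt.
by rewrite -phiM -phiD maddC // msubK //; exact: mdiv_le.
Qed.

Fact zfl_spec (u v : Z) : 0 < v -> 0 <= u - zfl u v * v /\ u - zfl u v * v < v.
Proof.
move=> v0; rewrite /zfl; set y := msub (toM v) m1.
have Ey : v = phi (madd y m1).
  rewrite msubK //; first by rewrite phi_toM // ltW.
  by apply/(phi_le M HM); rewrite phi_toM; [rewrite phi1; have := zdisc _ _ v0; rewrite add0r|exact: ltW].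
have toM0 (w : Z) : w <= 0 -> toM w = m0.
  elim/(zind M HM): w => a b; rewrite zc_phi subr_le0 => /phi_le le.
  rewrite -zc_phi; change (msub a b = m0).
  case: (msub_cases M HM a b) => -[d [E1 E2 E3]] //; rewrite E2; apply: (mle_anti _ HM); last exact: mge0.
  by apply: (mle_addI _ HM _ _ b); rewrite maddC // [madd m0 b]maddC // madd0 // -E1.
have div0 : mdiv y y = m0 /\ mdiv m0 y = m0.
  have h x : phi x < v -> mdiv x y = m0.
    move=> lt; have [r E ltr] := mdivP x y; apply: (phi_inj M HM); rewrite phi0.
    have r0 := phi_ge0 M HM r; have q0 := phi_ge0 M HM (mdiv x y); rewrite -Ey in E ltr.
    case: (ltgtP (phi (mdiv x y)) 0) q0 => // /zdisc q1 _; nra.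
  split; apply: h; last by rewrite phi0.
  by rewrite Ey phiD phi1 ltrDl ltr01.
case: (leP 0 u) => u0.
  rewrite [toM (- u)]toM0; last by rewrite oppr_le0.
  rewrite maddC // madd0 // (proj1 div0) phi0 subr0.
  have [r E ltr] := mdivP (toM u) y; have r0 := phi_ge0 M HM r.
  by rewrite phi_toM // -Ey in E; rewrite -Ey in ltr; split; lra.
rewrite toM0; last exact: ltW.
rewrite (proj2 div0) phi0 sub0r.
have [r E ltr] := mdivP (madd (toM (- u)) y) y; have r0 := phi_ge0 M HM r.
rewrite phiD phi_toM in E; last by rewrite oppr_ge0 ltW.
have Ey' := Ey; rewrite phiD phi1 in Ey'.
by rewrite -Ey in E ltr; have := zdisc _ _ ltr; split; lra.
Qed.

Definition zO : oring := Oring Z zpw zfl zdisc zpw0 zpwS zfl_spec.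
End ZO.

(** * Summability of terms *)

Section Pairs.
Variables (W : Type) (Mw : W -> model) (HM : forall w, models (Mw w) R_exp).
Variable L : (forall w, Mw w) -> Prop.

Record mclosed : Prop := MClosed {
  mc_0 : L (fun w => m0);
  mc_1 : L (fun w => m1);
  mc_add : forall F G, L F -> L G -> L (fun w => madd (F w) (G w));
  mc_sub : forall F G, L F -> L G -> L (fun w => msub (F w) (G w));
  mc_mul : forall F G, L F -> L G -> L (fun w => mmul (F w) (G w));
  mc_div : forall F G, L F -> L G -> L (fun w => mdiv (F w) (G w));
  mc_exp : forall F, L F -> L (fun w => mexp (F w)) }.

Local Notation Zw := (fun w => zO (Mw w) (HM w)).

(** Terms have no negative values, so integer-valued functions are handled as differences of two
    functions into the model. *)
Definition pairs (F : forall w, Zw w) : Prop := exists2 A, L A &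
  exists2 B, L B & forall w, F w = zcls (Mw w) (HM w) (A w) (B w).

Hypothesis Lc : mclosed.

Lemma pairs_phi A : L A -> pairs (fun w => phi _ (HM w) (A w)).
Proof. by move=> LA; exists A => //; exists (fun w => m0) => //; exact: mc_0. Qed.

Lemma pairs_closed : closed pairs.
Proof.
have [L0 L1 La Ls Lm Ld Le] := Lc.
have sub (F G : forall w, Zw w) : pairs F -> pairs G -> pairs (fun w => F w - G w)%R.
  move=> [A LA [B LB EF]] [C LC [D LD EG]].
  exists (fun w => madd (A w) (D w)); first by apply La.
  exists (fun w => madd (B w) (C w)); first by apply La.
  by move=> w; rewrite EF EG !zc_phi !phiD; ring.
split.
- by exists (fun w => m1) => //; exists (fun w => m0).
- move=> F G [A LA [B LB EF]] [C LC [D LD EG]].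
  exists (fun w => madd (A w) (C w)); first by apply La.
  exists (fun w => madd (B w) (D w)); first by apply La.
  by move=> w; rewrite EF EG !zc_phi !phiD; ring.
- move=> F [A LA [B LB EF]]; exists B => //; exists A => // w.
  by rewrite EF !zc_phi; ring.
- move=> F G [A LA [B LB EF]] [C LC [D LD EG]].
  exists (fun w => madd (mmul (A w) (C w)) (mmul (B w) (D w))); first by apply La; apply Lm.
  exists (fun w => madd (mmul (A w) (D w)) (mmul (B w) (C w))); first by apply La; apply Lm.
  by move=> w; rewrite EF EG !zc_phi !phiD !phiM; ring.
- move=> F G [A LA [B LB EF]] [C LC [D LD EG]].
  pose y w := msub (msub (C w) (D w)) m1.
  have Ly : L y by apply Ls => //; apply Ls.
  have -> : (fun w => fl (F w) (G w)) = (fun w =>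
      phi _ (HM w) (mdiv (msub (A w) (B w)) (y w)) -
      phi _ (HM w) (mdiv (madd (msub (B w) (A w)) (y w)) (y w)))%R.
    apply: functional_extensionality_dep => w; rewrite EF EG /fl /= /zfl.
    by rewrite (_ : (- (zcls _ (HM w) (A w) (B w) : zring _ (HM w)))%R = zcls _ (HM w) (B w) (A w)) //;
      exact: zoppE.
  by apply: sub; apply: pairs_phi; apply Ld => //; [apply Ls|apply La => //; apply Ls].
- move=> F [A LA [B LB EF]].
  have -> : (fun w => pw (F w)) = (fun w => phi _ (HM w) (mexp (msub (A w) (B w)))).
    by apply: functional_extensionality_dep => w; rewrite EF.
  by apply: pairs_phi; apply: Le; apply: Ls.
Qed.
End Pairs.

Section Eval.
Variables (W : Type) (Mw : W -> model) (HM : forall w, models (Mw w) R_exp).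
Variable L : (forall w, Mw w) -> Prop.
Hypothesis Lc : mclosed W Mw L.

Lemma mc_eval (E : nat -> forall w, Mw w) t :
  (forall i, L (E i)) -> L (fun w => eval (fun i => E i w) t).
Proof.
case: Lc => L0 L1 La Ls Lm Ld Le LE.
elim: t => [i| | |a IHa b IHb|a IHa b IHb|a IHa b IHb|a IHa b IHb|a IHa] /=; auto.
Qed.

Lemma pairs_toM F : pairs W Mw HM L F -> L (fun w => toM _ (HM w) (F w)).
Proof.
move=> [A LA [B LB EF]].
have -> : (fun w => toM _ (HM w) (F w)) = (fun w => msub (A w) (B w)).
  by apply: functional_extensionality_dep => w; rewrite EF.
by case: Lc => _ _ _ Ls _ _ _; apply Ls.
Qed.

End Eval.

Section Fixed.
Variable M : iomodel.
Let HM := im_R M.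
Local Notation Z := (zO M HM).
Local Notation phi := (phi M HM).
Local Notation toM := (toM M HM).

(** Two definitions may use different parameters; interleaving merges them into one environment. *)
Definition env_mix (e1 e2 : nat -> M) (i : nat) : M :=
  if Nat.even i then e1 (Nat.div2 i) else e2 (Nat.div2 i).
Definition mix1 : subst := fun i => match i with 0 => Var 0 | S j => Var (S (2 * j)) end.
Definition mix2 : subst := fun i => match i with 0 => Var 0 | S j => Var (S (S (2 * j))) end.

Lemma mix1E e1 e2 x : (fun i => eval (x .: env_mix e1 e2) (mix1 i)) = x .: e1.
Proof.
apply: functional_extensionality => -[|j] //=; rewrite /env_mix.
by have -> : (j + (j + 0) = 2 * j)%nat by []; rewrite Nat.even_even Nat.div2_even.
Qed.

Lemma mix2E e1 e2 x : (fun i => eval (x .: env_mix e1 e2) (mix2 i)) = x .: e2.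
Proof.
apply: functional_extensionality => -[|j] //=; rewrite /env_mix.
have -> : (S (j + (j + 0)) = 2 * j + 1)%nat by lia.
by rewrite Nat.even_odd Nat.add_1_r Nat.div2_succ_double.
Qed.

Definition defT (A : M -> M) : Prop := exists t e, forall x, A x = eval (x .: e) t.
Definition defP (P : M -> Prop) : Prop :=
  exists A e, qfree A /\ forall x, P x <-> sat (x .: e) A.

Lemma defT2 A B : defT A -> defT B ->
  exists s t e, forall x, A x = eval (x .: e) s /\ B x = eval (x .: e) t.
Proof.
move=> [s [e1 Es]] [t [e2 Et]].
exists (subst_t mix1 s), (subst_t mix2 t), (env_mix e1 e2) => x.
by rewrite !eval_subst mix1E mix2E.
Qed.

Lemma defP2 P Q : defP P -> defP Q -> exists A B e, qfree A /\ qfree B /\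
  forall x, (P x <-> sat (x .: e) A) /\ (Q x <-> sat (x .: e) B).
Proof.
move=> [A [e1 [qA EA]]] [B [e2 [qB EB]]].
exists (subst_f mix1 A), (subst_f mix2 B), (env_mix e1 e2).
split; [exact: qfree_subst|split; [exact: qfree_subst|move=> x]].
by rewrite !sat_subst mix1E mix2E.
Qed.

Lemma defT_const c : defT (fun _ => c).
Proof. by exists (Var 1), (fun _ => c). Qed.

Lemma defT_closed : mclosed M (fun _ => M) defT.
Proof.
split; try by [exists Zero, (fun _ => m0) | exists One, (fun _ => m0)].
- by move=> A B /defT2 H /H [s [t [e E]]]; exists (Add s t), e => x /=; have [-> ->] := E x.
- by move=> A B /defT2 H /H [s [t [e E]]]; exists (Sub s t), e => x /=; have [-> ->] := E x.
- by move=> A B /defT2 H /H [s [t [e E]]]; exists (Mul s t), e => x /=; have [-> ->] := E x.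
- by move=> A B /defT2 H /H [s [t [e E]]]; exists (Div s t), e => x /=; have [-> ->] := E x.
- by move=> A [s [e E]]; exists (Exp s), e => x /=; rewrite E.
Qed.

(** Definability is required on the nonnegative integers only, where induction takes place. *)
Definition zK (F : Z -> Z) : Prop := pairs M (fun _ => M) (fun _ => HM) defT (fun x => F (phi x)).
Definition zKP (P : Z -> Prop) : Prop := defP (fun x => P (phi x)).

Lemma zK_closed : closed (Zw := fun _ : Z => Z) zK.
Proof.
have [c1 ca co cm cf cp] := pairs_closed _ _ (fun _ => HM) _ defT_closed.
split=> [|F G|F|F G|F G|F]; rewrite /zK; [exact: c1|exact: ca|exact: co|exact: cm|exact: cf|exact: cp].
Qed.

Let rel2 (r : term -> term -> form) (R : Z -> Z -> Prop) F G :
  (forall s t, qfree (r s t)) ->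
  (forall (a b c d : M) e s t, eval e s = madd a d -> eval e t = madd c b ->
     (R (zcls M HM a b) (zcls M HM c d) <-> sat e (r s t))) ->
  zK F -> zK G -> zKP (fun x => R (F x) (G x)).
Proof.
move=> qr HR [A LA [B LB EF]] [C LC [D LD EG]].
have [_ _ La _ _ _ _] := defT_closed.
have [s [t [e E]]] := defT2 _ _ (La _ _ LA LD) (La _ _ LC LB).
exists (r s t), e; split=> // x; rewrite EF EG; apply: HR; have [E1 E2] := E x; exact: esym.
Qed.

Lemma io_ind_class : ind_class Z zK zKP.
Proof.
split.
- exact: zK_closed.
- exists (fun x => x); first by exists (Var 0), (fun _ => m0).
  by exists (fun _ => m0); first exact: defT_const.
- move=> c; elim/(zind M HM): c => a b; exists (fun _ => a); first exact: defT_const.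
  by exists (fun _ => b); first exact: defT_const.
- move=> F G; apply: (rel2 Eq eq) => // a b c d e s t /= -> ->; exact: zcls_eq.
- move=> F G; apply: (rel2 Le (fun x y => x <= y)%R) => // a b c d e s t /= -> ->; exact: zlebE.
- move=> F G; apply: (rel2 Lt (fun x y => x < y)%R) => // a b c d e s t /= -> ->.
  rewrite lt_neqAle; split=> [/andP [/eqP ne le]|[le ne]].
    by split; [apply/zlebE|move=> E; apply: ne; apply/zcls_eq].
  by apply/andP; split; [apply/eqP => /zcls_eq|apply/zlebE].
- move=> P Q /defP2 H /H [A [B [e [qA [qB E]]]]]; exists (And A B), e; split=> // x.
  by have [/= <- <-] := E x.
- move=> P Q /defP2 H /H [A [B [e [qA [qB E]]]]]; exists (Or A B), e; split=> // x.
  by have [/= <- <-] := E x.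
- move=> P Q /defP2 H /H [A [B [e [qA [qB E]]]]]; exists (Imp A B), e; split=> // x.
  by have [/= <- <-] := E x.
move=> P [A [e [qA E]]] P0 PS z /(phi_toM M HM) <-; apply/E; move: (toM z) => x.
apply: (im_IO M A qA) => [|{}x]; first by rewrite -E phi0.
by rewrite -!E phiD phi1; apply: PS; exact: phi_ge0.
Qed.

End Fixed.

(** The index type for uniformity: a function on all worlds that belongs to [termL] is the value of
    one term in all models at once. *)
Record world := World { wM : iomodel; wenv : nat -> wM }.

Local Notation Zw := (fun w => zO (wM w) (im_R (wM w))).
Local Notation mphi M := (phi M (im_R M)).
Local Notation mtoM M := (toM M (im_R M)).

Definition termL (F : forall w : world, wM w) : Prop := exists t, forall w, F w = eval (wenv w) t.

Lemma termL_closed : mclosed world wM termL.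
Proof.
split; try by [exists Zero | exists One].
- by move=> F G [s Es] [t Et]; exists (Add s t) => w /=; rewrite Es Et.
- by move=> F G [s Es] [t Et]; exists (Sub s t) => w /=; rewrite Es Et.
- by move=> F G [s Es] [t Et]; exists (Mul s t) => w /=; rewrite Es Et.
- by move=> F G [s Es] [t Et]; exists (Div s t) => w /=; rewrite Es Et.
- by move=> F [s Es]; exists (Exp s) => w /=; rewrite Es.
Qed.

Definition tfun (M : iomodel) (e : nat -> M) t : zO M (im_R M) -> zO M (im_R M) :=
  fun z => mphi M (eval (mtoM M z .: e) t).
Definition tfun2 (M : iomodel) (e : nat -> M) t : zO M (im_R M) -> zO M (im_R M) -> zO M (im_R M) :=
  fun n b => mphi M (eval (mtoM M n .: mtoM M b .: e) t).

(** In [s] the variables 0 and 1 are the length and the exponent, so that the parameters of [t] move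
    up by one. *)
Definition summable (t s : term) : Prop := forall (M : iomodel) (e : nat -> M), sums (tfun M e t) (tfun2 M e s).

Definition wtl (w : world) : nat -> wM w := fun i => wenv w (S (S i)).

Definition cU : closed (pairs world wM (fun w => im_R (wM w)) termL) := pairs_closed _ _ _ _ termL_closed.
Local Notation KU := (pairs world wM (fun w => im_R (wM w)) termL).

Lemma KU_tfun t : K1 KU (fun w => tfun (wM w) (wtl w) t).
Proof.
move=> F HF; apply: (pairs_phi _ _ _ _ termL_closed).
apply: (mc_eval _ _ _ termL_closed
  (fun i w => match i with 0 => mtoM (wM w) (F w) | S i => wtl w i end)) => -[|i].
  exact: (pairs_toM _ _ _ _ termL_closed).
by exists (Var (S (S i))).
Qed.

Lemma KU_tfun2 t : K2 KU (fun w => tfun2 (wM w) (wtl w) t).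
Proof.
move=> F G HF HG; apply: (pairs_phi _ _ _ _ termL_closed).
apply: (mc_eval _ _ _ termL_closed (fun i w => match i with 0 => mtoM (wM w) (F w)
  | S i => match i with 0 => mtoM (wM w) (G w) | S i => wtl w i end end)) => -[|[|i]].
- exact: (pairs_toM _ _ _ _ termL_closed).
- exact: (pairs_toM _ _ _ _ termL_closed).
by exists (Var (S (S i))).
Qed.

Section FixedM.
Variables (M : iomodel) (e : nat -> M).
Local Notation K := (zK M).

Lemma zK_tfun t : K1 (Zw := fun _ : zO M (im_R M) => zO M (im_R M)) K (fun _ => tfun M e t).
Proof.
move=> F HF; apply: (pairs_phi _ _ _ _ (defT_closed M)).
apply: (mc_eval _ _ _ (defT_closed M)
  (fun i x => match i with 0 => mtoM M (F (mphi M x)) | S i => e i end)) => -[|i].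
  exact: (pairs_toM _ _ (fun _ => im_R M) _ (defT_closed M) (fun x => F (mphi M x))).
exact: defT_const.
Qed.

Lemma zK_tfun2 t : K2 (Zw := fun _ : zO M (im_R M) => zO M (im_R M)) K (fun _ => tfun2 M e t).
Proof.
move=> F G HF HG; apply: (pairs_phi _ _ _ _ (defT_closed M)).
apply: (mc_eval _ _ _ (defT_closed M) (fun i x => match i with 0 => mtoM M (F (mphi M x))
  | S i => match i with 0 => mtoM M (G (mphi M x)) | S i => e i end end)) => -[|[|i]].
- exact: (pairs_toM _ _ (fun _ => im_R M) _ (defT_closed M) (fun x => F (mphi M x))).
- exact: (pairs_toM _ _ (fun _ => im_R M) _ (defT_closed M) (fun x => G (mphi M x))).
exact: defT_const.
Qed.

Lemma tfun_Add s t z : tfun M e (Add s t) z = (tfun M e s z + tfun M e t z)%R.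
Proof. exact: phiD. Qed.
Lemma tfun_Mul s t z : tfun M e (Mul s t) z = (tfun M e s z * tfun M e t z)%R.
Proof. exact: phiM. Qed.
Lemma phi_exp x : mphi M (mexp x) = pw (mphi M x : zO M (im_R M)).
Proof. by rewrite /pw /= /zpw toMK. Qed.

Lemma phi_sub x y : mphi M (msub x y) = pos (mphi M x - mphi M y : zO M (im_R M))%R.
Proof.
rewrite posE subr_ge0; case: ifP => [/phi_le le|/negbT].
  by rewrite -{2}(msubK M (im_R M) x y le) phiD; ring.
by rewrite -ltNge => /phi_lt lt; rewrite msub_lt //; exact: im_R.
Qed.

Lemma phi_div x y : mphi M (mdiv x y) = fl (mphi M x : zO M (im_R M)) (mphi M y + 1)%R.
Proof.
have [r E lt] := mdivP M (im_R M) x y; rewrite phiD phi1 in E lt.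
apply: esym; refine (fl_uniq (zO M (im_R M)) _ _ _ (mphi M r) _ _ lt); last exact: phi_ge0.
by rewrite E; ring.
Qed.

End FixedM.

(** A uniform operator, applied to the variables 0 and 1, is a difference of two terms. As sums are
    not negative, the truncated subtraction [Sub u v] computes it. *)
Lemma summable_step t (S : forall M : iomodel, (nat -> M) -> zO M (im_R M) -> zO M (im_R M) -> zO M (im_R M)) :
  K2 KU (fun w => S (wM w) (wtl w)) ->
  (forall (M : iomodel) e, K2 (Zw := fun _ : zO M (im_R M) => zO M (im_R M)) (zK M) (fun _ => S M e) /\
     sums (tfun M e t) (S M e)) ->
  exists s, summable t s.
Proof.
move=> KS HS.
have Kv i : KU (fun w => mphi (wM w) (wenv w i)).
  by apply: (pairs_phi _ _ _ _ termL_closed); exists (Var i).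
have [A [u Eu] [B [v Ev] E]] := KS _ _ (Kv 0) (Kv 1).
exists (Sub u v) => M e; have [KSM HSM] := HS M e.
have key (n b : zO M (im_R M)) : (0 <= n)%R -> (0 <= b)%R -> tfun2 M e (Sub u v) n b = S M e n b.
  move=> n0 b0; have Sn := s_nonneg (io_ind_class M) KSM HSM n b n0 b0.
  have := E (World M (mtoM M n .: mtoM M b .: e)); rewrite Eu Ev /wtl /= => E'.
  rewrite !(phi_toM M (im_R M)) // in E'.
  by transitivity (mphi M (mtoM M (S M e n b))); [rewrite E'|exact: phi_toM].
case: HSM => f0 S0 SS; split=> [|b b0|n b n0 b0]; first exact: f0.
  by rewrite key // S0.
by rewrite !key ?addr_ge0 ?ler01 // SS.
Qed.

Theorem all_summable t : exists s, summable t s.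
Proof.
have icM := io_ind_class.
have const_case (t' : term) (c : forall M : iomodel, (nat -> M) -> M) :
    (forall (M : iomodel) e z, tfun M e t' z = mphi M (c M e)) ->
    KU (fun w => mphi (wM w) (c (wM w) (wtl w))) -> exists s, summable t' s.
  move=> Ec Kc; apply: (summable_step _ (fun (M : iomodel) e => sconst (mphi M (c M e) : zO M (im_R M)))).
    exact: (cl_sconst _ _ _ cU _ Kc).
  move=> M e; split; first exact: (cl_sconst _ _ _ (zK_closed M) _ (ic_const _ _ _ (icM M) _)).
  have H := sums_const (icM M) (c := mphi M (c M e)) (phi_ge0 _ _ _).
  by apply: sums_ext H => z _; rewrite Ec.
elim: t => [[|i]| | |s [ss Hs] t [st Ht]|s [ss Hs] t [st Ht]|s [ss Hs] t [st Ht]|s [ss Hs] t [st Ht]|s [ss Hs]].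
- apply: (summable_step _ (fun (M : iomodel) e => sid)); first exact: (cl_sid _ _ _ cU).
  move=> M e; split; first exact: (cl_sid _ _ _ (zK_closed M)).
  by apply: sums_ext (sums_id (icM M)) => z z0; rewrite /tfun /= phi_toM.
- apply: (const_case _ (fun (M : iomodel) e => e i)) => //.
  by apply: (pairs_phi _ _ _ _ termL_closed); exists (Var (S (S i))).
- by apply: (const_case _ (fun (M : iomodel) e => m0)) => //; exact: (cl_0 _ _ _ cU).
- by apply: (const_case _ (fun (M : iomodel) e => m1)) => //; exact: (cl_1 _ cU).
- apply: (summable_step _ (fun (M : iomodel) e => sadd (tfun2 M e ss) (tfun2 M e st))).
    exact: (cl_sadd _ _ _ cU _ _ (KU_tfun2 ss) (KU_tfun2 st)).
  move=> M e; split; first exact: (cl_sadd _ _ _ (zK_closed M) _ _ (zK_tfun2 M e ss) (zK_tfun2 M e st)).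
  by apply: sums_ext (sums_add (Hs M e) (Ht M e)) => z _; rewrite tfun_Add.
- apply: (summable_step _ (fun (M : iomodel) e => smon (tfun2 M e ss) (tfun2 M e st))).
    exact: (cl_smon _ _ _ cU _ _ (KU_tfun2 ss) (KU_tfun2 st)).
  move=> M e; split; first exact: (cl_smon _ _ _ (zK_closed M) _ _ (zK_tfun2 M e ss) (zK_tfun2 M e st)).
  apply: sums_ext (sums_mon (icM M) (zK_tfun2 M e ss) (zK_tfun2 M e st) (Hs M e) (Ht M e)) => z _.
  by rewrite /tfun /= phi_sub.
- apply: (summable_step _ (fun (M : iomodel) e => shad (tfun2 M e ss) (tfun2 M e st))).
    exact: (cl_shad _ _ _ cU _ _ (KU_tfun2 ss) (KU_tfun2 st)).
  move=> M e; split; first exact: (cl_shad _ _ _ (zK_closed M) _ _ (zK_tfun2 M e ss) (zK_tfun2 M e st)).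
  apply: sums_ext (sums_had (icM M) (zK_tfun2 M e ss) (zK_tfun2 M e st) (Hs M e) (Ht M e)) => z _.
  by rewrite tfun_Mul.
- apply: (summable_step _ (fun (M : iomodel) e => sdiv (tfun M e s) (tfun M e t) (tfun2 M e ss) (tfun2 M e st))).
    exact: (cl_sdiv _ _ _ cU _ _ _ _ (KU_tfun s) (KU_tfun t) (KU_tfun2 ss) (KU_tfun2 st)).
  move=> M e; split.
    exact: (cl_sdiv _ _ _ (zK_closed M) _ _ _ _ (zK_tfun M e s) (zK_tfun M e t) (zK_tfun2 M e ss) (zK_tfun2 M e st)).
  apply: sums_ext (sums_div (icM M) (zK_tfun M e s) (zK_tfun M e t) (zK_tfun2 M e ss)
    (zK_tfun2 M e st) (Hs M e) (Ht M e)) => z _.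
  by rewrite /tfun /= phi_div.
apply: (summable_step _ (fun (M : iomodel) e => sexp (tfun M e s) (tfun2 M e ss))).
  exact: (cl_sexp _ _ _ cU _ _ (KU_tfun s) (KU_tfun2 ss)).
move=> M e; split; first exact: (cl_sexp _ _ _ (zK_closed M) _ _ (zK_tfun M e s) (zK_tfun2 M e ss)).
apply: sums_ext (sums_exp (icM M) (zK_tfun M e s) (zK_tfun2 M e ss) (Hs M e)) => z _.
by rewrite /tfun /= phi_exp.
Qed.

(** * Characteristic and Skolem terms *)

Section RFacts.
Variables (M : model) (HM : models M R_exp).
Implicit Types x y z : M.

Lemma msub0 x : msub x m0 = x.
Proof. by have := msubK M HM x m0 (mge0 M HM x); rewrite madd0. Qed.

Lemma msub_eq0 x y : msub x y = m0 <-> mle x y.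
Proof.
split=> [E|le].
  case: (m_lt_or M HM x y) => // lt; have := msubK M HM x y (proj1 lt).
  rewrite E maddC // madd0 // => ->; exact: mle_refl.
case: (msub_cases M HM x y) => -[d [E1 E2 E3]] //; rewrite E2.
apply: (mle_anti M HM) => //; last exact: mge0.
by apply: (mle_addI M HM _ _ y); rewrite maddC // [madd m0 y]maddC // madd0 // -E1.
Qed.

Lemma mlt_le_succ x y : mle x y <-> mlt M x (madd y m1).
Proof.
split=> [le|lt].
  split; first by apply: (mle_trans M HM y) => //; case: (mlt_succ M HM y).
  by move=> E; apply: (mlt_irr M HM x y le); rewrite E; exact: mlt_succ.
case: (m_lt_or M HM x y) => // /(mle_succ M HM) le; by case: (mlt_irr M HM _ _ le).
Qed.

Lemma mle0 x : mle x m0 -> x = m0.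
Proof. by move=> le; apply: (mle_anti M HM) => //; exact: mge0. Qed.

Lemma m10 : m1 <> m0 :> M.
Proof. by move=> E; have [_] := mlt01 M HM; rewrite E. Qed.

Lemma mge1 x : x <> m0 -> mle m1 x.
Proof.
move=> ne; have := mle_succ M HM m0 x; rewrite maddC // madd0 //; apply.
by split; [exact: mge0|move/esym].
Qed.

Lemma mle_add2 x y z w : mle x y -> mle z w -> mle (madd x z) (madd y w).
Proof.
move=> h1 h2; apply: (mle_trans M HM (madd y z)); first exact: mle_add.
by rewrite ![madd y _]maddC //; apply: mle_add.
Qed.

Lemma mle_addr x y : mle x (madd x y).
Proof. by have := mle_add2 x x m0 y (mle_refl M HM x) (mge0 M HM y); rewrite madd0. Qed.

Lemma mmul2 x y z w : mle x y -> mle z w -> mle (mmul x z) (mmul y w).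
Proof.
move=> h1 h2.
have aux (a b c : M) : mle a b -> mle (mmul a c) (mmul b c).
  move=> le; case: (classic (c = m0)) => [->|c0]; first by rewrite !(mmul0 M HM); exact: mle_refl.
  case: (classic (a = b)) => [->|ne]; first exact: mle_refl.
  by have lt : mlt M a b by []; case: (mlt_mul M HM a b c c0 lt).
apply: (mle_trans M HM (mmul y z)); first exact: aux.
by rewrite ![mmul y _]mmulC //; exact: aux.
Qed.

Lemma msub_le x y : mle (msub x y) x.
Proof.
case: (msub_cases M HM x y) => -[d [E1 -> _]]; last exact: mge0.
by rewrite E1 maddC //; exact: mle_addr.
Qed.

Lemma mdiv_le_num x y : mle (mdiv x y) x.
Proof.
apply: (mle_trans M HM (mmul (madd y m1) (mdiv x y))); last exact: mdiv_le.
rewrite -{1}(mmul1 M HM (mdiv x y)) [mmul _ m1]mmulC //; apply: mmul2; last exact: mle_refl.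
by rewrite maddC //; exact: mle_addr.
Qed.

Definition is01 (x : M) (P : Prop) := (P /\ x = m1) \/ (~ P /\ x = m0).

Lemma is01_1 x P : is01 x P -> (x = m1 <-> P).
Proof. by case=> -[p ->]; split=> // /esym /m10. Qed.

Lemma is01_not x P : is01 x P -> is01 (msub m1 x) (~ P).
Proof.
case=> -[p ->]; [right|left]; split=> //; last exact: msub0.
by apply/msub_eq0; exact: mle_refl.
Qed.

Lemma is01_and x y P Q : is01 x P -> is01 y Q -> is01 (mmul x y) (P /\ Q).
Proof.
case=> -[p ->]; case=> -[q ->].
- by left; split=> //; exact: mmul1.
- by right; split; [tauto|exact: mmul0].
- by right; split; [tauto|rewrite mmulC // mmul0].
- by right; split; [tauto|exact: mmul0].
Qed.

Lemma is01_iff x P Q : (P <-> Q) -> is01 x P -> is01 x Q.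
Proof. by move=> E [] [p ->]; [left|right]; rewrite -E. Qed.

Lemma is01_le x y : is01 (msub m1 (msub x y)) (mle x y).
Proof.
case: (classic (mle x y)) => [le|nle]; [left|right]; split=> //.
  by rewrite (proj2 (msub_eq0 x y) le) msub0.
by apply/msub_eq0/mge1 => /msub_eq0.
Qed.

End RFacts.

Definition tnot a := Sub One a.
Definition tle a b := Sub One (Sub a b).
Definition teq a b := Mul (tle a b) (tle b a).

Definition charac (A : form) (c : term) : Prop :=
  forall (M : iomodel) (e : nat -> M), is01 M (eval e c) (sat e A).

Lemma charac_qfree A : qfree A -> exists c, charac A c.
Proof.
have R := im_R.
elim: A => //=.
- move=> a b _; exists (teq a b) => M e.
  have H := is01_and M (R M) _ _ _ _ (is01_le M (R M) (eval e a) (eval e b)) (is01_le M (R M) (eval e b) (eval e a)).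
  apply: is01_iff H; split=> [[]|->]; last by split; apply: mle_refl; exact: R.
  exact: (mle_anti M (R M)).
- by move=> a b _; exists (tle a b) => M e; exact: is01_le.
- by move=> _; exists Zero => M e; right; split=> // -[].
- move=> A IHA B IHB [/IHA [c Hc] /IHB [d Hd]]; exists (tnot (Mul c (tnot d))) => M e.
  have H := is01_not M (R M) _ _ (is01_and M (R M) _ _ _ _ (Hc M e) (is01_not M (R M) _ _ (Hd M e))).
  apply: is01_iff H => /=; case: (classic (sat e A)); case: (classic (sat e B)); tauto.
- move=> A IHA B IHB [/IHA [c Hc] /IHB [d Hd]]; exists (Mul c d) => M e.
  exact: is01_and.
- move=> A IHA B IHB [/IHA [c Hc] /IHB [d Hd]]; exists (tnot (Mul (tnot c) (tnot d))) => M e.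
  have H := is01_not M (R M) _ _ (is01_and M (R M) _ _ _ _ (is01_not M (R M) _ _ (Hc M e))
    (is01_not M (R M) _ _ (Hd M e))).
  apply: is01_iff H => /=; case: (classic (sat e A)); case: (classic (sat e B)); tauto.
Qed.

(** The summation term with exponent 0, where all weights are 1. *)
Lemma sum_term c : exists s, forall (M : iomodel) (e : nat -> M),
  eval (m0 .: e) s = m0 /\
  forall n, eval (madd n m1 .: e) s = madd (eval (n .: e) s) (eval (n .: e) c).
Proof.
have [s Hs] := all_summable c; exists (subst_t (Var 0 .: (Zero .: shift 1)) s) => M e.
have [_ H0 HS] := Hs M e; pose HM := im_R M.
have E n : (fun i => eval (n .: e) ((Var 0 .: (Zero .: shift 1)) i)) = n .: (m0 .: e).
  by apply: functional_extensionality => -[|[|i]].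
have E2 n : tfun2 M e s (phi M HM n) (phi M HM m0) = phi M HM (eval (n .: (m0 .: e)) s).
  by rewrite /tfun2 !toMK.
split=> [|n]; rewrite !eval_subst !E; apply: (phi_inj M HM); rewrite -!E2.
  exact: H0 (phi M HM m0) (phi_ge0 M HM m0).
rewrite phiD phi1 (HS _ _ (phi_ge0 M HM n) (phi_ge0 M HM m0)) phiD /tfun toMK E2.
by rewrite ssralg.GRing.mul0r pw0 ssralg.GRing.mulr1.
Qed.

Section IOM.
Variable M : iomodel.
Let HM := im_R M.

Lemma io_ind P : defP M P -> P m0 -> (forall x, P x -> P (madd x m1)) -> forall x, P x.
Proof.
move=> [A [e [qA E]]] P0 PS x; apply/E.
by apply: (im_IO M A qA) => [|{}x]; rewrite -!E //; exact: PS.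
Qed.

Lemma defT_app t e F : defT M F -> defT M (fun x => eval (F x .: e) t).
Proof.
move=> HF; apply: (mc_eval _ _ _ (defT_closed M) (fun i x => (F x .: e) i)) => -[|i] //.
exact: defT_const.
Qed.

Lemma defT_id : defT M (fun x => x). Proof. by exists (Var 0), (fun _ => m0). Qed.

Lemma defP_eq F G : defT M F -> defT M G -> defP M (fun x => F x = G x).
Proof.
move=> /defT2 H /H [s [t [e E]]]; exists (Eq s t), e; split=> // x /=.
by have [-> ->] := E x.
Qed.

Lemma defP_le F G : defT M F -> defT M G -> defP M (fun x => mle (F x) (G x)).
Proof.
move=> /defT2 H /H [s [t [e E]]]; exists (Le s t), e; split=> // x /=.
by have [-> ->] := E x.
Qed.

Lemma defP_imp P Q : defP M P -> defP M Q -> defP M (fun x => P x -> Q x).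
Proof.
move=> /defP2 H /H [A [B [e [qA [qB E]]]]]; exists (Imp A B), e; split=> // x.
by have [/= <- <-] := E x.
Qed.

Lemma defT_add F G : defT M F -> defT M G -> defT M (fun x => madd (F x) (G x)).
Proof. by case: (defT_closed M) => _ _ H _ _ _ _; apply H. Qed.

Section Sum.
Variables (s c : term) (e : nat -> M).
Let S n := eval (n .: e) s.
Let c' n := eval (n .: e) c.
Hypothesis S0 : S m0 = m0.
Hypothesis SS : forall n, S (madd n m1) = madd (S n) (c' n).

Lemma sum_mono m n : mle m n -> mle (S m) (S n).
Proof.
move=> le; rewrite -(msubK M HM n m le) [madd _ m]maddC //; move: (msub n m).
apply: io_ind => [||x IH].
- apply: defP_le; first exact: defT_const.
  by apply: defT_app; apply: defT_add; [exact: defT_const|exact: defT_id].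
- rewrite madd0 //; exact: mle_refl.
by rewrite -maddA // SS; apply: (mle_trans M HM _ _ _ IH); exact: mle_addr.
Qed.

(** The least witness is the place where the partial sums cease to be 0. That there is none earlier
    is an equation, so its induction needs no bounded quantifier. *)
Lemma sum_witness n : S (madd n m1) <> m0 -> exists i, [/\ mle i n, S i = m0, S (madd i m1) <> m0 & c' i <> m0].
Proof.
move=> ne; apply: NNPP => H.
have main x : mle x (madd n m1) -> S x = m0.
  move: x; apply: io_ind => [|//|x IH le].
    apply: defP_imp; first by apply: defP_le; [exact: defT_id|exact: defT_const].
    by apply: defP_eq; [apply: defT_app; exact: defT_id|exact: defT_const].
  have le' : mle x n by apply: (mle_addI M HM _ _ m1).
  have Sx : S x = m0.
    by apply: IH; apply: (mle_trans M HM _ _ _ le'); case: (mlt_succ M HM n).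
  apply: NNPP => ne'; apply: H; exists x; split=> // cx.
  by apply: ne'; rewrite SS Sx cx madd0.
by apply: ne; apply: main; exact: mle_refl.
Qed.

Lemma sum_pos i n : mle i n -> c' i <> m0 -> S (madd n m1) <> m0.
Proof.
move=> le ci En; apply: ci.
have le' : mle (madd i m1) (madd n m1) by exact: mle_add.
have := sum_mono _ _ le'; rewrite SS En => /(mle0 M HM).
by rewrite maddC //; exact: madd_eq0.
Qed.

End Sum.

(** A term that is 1 exactly below [x], and 0 elsewhere, sums up to [x]: this makes a least witness
    the value of a term. *)
Lemma sum_count (s2 d : term) (e : nat -> M) x t :
  eval (m0 .: e) s2 = m0 ->
  (forall n, eval (madd n m1 .: e) s2 = madd (eval (n .: e) s2) (eval (n .: e) d)) ->
  (forall y, mlt M y x -> eval (y .: e) d = m1) ->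
  (forall y, mle x y -> eval (y .: e) d = m0) -> mle x t -> eval (t .: e) s2 = x.
Proof.
move=> S0 SS d1 d0 xt.
have main y : mle y x -> eval (y .: e) s2 = y.
  move: y; apply: io_ind => [|//|y IH le].
    apply: defP_imp; first by apply: defP_le; [exact: defT_id|exact: defT_const].
    by apply: defP_eq; [apply: defT_app; exact: defT_id|exact: defT_id].
  have lt : mlt M y x.
    split; first by apply: (mle_trans M HM _ _ _ _ le); case: (mlt_succ M HM y).
    by move=> E; rewrite -E in le; exact: (mlt_irr M HM _ _ le (mlt_succ M HM y)).
  by rewrite SS d1 // IH //; case: lt.
rewrite -(msubK M HM t x xt) [madd _ x]maddC //; move: (msub t x).
apply: io_ind => [||y IH].
- apply: defP_eq; last exact: defT_const.
  by apply: defT_app; apply: defT_add; [exact: defT_const|exact: defT_id].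
- by rewrite madd0 // main //; exact: mle_refl.
by rewrite -maddA // SS IH d0 ?madd0 //; exact: mle_addr.
Qed.

End IOM.

(** The minimum of both values. *)
Definition tmin s t := Sub s (Sub s t).

Lemma tmin_le (M : model) (HM : models M R_exp) e s t : mle (eval e (tmin s t)) (eval (M := M) e s).
Proof. exact: msub_le. Qed.

Lemma tminE (M : model) (HM : models M R_exp) e s t :
  mle (eval e t) (eval e s) -> eval e (tmin s t) = eval (M := M) e t.
Proof.
move=> le; rewrite /=; have := msubK M HM _ _ le; move: (eval e s) (eval e t) => x y.
move: (msub x y) => z E; case: (msub_cases M HM x z) => -[d [E1 -> _]].
  by apply: (maddI M HM _ _ z); rewrite maddC // -E1 [madd y z]maddC.
apply: esym; apply: (madd_eq0 M HM y d); apply: (maddI M HM _ _ x).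
by rewrite maddA // [madd d x]maddC // -E1 maddC // E [madd m0 x]maddC // madd0.
Qed.

(** A witness up to [t] exists iff the sum of [c] over the arguments up to [t] is not 0, and the
    least one is the number of [y] for which the sum up to and including [y] is still 0. The minimum
    with [t] enforces the bound in every model of R(exp), even without induction, since a reduction
    has to prove its bounds there. *)
Lemma charac_ex t A c : charac A c ->
  (exists d, charac (ExLe t A) d) /\
  exists w, (forall (M : model) (e : nat -> M), models M R_exp -> mle (eval e w) (eval e t)) /\
    forall (M : iomodel) (e : nat -> M), sat e (ExLe t A) -> sat (eval e w .: e) A.
Proof.
move=> Hc; have [s Hs] := sum_term c.
have c1 (M : iomodel) (e : nat -> M) x : eval (x .: e) c <> m0 <-> sat (x .: e) A.
  case: (Hc M (x .: e)) => -[a ->]; split=> //.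
  by move=> _; apply: m10; exact: im_R.
have ex (M : iomodel) (e : nat -> M) : sat e (ExLe t A) <->
    eval (madd (eval e t) m1 .: e) s <> m0.
  have [S0 SS] := Hs M e; split=> [[x /= []]|].
    rewrite eval_lift1 => le /c1 cx; exact: (sum_pos M s c e SS x).
  move=> /(sum_witness M s c e S0 SS) [i [le _ _ /c1 ci]]; exists i.
  by rewrite /= eval_lift1.
split.
  exists (tle One (subst_t (Add t One .: Var) s)) => M e.
  have := is01_le M (im_R M) (eval e One) (eval e (subst_t (Add t One .: Var) s)).
  apply: is01_iff; rewrite ex eval_subst.
  have -> : (fun i => eval e ((Add t One .: Var) i)) = madd (eval e t) m1 .: e.
    by apply: functional_extensionality => -[|i].
  split=> [le E|]; last exact: mge1 (im_R M) _.
  by rewrite E in le; apply: (m10 M (im_R M)); exact: mle0 (im_R M) _ le.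
(* This term is 1 exactly at the arguments below the least witness. *)
pose d := teq (subst_t (Add (Var 0) One .: shift 1) s) Zero.
have [s2 Hs2] := sum_term d.
exists (tmin t (subst_t (t .: Var) s2)); split=> [M e HM|M e]; first exact: tmin_le.
have HM := im_R M; rewrite ex; have [S0 SS] := Hs M e.
move=> /(sum_witness M s c e S0 SS) [x [le Sx Sx1 /c1 cx]].
have Ed y : is01 M (eval (y .: e) d) (eval (madd y m1 .: e) s = m0).
  have H := is01_and M HM _ _ _ _ (is01_le M HM (eval (y .: e) (subst_t (Add (Var 0) One .: shift 1) s)) m0)
    (is01_le M HM m0 (eval (y .: e) (subst_t (Add (Var 0) One .: shift 1) s))).
  apply: is01_iff H; rewrite eval_subst.
  have -> : (fun i => eval (y .: e) ((Add (Var 0) One .: shift 1) i)) = madd y m1 .: e.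
    by apply: functional_extensionality => -[|i].
  by split=> [[/(mle0 M HM)]|->]; last by split; exact: mle_refl.
have [T0 TS] := Hs2 M e.
have Ew : eval (eval e t .: e) s2 = x.
  apply: (sum_count M s2 d e x _ T0 TS) => // y H.
    apply/(is01_1 _ HM _ _ (Ed y)); apply: (mle0 M HM); rewrite -Sx.
    by apply: (sum_mono M s c e SS); exact: mle_succ.
  case: (Ed y) => -[] // E _; case: Sx1; apply: (mle0 M HM); rewrite -E.
  by apply: (sum_mono M s c e SS); exact: mle_add.
have -> : eval e (tmin t (subst_t (t .: Var) s2)) = x; last by [].
have Es : eval e (subst_t (t .: Var) s2) = x.
  rewrite eval_subst -[RHS]Ew; congr (eval _ s2).
  by apply: functional_extensionality => -[|i].
by rewrite tminE // Es.
Qed.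

Lemma charac_bounded A : bounded A -> exists c, charac A c.
Proof.
elim=> {A} [A|A B _ [c Hc] _ [d Hd]|A B _ [c Hc] _ [d Hd]|A B _ [c Hc] _ [d Hd]|t A _ [c Hc]|t A _ [c Hc]].
- exact: charac_qfree.
- exists (tnot (Mul c (tnot d))) => M e; have R := im_R M.
  have H := is01_not M R _ _ (is01_and M R _ _ _ _ (Hc M e) (is01_not M R _ _ (Hd M e))).
  apply: is01_iff H => /=; case: (classic (sat e A)); case: (classic (sat e B)); tauto.
- by exists (Mul c d) => M e; apply: is01_and => //; exact: im_R.
- exists (tnot (Mul (tnot c) (tnot d))) => M e; have R := im_R M.
  have H := is01_not M R _ _ (is01_and M R _ _ _ _ (is01_not M R _ _ (Hc M e)) (is01_not M R _ _ (Hd M e))).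
  apply: is01_iff H => /=; case: (classic (sat e A)); case: (classic (sat e B)); tauto.
- have Hn : charac (Neg A) (tnot c) by move=> M e; apply: is01_not; first exact: im_R.
  have [[d Hd] _] := charac_ex t _ _ Hn; exists (tnot d) => M e.
  apply: is01_iff (is01_not M (im_R M) _ _ (Hd M e)).
  rewrite /=; split=> [H x le|H [x [le nA]]]; last exact: nA (H x le).
  by apply: NNPP => nA; apply: H; exists x.
- by have [] := charac_ex t _ _ Hc.
Qed.

Lemma io_IDelta0 (M : iomodel) : models M IDelta0_EXP.
Proof.
move=> _ [A|A bA] e; first exact: im_R.
have [c Hc] := charac_bounded A bA; have HM := im_R M => /= -[A0 AS] x.
have E y : sat (y .: e) A <-> eval (y .: e) c = m1 by rewrite (is01_1 _ HM _ _ (Hc M _)).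
rewrite E; move: x; apply: io_ind => [||x].
- by apply: defP_eq; [apply: defT_app; exact: defT_id|exact: defT_const].
- by rewrite -E; move: A0; rewrite sat_inst1.
rewrite -!E => /AS; rewrite sat_inst /= apps_cons apps_nil.
by [].
Qed.

(** The head of the list belongs to the innermost quantifier: the other terms are found first, for
    the formula quantified by it, and are then substituted into its own term. *)
Lemma skolem (ps : list term) : forall A, bounded A -> exists fs : list term,
  length fs = length ps /\
  (forall (M : model) (e : nat -> M), models M R_exp -> Forall2 mle (map (eval e) fs) (map (eval e) ps)) /\
  forall (M : iomodel) (e : nat -> M) us, Forall2 mle us (map (eval e) ps) -> sat (apps us e) A ->
    sat (apps (map (eval e) fs) e) A.
Proof.
elim: ps => [|p ps IH] A bA.
  exists []; split=> //; split=> [M e _|M e us H]; first by constructor.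
  by inversion H.
have [c Hc] := charac_bounded A bA.
have [_ [w [wp wA]]] := charac_ex (lift_t (length ps) p) A c Hc.
have [fs [lfs [fp fA]]] := IH _ (bd_ex (lift_t (length ps) p) A bA).
have ev (M : model) (e : nat -> M) :
    eval e (subst_t (inst fs Var) w) = eval (apps (map (eval e) fs) e) w.
  by rewrite eval_subst inst_apps apps_map.
exists (subst_t (inst fs Var) w :: fs); split; first by rewrite /= lfs.
split=> [M e HM|M e us H satA] /=.
  constructor; last exact: fp.
  rewrite ev; have := wp M (apps (map (eval e) fs) e) HM.
  by rewrite -lfs -(length_map (eval e) fs) eval_lift.
inversion H as [|u p' us' ps' le Hus E1 E2]; subst us p' ps'.
rewrite apps_cons ev; apply: wA; apply: (fA M e us' Hus); exists u; split.
  rewrite /= eval_lift1; have := Forall2_length Hus; rewrite length_map => <-.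
  by rewrite eval_lift.
by move: satA; rewrite apps_cons.
Qed.

(** * The quantifier-free induction rule *)

(** The quantifier-free theorems of open induction over R(exp). *)
Inductive U : form -> Prop :=
| U_ax A : qfree A -> (forall (M : model) (e : nat -> M), models M R_exp -> sat e A) -> U A
| U_mp A B : U (Imp A B) -> U A -> U B
| U_sub s A : U A -> U (subst_f s A)
| U_induct A : U (subst_f (inst [Zero] Var) A) ->
    U (Imp A (subst_f (inst [Add (Var 0) One] (shift 1)) A)) -> U A.

Lemma U_qfree A : U A -> qfree A.
Proof.
elim=> {A} [A //|A B _ [] //|s A _ IH|A _ _ _ [] //]; exact: qfree_subst.
Qed.

Lemma U_cons1 A C : qfree C -> U A ->
  (forall (M : model) (e : nat -> M), models M R_exp -> sat e A -> sat e C) -> U C.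
Proof.
by move=> qC UA H; apply: (U_mp A) => //; apply: U_ax => //; split=> //; exact: U_qfree.
Qed.

Lemma U_cons2 A B C : qfree C -> U A -> U B ->
  (forall (M : model) (e : nat -> M), models M R_exp -> sat e A -> sat e B -> sat e C) -> U C.
Proof.
move=> qC UA UB H; apply: (U_cons1 (And A B)) => // [|M e HM [a b]]; last exact: H.
apply: (U_mp B) => //; apply: (U_mp A) => //; apply: U_ax => //=.
by have := U_qfree _ UA; have := U_qfree _ UB.
Qed.

Fixpoint imps (L : list form) (C : form) : form :=
  match L with [] => C | A :: L => Imp A (imps L C) end.

Lemma sat_imps (M : model) (e : nat -> M) L C :
  sat e (imps L C) <-> ((forall B, In B L -> sat e B) -> sat e C).
Proof.
elim: L => [|A L IH] /=; first by split=> [//|]; apply.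
rewrite IH; split=> [H HL|H a HL].
  by apply: H => [|B inB]; apply: HL; [left|right].
by apply: H => B [<- //|]; exact: HL.
Qed.

Lemma subst_imps s L C : subst_f s (imps L C) = imps (map (subst_f s) L) (subst_f s C).
Proof. by elim: L => //= A L ->. Qed.

Lemma qfree_imps L C : (forall B, In B L -> qfree B) -> qfree C -> qfree (imps L C).
Proof.
elim: L => //= A L IH H qC; split; first by apply: H; left.
by apply: IH => // B inB; apply: H; right.
Qed.

Lemma qfree_imps_r L C : qfree (imps L C) -> qfree C.
Proof. by elim: L => //= A L IH [_ /IH]. Qed.

Lemma qfree_R_exp A : R_exp A -> qfree A.
Proof. by case=> [_ []| |]. Qed.

(** * A model of open induction from underivability *)

Section Conservativity.
Let Con (L : list form) := (forall B, In B L -> qfree B) /\ ~ U (imps L Bot).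
Local Notation "A .[ t ]" := (subst_f (inst [t] Var) A).

Let con_split L A B : (forall D, In D L -> qfree D) -> qfree A -> qfree B -> ~ U (imps L Bot) ->
  U (imps L (Or A B)) -> ~ U (imps (A :: L) Bot) \/ ~ U (imps (B :: L) Bot).
Proof.
move=> qL qA qB nL UL; apply: NNPP => H; apply: nL.
have [UA UB] : U (imps (A :: L) Bot) /\ U (imps (B :: L) Bot) by split; apply: NNPP; tauto.
have qbot : qfree (imps L Bot) by exact: qfree_imps.
have H1 : U (Imp (Or A B) (imps L Bot)).
  by apply: (U_cons2 _ _ _ _ UA UB) => //= M e HM a b [].
apply: (U_cons2 _ _ _ qbot H1 UL) => M e HM /= h1; rewrite !sat_imps => h2 HL.
by have := h1 (h2 HL); rewrite sat_imps; apply.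
Qed.

(** If all three extensions were inconsistent, [L] would yield [A] at 0 and, for a fresh [v], the
    step from [v] to [v + 1]. Binding [v] makes the induction rule applicable, so [L] would yield
    [A] at [t], against the second extension. *)
Let ind_step L A t : Con L -> qfree A -> exists C,
  [/\ C = Neg A.[Zero] \/ C = A.[t] \/ (exists v, C = And A.[Var v] (Neg A.[Add (Var v) One])), qfree C &
      ~ U (imps (C :: L) Bot)].
Proof.
move=> [qL nL] qA; apply: NNPP => H; apply: nL.
have qAs s : qfree (subst_f s A) by exact: qfree_subst.
have refute C : (C = Neg A.[Zero] \/ C = A.[t] \/ (exists v, C = And A.[Var v] (Neg A.[Add (Var v) One]))) ->
    qfree C -> U (imps (C :: L) Bot).
  by move=> HC qC; apply: NNPP => nU; apply: H; exists C.
have U0 : U (imps L A.[Zero]).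
  apply: (U_cons1 (imps (Neg A.[Zero] :: L) Bot)).
  - exact: qfree_imps.
  - by apply: refute; [left|split].
  by move=> M e HM /=; rewrite !sat_imps => h1 HL; apply: NNPP => n; apply: h1.
have Ut : U (imps (A.[t] :: L) Bot) by apply: refute => //; right; left.
have [n1 Hn1] := forms_below L; have [n2 Hn2] := form_below A.
pose v := n1 + n2.
have Uv : U (imps L (Imp A.[Var v] A.[Add (Var v) One])).
  apply: (U_cons1 (imps (And A.[Var v] (Neg A.[Add (Var v) One]) :: L) Bot)).
  - by apply: qfree_imps => //; split.
  - by apply: refute; [right; right; exists v|split; [|split]].
  by move=> M e HM /=; rewrite !sat_imps => h1 HL a; apply: NNPP => n; apply: h1.
have UB : U (imps (map (lift_f 1) L) A).
  apply: U_induct.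
    rewrite subst_imps map_map; have -> // : map (fun B => (lift_f 1 B).[Zero]) L = L.
    rewrite -[RHS]map_id; apply: map_ext => B.
    by rewrite inst1 subst_f_lift1 subst_f_id.
  have /= := U_sub (bind v) _ Uv; rewrite subst_imps bind_lifts; last first.
    by move=> B inB; apply: fv_below_mono (Hn1 _ inB); rewrite /v; lia.
  rewrite /= bind_inst; last by apply: fv_below_mono Hn2; rewrite /v; lia.
  have -> : subst_f (bind v) A.[Add (Var v) One] = subst_f (inst [Add (Var 0) One] (shift 1)) A.
    rewrite subst_f_comp.
    have fv : fv_below (S v) A by apply: fv_below_mono Hn2; rewrite /v; lia.
    apply: fv => -[|i] lt; rewrite !inst1 /= /bind; first by rewrite Nat.eqb_refl.
    by case: Nat.eqb_spec => // ?; lia.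
  have qL1 B : In B (map (lift_f 1) L) -> qfree B.
    by case/in_map_iff => D [<- /qL qD]; exact: qfree_subst.
  have EL : map (subst_f (inst [Add (Var 0) One] (shift 1))) (map (lift_f 1) L) = map (lift_f 1) L.
    by rewrite map_map; apply: map_ext => B; rewrite inst1 subst_f_lift1.
  rewrite subst_imps EL => UvL; apply: (U_cons1 _ _ _ UvL) => [|M e HM].
    by split; apply: qfree_imps.
  by rewrite /= !sat_imps /= => h1 h2 h3; apply: h1 => //; apply: h2.
have := U_sub (inst [t] Var) _ UB; rewrite subst_imps map_map.
have -> : map (fun B => (lift_f 1 B).[t]) L = L.
  by rewrite -[RHS]map_id; apply: map_ext => B; rewrite inst1 subst_f_lift1 subst_f_id.
move=> UAt; apply: (U_cons2 _ _ _ _ UAt Ut); first exact: qfree_imps.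
by move=> M e HM /=; rewrite !sat_imps => h1 h2 HL; apply: h2 => //; exact: h1.
Qed.

(** Each stage decides a formula and settles its induction at one term, as in [ind_step]. The
    elements of the term model are classes of terms, so no element can violate induction. *)
Theorem conservativity A : qfree A ->
  (forall (M : iomodel) (e : nat -> M), sat e A) -> U A.
Proof.
move=> qA valid; apply: NNPP => nUA.
have [en en_surj] := form_term_enum.
pose Opt n C := let B := (en n).1 in let t := (en n).2 in qfree B ->
  exists C1 C2, [/\ C = And C1 C2, C1 = B \/ C1 = Neg B &
    C2 = Neg B.[Zero] \/ C2 = B.[t] \/ exists v, C2 = And B.[Var v] (Neg B.[Add (Var v) One])].
have step n L : Con L -> exists C, Opt n C /\ Con (C :: L).
  move=> conL; rewrite /Opt; move: (en n).1 (en n).2 => B t.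
  case: (classic (qfree B)) => [qB|nqB]; last first.
    exists Top; split=> //; case: conL => qL nL; split=> [D [<- //|] //|]; first exact: qL.
    move=> H; apply: nL; apply: (U_cons1 _ _ _ H); first exact: qfree_imps.
    by move=> M e HM /=; rewrite !sat_imps => h1 HL; apply: h1.
  have [C2 [HC2 qC2 nC2]] := ind_step L B t conL qB.
  have qL2 D : In D (C2 :: L) -> qfree D by case=> [<- //|]; case: conL => qL _; exact: qL.
  have qBot : qfree (imps (C2 :: L) Bot) by exact: qfree_imps.
  have [C1 [HC1 nC1]] : exists C1, (C1 = B \/ C1 = Neg B) /\ ~ U (imps (C1 :: C2 :: L) Bot).
    have qNB : qfree (Neg B) by [].
    have [|H|H] := con_split (C2 :: L) B (Neg B) qL2 qB qNB nC2.
    - apply: U_ax => [|M e HM]; first by apply: qfree_imps => //=.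
      by rewrite sat_imps /= => _; exact: classic.
    - by exists B; split=> //; left.
    - by exists (Neg B); split=> //; right.
  have qC1 : qfree C1 by case: HC1 => ->.
  exists (And C1 C2); split; first by move=> _; exists C1, C2.
  split=> [D [<- //|inD]|H]; first by apply: qL2; right.
  apply: nC1; apply: (U_cons1 _ _ _ H) => //=.
  move=> M e HM /=; rewrite !sat_imps => h1 c1 c2 HL; exact: h1.
have con0 : Con [Neg A].
  split=> [D [<- //|[]]|H]; apply: nUA; apply: (U_cons1 _ _ _ H) => // M e HM /= h.
  exact: NNPP.
have [G [G0 Gopt Gfin]] := lindenbaum Con Opt step [Neg A] con0.
(* [G] contains just the choices that were made; [Gd] is its closure under consequence in the sense
   of [U]. *)
pose Gd C := exists K, (forall B, In B K -> G B) /\ U (imps K C).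
have Gq B : G B -> qfree B.
  move=> GB; have [|L [qL _] sub] := Gfin [B]; first by move=> C [<-|[]].
  by apply: qL; apply: sub; left.
have GdG B : G B -> Gd B.
  move=> GB; exists [B]; split=> [C [<- //|[]]|]; apply: U_ax => /=; first by split; exact: Gq.
  by [].
have Gdq B : Gd B -> qfree B.
  by move=> [K [_ /U_qfree]]; exact: qfree_imps_r.
have Gbot : ~ Gd Bot.
  move=> [K [/Gfin [L [qL nL] sub] UK]]; apply: nL; apply: (U_cons1 _ _ _ UK); first exact: qfree_imps.
  by move=> M e HM; rewrite !sat_imps => h HL; apply: h => B /sub; exact: HL.
have Gprv K C : qfree C -> (forall B, In B K -> Gd B) -> prv R_exp K C -> Gd C.
  move=> qC GK H.
  have [K' [GK' UK']] : exists K', (forall B, In B K' -> G B) /\ forall B, In B K -> U (imps K' B).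
    elim: K GK {H} => [|D K IH] GK; first by exists [].
    have [K1 [G1 U1]] := IH (fun B inB => GK B (or_intror inB)).
    have [K2 [G2 U2]] := GK D (or_introl erefl).
    have qK B : In B (K2 ++ K1) -> qfree B by case/in_app_iff => [/G2|/G1]; exact: Gq.
    exists (K2 ++ K1); split=> [B /in_app_iff [/G2|/G1] //|B [<-|/U1 UB]].
      apply: (U_cons1 _ _ _ U2); first by apply: qfree_imps => //; exact: qfree_imps_r (U_qfree _ U2).
      by move=> M e HM; rewrite !sat_imps => h HL; apply: h => E inE; apply: HL; apply/in_app_iff; left.
    apply: (U_cons1 _ _ _ UB); first by apply: qfree_imps => //; exact: qfree_imps_r (U_qfree _ UB).
    by move=> M e HM; rewrite !sat_imps => h HL; apply: h => E inE; apply: HL; apply/in_app_iff; right.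
  have qK' B : In B K' -> qfree B by move/GK'; exact: Gq.
  exists K'; split=> //.
  have UL : U (imps K' (fold_right And Top K)).
    elim: K UK' {GK H} => [|D K IH] UK' /=.
apply: U_ax => [|M e HM]; first exact: qfree_imps.
      by rewrite sat_imps /=.
    have U1 := UK' D (or_introl erefl); have U2 := IH (fun B inB => UK' B (or_intror inB)).
    apply: (U_cons2 _ _ _ _ U1 U2) => [|M e HM].
      by apply: qfree_imps => //=; split; apply: qfree_imps_r; apply: U_qfree; eassumption.
    by rewrite !sat_imps /= => h1 h2 HL; split; [apply: h1|apply: h2].
  apply: (U_cons1 _ _ _ UL) => [|M e HM]; first exact: qfree_imps.
  rewrite !sat_imps => h HL; apply: (soundness M _ _ _ HM H) => B; move: (h HL).
  by elim: K {H GK UL UK' h} => //= D K IH [d /IH IHK] [<- //|].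
have Gdec B : qfree B -> Gd B \/ Gd (Neg B).
  move=> qB; have [n E] := en_surj B Zero; have [C] := Gopt n; rewrite /Opt E /= => /(_ qB).
  move=> [C1 [C2 [-> HC1 _]]] GC.
  have GC1 : Gd C1.
    have qC := Gq _ GC; exists [And C1 C2]; split=> [D [<- //|[]]|].
    by apply: U_ax => [|M e HM /= []//]; move: qC => /= [].
  by case: HC1 => <-; [left|right].
have GK C D : qfree D -> Gd C -> (forall (M : model) (e : nat -> M), models M R_exp -> sat e C -> sat e D) -> Gd D.
  move=> qD [K [GK UK]] H; exists K; split=> //; apply: (U_cons1 _ _ _ UK) => [|M e HM].
    by apply: qfree_imps => // B /GK; exact: Gq.
  by rewrite !sat_imps => h HL; apply: (H M e HM); exact: h.
have Fq C : qfree C -> qfree C by [].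
pose M := term_model R_exp qfree Gd Fq Gprv.
pose cl := cls R_exp qfree Gd Fq Gprv.
have truth C : qfree C -> forall s : nat -> term, sat (M := M) (fun i => cl (s i)) C <-> Gd (subst_f s C).
  exact: truth_qf.
have HM : models M R_exp.
  move=> C RC e; rewrite (env_cls R_exp qfree Gd Fq Gprv e); apply/truth; first exact: qfree_R_exp.
  apply: (Gprv []) => //; first by apply: qfree_subst; exact: qfree_R_exp.
  exact: prv_ax.
have HIO : IO M.
  move=> C qC e; rewrite (env_cls R_exp qfree Gd Fq Gprv e) -/cl; pose s i := proj1_sig (e i); move=> C0 CS x.
  rewrite -(cls_val R_exp qfree Gd Fq Gprv x) -/cl; move: (proj1_sig x) => {x} t.
  have sat_at u : sat (M := M) (cl u .: (fun i => cl (s i))) C <-> Gd ((subst_f (up 1 s) C).[u]).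
    by rewrite scons_cls truth // subst_up1.
  apply/sat_at; have [n E] := en_surj (subst_f (up 1 s) C) t; have [D] := Gopt n.
  rewrite /Opt E /= => /(_ (qfree_subst _ _ qC)) [C1 [C2 [-> _ HC2]]] GC.
  have qC' u : qfree (subst_f (up 1 s) C).[u] by do 2 apply: qfree_subst.
  have GC2 : Gd C2.
    have qD := Gq _ GC; exists [And C1 C2]; split=> [D' [<- //|[]]|].
    by apply: U_ax => [|M' e' HM' /= []//]; move: qD => /= [].
  (* The first choice contradicts the base case [C0], the second is the claim, and the third
     contradicts [CS] at the class of [Var v]. *)
  case: HC2 => [E2|[<- //|[v E2]]]; exfalso; apply: Gbot.
    have G1 : Gd (subst_f (up 1 s) C).[Zero] by apply/sat_at.
    apply: (Gprv [C2; (subst_f (up 1 s) C).[Zero]]) => // [B [<- //|[<- //|[]]]|].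
    by rewrite E2; apply: (prv_impE _ _ (subst_f (up 1 s) C).[Zero]); apply: prv_hyp; [left|right; left].
  have [Gv Gnv] : Gd (subst_f (up 1 s) C).[Var v] /\ Gd (Neg (subst_f (up 1 s) C).[Add (Var v) One]).
    by split; apply: (GK _ _ _ GC2) => [|M' e' HM']; rewrite ?E2 //=; case.
  have Gv1 : Gd (subst_f (up 1 s) C).[Add (Var v) One].
    apply/sat_at; move/sat_at: Gv => /CS; rewrite /cl.
    by have /= -> := eval_term_model R_exp qfree Gd Fq Gprv (fun i => Var i) (Add (Var v) One).
  apply: (Gprv [Neg (subst_f (up 1 s) C).[Add (Var v) One]; (subst_f (up 1 s) C).[Add (Var v) One]]) => //.
    by move=> B [<- //|[<- //|[]]].
  by apply: (prv_impE _ _ (subst_f (up 1 s) C).[Add (Var v) One]); apply: prv_hyp; [left|right; left].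
have satA : sat (M := M) (fun i => cl (Var i)) A := valid (IOModel M HM HIO) (fun i => cl (Var i)).
move/truth: satA => /(_ qA); rewrite subst_f_id => GA.
apply: Gbot; apply: (Gprv [Neg A; A]) => // [B [<-|[<- //|[]]]|].
  by apply: GdG; apply: G0; left.
by apply: (prv_impE _ _ A); apply: prv_hyp; [left|right; left].
Qed.
End Conservativity.

(** * Quantifier-free flows *)

(** A flow from truth to [A], of length [T(z)], for parameters [y 0, ..., y (n-1)] bounded by [z].
    In [H] the variable 0 is the time and the variable 1 is [z]; in [A] the variable 0 is [z]. *)
Record flow (n : nat) (T : term) (H A : form) : Prop := Flow {
  fl_qf : qfree H;
  fl_0 : forall (M : model) z (y : nat -> M), models M R_exp -> sat (m0 .: (z .: y)) H;
  fl_S : forall (M : model) z (y : nat -> M) u, models M R_exp ->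
    mlt M u (eval (fun _ => z) T) -> sat (u .: (z .: y)) H -> sat (madd u m1 .: (z .: y)) H;
  fl_T : forall (M : model) z (y : nat -> M), models M R_exp ->
    sat (eval (fun _ => z) T .: (z .: y)) H -> (forall i, i < n -> mle (y i) z) -> sat (z .: y) A }.

Definition flows (A : form) := exists n T H, flow n T H A.

Lemma flows_valid A : (forall (M : model) (e : nat -> M), models M R_exp -> sat e A) -> flows A.
Proof. by move=> HA; exists 0, Zero, Top; split=> //= M z y HM _ _; exact: HA. Qed.

Lemma eval_z (M : model) z (e : nat -> M) T : e 1 = z ->
  eval e (subst_t (fun _ => Var 1) T) = eval (fun _ => z) T.
Proof. by move=> <-; rewrite eval_subst. Qed.

Section Time.
Variables (M : model) (HM : models M R_exp).
Implicit Types u a b : M.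

Definition mmin a b := msub a (msub a b).

Lemma mmin_cases a b : (mle a b /\ mmin a b = a) \/ (mle b a /\ mmin a b = b).
Proof.
case: (m_lt_or M HM a b) => [le|[le _]]; [left|right]; split=> //.
  by rewrite /mmin (proj2 (msub_eq0 M HM a b) le) msub0.
exact: (tminE M HM (a .: (b .: fun _ => m0)) (Var 0) (Var 1) le).
Qed.

Lemma msub_succ u a : mle a u -> msub (madd u m1) a = madd (msub u a) m1.
Proof.
move=> le; apply: (maddI M HM _ _ a); rewrite msubK //.
  by rewrite maddA // [madd m1 a]maddC // -maddA // msubK.
by apply: (mle_trans M HM _ _ _ le); case: (mlt_succ M HM u).
Qed.

Lemma mlt_sub u a b : mle a u -> mlt M u (madd a b) -> mlt M (msub u a) b.
Proof.
move=> le lt; case: (m_lt_or M HM b (msub u a)) => // le'; case: (mlt_irr M HM _ _ _ lt).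
by rewrite -(msubK M HM u a le) [madd a b]maddC //; exact: mle_add.
Qed.

(** Two consecutive clocks: before [a] only the minimum advances, afterwards only the truncated
    difference. *)
Lemma time_split u a : (mlt M u a /\ mmin u a = u /\ mmin (madd u m1) a = madd u m1 /\
    msub u a = m0 /\ msub (madd u m1) a = m0) \/
  (mle a u /\ mmin u a = a /\ mmin (madd u m1) a = a /\ msub (madd u m1) a = madd (msub u a) m1).
Proof.
case: (m_lt_or M HM a u) => [le|lt]; [right|left]; split=> //.
  have le1 : mle a (madd u m1) by apply: (mle_trans M HM _ _ _ le); case: (mlt_succ M HM u).
  rewrite msub_succ //; split; last split=> //.
    by case: (mmin_cases u a) => -[h ->] //; exact: (mle_anti M HM).
  by case: (mmin_cases (madd u m1) a) => -[h ->] //; exact: (mle_anti M HM).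
have le1 := mle_succ M HM _ _ lt; have le0 := proj1 lt.
rewrite (proj2 (msub_eq0 M HM u a) le0) (proj2 (msub_eq0 M HM _ a) le1).
split; last split=> //.
  by case: (mmin_cases u a) => -[h ->] //; exact: (mle_anti M HM).
by case: (mmin_cases (madd u m1) a) => -[h ->] //; exact: (mle_anti M HM).
Qed.

End Time.

(** The flows run one after the other: the time of the first is [min(u, T1)], that of the second
    [u - T1]. *)
Lemma flows_mp2 A B C : flows A -> flows B ->
  (forall (M : model) (e : nat -> M), models M R_exp -> sat e A -> sat e B -> sat e C) -> flows C.
Proof.
move=> [n1 [T1 [H1 F1]]] [n2 [T2 [H2 F2]]] HC.
pose T1z := subst_t (fun _ => Var 1) T1.
pose tail : subst := fun i => Var (S i).
exists (n1 + n2), (Add T1 T2), (And (subst_f (tmin (Var 0) T1z .: tail) H1)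
  (subst_f (Sub (Var 0) T1z .: tail) H2)).
have ev1 (M : model) u z (y : nat -> M) : (fun i => eval (u .: (z .: y)) ((tmin (Var 0) T1z .: tail) i)) =
    mmin M u (eval (fun _ => z) T1) .: (z .: y).
  by apply: functional_extensionality => -[|i] //=; rewrite /T1z !(eval_z M z).
have ev2 (M : model) u z (y : nat -> M) : (fun i => eval (u .: (z .: y)) ((Sub (Var 0) T1z .: tail) i)) =
    msub u (eval (fun _ => z) T1) .: (z .: y).
  by apply: functional_extensionality => -[|i] //=; rewrite /T1z !(eval_z M z).
split.
- by split; apply: qfree_subst; [exact: fl_qf F1|exact: fl_qf F2].
- move=> M z y HM; rewrite /= !sat_subst ev1 ev2.
  have /(msub_eq0 M HM) E := mge0 M HM (eval (fun _ => z) T1).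
  by rewrite /mmin E msub0 //; split; [exact: fl_0 F1 M z y HM|exact: fl_0 F2 M z y HM].
- move=> M z y u HM lt; rewrite /= !sat_subst !ev1 !ev2 => -[h1 h2].
  move: h1 h2; case: (time_split M HM u (eval (fun _ => z) T1)).
    by move=> [lt1 [-> [-> [-> ->]]]] h1 h2; split=> //; exact: fl_S F1 M z y u HM lt1 h1.
  move=> [le [-> [-> ->]]] h1 h2; split=> //; apply: (fl_S _ _ _ _ F2) => //.
  exact: mlt_sub.
move=> M z y HM; rewrite /= !sat_subst !ev1 !ev2; set t1 := eval _ T1; set t2 := eval _ T2.
have -> : mmin M (madd t1 t2) t1 = t1.
  by case: (mmin_cases M HM (madd t1 t2) t1) => -[h ->] //; apply: (mle_anti M HM) => //; exact: mle_addr.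
have -> : msub (madd t1 t2) t1 = t2.
  apply: (maddI M HM _ _ t1); rewrite msubK //; [exact: maddC|exact: mle_addr].
move=> [h1 h2] le; apply: HC => //.
  by apply: (fl_T _ _ _ _ F1) => // i lt; apply: le; lia.
by apply: (fl_T _ _ _ _ F2) => // i lt; apply: le; lia.
Qed.

Lemma flows_mp1 A C : flows A ->
  (forall (M : model) (e : nat -> M), models M R_exp -> sat e A -> sat e C) -> flows C.
Proof. move=> FA H; apply: (flows_mp2 A A) => // M e HM a _; exact: H. Qed.

(** A bound for [t] that is monotone in the common bound of the variables: the operations that do
    not increase their first argument are dropped. *)
Fixpoint maj (t : term) : term :=
  match t with
  | Var _ => Var 0
  | Zero => Zero
  | One => One
  | Add a b => Add (maj a) (maj b)
  | Sub a b => maj a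
  | Mul a b => Mul (maj a) (maj b)
  | Div a b => maj a
  | Exp a => Exp (maj a)
  end.

Definition majz t := subst_t (fun _ => Var 0) (maj t).

(** Monotonicity of exponentiation has no quantifier-free proof without induction. *)
Lemma flows_exp s t : flows (Imp (Le s (subst_t (fun _ => Var 0) t))
  (Le (Exp s) (Exp (subst_t (fun _ => Var 0) t)))).
Proof.
pose tail : subst := fun i => Var (S i).
pose s' := subst_t tail s; pose t' := subst_t (fun _ => Var 1) t.
exists 0, t, (Le (Exp s') (Exp (Add s' (tmin (Var 0) (Sub t' s'))))).
have es (M : model) u z (y : nat -> M) : eval (u .: (z .: y)) s' = eval (z .: y) s.
  by rewrite /s' eval_subst.
have et (M : model) u z (y : nat -> M) : eval (u .: (z .: y)) t' = eval (fun _ => z) t by exact: eval_z.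
split=> //= [M z y HM|M z y u HM lt|M z y HM].
- rewrite es et; have /(msub_eq0 M HM) -> := mge0 M HM (msub (eval (fun _ => z) t) (eval (z .: y) s)).
  by rewrite (proj2 (msub_eq0 M HM _ _)) ?madd0 //; [exact: mle_refl|exact: mge0].
- rewrite !es !et; set d := msub _ (eval _ s); rewrite -!/(mmin M _ d).
  case: (time_split M HM u d) => [[_ [-> [-> _]]]|[_ [-> [-> _]]]] // le.
  rewrite -maddA // mexpS // mmulC // mmulD // !mmul1 //.
  by apply: (mle_trans M HM _ _ _ le); exact: mle_addr.
rewrite es et eval_subst /=; set a := eval (z .: y) s; set b := eval _ t; rewrite -/(mmin M b (msub b a)).
have -> : mmin M b (msub b a) = msub b a.
  by case: (mmin_cases M HM b (msub b a)) => -[h ->] //; apply: (mle_anti M HM) => //; exact: msub_le.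
by move=> le _ ab; rewrite maddC // msubK // in le.
Qed.

Lemma flows_maj t : flows (Le t (majz t)).
Proof.
elim: t => [i| | |a IHa b IHb|a IHa b IHb|a IHa b IHb|a IHa b IHb|a IHa].
- case: i => [|i]; first by apply: flows_valid => M e HM; exact: mle_refl.
  by exists (S i), Zero, Top; split=> //= M z y HM _ le; apply: le; lia.
- by apply: flows_valid => M e HM; exact: mle_refl.
- by apply: flows_valid => M e HM; exact: mle_refl.
- by apply: (flows_mp2 _ _ _ IHa IHb) => M e HM /=; exact: mle_add2.
- apply: (flows_mp1 _ _ IHa) => M e HM /= le; apply: (mle_trans M HM _ _ _ _ le); exact: msub_le.
- by apply: (flows_mp2 _ _ _ IHa IHb) => M e HM /=; exact: mmul2.
- apply: (flows_mp1 _ _ IHa) => M e HM /= le; apply: (mle_trans M HM _ _ _ _ le); exact: mdiv_le_num.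
apply: (flows_mp2 _ _ _ IHa (flows_exp a (maj a))) => M e HM /= le; exact.
Qed.

Definition big_conj (n : nat) (f : nat -> form) : form :=
  fold_right And Top (map f (seq 0 n)).

Lemma sat_big_conj (M : model) (e : nat -> M) n f :
  sat e (big_conj n f) <-> forall i, i < n -> sat e (f i).
Proof.
rewrite /big_conj; have E i : i < n <-> In i (seq 0 n) by rewrite in_seq; lia.
split=> [H i /E|H].
  by elim: (seq 0 n) H => //= j l IH [h1 h2] [<- //|]; exact: IH.
have {}H i : In i (seq 0 n) -> sat e (f i) by move/E; exact: H.
elim: (seq 0 n) H => //= j l IH H; split; first by apply: H; left.
by apply: IH => i inl; apply: H; right.
Qed.

Lemma qfree_big_conj n f : (forall i, qfree (f i)) -> qfree (big_conj n f).
Proof. by move=> H; rewrite /big_conj; elim: (seq 0 n) => //= i l IH; split. Qed.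

Lemma flows_big_conj n f : (forall i, flows (f i)) -> flows (big_conj n f).
Proof.
move=> H; rewrite /big_conj; elim: (seq 0 n) => [|i l IH] /=; first by apply: flows_valid => M e HM /=.
by apply: (flows_mp2 _ _ _ (H i) IH).
Qed.

(** The substituted terms may exceed [z], so the flow is run with the sum [Zs] of their majorants in
    place of [z]. That they stay below the majorants is first a hypothesis and is then discharged by
    [flows_maj]. *)
Lemma flows_sub s B : flows (lift_f 1 B) -> flows (lift_f 1 (subst_f s B)).
Proof.
move=> [n [T [H F]]].
pose m i := maj (lift_t 1 (s i)).
pose Zs := fold_right Add Zero (map m (seq 0 n)).
have m_le (M : model) z i : models M R_exp -> i < n -> mle (eval (fun _ => z) (m i)) (eval (M := M) (fun _ => z) Zs).
  move=> HM lt; have : In i (seq 0 n) by apply/in_seq; lia.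
  rewrite /Zs; elim: (seq 0 n) => //= j l IH [->|/IH le]; first exact: mle_addr.
  by apply: (mle_trans M HM _ _ _ le); rewrite maddC //; exact: mle_addr.
have F1 := flows_big_conj n _ (fun i => flows_maj (lift_t 1 (s i))).
apply: (flows_mp2 _ (Imp (big_conj n (fun i => Le (lift_t 1 (s i)) (majz (lift_t 1 (s i)))))
  (lift_f 1 (subst_f s B))) _ F1); last by move=> M e HM /= h1 h2; exact: h2.
exists 0, (subst_t (fun _ => subst_t (fun _ => Var 0) Zs) T).
exists (subst_f (Var 0 .: (subst_t (fun _ => Var 1) Zs .: (fun i => lift_t 2 (s i)))) H).
have ev (M : model) u z (y : nat -> M) :
    (fun i => eval (u .: (z .: y)) ((Var 0 .: (subst_t (fun _ => Var 1) Zs .: (fun i => lift_t 2 (s i)))) i)) =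
    u .: (eval (fun _ => z) Zs .: (fun i => eval y (s i))).
  apply: functional_extensionality => -[|[|i]] //=; rewrite eval_subst //.
have evT (M : model) (z : M) : eval (fun _ => z) (subst_t (fun _ => subst_t (fun _ => Var 0) Zs) T) =
    eval (fun _ => eval (fun _ => z) Zs) T.
  by rewrite eval_subst; congr (eval _ T); apply: functional_extensionality => i; rewrite eval_subst.
split.
- exact: qfree_subst (fl_qf _ _ _ _ F).
- by move=> M z y HM; rewrite sat_subst ev; exact: (fl_0 _ _ _ _ F).
- by move=> M z y u HM; rewrite !sat_subst !ev evT; exact: (fl_S _ _ _ _ F).
move=> M z y HM; rewrite sat_subst ev evT => h _ /= hb.
rewrite sat_lift1 sat_subst; have := fl_T _ _ _ _ F M _ _ HM h.
rewrite sat_lift1; apply=> i lt; move/sat_big_conj: hb => /(_ i lt) /=.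
rewrite eval_lift1 => le; apply: (mle_trans M HM _ _ _ le).
rewrite /majz eval_subst; exact: m_le.
Qed.

Section Division.
Variables (M : model) (HM : models M R_exp).
Implicit Types x t q r u : M.

Lemma mdiv_uniq x t q r : x = madd (mmul (madd t m1) q) r -> mle r t ->
  mdiv x t = q /\ msub x (mmul (madd t m1) q) = r.
Proof.
move=> E le; split; last first.
  apply: (maddI M HM _ _ (mmul (madd t m1) q)); rewrite msubK //; rewrite E.
    exact: maddC.
  exact: mle_addr.
have [r' E' lt'] := mdivP M HM x t.
apply: (phi_inj M HM).
have F1 := fl_uniq (zO M HM) (phi M HM x) (phi M HM (madd t m1)) (phi M HM q) (phi M HM r).
rewrite -F1.
- apply: esym; apply: (fl_uniq (zO M HM)) lt'; last exact: phi_ge0.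
  by rewrite E' ssralg.GRing.mulrC.
- by rewrite E phiD phiM ssralg.GRing.mulrC.
- exact: phi_ge0.
by apply/phi_lt/mlt_le_succ.
Qed.

Lemma mdiv_eq x t : exists2 r, x = madd (mmul (madd t m1) (mdiv x t)) r & mle r t.
Proof.
exists (msub x (mmul (madd t m1) (mdiv x t))); last by apply/(mlt_le_succ M HM); exact: mdiv_lt.
by rewrite maddC // msubK //; exact: mdiv_le.
Qed.

Lemma mdiv_step u t : let s := mdiv u t in let r := msub u (mmul (madd t m1) s) in
  let s' := mdiv (madd u m1) t in let r' := msub (madd u m1) (mmul (madd t m1) s') in
  (mlt M r t /\ s' = s /\ r' = madd r m1) \/ (r = t /\ s' = madd s m1 /\ r' = m0).
Proof.
move=> s r s' r'; have [r0 E le] := mdiv_eq u t; have [_ Er] := mdiv_uniq _ _ _ _ E le.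
rewrite -/s -/r in E Er; rewrite -Er in E le.
case: (classic (r = t)) => [rt|ne]; [right|left].
  have E' : madd u m1 = madd (mmul (madd t m1) (madd s m1)) m0.
    by rewrite E rt madd0 // mmulD // mmul1 // maddA.
  have [E1 E2] := mdiv_uniq _ _ _ _ E' (mge0 M HM t).
  by rewrite /r' /s' E1 E2.
have lt : mlt M r t by [].
have E' : madd u m1 = madd (mmul (madd t m1) s) (madd r m1) by rewrite E maddA.
have [E1 E2] := mdiv_uniq _ _ _ _ E' (mle_succ M HM _ _ lt).
by rewrite /r' /s' E1 E2.
Qed.

End Division.

(** At time [(T + 1) s + r] the flow of the step has reached the inner time [r] for the value
    [min(x, s)] of the induction variable. All stages are equally long because [T] depends on [z]
    alone; the extra tick of each stage leads to the next one. After [z] stages [x] has been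
    reached. *)
Lemma flows_loop A : flows (lift_f 1 (Imp A (subst_f (inst [Add (Var 0) One] (shift 1)) A))) -> qfree A ->
  flows (lift_f 1 (Imp (subst_f (inst [Zero] (shift 1)) A) A)).
Proof.
move=> [n [T [H F]]] qA.
pose t := subst_t (fun _ => Var 1) T.
pose s := Div (Var 0) t.
pose r := Sub (Var 0) (Mul (Add t One) s).
pose m := tmin (Var 2) s.
pose tail : subst := fun i => Var (S (S (S i))).
pose G := big_conj (S n) (fun i => Le (Var (S (S i))) (Var 1)).
have satG (M : model) u z (y : nat -> M) : sat (u .: (z .: y)) G <-> forall i, i < S n -> mle (y i) z.
  exact: sat_big_conj.
have qG : qfree G by exact: qfree_big_conj.
(* With [S n], the induction variable, which is parameter 0, is bounded by [z] even if [n] is 0. *)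
clearbody G; exists (S n), (Mul (Add T One) (Var 0)).
exists (Imp G (Imp (subst_f (Zero .: tail) A)
  (And (subst_f (m .: tail) A) (subst_f (r .: (Var 1 .: (m .: tail))) H)))).
pose P (M : model) (u z x : M) (y : nat -> M) : Prop :=
  (forall i, i < S n -> mle ((x .: y) i) z) -> sat (m0 .: y) A ->
  let t := eval (fun _ => z) T in let s := mdiv u t in
  sat (mmin M x s .: y) A /\ sat (msub u (mmul (madd t m1) s) .: (z .: (mmin M x s .: y))) H.
have EP (M : model) u z x (y : nat -> M) : sat (u .: (z .: (x .: y))) (Imp G (Imp (subst_f (Zero .: tail) A)
  (And (subst_f (m .: tail) A) (subst_f (r .: (Var 1 .: (m .: tail))) H)))) <-> P M u z x y.
  rewrite /= satG !sat_subst /P.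
  have et : eval (u .: (z .: (x .: y))) t = eval (fun _ => z) T by exact: eval_z.
  have -> : (fun i => eval (u .: (z .: (x .: y))) ((Zero .: tail) i)) = m0 .: y.
    by apply: functional_extensionality => -[|i].
  have -> : (fun i => eval (u .: (z .: (x .: y))) ((m .: tail) i)) =
      mmin M x (mdiv u (eval (fun _ => z) T)) .: y.
    by apply: functional_extensionality => -[|i] //=; rewrite !et.
  have -> // : (fun i => eval (u .: (z .: (x .: y))) ((r .: (Var 1 .: (m .: tail))) i)) =
      msub u (mmul (madd (eval (fun _ => z) T) m1) (mdiv u (eval (fun _ => z) T))) .:
      (z .: (mmin M x (mdiv u (eval (fun _ => z) T)) .: y)).
  by apply: functional_extensionality => -[|[|[|i]]] //=; rewrite !et.
have Ey (M : model) (y : nat -> M) : y = y 0 .: (fun i => y (S i)).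
  by apply: functional_extensionality => -[|i].
split.
- split=> //; by do !split; apply: qfree_subst => //; exact: fl_qf F.
- move=> M z y HM; rewrite (Ey M y); apply/EP => le A0; cbv zeta.
  have [D1 D2] := mdiv_uniq M HM m0 (eval (fun _ => z) T) m0 m0
    ltac:(by rewrite mmul0 // madd0) (mge0 M HM _).
  rewrite D1 D2; have -> : mmin M (y 0) m0 = m0.
    by case: (mmin_cases M HM (y 0) m0) => -[h ->] //; exact: mle0.
  by split=> //; exact: fl_0 F M _ _ HM.
- move=> M z y u HM _; rewrite (Ey M y) => /EP IH; apply/EP => le A0; cbv zeta.
  move: (y 0) (fun i => y (S i)) le A0 IH => x {}y le A0 /(_ le A0); cbv zeta.
  set tz := eval _ T; set s0 := mdiv u tz => -[As Hs].
  case: (mdiv_step M HM u tz) => [[lt [-> ->]]|[E [-> ->]]]; rewrite -/s0.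
    by split=> //; apply: (fl_S _ _ _ _ F) lt Hs.
  rewrite -/s0 in E; rewrite E in Hs.
  have := fl_T _ _ _ _ F M _ _ HM Hs => H1.
  have mx : mle (mmin M x s0) x by exact: msub_le.
  have {}H1 : sat (madd (mmin M x s0) m1 .: y) A.
    have : sat (z .: (mmin M x s0 .: y)) (lift_f 1 (Imp A (subst_f (inst [Add (Var 0) One] (shift 1)) A))).
      apply: H1 => -[|i] lt /=; last by apply: (le (S i)); lia.
      by apply: (mle_trans M HM _ _ _ mx); apply: (le 0); lia.
    rewrite sat_lift1 /= => /(_ As); rewrite sat_inst /= apps_cons apps_nil.
    by [].
  split; last exact: fl_0 F M _ _ HM.
  case: (m_lt_or M HM x s0) => [xs|lt].
    have xs' : mle x (madd s0 m1) by apply: (mle_trans M HM _ _ _ xs); exact: mle_addr.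
    have -> : mmin M x (madd s0 m1) = x.
      by case: (mmin_cases M HM x (madd s0 m1)) => -[h ->] //; exact: (mle_anti M HM).
    have Ex : mmin M x s0 = x.
      by case: (mmin_cases M HM x s0) => -[h ->] //; exact: (mle_anti M HM).
    by rewrite -Ex.
  have sx := mle_succ M HM _ _ lt.
  have -> : mmin M x (madd s0 m1) = madd s0 m1.
    by case: (mmin_cases M HM x (madd s0 m1)) => -[h ->] //; exact: (mle_anti M HM).
  have <- : mmin M x s0 = s0; last exact: H1.
  by case: (mmin_cases M HM x s0) => -[h ->] //; apply: (mle_anti M HM) => //; case: lt.
move=> M z y HM; rewrite (Ey M y) => /EP; move: (y 0) (fun i => y (S i)) => x {}y HP le.
rewrite sat_lift1 /= sat_inst /= apps_cons apps_nil => A0; have [] := HP le A0.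
have [-> _] := mdiv_uniq M HM (mmul (madd (eval (fun _ => z) T) m1) z) (eval (fun _ => z) T) z m0
  ltac:(by rewrite madd0) (mge0 M HM _).
have -> // : mmin M x z = x.
case: (mmin_cases M HM x z) => -[h ->] //; apply: (mle_anti M HM) => //; apply: (le 0); lia.
Qed.

(** The lifting frees the variable 0 for the bound [z]. *)
Theorem U_flows A : U A -> flows (lift_f 1 A).
Proof.
elim=> {A} [A qA valid|A B UAB FAB UA FA|s A UA FA|A U0 F0 U1 F1].
- by apply: flows_valid => M e HM; rewrite sat_subst; exact: valid.
- by apply: (flows_mp2 _ _ _ FAB FA) => M e HM /=; apply.
- exact: flows_sub.
have qA : qfree A by have [] := U_qfree _ U1.
have FL := flows_loop A F1 qA.
have E : lift_f 1 (subst_f (inst [Zero] Var) A) = subst_f (inst [Zero] (shift 1)) A.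
  by rewrite subst_f_comp; apply: subst_f_ext => -[|i] //; rewrite !inst1.
have := flows_sub (shift 1) _ F0; rewrite E => F0'.
by apply: (flows_mp2 _ _ _ FL F0') => M e HM /=; apply.
Qed.

(** * Reductions as games *)

Section Sat.
Variable M : model.
Implicit Types e : nat -> M.

Definition below (us : list M) e (ps : list term) : Prop := Forall2 mle us (map (eval e) ps).

Lemma below_length us e ps : below us e ps -> length us = length ps.
Proof. by move/Forall2_length; rewrite length_map. Qed.

Fixpoint psat e (A : pform) : Prop :=
  match A with
  | Mat A => sat e A
  | BAll ps C => forall us, below us e ps -> psat (apps us e) C
  | BEx ps C => exists2 us, below us e ps & psat (apps us e) C
  end.

Lemma sat_all_block ps : forall e A,
  sat e (all_block ps A) <-> forall us, below us e ps -> sat (apps us e) A.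
Proof.
elim: ps => [|p ps IH] e A /=.
  split=> [H us Hus|H]; last by rewrite -(apps_nil _ e); apply: H; constructor.
  by inversion Hus; rewrite apps_nil.
rewrite IH; split=> H us Hus; last first.
  move=> u /=; rewrite -(below_length _ _ _ Hus) eval_lift1 eval_lift => le.
  by rewrite -apps_cons; apply: H; constructor.
inversion Hus as [|u p' us' ps' le Hus' E1 E2]; subst.
rewrite apps_cons; apply: (H us' Hus').
by rewrite /= -(below_length _ _ _ Hus') eval_lift1 eval_lift.
Qed.

Lemma sat_ex_block ps : forall e A,
  sat e (ex_block ps A) <-> exists2 us, below us e ps & sat (apps us e) A.
Proof.
elim: ps => [|p ps IH] e A /=.
  split=> [H|[us Hus]]; first by exists []; [constructor|rewrite apps_nil].
  by inversion Hus; rewrite apps_nil.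
rewrite IH; split=> [[us Hus [u /= []]]|[us Hus]].
  rewrite -(below_length _ _ _ Hus) eval_lift1 eval_lift => le satA.
  by exists (u :: us); [constructor|rewrite apps_cons].
inversion Hus as [|u p' us' ps' le Hus' E1 E2]; subst; rewrite apps_cons => satA.
by exists us' => //; exists u; rewrite /= -(below_length _ _ _ Hus') eval_lift1 eval_lift.
Qed.

Lemma sat_to_form A : forall e, sat e (to_form A) <-> psat e A.
Proof.
elim: A => [A|ps C IH|ps C IH] e //=.
  by rewrite sat_all_block; split=> H us Hus; apply/IH/H.
by rewrite sat_ex_block; split=> -[us Hus H]; exists us => //; apply/IH.
Qed.

Lemma map_eval_vars vs e : map (eval (apps vs e)) (vars (length vs)) = vs.
Proof.
apply: nth_error_ext => i; rewrite nth_error_map.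
case: (Nat.lt_ge_cases i (length vs)) => H.
  rewrite nth_error_vars //= /apps.
  by case E: (nth_error vs i) => //; move/nth_error_None: E; lia.
by rewrite !(proj2 (nth_error_None _ _)) // length_vars.
Qed.

Lemma map_eval_lift vs e ts : map (eval (apps vs e)) (map (lift_t (length vs)) ts) = map (eval e) ts.
Proof. by rewrite map_map; apply: map_ext => t; rewrite eval_lift. Qed.

Lemma sat_tuple_le e ts ps : length ts = length ps ->
  sat e (tuple_le ts ps) <-> below (map (eval e) ts) e ps.
Proof.
elim: ts ps => [|t ts IH] [|p ps] //= => [_|[E]].
  by split=> // _; constructor.
rewrite IH //; split=> [[h1 h2]|H]; first by constructor.
by inversion H.
Qed.

Lemma env_split n e : exists us e', length us = n /\ e = apps us e'.
Proof.
exists (map e (seq 0 n)), (fun i => e (n + i)); rewrite length_map length_seq; split=> //.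
apply: functional_extensionality => i; rewrite /apps nth_error_map nth_error_seq length_map length_seq.
by case: Nat.ltb_spec => //= H; congr e; lia.
Qed.

Lemma psat_subst A : forall e s, psat e (subst_p s A) <-> psat (fun i => eval e (s i)) A.
Proof.
have ev e s us ps : below us e (map (subst_t s) ps) <-> below us (fun i => eval e (s i)) ps.
  by rewrite /below map_map; under map_ext => t do rewrite eval_subst.
elim: A => [A|ps C IH|ps C IH] e s /=; first exact: sat_subst.
  split=> H us Hus; [have := H us (proj2 (ev _ _ _ _) Hus)|have := H us (proj1 (ev _ _ _ _) Hus)];
    rewrite IH; have L := below_length _ _ _ Hus; rewrite ?length_map in L; rewrite -L eval_up //.
split=> -[us Hus H]; exists us; [exact/ev| |exact/ev|]; move: H; rewrite IH;
  have L := below_length _ _ _ Hus; rewrite ?length_map in L; rewrite -L eval_up //.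
Qed.

(** Plays of the reduction of [A] to [B] by [F]: universal moves are made in [B], existential ones
    in [A], and [F] answers in the other formula.  [K] collects the bounds of the moves. *)
Fixpoint game (F : list (list term)) (K : Prop) e (A : pform) eA (B : pform) eB : Prop :=
  match F, A, B with
  | [], Mat a, Mat b => K -> sat eA a -> sat eB b
  | f :: F, BAll ps C, BAll qs D => forall vs, length vs = length qs ->
      let e' := apps vs e in let fs := map (eval e') f in
      (below vs eB qs -> below fs eA ps) /\
      game F (K /\ below vs eB qs) e' C (apps fs eA) D (apps vs eB)
  | f :: F, BEx ps C, BEx qs D => forall us, length us = length ps ->
      let e' := apps us e in let fs := map (eval e') f in
      (below us eA ps -> below fs eB qs) /\
      game F (K /\ below us eA ps) e' C (apps us eA) D (apps fs eB)
  | _, _, _ => False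
  end.

Lemma game_psat F : forall K e A eA B eB, game F K e A eA B eB -> K -> psat eA A -> psat eB B.
Proof.
elim: F => [|f F IH] K e [a|ps C|ps C] eA [b|qs D|qs D] eB //=.
- move=> H k HA vs Hvs; have [h1 h2] := H vs (below_length _ _ _ Hvs).
  by apply: IH h2 (conj k Hvs) _; apply: HA; exact: h1.
move=> H k [us Hus HC]; have [h1 h2] := H us (below_length _ _ _ Hus).
exists (map (eval (apps us e)) f); first exact: h1.
exact: IH h2 (conj k Hus) HC.
Qed.

(** [A] at [e] is [A0] at [eA] with a guard [G] on the matrix. *)
Fixpoint rep e (A A0 : pform) eA (G : Prop -> Prop) : Prop :=
  match A, A0 with
  | Mat a, Mat a0 => sat e a <-> G (sat eA a0)
  | BAll ps C, BAll ps0 C0 | BEx ps C, BEx ps0 C0 =>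
      map (eval e) ps = map (eval eA) ps0 /\
      forall vs, length vs = length ps -> rep (apps vs e) C C0 (apps vs eA) G
  | _, _ => False
  end.

Lemma rep_refl A : forall e, rep e A A e id.
Proof. by elim: A. Qed.

Lemma rep_guard (op : form -> form -> form) (h : Prop -> Prop -> Prop) P A :
  (forall e X Y, sat e (op X Y) <-> h (sat e X) (sat e Y)) ->
  (forall X Y Z, (Y <-> Z) -> (h X Y <-> h X Z)) ->
  forall A0 e eA G, rep e A A0 eA G -> rep e (guard op P A) A0 eA (fun X => h (sat e P) (G X)).
Proof.
move=> Hop Hh; elim: A P => [a|ps C IH|ps C IH] P [a0|ps0 C0|ps0 C0] e eA G //=.
- by move=> E; rewrite Hop; apply: Hh.
- move=> [E H]; split=> // vs L; have := IH (lift_f (length ps) P) C0 _ _ _ (H vs L).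
  have -> // : sat (apps vs e) (lift_f (length ps) P) = sat e P.
  by apply: PropExtensionality.propositional_extensionality; rewrite -L sat_lift.
- move=> [E H]; split=> // vs L; have := IH (lift_f (length ps) P) C0 _ _ _ (H vs L).
  have -> // : sat (apps vs e) (lift_f (length ps) P) = sat e P.
  by apply: PropExtensionality.propositional_extensionality; rewrite -L sat_lift.
Qed.

Lemma rep_subst A : forall s A0 e eA G, rep (fun i => eval e (s i)) A A0 eA G -> rep e (subst_p s A) A0 eA G.
Proof.
have ev e s ps : map (eval e) (map (subst_t s) ps) = map (eval (fun i => eval e (s i))) ps.
  by rewrite map_map; apply: map_ext => t; rewrite eval_subst.
elim: A => [a|ps C IH|ps C IH] s [a0|ps0 C0|ps0 C0] e eA G //=; first by rewrite sat_subst.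
  by move=> [E H]; rewrite ev; split=> // vs L; apply: IH; rewrite length_map in L; rewrite -L eval_up; exact: H.
by move=> [E H]; rewrite ev; split=> // vs L; apply: IH; rewrite length_map in L; rewrite -L eval_up; exact: H.
Qed.

Lemma rep_imp P A A0 e eA G : rep e A A0 eA G -> rep e (guard Imp P A) A0 eA (fun X => sat e P -> G X).
Proof. by apply: (rep_guard Imp (fun X Y => X -> Y)) => // X Y Z; tauto. Qed.

Lemma rep_and P A A0 e eA G : rep e A A0 eA G -> rep e (guard And P A) A0 eA (fun X => sat e P /\ G X).
Proof. by apply: (rep_guard And and) => // X Y Z; tauto. Qed.

Lemma eval_inst_shift e f vs : (fun i => eval (apps vs e) (inst f (shift (length vs)) i)) =
  apps (map (eval (apps vs e)) f) e.
Proof.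
rewrite inst_apps apps_map; congr apps; apply: functional_extensionality => i; exact: apps_shift.
Qed.

End Sat.

(** A reduction piles up guards and substitutions, whereas a game keeps the original formulas with
    two environments; [rep] relates the two. Once the bounds collected in [K] hold, the guards have
    no effect. *)
Lemma game_of_dred (M : model) T F : models M T -> forall L A B (e : nat -> M),
  dred T L F A B -> (forall C, In C L -> sat e C) -> forall K A0 eA GA B0 eB GB,
  rep M e A A0 eA GA -> rep M e B B0 eB GB ->
  (K -> forall X, GA X <-> X) -> (K -> forall X, GB X <-> X) -> game M F K e A0 eA B0 eB.
Proof.
move=> MT; elim: F => [|f F IH] L [a|ps C|ps C] [b|qs D|qs D] e //=.
- move=> H satL K A0 eA GA B0 eB GB; case: A0 => //= a0 Ea; case: B0 => //= b0 Eb KA KB k Xa.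
  apply/(KB k)/Eb; apply: (soundness M T _ _ MT H e satL); exact/Ea/(KA k).
- move=> [Lf [Hle Hd]] satL K A0 eA GA B0 eB GB; case: A0 => //= ps0 C0 [Ep HC]; case: B0 => //= qs0 D0 [Eq HD] KA KB vs Lvs.
  have Lq : length vs = length qs.
    by rewrite Lvs; have := f_equal (@length _) Eq; rewrite !length_map.
  have satL' X : In X (map (lift_f (length qs)) L) -> sat (apps vs e) X.
    by case/in_map_iff => Y [<- inY]; rewrite -Lq sat_lift; exact: satL.
  have Ev : sat (apps vs e) (tuple_le (vars (length qs)) (map (lift_t (length qs)) qs)) <->
      below M vs eB qs0.
    rewrite sat_tuple_le ?length_vars ?length_map // -Lq /below map_eval_vars map_eval_lift -Eq //.
  have Ef : sat (apps vs e) (tuple_le f (map (lift_t (length qs)) ps)) <->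
      below M (map (eval (apps vs e)) f) eA ps0.
    by rewrite sat_tuple_le ?length_map // -Lq /below map_eval_lift Ep.
  have imp : below M vs eB qs0 -> below M (map (eval (apps vs e)) f) eA ps0.
    by have := soundness M T _ _ MT Hle _ satL'; rewrite /= Ev Ef.
  split=> //; apply: (IH _ _ _ _ Hd satL').
  + apply: rep_imp; apply: rep_subst; rewrite -Lq eval_inst_shift; apply: HC.
    by rewrite length_map.
  + by apply: rep_imp; exact: HD.
  + by case=> k bv X; rewrite -[X in _ <-> X](KA k) Ef; split=> [|//]; apply; exact: imp.
  + by case=> k bv X; rewrite -[X in _ <-> X](KB k) Ev; split=> [|//]; apply.
- move=> [Lf [Hle Hd]] satL K A0 eA GA B0 eB GB; case: A0 => //= ps0 C0 [Ep HC]; case: B0 => //= qs0 D0 [Eq HD] KA KB us Lus.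
  have Lp : length us = length ps.
    by rewrite Lus; have := f_equal (@length _) Ep; rewrite !length_map.
  have satL' X : In X (map (lift_f (length ps)) L) -> sat (apps us e) X.
    by case/in_map_iff => Y [<- inY]; rewrite -Lp sat_lift; exact: satL.
  have Eu : sat (apps us e) (tuple_le (vars (length ps)) (map (lift_t (length ps)) ps)) <->
      below M us eA ps0.
    rewrite sat_tuple_le ?length_vars ?length_map // -Lp /below map_eval_vars map_eval_lift -Ep //.
  have Ef : sat (apps us e) (tuple_le f (map (lift_t (length ps)) qs)) <->
      below M (map (eval (apps us e)) f) eB qs0.
    by rewrite sat_tuple_le ?length_map // -Lp /below map_eval_lift Eq.
  have imp : below M us eA ps0 -> below M (map (eval (apps us e)) f) eB qs0.
    by have := soundness M T _ _ MT Hle _ satL'; rewrite /= Eu Ef.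
  split=> //; apply: (IH _ _ _ _ Hd satL').
  + by apply: rep_and; exact: HC.
  + apply: rep_and; apply: rep_subst; rewrite -Lp eval_inst_shift; apply: HD.
    by rewrite length_map.
  + by case=> k bu X; rewrite -[X in _ <-> X](KA k) Eu; tauto.
  + by case=> k bu X; rewrite -[X in _ <-> X](KB k) Ef; have := imp bu; tauto.
Qed.

(** The part of a reduction that concerns shapes and lengths and has to be known before any model is
    given. *)
Fixpoint wf_red (F : list (list term)) (A B : pform) : Prop :=
  match F, A, B with
  | [], Mat _, Mat _ => True
  | f :: F, BAll ps C, BAll qs D => length f = length ps /\ wf_red F C D
  | f :: F, BEx ps C, BEx qs D => length f = length qs /\ wf_red F C D
  | _, _, _ => False
  end.

Lemma wf_guard op op' P Q F : forall A B, wf_red F A B -> forall s s',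
  wf_red F (guard op P (subst_p s A)) (guard op' Q (subst_p s' B)).
Proof.
elim: F P Q => [|f F IH] P Q [a|ps C|ps C] [b|qs D|qs D] //= [L H] s s'; rewrite length_map; split=> //; exact: IH.
Qed.

Lemma subst_p_id A : subst_p Var A = A.
Proof.
elim: A => [A|ps C IH|ps C IH] /=; rewrite ?subst_f_id ?up_id ?IH ?(map_ext _ id subst_t_id) ?map_id //.
Qed.

(** By completeness, the proofs required in [T] are replaced by plays in all models. Of [GA] and
    [GB] it is asked only that they carry an implication under [K] to an implication; adding the
    guards of a block preserves this. *)
Lemma dred_of_game T F : forall L A B, wf_red F A B ->
  (forall (M : model) (e : nat -> M), models M T -> (forall C, In C L -> sat e C) ->
     exists K A0 eA GA B0 eB GB, [/\ rep M e A A0 eA GA, rep M e B B0 eB GB,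
       (forall X Y : Prop, (K -> X -> Y) -> GA X -> GB Y) & game M F K e A0 eA B0 eB]) ->
  dred T L F A B.
Proof.
elim: F => [|f F IH] L [a|ps C|ps C] [b|qs D|qs D] //=.
- move=> _ H; apply: completeness => M MT e satL /=.
  have [K [A0 [eA [GA [B0 [eB [GB []]]]]]]] := H M e MT satL.
  case: A0 => //= a0 Ea; case: B0 => //= b0 Eb HG Hg /Ea GX; apply/Eb; exact: HG GX.
- move=> [Lf wf] H; split=> //.
  have step (M : model) (e' : nat -> M) : models M T ->
      (forall X, In X (map (lift_f (length qs)) L) -> sat e' X) -> exists vs e K C0 eA GA D0 eB GB,
      [/\ length vs = length qs, e' = apps vs e & 
        (sat e' (tuple_le (vars (length qs)) (map (lift_t (length qs)) qs)) ->
         sat e' (tuple_le f (map (lift_t (length qs)) ps)))] /\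
      [/\ rep M e' (guard Imp (tuple_le f (map (lift_t (length qs)) ps)) (subst_p (inst f (shift (length qs))) C))
           C0 eA GA, rep M e' (guard Imp (tuple_le (vars (length qs)) (map (lift_t (length qs)) qs)) D) D0 eB GB,
        (forall X Y : Prop, (K -> X -> Y) -> GA X -> GB Y) & game M F K e' C0 eA D0 eB].
    move=> MT satL'; have [vs [e [Lvs Ee']]] := env_split M (length qs) e'; subst e'.
    have satL X : In X L -> sat e X.
      by move=> inX; rewrite -(sat_lift M vs e X) Lvs; apply: satL'; exact: in_map.
    have [K [A0 [eA [GA [B0 [eB [GB []]]]]]]] := H M e MT satL.
    case: A0 => //= ps0 C0 [Ep HC]; case: B0 => //= qs0 D0 [Eq HD] HG Hg.
    have Lq0 : length vs = length qs0.
      by rewrite Lvs; have := f_equal (@length _) Eq; rewrite !length_map.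
    have Ev : sat (apps vs e) (tuple_le (vars (length qs)) (map (lift_t (length qs)) qs)) <->
        below M vs eB qs0.
      rewrite sat_tuple_le ?length_vars ?length_map // -Lvs /below map_eval_vars map_eval_lift -Eq //.
    have Ef : sat (apps vs e) (tuple_le f (map (lift_t (length qs)) ps)) <->
        below M (map (eval (apps vs e)) f) eA ps0.
      by rewrite sat_tuple_le ?length_map // -Lvs /below map_eval_lift Ep.
    have [imp Hgame] := Hg vs Lq0.
    do 9 eexists; split; first by split; [exact: Lvs|reflexivity|rewrite Ev Ef; exact: imp].
    split; [| | |exact: Hgame].
    + apply: rep_imp; apply: rep_subst; rewrite -Lvs eval_inst_shift; apply: HC.
      by rewrite length_map.
    + by apply: rep_imp; exact: HD.
    move=> X Y KXY GX; rewrite Ev => bv; apply: (HG X Y); last by apply: GX; rewrite Ef; exact: imp.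
    by move=> k; apply: KXY.
  split.
    apply: completeness => M MT e' satL' /=.
    by have [vs [e [K [C0 [eA [GA [D0 [eB [GB [[]]]]]]]]]]] := step M e' MT satL'.
  apply: IH => [|M e' MT satL'].
    by have := wf_guard Imp Imp (tuple_le f (map (lift_t (length qs)) ps)) (tuple_le (vars (length qs)) (map (lift_t (length qs)) qs)) F C D wf (inst f (shift (length qs))) Var; rewrite subst_p_id.
  have [vs [e [K [C0 [eA [GA [D0 [eB [GB [_ [h1 h2 h3 h4]]]]]]]]]]] := step M e' MT satL'.
  by exists K, C0, eA, GA, D0, eB, GB.
move=> [Lf wf] H; split=> //.
have step (M : model) (e' : nat -> M) : models M T ->
    (forall X, In X (map (lift_f (length ps)) L) -> sat e' X) -> exists us e K C0 eA GA D0 eB GB,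
    [/\ length us = length ps, e' = apps us e &
      (sat e' (tuple_le (vars (length ps)) (map (lift_t (length ps)) ps)) ->
       sat e' (tuple_le f (map (lift_t (length ps)) qs)))] /\
    [/\ rep M e' (guard And (tuple_le (vars (length ps)) (map (lift_t (length ps)) ps)) C) C0 eA GA,
      rep M e' (guard And (tuple_le f (map (lift_t (length ps)) qs)) (subst_p (inst f (shift (length ps))) D))
         D0 eB GB,
      (forall X Y : Prop, (K -> X -> Y) -> GA X -> GB Y) & game M F K e' C0 eA D0 eB].
  move=> MT satL'; have [us [e [Lus Ee']]] := env_split M (length ps) e'; subst e'.
  have satL X : In X L -> sat e X.
    by move=> inX; rewrite -(sat_lift M us e X) Lus; apply: satL'; exact: in_map.
  have [K [A0 [eA [GA [B0 [eB [GB []]]]]]]] := H M e MT satL.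
  case: A0 => //= ps0 C0 [Ep HC]; case: B0 => //= qs0 D0 [Eq HD] HG Hg.
  have Lp0 : length us = length ps0.
    by rewrite Lus; have := f_equal (@length _) Ep; rewrite !length_map.
  have Eu : sat (apps us e) (tuple_le (vars (length ps)) (map (lift_t (length ps)) ps)) <->
      below M us eA ps0.
    rewrite sat_tuple_le ?length_vars ?length_map // -Lus /below map_eval_vars map_eval_lift -Ep //.
  have Ef : sat (apps us e) (tuple_le f (map (lift_t (length ps)) qs)) <->
      below M (map (eval (apps us e)) f) eB qs0.
    by rewrite sat_tuple_le ?length_map // -Lus /below map_eval_lift Eq.
  have [imp Hgame] := Hg us Lp0.
  do 9 eexists; split; first by split; [exact: Lus|reflexivity|rewrite Eu Ef; exact: imp].
  split; [| | |exact: Hgame].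
  + by apply: rep_and; exact: HC.
  + apply: rep_and; apply: rep_subst; rewrite -Lus eval_inst_shift; apply: HD.
    by rewrite length_map.
  move=> X Y KXY [/Eu bu GX]; split; first by rewrite Ef; exact: imp.
  by apply: (HG X Y) => // k; apply: KXY.
split.
  apply: completeness => M MT e' satL' /=.
  by have [vs [e [K [C0 [eA [GA [D0 [eB [GB [[]]]]]]]]]]] := step M e' MT satL'.
apply: IH => [|M e' MT satL'].
  by have := wf_guard And And (tuple_le (vars (length ps)) (map (lift_t (length ps)) ps)) (tuple_le f (map (lift_t (length ps)) qs)) F C D wf Var (inst f (shift (length ps))); rewrite subst_p_id.
have [vs [e [K [C0 [eA [GA [D0 [eB [GB [_ [h1 h2 h3 h4]]]]]]]]]]] := step M e' MT satL'.
by exists K, C0, eA, GA, D0, eB, GB.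
Qed.

Lemma subst_p_comp A : forall s s', subst_p s (subst_p s' A) = subst_p (fun i => subst_t s (s' i)) A.
Proof.
elim: A => [A|ps C IH|ps C IH] s s' /=; first by rewrite subst_f_comp.
  by rewrite map_map length_map IH; congr BAll; [apply: map_ext => t; rewrite subst_t_comp
    |congr subst_p; rewrite up_comp].
by rewrite map_map length_map IH; congr BEx; [apply: map_ext => t; rewrite subst_t_comp
  |congr subst_p; rewrite up_comp].
Qed.

Definition in_class (p : bool) (k : nat) : pform -> Prop :=
  if p then in_Pi qfree k else in_Sigma qfree k.

Definition block (p : bool) : list term -> pform -> pform := if p then BAll else BEx.

Lemma in_class0 p A : in_class p 0 A -> exists2 a, A = Mat a & qfree a.
Proof. by case: p => H; inversion H; eexists. Qed.

Lemma in_classS p k A : in_class p (S k) A -> exists ps C, A = block p ps C /\ in_class (~~ p) k C.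
Proof. by case: p => H; inversion H; do 2 eexists. Qed.

Lemma in_class_mat p a : qfree a -> in_class p 0 (Mat a).
Proof. by case: p; constructor. Qed.

Lemma in_class_block p k ps C : in_class (~~ p) k C -> in_class p (S k) (block p ps C).
Proof. by case: p; constructor. Qed.

Lemma subst_block p s ps C : subst_p s (block p ps C) = block p (map (subst_t s) ps) (subst_p (up (length ps) s) C).
Proof. by case: p. Qed.

Lemma in_class_subst k : forall p A s, in_class p k A -> in_class p k (subst_p s A).
Proof.
elim: k => [|k IH] p A s.
  by case/in_class0 => a -> qa; apply: in_class_mat; exact: qfree_subst.
by case/in_classS => [ps [C [-> HC]]]; rewrite subst_block; apply: in_class_block; exact: IH.
Qed.

Definition left_s (m n : nat) : subst := inst (vars m) (shift (m + n)).
Definition right_s (m n : nat) : subst := inst (map Var (seq m n)) (shift (m + n)).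

Lemma merge_block op p k ps C qs D : merge op (S k) (block p ps C) (block p qs D) =
  block p (ps ++ qs) (merge op k (subst_p (left_s (length ps) (length qs)) C)
    (subst_p (right_s (length ps) (length qs)) D)).
Proof. by case: p. Qed.

Lemma in_class_merge op : (forall a b, qfree a -> qfree b -> qfree (op a b)) ->
  forall k p A B, in_class p k A -> in_class p k B -> in_class p k (merge op k A B).
Proof.
move=> Hop; elim=> [|k IH] p A B.
  case/in_class0 => a -> qa; case/in_class0 => b -> qb; apply: in_class_mat; exact: Hop.
case/in_classS => [ps [C [-> HC]]]; case/in_classS => [qs [D [-> HD]]].
by rewrite merge_block; apply: in_class_block; apply: IH; exact: in_class_subst.
Qed.

Lemma bounded_to_form k : forall p A, in_class p k A -> bounded (to_form A).
Proof.
elim: k => [|k IH] p A; first by case/in_class0 => a -> qa; exact: bd_qfree.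
case/in_classS => [ps [C [-> /IH]]]; case: p => /=; move: (to_form C) => F; elim: ps F => //= q ps IHps F bF;
  apply: IHps; by [exact: bd_all|exact: bd_ex].
Qed.

Lemma eval_left (M : model) (e : nat -> M) us vs : (fun i => eval (apps (us ++ vs) e) (left_s (length us) (length vs) i)) =
  apps us e.
Proof.
rewrite /left_s inst_apps apps_map apps_app map_eval_vars; congr apps; apply: functional_extensionality => i.
by rewrite -apps_app -length_app; exact: apps_shift.
Qed.

Lemma map_eval_seq (M : model) (e : nat -> M) us vs :
  map (eval (apps (us ++ vs) e)) (map Var (seq (length us) (length vs))) = vs.
Proof.
apply: nth_error_ext => i; rewrite !nth_error_map nth_error_seq.
case: Nat.ltb_spec => /= H; last by rewrite (proj2 (nth_error_None _ _)).
rewrite apps_app apps_shift /apps; case E: (nth_error vs i) => //.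
by move/nth_error_None: E; lia.
Qed.

Lemma eval_right (M : model) (e : nat -> M) us vs : (fun i => eval (apps (us ++ vs) e) (right_s (length us) (length vs) i)) =
  apps vs e.
Proof.
rewrite /right_s inst_apps apps_map map_eval_seq; congr apps; apply: functional_extensionality => i.
by rewrite -length_app; exact: apps_shift.
Qed.

Lemma apps_at X (xs : list X) e n i : length xs = n -> apps xs e (n + i) = e i.
Proof. by move=> <-; exact: apps_shift. Qed.

Lemma up_left m n s : (fun i => subst_t (left_s m n) (up m s i)) = (fun i => subst_t (up (m + n) s) (left_s m n i)).
Proof.
apply: functional_extensionality => i; rewrite /left_s inst_apps !up_apps.
case: (Nat.lt_ge_cases i m) => H.
  rewrite /apps nth_error_vars //= /apps nth_error_vars //= nth_error_vars //; lia.
have {H}-> : i = m + (i - m) by lia.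
move: (i - m) => {}i; rewrite !apps_at ?length_vars // subst_t_comp /= apps_at ?length_vars //.
by apply: subst_t_ext => j; rewrite /= apps_at ?length_vars.
Qed.

Lemma up_right m n s : (fun i => subst_t (right_s m n) (up n s i)) = (fun i => subst_t (up (m + n) s) (right_s m n i)).
Proof.
apply: functional_extensionality => i; rewrite /right_s inst_apps !up_apps.
have L : length (map Var (seq m n)) = n by rewrite length_map length_seq.
case: (Nat.lt_ge_cases i n) => H.
  rewrite /apps nth_error_vars //= /apps nth_error_map nth_error_seq.
  by case: Nat.ltb_spec => [_|] /=; [rewrite nth_error_vars //; lia|lia].
have {H}-> : i = n + (i - n) by lia.
move: (i - n) => {}i; rewrite !apps_at ?length_vars // subst_t_comp /= apps_at ?length_vars //.
by apply: subst_t_ext => j; rewrite /= apps_at.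
Qed.

Lemma eval_up_at (M : model) (xs : list M) (e : nat -> M) n s : length xs = n ->
  (fun i => eval (apps xs e) (up n s i)) = apps xs (fun i => eval e (s i)).
Proof. by move=> <-; exact: eval_up. Qed.

Lemma game_subst (M : model) F : forall K (e : nat -> M) A eA B eB s s', wf_red F A B ->
  game M F K e (subst_p s A) eA (subst_p s' B) eB <->
  game M F K e A (fun i => eval eA (s i)) B (fun i => eval eB (s' i)).
Proof.
have ev (e : nat -> M) s ps : map (eval e) (map (subst_t s) ps) = map (eval (fun i => eval e (s i))) ps.
  by rewrite map_map; apply: map_ext => t; rewrite eval_subst.
elim: F => [|f F IH] K e [a|ps C|ps C] eA [b|qs D|qs D] eB s s' //=; first by rewrite !sat_subst.
  move=> [Lf wf]; rewrite length_map /below !ev.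
  have Lfs e' : length (map (eval e') f : list M) = length ps by rewrite length_map.
  by split=> H vs L; have := H vs L; rewrite IH // (eval_up_at _ _ _ _ _ L) (eval_up_at _ _ _ _ _ (Lfs _)).
move=> [Lf wf]; rewrite length_map /below !ev.
have Lfs e' : length (map (eval e') f : list M) = length qs by rewrite length_map.
by split=> H us L; have := H us L; rewrite IH // (eval_up_at _ _ _ _ _ L) (eval_up_at _ _ _ _ _ (Lfs _)).
Qed.

Lemma wf_subst F : forall A B s s', wf_red F (subst_p s A) (subst_p s' B) <-> wf_red F A B.
Proof.
by elim: F => [|f F IH] [a|ps C|ps C] [b|qs D|qs D] s s' //=; rewrite length_map IH.
Qed.

(** * The merged flow *)

Inductive side := SA | SB | SH.

Definition proj {T} (X : side) (m : nat) (W : list T) : list T :=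
  match X with SA => firstn m W | SB => skipn m W | SH => W end.

Definition inner (X : side) (m n : nat) : subst :=
  match X with SA => left_s m n | SB => right_s m n | SH => Var end.

(** [A], [B], or the merge of both with the new matrix [lf]. *)
Definition pfm (X : side) (k : nat) (A B : pform) (s : subst) (lf : form) : pform :=
  match X with
  | SA => subst_p s A
  | SB => subst_p s B
  | SH => merge (fun _ _ => lf) k (subst_p s A) (subst_p s B)
  end.

Definition leaf (X : side) (M : model) (a b : form) (e0 eX : nat -> M) lf ws : Prop :=
  match X with
  | SA => sat (apps ws e0) a
  | SB => sat (apps ws e0) b
  | SH => sat (apps ws eX) lf
  end.

Lemma map_proj T T' (f : T -> T') X m W : map f (proj X m W) = proj X m (map f W).
Proof. by case: X => /=; rewrite ?firstn_map ?skipn_map. Qed.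

Lemma below_proj (M : model) (e : nat -> M) X m us ps : below M us e ps -> below M (proj X m us) e (proj X m ps).
Proof.
rewrite /below map_proj => H; case: X => //=; elim: H m => [|u v us' vs' le H IH] [|m] //=; by constructor.
Qed.

Lemma up_left_p m n s C : subst_p (left_s m n) (subst_p (up m s) C) = subst_p (up (m + n) s) (subst_p (left_s m n) C).
Proof. by rewrite !subst_p_comp up_left. Qed.

Lemma up_right_p m n s C : subst_p (right_s m n) (subst_p (up n s) C) = subst_p (up (m + n) s) (subst_p (right_s m n) C).
Proof. by rewrite !subst_p_comp up_right. Qed.

Lemma pfm_block X p k ps qs C D s lf : let m := length ps in let n := length qs in
  exists2 E, pfm X (S k) (block p ps C) (block p qs D) s lf = block p (map (subst_t s) (proj X m (ps ++ qs))) E &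
    subst_p (inner X m n) E = pfm X k (subst_p (left_s m n) C) (subst_p (right_s m n) D) (up (m + n) s) lf.
Proof.
move=> m n; case: X; rewrite /pfm /inner /proj.
- exists (subst_p (up m s) C); rewrite ?subst_block ?up_left_p //.
  by rewrite /m firstn_app firstn_all Nat.sub_diag app_nil_r.
- exists (subst_p (up n s) D); rewrite ?subst_block ?up_right_p //.
  by rewrite /m skipn_app skipn_all Nat.sub_diag.
eexists; last exact: subst_p_id.
by rewrite !subst_block merge_block !length_map map_app -/m -/n up_left_p up_right_p.
Qed.

Lemma eval_inner X (M : model) (e : nat -> M) W m n : length W = m + n ->
  (fun i => eval (apps W e) (inner X m n i)) = apps (proj X m W) e.
Proof.
move=> L; have Lm : length (firstn m W) = m by rewrite length_firstn; lia.
have Ln : length (skipn m W) = n by rewrite length_skipn; lia.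
case: X => //=.
  by have := eval_left M e (firstn m W) (skipn m W); rewrite Lm Ln firstn_skipn.
by have := eval_right M e (firstn m W) (skipn m W); rewrite Lm Ln firstn_skipn.
Qed.

(** Completes a tuple of the side [X] to one for the merged block, with [h1] or [h2] for the missing
    half. *)
Definition compl (X : side) (m n : nat) (h1 h2 : list term) : list term :=
  match X with
  | SA => vars m ++ map (lift_t m) h2
  | SB => map (lift_t n) h1 ++ vars n
  | SH => vars (m + n)
  end.

Lemma length_compl X m n h1 h2 : length h1 = m -> length h2 = n -> length (compl X m n h1 h2) = m + n.
Proof. by case: X => L1 L2; rewrite /compl ?length_app ?length_vars ?length_map; lia. Qed.

Lemma complP X (M : model) (e e0 : nat -> M) ps qs h1 h2 mv : let m := length ps in let n := length qs in
  length h1 = m -> length h2 = n -> below M (map (eval e) h1) e0 ps -> below M (map (eval e) h2) e0 qs ->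
  length mv = length (proj X m (ps ++ qs)) ->
  let W := map (eval (apps mv e)) (compl X m n h1 h2) in
  [/\ length W = m + n, proj X m W = mv, below M mv e0 (proj X m (ps ++ qs)) -> below M W e0 (ps ++ qs),
    X = SB -> firstn m W = map (eval e) h1 & X = SA -> skipn m W = map (eval e) h2].
Proof.
move=> m n L1 L2 b1 b2; have Ep : proj SA m (ps ++ qs) = ps.
  by rewrite /m /= firstn_app firstn_all Nat.sub_diag app_nil_r.
have Eq : proj SB m (ps ++ qs) = qs by rewrite /m /= skipn_app skipn_all Nat.sub_diag.
have fn T (us vs : list T) : length us = m -> firstn m (us ++ vs) = us.
  by move=> <-; rewrite firstn_app firstn_all Nat.sub_diag app_nil_r.
have sn T (us vs : list T) : length us = m -> skipn m (us ++ vs) = vs.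
  by move=> <-; rewrite skipn_app skipn_all Nat.sub_diag.
case: X => Lmv W.
- rewrite Ep in Lmv.
  have EW : W = mv ++ map (eval e) h2.
    by rewrite /W /= map_app -/m in Lmv *; rewrite -Lmv map_eval_vars map_eval_lift.
  rewrite EW Ep length_app length_map L2 Lmv; split=> //; [exact: fn|by move=> bm; rewrite /below map_app; exact: Forall2_app|].
  by move=> _; exact: sn.
- rewrite Eq in Lmv.
  have EW : W = map (eval e) h1 ++ mv.
    by rewrite /W /= map_app -/n in Lmv *; rewrite -Lmv map_eval_vars map_eval_lift.
  rewrite EW Eq length_app length_map L1 Lmv; split=> //; [apply: sn; rewrite length_map //|by move=> bm; rewrite /below map_app; exact: Forall2_app|].
  by move=> _; apply: fn; rewrite length_map.
have Lmn : length mv = m + n by rewrite Lmv /= length_app.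
have EW : W = mv by rewrite /W /= -Lmn map_eval_vars.
by rewrite EW; split.
Qed.

Fixpoint tuple_eq (ts ps : list term) : form :=
  match ts, ps with
  | t :: ts, p :: ps => And (Eq t p) (tuple_eq ts ps)
  | _, _ => Top
  end.

Lemma sat_tuple_eq (M : model) (e : nat -> M) ts ps : length ts = length ps ->
  sat e (tuple_eq ts ps) <-> map (eval e) ts = map (eval e) ps.
Proof.
elim: ts ps => [|t ts IH] [|p ps] //= [E]; rewrite IH //; split=> [[-> ->] //|].
by case.
Qed.

Lemma qfree_tuple_eq ts ps : qfree (tuple_eq ts ps).
Proof. by elim: ts ps => [|t ts IH] [|p ps] //=; split. Qed.

Lemma qfree_tuple_le ts ps : qfree (tuple_le ts ps).
Proof. by elim: ts ps => [|t ts IH] [|p ps] //=; split. Qed.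

(** Bounds on the variables of all blocks, the outer blocks last. *)
Inductive chain : nat -> form -> Prop :=
| chain0 : chain 0 Top
| chainS N Q ts : chain N Q ->
    chain (N + length ts) (And Q (lift_f N (tuple_le (vars (length ts)) (map (lift_t (length ts)) ts)))).

Lemma qfree_chain N Q : chain N Q -> qfree Q.
Proof.
elim=> //= {}N {}Q ts _ qQ; split=> //; apply: qfree_subst; exact: qfree_tuple_le.
Qed.

Lemma below_zeros (M : model) (e e0 : nat -> M) ps : models M R_exp ->
  below M (map (eval e) (repeat Zero (length ps))) e0 ps.
Proof. by move=> HM; rewrite /below; elim: ps => //= p ps IH; constructor => //; exact: mge0. Qed.

(** Skolem terms for the block that the reduction has to guess. *)
Lemma skolem_block p k ps qs C D : in_class (~~ p) k C -> in_class (~~ p) k D -> exists h1 h2,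
  [/\ length h1 = length ps, length h2 = length qs,
    forall (M : model) (e : nat -> M), models M R_exp ->
      below M (map (eval e) h1) e ps /\ below M (map (eval e) h2) e qs &
    forall (M : iomodel) (e : nat -> M), if p
      then psat M (apps (map (eval e) h1) e) C -> psat M e (block p ps C)
      else psat M e (block p qs D) -> psat M (apps (map (eval e) h2) e) D].
Proof.
move=> HC HD; case: p HC HD => HC HD.
  have bC : bounded (Neg (to_form C)) by constructor; [exact: bounded_to_form HC|exact: bd_qfree].
  have [h1 [L1 [b1 H1]]] := skolem ps _ bC.
  exists h1, (repeat Zero (length qs)); split=> //; first by rewrite repeat_length.
    by move=> M e HM; split; [exact: b1|exact: below_zeros].
  move=> M e C1 us bus; apply: NNPP => nC; apply: (H1 M e us bus) => /=; first by move/sat_to_form.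
  exact/sat_to_form.
have [h2 [L2 [b2 H2]]] := skolem qs _ (bounded_to_form _ _ _ HD).
exists (repeat Zero (length ps)), h2; split=> //; first by rewrite repeat_length.
  by move=> M e HM; split; [exact: below_zeros|exact: b2].
by move=> M e [us bus /sat_to_form D1]; apply/sat_to_form; exact: H2 bus D1.
Qed.

Lemma game_mono (M : model) F : forall (K K' : Prop) (e : nat -> M) A eA B eB, (K' -> K) ->
  game M F K e A eA B eB -> game M F K' e A eA B eB.
Proof.
elim: F => [|f F IH] K K' e [a|ps C|ps C] eA [b|qs D|qs D] eB //= KK.
- by move=> H /KK.
- move=> H vs L; have [h1 h2] := H vs L; split=> //; apply: IH h2 => -[k b]; split=> //; exact: KK.
move=> H us L; have [h1 h2] := H us L; split=> //; apply: IH h2 => -[k b]; split=> //; exact: KK.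
Qed.

Lemma game_block (M : model) p f F (K : Prop) (e : nat -> M) ps C eA qs D eB :
  (forall mv, length mv = length (if p then qs else ps) ->
    let fs := map (eval (apps mv e)) f in
    let us := if p then fs else mv in let vs := if p then mv else fs in
    (if p then below M vs eB qs -> below M us eA ps else below M us eA ps -> below M vs eB qs) /\
    game M F (K /\ below M us eA ps /\ below M vs eB qs) (apps mv e) C (apps us eA) D (apps vs eB)) ->
  game M (f :: F) K e (block p ps C) eA (block p qs D) eB.
Proof.
case: p => H mv L /=; have [h1 h2] := H mv L; split=> //; apply: game_mono h2 => -[k b];
  split=> //; split=> //; exact: h1.
Qed.

Lemma wf_block p f F ps C qs D : length f = length (if p then ps else qs) -> wf_red F C D ->
  wf_red (f :: F) (block p ps C) (block p qs D).
Proof. by case: p. Qed.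

Lemma map_eval_at (M : model) (e : nat -> M) s ps :
  map (eval e) (map (subst_t s) ps) = map (eval (fun i => eval e (s i))) ps.
Proof. by rewrite map_map; apply: map_ext => t; rewrite eval_subst. Qed.

Lemma map_eval_lift_at (M : model) us (e : nat -> M) d ts : length us = d ->
  map (eval (apps us e)) (map (lift_t d) ts) = map (eval e) ts.
Proof. by move=> <-; exact: map_eval_lift. Qed.

Lemma map_eval_vars_at (M : model) us (e : nat -> M) d : length us = d ->
  map (eval (apps us e)) (vars d) = us.
Proof. by move=> <-; exact: map_eval_vars. Qed.

(** The merged blocks contain the variables of both formulas, so a reduction has to guess only where
    it is shown one half. In a universal block the reduction to [B] needs variables for [A], and in
    an existential block the reduction from [A] needs variables for [B]: these are Skolem terms,
    recorded by the equations [Eo] and [Ee], under which truth of [A -> B] descends to the matrices.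
    Guesses in the opposite directions only have to respect the bounds and are 0. *)
Lemma join k : forall p A B, in_class p k A -> in_class p k B -> exists N Bd Ee Eo a b,
  [/\ chain N Bd, qfree Ee, qfree Eo & qfree a /\ qfree b] /\
  (forall (M : iomodel) (e : nat -> M) ws, length ws = N -> (psat M e A -> psat M e B) ->
     sat (apps ws e) Bd -> sat (apps ws e) Ee -> sat (apps ws e) Eo -> sat (apps ws e) a -> sat (apps ws e) b) /\
  forall X Y tau, exists F,
    (forall s lX s' lY, wf_red F (pfm X k A B s lX) (pfm Y k A B s' lY)) /\
    forall (M : model) (K : Prop) (e : nat -> M) eX sX lX eY sY lY e0, models M R_exp ->
      e0 = (fun i => eval e (tau i)) -> e0 = (fun i => eval eX (sX i)) -> e0 = (fun i => eval eY (sY i)) ->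
      (K -> forall ws, length ws = N -> sat (apps ws e0) Bd ->
         (Y = SB -> sat (apps ws e0) Eo) -> (X = SA -> sat (apps ws e0) Ee) ->
         leaf X M a b e0 eX lX ws -> leaf Y M a b e0 eY lY ws) ->
      game M F K e (pfm X k A B sX lX) eX (pfm Y k A B sY lY) eY.
Proof.
elim: k => [|k IH] p A B.
  move=> /in_class0 [a -> qa] /in_class0 [b -> qb]; exists 0, Top, Top, Top, a, b.
  split; first by split=> //; constructor.
  split; first by move=> M e [|//] _ /=; rewrite apps_nil; auto.
  move=> X Y tau; exists []; split; first by case: X => s lX; case: Y.
  move=> M K e eX sX lX eY sY lY e0 HM _ EX EY H.
  have sA (e' : nat -> M) s c : e0 = (fun i => eval e' (s i)) -> sat e' (subst_f s c) = sat (apps [] e0) c.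
    by move=> ->; rewrite apps_nil; apply: PropExtensionality.propositional_extensionality; exact: sat_subst.
  have HK k0 := H k0 [] erefl (fun f => f) (fun _ f => f) (fun _ f => f).
  move: HK {H}; case: X; case: Y => /=; rewrite ?(sA _ _ _ EX) ?(sA _ _ _ EY) ?(apps_nil M eX) ?(apps_nil M eY) //.
move=> /in_classS [ps [C [-> HC]]] /in_classS [qs [D [-> HD]]].
set m := length ps; set n := length qs.
have [N [Bd [Ee [Eo [a [b [[cBd qe qo [qa qb]] [H0 HG]]]]]]]] := IH _ _ _
  (in_class_subst _ _ _ (left_s m n) HC) (in_class_subst _ _ _ (right_s m n) HD).
have [h1 [h2 [L1 L2 hb hS]]] := skolem_block p k ps qs C D HC HD.
pose bl := tuple_le (vars (length (ps ++ qs))) (map (lift_t (length (ps ++ qs))) (ps ++ qs)).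
(* A universal block fixes the half of [A] by [h1], an existential one the half of [B] by [h2]. *)
pose Eo' := if p then And Eo (lift_f N (tuple_eq (vars m) (map (lift_t (m + n)) h1))) else Eo.
pose Ee' := if p then Ee else And Ee (lift_f N (tuple_eq (map Var (seq m n)) (map (lift_t (m + n)) h2))).
exists (N + length (ps ++ qs)), (And Bd (lift_f N bl)), Ee', Eo', a, b.
have Lmn : length (ps ++ qs) = m + n by rewrite length_app.
have sat_bl (M : model) (e : nat -> M) ws us : length ws = N -> length us = m + n ->
    sat (apps ws (apps us e)) (lift_f N bl) <-> below M us e (ps ++ qs).
  move=> <- L; rewrite sat_lift /bl Lmn sat_tuple_le; last by rewrite length_vars length_map.
  by rewrite /below map_eval_vars_at // map_eval_lift_at.
have sat_eo (M : model) (e : nat -> M) ws us : length ws = N -> length us = m + n ->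
    sat (apps ws (apps us e)) (lift_f N (tuple_eq (vars m) (map (lift_t (m + n)) h1))) <->
    firstn m us = map (eval e) h1.
  move=> <- L; rewrite sat_lift sat_tuple_eq; last by rewrite length_vars length_map.
  rewrite map_eval_lift_at // -{1}(firstn_skipn m us) apps_app map_eval_vars_at //.
  by rewrite length_firstn; lia.
have sat_ee (M : model) (e : nat -> M) ws us : length ws = N -> length us = m + n ->
    sat (apps ws (apps us e)) (lift_f N (tuple_eq (map Var (seq m n)) (map (lift_t (m + n)) h2))) <->
    skipn m us = map (eval e) h2.
  move=> <- L; rewrite sat_lift sat_tuple_eq; last by rewrite !length_map length_seq.
  rewrite map_eval_lift_at //; have := map_eval_seq M e (firstn m us) (skipn m us).
  rewrite firstn_skipn length_firstn length_skipn L Nat.min_l; last by lia.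
  by rewrite Nat.add_comm Nat.add_sub => ->.
split.
  split; [exact: (chainS N Bd (ps ++ qs))|rewrite /Ee'|rewrite /Eo'|] => //.
    by case: (p) => //=; split=> //; apply: qfree_subst; exact: qfree_tuple_eq.
  by case: (p) => //=; split=> //; apply: qfree_subst; exact: qfree_tuple_eq.
split.
  move=> M e ws0 Lws HAB; have [ws [us [Lw Lu E]]] : exists ws us, [/\ length ws = N, length us = m + n & ws0 = ws ++ us].
    exists (firstn N ws0), (skipn N ws0); rewrite firstn_skipn length_firstn length_skipn; split=> //; lia.
  rewrite {}E {ws0 Lws} apps_app /= sat_bl // => -[hBd bu] hEe hEo.
  have Eus := firstn_skipn m us.
  have Lm : length (firstn m us) = m by rewrite length_firstn; lia.
  have Ln : length (skipn m us) = n by rewrite length_skipn; lia.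
  have bm : below M (firstn m us) e ps.
    by have := below_proj M e SA m _ _ bu; rewrite /= firstn_app firstn_all Nat.sub_diag app_nil_r.
  have bn : below M (skipn m us) e qs.
    by have := below_proj M e SB m _ _ bu; rewrite /= skipn_app skipn_all Nat.sub_diag.
  apply: (H0 M _ ws Lw) hBd _ _; last first.
  - by move: hEo; rewrite /Eo'; case: (p) => //= -[].
  - by move: hEe; rewrite /Ee'; case: (p) => //= -[].
  rewrite !psat_subst; have := eval_left M e (firstn m us) (skipn m us); rewrite Eus Lm Ln => ->.
  have := eval_right M e (firstn m us) (skipn m us); rewrite Eus Lm Ln => ->.
  move: HAB (hS M e) hEe hEo; rewrite /Ee' /Eo'; case: (p) => /= HAB hC hEe hEo Cu.
    apply: (HAB _ _ bn); apply: hC; case: hEo => _ /(sat_eo M e ws us Lw Lu) <-; exact: Cu.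
  case: hEe => _ /(sat_ee M e ws us Lw Lu) ->; apply: hC; apply: HAB; by exists (firstn m us).
(* [Z] is the side that moves and [O] the one that answers. [W] completes the move to a tuple of the
   merged block, of which both sides take their part. *)
move=> X Y tau; pose Z := if p then Y else X; pose O := if p then X else Y.
pose W := compl Z m n (map (subst_t tau) h1) (map (subst_t tau) h2).
pose j := length (proj Z m (ps ++ qs)).
have [F [wfF gF]] := HG X Y (apps W (fun i => lift_t j (tau i))).
have LW : length W = m + n by apply: length_compl; rewrite length_map.
have Lproj T T' (U : side) (us : list T) (vs : list T') : length us = length vs ->
    length (proj U m us) = length (proj U m vs).
  by move=> L; case: U => /=; rewrite ?length_firstn ?length_skipn L.
exists (proj O m W :: F); split.
  move=> s lX s' lY; have [E -> hE] := pfm_block X p k ps qs C D s lX.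
  have [E' -> hE'] := pfm_block Y p k ps qs C D s' lY.
  apply: wf_block; last by apply/(wf_subst F E E' (inner X m n) (inner Y m n)); rewrite hE hE'.
  by rewrite /O; case: (p); rewrite length_map; apply: Lproj => //; rewrite LW.
move=> M K e eX sX lX eY sY lY e0 HM E0 EX EY H.
have [E -> hE] := pfm_block X p k ps qs C D sX lX.
have [E' -> hE'] := pfm_block Y p k ps qs C D sY lY.
have [b1 b2] : below M (map (eval e) (map (subst_t tau) h1)) e0 ps /\ below M (map (eval e) (map (subst_t tau) h2)) e0 qs.
  by rewrite !map_eval_at -E0; exact: hb.
apply: game_block => mv Lmv; cbv zeta.
have {}Lmv : length mv = length (proj Z m (ps ++ qs)).
  by rewrite Lmv /Z; case: (p); rewrite length_map.
have := complP Z M e e0 ps qs _ _ mv (eq_trans (length_map _ _) L1) (eq_trans (length_map _ _) L2) b1 b2 Lmv.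
cbv zeta; rewrite -/m -/n -/W !map_proj; move: (map (eval (apps mv e)) W) (apps_map _ _ (eval (apps mv e)) W) => W' EW [LW' Emv bW' fW' sW'].
have -> : (if p then proj O m W' else mv) = proj X m W' by rewrite -Emv /O /Z; case: (p).
have -> : (if p then mv else proj O m W') = proj Y m W' by rewrite -Emv /O /Z; case: (p).
have bU U e' s : e0 = (fun i => eval e' (s i)) -> forall us, below M us e' (proj U m (map (subst_t s) (ps ++ qs))) =
    below M us e0 (proj U m (ps ++ qs)).
  by move=> -> us; rewrite -map_proj /below map_eval_at.
rewrite (bU _ _ _ EX) (bU _ _ _ EY).
have bZ : (if p then below M (proj Y m W') e0 (proj Y m (ps ++ qs)) else below M (proj X m W') e0 (proj X m (ps ++ qs))) ->
    below M W' e0 (ps ++ qs).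
  by move=> h; apply: bW'; move: h; rewrite -Emv /Z; case: (p).
split; first by move: bZ; case: (p) => bZ h; apply: below_proj; exact: bZ.
rewrite -(eval_inner X M eX W' m n LW') -(eval_inner Y M eY W' m n LW').
apply/game_subst; first by apply/(wf_subst F E E' (inner X m n) (inner Y m n)); rewrite hE hE'.
rewrite hE hE'; apply: (gF M _ _ _ _ _ _ _ _ (apps W' e0)) => //.
- by rewrite EW; congr apps; rewrite E0; apply: functional_extensionality => i; rewrite /j -Lmv eval_lift.
- by rewrite eval_up_at // -EX.
- by rewrite eval_up_at // -EY.
move=> [k0 [bX bY]] ws Lws hBd hEo hEe hX.
have := H k0 (ws ++ W') ltac:(by rewrite length_app Lws LW' Lmn).
have bWW : below M W' e0 (ps ++ qs) by apply: bZ; case: (p).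
rewrite !apps_app /= sat_bl // => HH; rewrite !map_eval_at -E0 in fW' sW'.
have {HH} : leaf X M a b e0 eX lX (ws ++ W') -> leaf Y M a b e0 eY lY (ws ++ W').
  apply: HH => // [YB|XA].
    move: (hEo YB) (YB) fW'; rewrite /Eo' /Z; case: (p) => //= h _ fW'.
    by split=> //; apply/(sat_eo M e0 ws W' Lws LW'); exact: fW'.
  move: (hEe XA) (XA) sW'; rewrite /Ee' /Z; case: (p) => //= h _ sW'.
  by split=> //; apply/(sat_ee M e0 ws W' Lws LW'); exact: sW'.
move=> HH; move: hX HH; rewrite /leaf.
by case: (X); case: (Y); rewrite ?apps_app; auto.
Qed.

(** As [flow], but the time only depends on the variables from [L] on, and nothing is assumed of the
    variables. *)
Record cflow (L : nat) (T : term) (H A : form) : Prop := CFlow {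
  cf_qf : qfree H;
  cf_0 : forall (M : model) (y : nat -> M), models M R_exp -> sat (m0 .: y) H;
  cf_S : forall (M : model) (y : nat -> M) u, models M R_exp ->
    mlt M u (eval y (lift_t L T)) -> sat (u .: y) H -> sat (madd u m1 .: y) H;
  cf_T : forall (M : model) (y : nat -> M), models M R_exp ->
    sat (eval y (lift_t L T) .: y) H -> sat y A }.

Definition cflows L A := exists T H, cflow L T H A.

Lemma cflows_valid L A : (forall (M : model) (e : nat -> M), models M R_exp -> sat e A) -> cflows L A.
Proof. by move=> HA; exists Zero, Top; split=> //= M y HM _; exact: HA. Qed.

Lemma cflows_mp2 L A B C : cflows L A -> cflows L B ->
  (forall (M : model) (e : nat -> M), models M R_exp -> sat e A -> sat e B -> sat e C) -> cflows L C.
Proof.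
move=> [T1 [H1 F1]] [T2 [H2 F2]] HC.
pose T1' := lift_t 1 (lift_t L T1).
exists (Add T1 T2), (And (subst_f (tmin (Var 0) T1' .: shift 1) H1) (subst_f (Sub (Var 0) T1' .: shift 1) H2)).
have ev1 (M : model) u (y : nat -> M) : (fun i => eval (u .: y) ((tmin (Var 0) T1' .: shift 1) i)) =
    mmin M u (eval y (lift_t L T1)) .: y.
  by apply: functional_extensionality => -[|i] //=; rewrite /T1' !eval_lift1.
have ev2 (M : model) u (y : nat -> M) : (fun i => eval (u .: y) ((Sub (Var 0) T1' .: shift 1) i)) =
    msub u (eval y (lift_t L T1)) .: y.
  by apply: functional_extensionality => -[|i] //=; rewrite /T1' !eval_lift1.
split.
- by split; apply: qfree_subst; [exact: cf_qf F1|exact: cf_qf F2].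
- move=> M y HM; rewrite /= !sat_subst ev1 ev2.
  have /(msub_eq0 M HM) E := mge0 M HM (eval y (lift_t L T1)).
  by rewrite /mmin E msub0 //; split; [exact: cf_0 F1 M y HM|exact: cf_0 F2 M y HM].
- move=> M y u HM lt; rewrite /= !sat_subst !ev1 !ev2 => -[h1 h2].
  move: h1 h2; case: (time_split M HM u (eval y (lift_t L T1))).
    by move=> [lt1 [-> [-> [-> ->]]]] h1 h2; split=> //; exact: cf_S F1 M y u HM lt1 h1.
  move=> [le [-> [-> ->]]] h1 h2; split=> //; apply: (cf_S _ _ _ _ F2) => //.
  exact: mlt_sub.
move=> M y HM; rewrite /= !sat_subst !ev1 !ev2; set t1 := eval y (lift_t L T1); set t2 := eval y (lift_t L T2).
have -> : mmin M (madd t1 t2) t1 = t1.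
  by case: (mmin_cases M HM (madd t1 t2) t1) => -[h ->] //; apply: (mle_anti M HM) => //; exact: mle_addr.
have -> : msub (madd t1 t2) t1 = t2.
  apply: (maddI M HM _ _ t1); rewrite msubK //; [exact: maddC|exact: mle_addr].
by move=> [h1 h2]; apply: HC => //; [exact: cf_T F1 M y HM h1|exact: cf_T F2 M y HM h2].
Qed.

Lemma cflows_mp1 L A C : cflows L A ->
  (forall (M : model) (e : nat -> M), models M R_exp -> sat e A -> sat e C) -> cflows L C.
Proof. move=> FA H; apply: (cflows_mp2 _ A A) => // M e HM a _; exact: H. Qed.

(** * Bounding the block variables by terms in the free variables *)

Definition var_bounds L n Z : form := big_conj n (fun i => Le (Var i) (lift_t L Z)).

Lemma sat_var_bounds (M : model) (y : nat -> M) L n Z :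
  sat y (var_bounds L n Z) <-> forall i, i < n -> mle (y i) (eval y (lift_t L Z)).
Proof. exact: sat_big_conj. Qed.

(** The bound [z] is replaced by a term in the outer variables, and its being a bound becomes a
    hypothesis of the formula. *)
Lemma cflows_of_flows A : flows A -> exists n, forall L Z,
  cflows L (Imp (var_bounds L n Z) (subst_f (lift_t L Z .: Var) A)).
Proof.
move=> [n [T [H F]]]; exists n => L Z; exists (subst_t (fun _ => Z) T).
exists (subst_f (Var 0 .: (lift_t 1 (lift_t L Z) .: shift 1)) H).
have ev (M : model) u (y : nat -> M) :
    (fun i => eval (u .: y) ((Var 0 .: (lift_t 1 (lift_t L Z) .: shift 1)) i)) =
    u .: (eval y (lift_t L Z) .: y).
  by apply: functional_extensionality => -[|[|i]] //=; rewrite eval_lift1.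
have evT (M : model) (y : nat -> M) : eval y (lift_t L (subst_t (fun _ => Z) T)) =
    eval (fun _ => eval y (lift_t L Z)) T.
  by rewrite subst_t_comp eval_subst.
split.
- exact: qfree_subst (fl_qf _ _ _ _ F).
- by move=> M y HM; rewrite sat_subst ev; exact: fl_0 F M _ _ HM.
- by move=> M y u HM; rewrite !sat_subst !ev evT; exact: fl_S F M _ _ _ HM.
move=> M y HM; rewrite sat_subst ev evT => h /= /sat_var_bounds hb.
rewrite sat_subst; have -> : (fun i => eval y ((lift_t L Z .: Var) i)) = eval y (lift_t L Z) .: y.
  by apply: functional_extensionality => -[|i].
exact: fl_T F M _ _ HM h hb.
Qed.

(** Under [Q], any number of variables is bounded by a term in those from [L] on. The bound is
    reached by a flow, because monotonicity of the exponentials in it needs induction. *)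
Definition reach L Q := forall n, exists Z, cflows L (Imp Q (var_bounds L n Z)).

Lemma reach0 : reach 0 Top.
Proof.
move=> n; exists (fold_right Add Zero (vars n)); apply: cflows_valid => M e HM _.
apply/sat_var_bounds => i lt.
have : In (Var i) (vars n) by apply: in_map; apply/in_seq; lia.
rewrite eval_subst; elim: (vars n) => //= t l IH [->|/IH le]; first exact: mle_addr.
by apply: (mle_trans M HM _ _ _ le); rewrite maddC //; exact: mle_addr.
Qed.

Lemma lift_t_lift m n t : lift_t m (lift_t n t) = lift_t (n + m) t.
Proof. by rewrite subst_t_comp; apply: subst_t_ext => i; rewrite /= /shift; congr Var; lia. Qed.

Lemma cflows_lift d L A : cflows L A -> cflows (d + L) (lift_f d A).
Proof.
move=> [T [H F]]; exists T, (subst_f (Var 0 .: shift (S d)) H).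
have ev (M : model) u us (y : nat -> M) : length us = d ->
    (fun i => eval (u .: apps us y) ((Var 0 .: shift (S d)) i)) = u .: y.
  by move=> <-; apply: functional_extensionality => -[|i] //=; rewrite apps_shift.
have evT (M : model) us (y : nat -> M) : length us = d ->
    eval (apps us y) (lift_t (d + L) T) = eval y (lift_t L T).
  by move=> <-; rewrite Nat.add_comm -lift_t_lift eval_lift.
split.
- exact: qfree_subst (cf_qf _ _ _ _ F).
- move=> M y HM; have [us [y' [Lus ->]]] := env_split M d y.
  by rewrite sat_subst ev //; exact: cf_0 F M _ HM.
- move=> M y u HM; have [us [y' [Lus ->]]] := env_split M d y.
  by rewrite !sat_subst !ev // evT //; exact: cf_S F M _ _ HM.
move=> M y HM; have [us [y' [Lus ->]]] := env_split M d y.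
by rewrite sat_subst ev // evT // => h; rewrite -Lus sat_lift; exact: cf_T F M _ HM h.
Qed.

(** The bounds [ts] are terms in variables already bounded by [Z], hence at most their majorants at
    [Z]. Adding these majorants to [Z] covers the new variables too. *)
Lemma reach_block L Q ts : reach L Q ->
  reach (length ts + L) (And (lift_f (length ts) Q) (tuple_le (vars (length ts)) (map (lift_t (length ts)) ts))).
Proof.
move=> HQ n; set d := length ts.
pose mj t := maj (lift_t 1 t).
pose A := fold_right And Top (map (fun t => Le (lift_t 1 t) (majz (lift_t 1 t))) ts).
have FA : flows A.
  rewrite /A; elim: (ts) => [|t l IH] /=; first by apply: flows_valid => M e HM /=.
  by apply: (flows_mp2 _ _ _ (flows_maj (lift_t 1 t)) IH).
have [n0 CA] := cflows_of_flows A FA; have [Z CZ] := HQ (Nat.max n n0).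
exists (Add Z (fold_right Add Zero (map (fun t => subst_t (fun _ => Z) (mj t)) ts))).
have C1 : cflows L (Imp Q (And (var_bounds L n Z) (subst_f (lift_t L Z .: Var) A))).
  apply: (cflows_mp2 _ _ _ _ CZ (CA L Z)) => M e HM /= h1 h2 /h1 /sat_var_bounds h.
  split; first by apply/sat_var_bounds => i lt; apply: h; lia.
  by apply: h2; apply/sat_var_bounds => i lt; apply: h; lia.
apply: (cflows_mp1 _ _ _ (cflows_lift d _ _ C1)) => M y HM; have [us [y' [Lus ->]]] := env_split M d y.
have sl B : sat (apps us y') (lift_f d B) <-> sat y' B by rewrite -Lus sat_lift.
rewrite sl /= sl sat_tuple_le ?length_vars ?length_map // -{1 2}Lus /below map_eval_vars map_eval_lift.
move=> h1 [/h1 [/sat_var_bounds hv hA] hb]; apply/sat_var_bounds.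
rewrite -Lus Nat.add_comm -lift_t_lift eval_lift => i lt {FA CA CZ C1 HQ}.
rewrite sat_subst in hA; set zL := eval y' (lift_t L Z) in hv.
have Ez : (fun i => eval y' ((lift_t L Z .: Var) i)) = zL .: y' by apply: functional_extensionality => -[|j].
rewrite {}Ez in hA; rewrite /= -/zL /apps.
have hS : forall l vs, sat (zL .: y') (fold_right And Top (map (fun t => Le (lift_t 1 t) (majz (lift_t 1 t))) l)) ->
    Forall2 mle vs (map (eval y') l) -> forall v, In v vs ->
    mle v (eval y' (lift_t L (fold_right Add Zero (map (fun t => subst_t (fun _ => Z) (mj t)) l)))).
  elim=> [|t l IH] vs /=; first by move=> _ H; inversion H.
  move=> [hle hl] H; inversion H as [|v t' vs' l' le H' E1 E2]; subst => w.
  rewrite eval_lift1 /majz eval_subst /= in hle.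
  case=> [<-|/(IH _ hl H') le']; last first.
    by apply: (mle_trans M HM _ _ _ le'); rewrite maddC //; exact: mle_addr.
  apply: (mle_trans M HM _ _ _ le); apply: (mle_trans M HM _ _ _ hle).
  by rewrite subst_t_comp eval_subst; exact: mle_addr.
have {}hS := hS ts us hA hb.
case E: (nth_error us i) => [u|].
  have /hS le := nth_error_In _ _ E.
  by apply: (mle_trans M HM _ _ _ le); rewrite maddC //; exact: mle_addr.
have le : mle (y' (i - length us)) zL by apply: hv; lia.
by apply: (mle_trans M HM _ _ _ le); exact: mle_addr.
Qed.

Lemma reach_impl L A B : (forall (M : model) (e : nat -> M), models M R_exp -> sat e B -> sat e A) ->
  reach L A -> reach L B.
Proof.
move=> H HA n; have [Z C] := HA n; exists Z; apply: (cflows_mp1 _ _ _ C) => M e HM /= h b.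
by apply: h; exact: H.
Qed.

Lemma reach_chain N B : chain N B -> forall L Q, reach L Q -> reach (N + L) (And (lift_f N Q) B).
Proof.
elim=> {N B} [|N B ts _ IH] L Q HQ.
  apply: reach_impl HQ => M e HM /= [h _]; move: h; rewrite sat_subst.
  by have -> : (fun i => eval e (shift 0 i)) = e by apply: functional_extensionality.
have := IH _ _ (reach_block _ _ ts HQ); rewrite Nat.add_assoc; apply: reach_impl => M e HM /= [h [hB ht]].
split=> //; move: h; rewrite subst_f_comp.
suff -> : (fun i => lift_t N (shift (length ts) i)) = shift (N + length ts) by [].
by apply: functional_extensionality => i; rewrite /shift /= Nat.add_assoc.
Qed.

(** Removes the block variables from the length of the flow: the chain of bounds limits them by a
    term in the remaining variables, which takes the place of [z]. *)
Lemma cflows_chain N B C : chain N B -> flows (lift_f 1 (Imp B C)) -> cflows N (Imp B C).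
Proof.
move=> HB /cflows_of_flows [n CA].
have [Z CZ] := reach_chain N B HB _ _ reach0 n; rewrite Nat.add_0_r in CZ.
apply: (cflows_mp2 _ _ _ _ CZ (CA N Z)) => M e HM h1 h2 hB.
have h3 : sat e (var_bounds N n Z) by apply h1; split.
have := h2 h3 : sat e (subst_f (lift_t N Z .: Var) (lift_f 1 (Imp B C))).
by rewrite subst_f_lift1 subst_f_id => /= h; exact: h.
Qed.

(** * Truth of merged connectives *)

Lemma below_app (M : model) (e : nat -> M) us vs ps qs : below M us e ps ->
  below M (us ++ vs) e (ps ++ qs) <-> below M vs e qs.
Proof.
rewrite /below map_app; elim=> //= u p us' ps' le _ <-.
by split=> [H|H]; [inversion H|constructor].
Qed.

Lemma below_split (M : model) (e : nat -> M) ws ps qs : below M ws e (ps ++ qs) ->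
  exists us vs, [/\ ws = us ++ vs, below M us e ps & below M vs e qs].
Proof.
move=> H; exists (firstn (length ps) ws), (skipn (length ps) ws); rewrite firstn_skipn; split=> //.
  by have := below_proj M e SA (length ps) _ _ H; rewrite /= firstn_app firstn_all Nat.sub_diag app_nil_r.
by have := below_proj M e SB (length ps) _ _ H; rewrite /= skipn_app skipn_all Nat.sub_diag.
Qed.

(** Pulling a block out of one side of [op] is sound because its range is never empty. *)
Lemma psat_merge (M : model) op (h : Prop -> Prop -> Prop) : models M R_exp ->
  (forall (e : nat -> M) a b, sat e (op a b) <-> h (sat e a) (sat e b)) ->
  (forall T (S S' P Q : T -> Prop), (exists u, S u) -> (exists v, S' v) ->
     ((forall u v, S u -> S' v -> h (P u) (Q v)) <-> h (forall u, S u -> P u) (forall v, S' v -> Q v)) /\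
     ((exists u v, [/\ S u, S' v & h (P u) (Q v)]) <-> h (exists2 u, S u & P u) (exists2 v, S' v & Q v))) ->
  forall k p A B (e : nat -> M), in_class p k A -> in_class p k B ->
    psat M e (merge op k A B) <-> h (psat M e A) (psat M e B).
Proof.
move=> HM Hop Hh; elim=> [|k IH] p A B e.
  by case/in_class0 => a -> _ /in_class0 [b -> _] /=.
case/in_classS => [ps [C [-> HC]]] /in_classS [qs [D [-> HD]]]; rewrite merge_block.
have IH' us vs : below M us e ps -> below M vs e qs ->
    psat M (apps (us ++ vs) e) (merge op k (subst_p (left_s (length ps) (length qs)) C)
      (subst_p (right_s (length ps) (length qs)) D)) <-> h (psat M (apps us e) C) (psat M (apps vs e) D).
  move=> /below_length <- /below_length <-; rewrite (IH (~~ p)); last 2 first.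
  - exact: in_class_subst.
  - exact: in_class_subst.
  by rewrite (PropExtensionality.propositional_extensionality _ _ (psat_subst M C _ _))
    (PropExtensionality.propositional_extensionality _ _ (psat_subst M D _ _)) eval_left eval_right.
have [H1 H2] := Hh _ (fun us => below M us e ps) (fun vs => below M vs e qs)
  (fun us => psat M (apps us e) C) (fun vs => psat M (apps vs e) D)
  (ex_intro (fun us => below M us e ps) _ (below_zeros M e e ps HM))
  (ex_intro (fun vs => below M vs e qs) _ (below_zeros M e e qs HM)).
case: (p) => /=; [rewrite -H1|rewrite -H2]; split.
- by move=> H us vs bu bv; apply/IH' => //; apply: H; apply/below_app.
- by move=> H ws /below_split [us [vs [-> bu bv]]]; apply/IH' => //; exact: H.
- by case=> ws /below_split [us [vs [-> bu bv]]] /IH' H; exists us, vs; split=> //; exact: H.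
- by case=> us [vs [bu bv H]]; exists (us ++ vs); [apply/below_app|apply/IH'].
Qed.

Lemma psat_merge_and (M : model) k p A B (e : nat -> M) : models M R_exp -> in_class p k A -> in_class p k B ->
  psat M e (merge And k A B) <-> psat M e A /\ psat M e B.
Proof.
move=> HM; apply: (psat_merge M And and HM) => // T S S' P Q [u0 su] [v0 sv]; split; split.
- by move=> H; split=> [u|v] s; [case: (H u v0)|case: (H u0 v)].
- by move=> [hP hQ] u v s s'; split; [exact: hP|exact: hQ].
- by move=> [u [v [s s' [hP hQ]]]]; split; [exists u|exists v].
- by move=> [[u s hP] [v s' hQ]]; exists u, v; split.
Qed.

Lemma psat_merge_or (M : model) k p A B (e : nat -> M) : models M R_exp -> in_class p k A -> in_class p k B ->
  psat M e (merge Or k A B) <-> psat M e A \/ psat M e B.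
Proof.
move=> HM; apply: (psat_merge M Or or HM) => // T S S' P Q [u0 su] [v0 sv]; split; split.
- move=> H; case: (classic (forall u, S u -> P u)) => [|nP]; [by left|right=> v s'].
  apply: NNPP => nQ; apply: nP => u s; by case: (H u v s s').
- by case=> hP u v s s'; [left; exact: hP|right; exact: hP].
- by move=> [u [v [s s' [hP|hQ]]]]; [left; exists u|right; exists v].
- by case=> [[u s hP]|[v s' hQ]]; [exists u, v0|exists u0, v]; split=> //; [left|right].
Qed.

Lemma in_class_pad k a : qfree a -> in_class true k (pad_Pi k a) /\ in_class false k (pad_Sigma k a).
Proof.
move=> qa; elim: k => [|k [IH1 IH2]] /=; first by split; constructor.
by split; constructor.
Qed.

Lemma psat_pad (M : model) k a : forall e : nat -> M,
  (psat M e (pad_Pi k a) <-> sat e a) /\ (psat M e (pad_Sigma k a) <-> sat e a).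
Proof.
elim: k => [|k IH] e //=; split; split.
- move=> H; have := H [] (Forall2_nil _); rewrite apps_nil; exact: (proj1 (proj2 (IH e))).
- by move=> H us Hus; inversion Hus; rewrite apps_nil; apply/(proj2 (IH e)).
- by case=> us Hus; inversion Hus; rewrite apps_nil => /(proj1 (IH e)).
- by move=> H; exists []; [constructor|rewrite apps_nil; apply/(proj1 (IH e))].
Qed.

Lemma in_class_big op c k L : (forall a b, qfree a -> qfree b -> qfree (op a b)) -> qfree c ->
  Forall (Pib_open k) L -> in_class true k (big_merge op c k L).
Proof.
move=> Hop qc; elim=> [|A [|B l] HA Hl IH] //; first exact: (proj1 (in_class_pad k c qc)).
exact: (in_class_merge op Hop k true A (big_merge op c k (B :: l)) HA IH).
Qed.

Lemma psat_big_and (M : model) k L (e : nat -> M) : models M R_exp -> Forall (Pib_open k) L ->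
  psat M e (big_and_Pi k L) <-> sat e (big_and (map to_form L)).
Proof.
move=> HM; rewrite /big_and_Pi; elim=> [|A [|B l] HA Hl IH].
- exact: (proj1 (psat_pad M k Top e)).
- by rewrite /= sat_to_form; tauto.
have -> : big_merge And Top k (A :: B :: l) = merge And k A (big_merge And Top k (B :: l)) by [].
rewrite (psat_merge_and M k true) //; last exact: in_class_big.
by rewrite IH [sat e (big_and (map to_form (A :: _)))]/= sat_to_form.
Qed.

Lemma psat_big_or (M : model) k L (e : nat -> M) : models M R_exp -> Forall (Pib_open k) L ->
  psat M e (big_or_Pi k L) <-> sat e (big_or (map to_form L)).
Proof.
move=> HM; rewrite /big_or_Pi; elim=> [|A [|B l] HA Hl IH].
- exact: (proj1 (psat_pad M k Bot e)).
- by rewrite /= sat_to_form; tauto.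
have -> : big_merge Or Bot k (A :: B :: l) = merge Or k A (big_merge Or Bot k (B :: l)) by [].
rewrite (psat_merge_or M k true) //; last exact: in_class_big.
by rewrite IH [sat e (big_or (map to_form (A :: _)))]/= sat_to_form.
Qed.

(** * From flows to implications and back *)

Lemma dred_psat (M : model) T L F A B (e : nat -> M) : models M T -> dred T L F A B ->
  (forall C, In C L -> sat e C) -> psat M e A -> psat M e B.
Proof.
move=> MT H satL; apply: (game_psat M F True e) => //.
exact: (game_of_dred M T F MT L A B e H satL True A e id B e id (rep_refl M A e) (rep_refl M B e)).
Qed.

Lemma dflow_psat k A B : dflow qfree k R_exp A B -> forall (M : model) (e : nat -> M), models M IDelta0_EXP ->
  psat M e A -> psat M e B.
Proof.
move=> [t [H [E0 [E1 [G0 [G1 [F [HH [[_ HA] [[HB _] HF]]]]]]]]]] M e MI eA.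
have HM : models M R_exp by move=> C ax; apply: MI; exact: ID0_base.
have H0 : psat M (m0 .: e) H.
  have := dred_psat M _ _ _ _ _ e HM HA (fun _ f => match f with end) eA; rewrite psat_subst.
  by have -> : (fun i => eval e (inst [Zero] Var i)) = m0 .: e by rewrite inst1; apply: functional_extensionality => -[|i].
apply: (dred_psat M _ _ _ _ _ e HM HB (fun _ f => match f with end)); rewrite psat_subst.
have -> : (fun i => eval e (inst [t] Var i)) = eval e t .: e by rewrite inst1; apply: functional_extensionality => -[|i].
(* The time bound belongs to the induction formula, since the steps of the flow are only given below
   [t]. *)
pose P := Imp (Le (Var 0) (lift_t 1 t)) (to_form H).
have bP : bounded P by constructor; [exact: bd_qfree|exact: (bounded_to_form k true)].
have PE u : sat (u .: e) P <-> (mle u (eval e t) -> psat M (u .: e) H).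
  by rewrite /= eval_lift1 sat_to_form.
have ind : sat e (subst_f (inst [Zero] Var) P) /\
    (forall x, sat (x .: e) P -> sat (x .: e) (subst_f (inst [Add (Var 0) One] (shift 1)) P)) ->
    forall x, sat (x .: e) P := MI _ (ID0_ind P bP) e.
clearbody P.
suff /PE : sat (eval e t .: e) P by apply; exact: mle_refl.
apply: ind; split.
  rewrite sat_inst1; apply/PE => _; exact: H0.
move=> u /PE IH; rewrite sat_inst [map _ _]/= apps_cons apps_nil; apply/PE => le.
have lt : mlt M u (eval e t).
  case: (m_lt_or M HM (eval e t) u) => // le'.
  by case: (mlt_irr M HM _ _ (mle_trans M HM _ _ _ le le') (mlt_succ M HM u)).
have := dred_psat M _ _ _ _ _ (u .: e) HM HF; rewrite psat_subst.
have -> : (fun i => eval (u .: e) (inst [Add (Var 0) One] (shift 1) i)) = madd u m1 .: e.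
  by rewrite inst1; apply: functional_extensionality => -[|i].
apply; last by apply: IH; case: lt.
by move=> C [<-|//]; case: lt => l1 l2; rewrite /= eval_lift1.
Qed.

Lemma dflow_of_valid k A B : in_class true k A -> in_class true k B ->
  (forall (M : iomodel) (e : nat -> M), psat M e A -> psat M e B) -> dflow qfree k R_exp A B.
Proof.
move=> HA HB valid.
have [N [Bd [Ee [Eo [a [b [[cBd qe qo [qa qb]] [H0 HG]]]]]]]] := join k true A B HA HB.
pose Q := Imp Bd (Imp Ee (Imp Eo (Imp a b))).
have FQ : flows (lift_f 1 Q).
  apply/U_flows/conservativity; first by rewrite /Q /=; have := qfree_chain _ _ cBd.
  move=> M e; have [ws [x [Lws ->]]] := env_split M N e.
  exact: H0 M x ws Lws (valid M x).
have [T [Hm F]] := cflows_chain N Bd _ cBd FQ.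
pose s := up N (shift 1).
pose uT := Le (Var N) (lift_t (S N) T).
(* Up to the time [T] the flow is that of the quantifier-free implication [Q], and [a] is kept; the
   last step replaces [a] by [b]. *)
pose lf := Or (And uT (And (subst_f s a) (And (subst_f (Var N .: s) Hm) (subst_f s Ee))))
  (And (Neg uT) (Imp (subst_f s Eo) (subst_f s b))).
have lfP (M : model) (x : nat -> M) u ws : length ws = N -> sat (apps ws (u .: x)) lf <->
    (mle u (eval x T) /\ sat (apps ws x) a /\ sat (u .: apps ws x) Hm /\ sat (apps ws x) Ee) \/
    (~ mle u (eval x T) /\ (sat (apps ws x) Eo -> sat (apps ws x) b)).
  move=> Lws; have Es : (fun i => eval (apps ws (u .: x)) (s i)) = apps ws x by rewrite eval_up_at.
  have Eu : eval (apps ws (u .: x)) (Var N) = u.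
    by rewrite /= -{1}(Nat.add_0_r N) apps_at.
  have Eus : (fun i => eval (apps ws (u .: x)) ((Var N .: s) i)) = u .: apps ws x.
    by rewrite -Es; apply: functional_extensionality => -[|i].
  have ET : eval (apps ws (u .: x)) (lift_t (S N) T) = eval x T.
    by rewrite -Nat.add_1_r Nat.add_comm -lift_t_lift -Lws eval_lift eval_lift1.
  have EuT : sat (apps ws (u .: x)) uT = mle u (eval x T) by rewrite -{2}Eu -ET.
  have -> : sat (apps ws (u .: x)) lf =
    let sat' := sat (apps ws (u .: x)) in
    (sat' uT /\ sat' (subst_f s a) /\ sat' (subst_f (Var N .: s) Hm) /\ sat' (subst_f s Ee)) \/
    (~ sat' uT /\ (sat' (subst_f s Eo) -> sat' (subst_f s b))) by [].
  by cbv zeta; rewrite EuT !sat_subst Es Eus.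
have qlf : qfree lf.
  by rewrite /lf /=; do !split; apply: qfree_subst => //; exact: cf_qf F.
clearbody lf.
pose P X r := pfm X k A B r lf.
(* All reductions of the flow are games of [join] between two of the sides [SA], [SB], [SH]; what
   remains to be checked is an implication between matrices. *)
have red X Y (tau r th r' th' : subst) L :
    (forall i, subst_t th (r i) = tau i) -> (forall i, subst_t th' (r' i) = tau i) ->
    (forall (M : model) (e : nat -> M), models M R_exp -> (forall C, In C L -> sat e C) ->
      let e0 := fun i => eval e (tau i) in forall ws, length ws = N -> sat (apps ws e0) Bd ->
      (Y = SB -> sat (apps ws e0) Eo) -> (X = SA -> sat (apps ws e0) Ee) ->
      leaf X M a b e0 (fun i => eval e (th i)) lf ws -> leaf Y M a b e0 (fun i => eval e (th' i)) lf ws) ->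
    exists F, dred R_exp L F (subst_p th (P X r)) (subst_p th' (P Y r')).
  move=> Er Er' H; have [F' [wf g]] := HG X Y tau; exists F'.
  apply: dred_of_game; first by apply/wf_subst; exact: wf.
  move=> M e HM satL; exists True, (P X r), (fun i => eval e (th i)), id, (P Y r'), (fun i => eval e (th' i)), id.
  split; [apply: rep_subst; exact: rep_refl|apply: rep_subst; exact: rep_refl|by auto|].
  apply: (g M True e _ _ _ _ _ _ (fun i => eval e (tau i))) => //.
  - by apply: functional_extensionality => i; rewrite -Er eval_subst.
  - by apply: functional_extensionality => i; rewrite -Er' eval_subst.
  by move=> _; exact: H.
pose H := P SH (shift 1).
have PA : P SA Var = A by exact: subst_p_id.
have PB : P SB Var = B by exact: subst_p_id.
have E0 (M : model) (e : nat -> M) t : (fun i => eval e (inst [t] Var i)) = eval e t .: e.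
  by rewrite inst1; apply: functional_extensionality => -[|i].
have L0 (M : model) (x : M) : models M R_exp -> mle m0 x by move=> HM; exact: mge0.
have LT (M : model) (x : M) : models M R_exp -> ~ mle (madd x m1) x.
  by move=> HM le; case: (mlt_irr M HM _ _ le (mlt_succ M HM x)).
have shI t r i : subst_t (inst [t] r) (shift 1 i) = r i by rewrite inst1.
have D1 : exists F, dred R_exp [] F (subst_p (inst [Zero] Var) H) A.
  rewrite -PA -[P SA Var]subst_p_id; apply: (red SH SA Var); [exact: shI|by []|] => M e HM _ e0 ws Lws _ _ _ /=.
  by rewrite (E0 M e Zero) lfP // => -[[_ [ha _]]|[[]]]; [exact: ha|exact: L0].
(* Here [Ee] is available: coming from [A], the existential variables of [B] are guessed by Skolem
   terms. *)
have D2 : exists F, dred R_exp [] F A (subst_p (inst [Zero] Var) H).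
  rewrite -PA -[P SA Var]subst_p_id; apply: (red SA SH Var); [by []|exact: shI|] => M e HM _ e0 ws Lws _ _ he /= ha.
  rewrite (E0 M e Zero) lfP //; left; split; [exact: L0|split=> //].
  by split; [exact: cf_0 F M _ HM|exact: he].
(* Dually, going to [B], the universal variables of [A] are guessed by Skolem terms, so [Eo] holds
   and releases [b]. *)
have D3 : exists F, dred R_exp [] F (subst_p (inst [Add T One] Var) H) B.
  rewrite -PB -[P SB Var]subst_p_id; apply: (red SH SB Var); [exact: shI|by []|] => M e HM _ e0 ws Lws _ ho _ /=.
  by rewrite (E0 M e (Add T One)) lfP // => -[[/(LT M _ HM) []]|[_]]; apply; exact: ho.
have D4 : exists F, dred R_exp [] F B (subst_p (inst [Add T One] Var) H).
  rewrite -PB -[P SB Var]subst_p_id; apply: (red SB SH Var); [by []|exact: shI|] => M e HM _ e0 ws Lws _ _ _ /= hb.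
  by rewrite (E0 M e (Add T One)) lfP //; right; split=> //; exact: LT.
have D5 : exists F, dred R_exp [Lt (Var 0) (lift_t 1 (Add T One))] F H
    (subst_p (inst [Add (Var 0) One] (shift 1)) H).
  rewrite -{1}[H]subst_p_id; apply: (red SH SH (shift 1)); [by []|exact: shI|] => M e HM satL e0 ws Lws hBd _ _ /=.
  have Ee0 : e = e 0 .: e0 by apply: functional_extensionality => -[|i].
  have -> : (fun i => eval e (inst [Add (Var 0) One] (shift 1) i)) = madd (e 0) m1 .: e0.
    by rewrite inst1; apply: functional_extensionality => -[|i].
  have lt : mlt M (e 0) (madd (eval e0 T) m1).
    have := satL _ (or_introl erefl); rewrite {1}Ee0 => -[].
    by rewrite eval_lift1 [eval _ (Var 0)]/= /=.
  have le : mle (e 0) (eval e0 T) by apply/(mlt_le_succ M HM).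
  have -> : (fun i => eval e (Var i)) = e 0 .: e0 by exact: Ee0.
  rewrite !lfP // => -[[_ [ha [hH he]]]|[[]]]; last exact: le.
  have ET : eval (apps ws e0) (lift_t N T) = eval e0 T by rewrite -Lws eval_lift.
  case: (m_lt_or M HM (eval e0 T) (e 0)) => [le'|lt']; [right|left].
    have Eu := mle_anti M HM _ _ le le'; rewrite Eu -ET in hH *.
    split; first by rewrite ET; exact: LT.
    by move=> ho; apply: (cf_T _ _ _ _ F M _ HM hH).
  split; first exact: mle_succ.
  by split=> //; split=> //; apply: (cf_S _ _ _ _ F) => //; rewrite ET.
have [F1 {}D1] := D1; have [F2 {}D2] := D2; have [F3 {}D3] := D3; have [F4 {}D4] := D4; have [F5 {}D5] := D5.
exists (Add T One), H, F1, F2, F3, F4, F5; split=> //.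
by apply: (in_class_merge _ _ k true) => //; exact: (in_class_subst k true).
Qed.

Theorem corollary3p3 (k : nat) (Gamma Delta : list pform)
  (HGamma : Forall (Pib_open k) Gamma)
  (HDelta : Forall (Pib_open k) Delta) :
  proves_seq IDelta0_EXP (map to_form Gamma) (map to_form Delta) <->
  dflow_seq qfree k R_exp Gamma Delta.
Proof.
split=> H.
  apply: dflow_of_valid; [exact: in_class_big|exact: in_class_big|move=> M e].
  have HM := im_R M; move/(psat_big_and M k Gamma e HM HGamma) => hA; apply/(psat_big_or M k Delta e HM HDelta).
  exact: (soundness M _ _ _ (io_IDelta0 M) H e (fun _ f => match f with end) hA).
apply: completeness => M MI e _ hA; have HM : models M R_exp by move=> C ax; apply: MI; exact: ID0_base.
apply/(psat_big_or M k Delta e HM HDelta); apply: (dflow_psat k _ _ H M e MI).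
exact/(psat_big_and M k Gamma e HM HGamma).
Qed.
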